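(* Let $\alpha_1,\alpha_2>0$ and $\lambda_1,\lambda_2\in[0,1]$ with $\lambda_i\notin\{0,1\}$ for at least one $i\in\{1,2\}$. Then $$\zeta_{EH}'(0;\alpha_1,\alpha_2;\lambda_1,\lambda_2)=2\pi\frac{\alpha_1}{\alpha_2}B_2(\lambda_2)-2\log\prod_{n\in\mathbb{Z}}\Big|1-e^{2\pi i\lambda_1}e^{-2\pi\frac{\alpha_1}{\alpha_2}|n+\lambda_2|}\Big|,$$ where $B_2(x)=x^2-x+\frac{1}{6}$ is the second Bernoulli polynomial.
   Context: For $\Re(s)>1$ the Epstein–Hurwitz zeta function is $$\zeta_{EH}(s;\alpha_1,\alpha_2;\lambda_1,\lambda_2)=(2\pi)^{-2s}\sum_{(k_1,k_2)\in\mathbb{Z}^2}\Big(\Big(\frac{k_1+\lambda_1}{\alpha_1}\Big)^2+\Big(\frac{k_2+\lambda_2}{\alpha_2}\Big)^2\Big)^{-s};$$ it extends meromorphically to $\mathbb{C}$ (holomorphic at $s=0$), and $\zeta_{EH}'(0;\ldots)$ denotes the derivative of this continuation at $s=0$. *)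

(* Defs.v *)
From Stdlib Require Import Reals ZArith List Classical ClassicalEpsilon.
From Coquelicot Require Import Coquelicot.

Open Scope R_scope.

(** [finset_filter T] is the filter of eventually-true properties of finite
    subsets of [T] directed by inclusion, finite subsets being represented by
    duplicate-free lists.  Limits along it are unconditional sums/products. *)
Definition finset_filter (T : Type) (P : list T -> Prop) : Prop :=
  exists l0 : list T, forall l : list T, NoDup l -> incl l0 l -> P l.

Global Instance finset_filter_proper (T : Type) : ProperFilter (finset_filter T).
Proof.
  split.
  - intros P [l0 H].
    set (dec := fun x y : T => excluded_middle_informative (x = y)).
    exists (nodup dec l0).
    apply H; [apply NoDup_nodup | intros x; apply nodup_In].
  - split.
    + exists nil; easy.
    + intros P Q [l1 H1] [l2 H2]; exists (l1 ++ l2)%list; intros l nd inc.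
      split; [apply H1 | apply H2]; trivial; intros x hx; apply inc, in_or_app;
        auto.
    + intros P Q PQ [l0 H]; exists l0; intros l nd inc; apply PQ, H; trivial.
Qed.

Definition is_sum {T : Type} (f : T -> C) (v : C) : Prop :=
  filterlim (fun l => Iter.iter Cplus (RtoC 0) l f)
    (finset_filter T) (@locally C_UniformSpace v).

Definition is_prod {T : Type} (f : T -> R) (v : R) : Prop :=
  filterlim (fun l => Iter.iter Rmult 1 l f)
    (finset_filter T) (@locally R_UniformSpace v).

Definition Cexp (z : C) : C :=
  (exp (Re z) * cos (Im z), exp (Re z) * sin (Im z)).

(** [x ^ s] for a positive real base [x] (junk for [x <= 0]). *)
Definition RCpow (x : R) (s : C) : C := Cexp (s * RtoC (ln x))%C.

Definition holomorphic_at (f : C -> C) (p : C) : Prop :=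
  @locally C_UniformSpace p
    (fun s => @ex_derive C_AbsRing C_NormedModule f s).

(** Only the punctured germ of [f] at [p] matters, so a meromorphic function
    is total here, with an irrelevant value at each of its poles. *)
Definition meromorphic_at (f : C -> C) (p : C) : Prop :=
  exists (n : nat) (g : C -> C),
    holomorphic_at g p /\
    @locally' C_UniformSpace p (fun s => g s = ((s - p) ^ n * f s)%C).

Definition EH_term (a1 a2 l1 l2 : R) (s : C) (k : Z * Z) : C :=
  RCpow (((IZR (fst k) + l1) / a1) ^ 2 + ((IZR (snd k) + l2) / a2) ^ 2) (- s).

(** [F] is a meromorphic continuation to the whole plane of the
    Epstein-Hurwitz series, regular at [0]. *)
Definition is_EH_continuation (a1 a2 l1 l2 : R) (F : C -> C) : Prop :=
  (forall s : C, 1 < Re s ->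
     exists v : C, is_sum (EH_term a1 a2 l1 l2 s) v /\
       F s = (RCpow (2 * PI) (- (2 * s)) * v)%C) /\
  (forall p : C, meromorphic_at F p) /\
  holomorphic_at F 0.

(** By the identity theorem two continuations agree except at isolated points,
    and both are holomorphic near [0], so they have the same germ there: the
    choice made by [epsilon] is immaterial for the derivative at [0]. *)
Definition zeta_EH (a1 a2 l1 l2 : R) : C -> C :=
  epsilon (inhabits (fun _ : C => RtoC 0)) (is_EH_continuation a1 a2 l1 l2).

Definition B2 (x : R) : R := x ^ 2 - x + 1 / 6.

(* Main.v *)
(* With [b = a1/a2] and [Q = (k + l1)^2 + b^2 (n + l2)^2], write
     [Q^(-s) B(s) = int_0^oo u^(3-2s) / (Q + u^2)^2 du],  [1/B(s) = -2 sin(PI s) / (PI (s-1))].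
   Summing over the lattice, the zeta function is [1/B(s)] times the Mellin transform of
   [Y(u) = sum 1/(Q + u^2)^2], which is [PI/(b u^2)] up to an exponentially small error.
   Splitting the transform at [u = 1] continues it, and since [1/B] vanishes at [0] with
   derivative [2], the derivative sought is twice the finite part of [int_0^oo u^3 Y(u) du].
   The sum over [k] is elementary (the cotangent series), so that this integral is a sum over
   [n] of [ln |1 - e^(2 i PI l1 - 2 PI b |n + l2|)|] and of an explicit algebraic term, which
   Euler-Maclaurin turns into [B2(l2)].
   That the choice of continuation is immaterial follows from the identity theorem, proved
   from Goursat's theorem on rectangles in the coordinate [log z]. *)

Require Import Defs.
From Stdlib Require Import Reals ZArith List Permutation Classical ClassicalEpsilon FunctionalExtensionality Lra Lia.
From Coquelicot Require Import Coquelicot.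

Open Scope R_scope.

(** * Complex derivatives and integrals of complex-valued functions *)

Notation is_cderive := (@is_derive C_AbsRing C_NormedModule).

Lemma is_cderive_eps (f : C -> C) (z l : C) :
  is_cderive f z l <->
  forall eps, 0 < eps -> exists delta, 0 < delta /\
    forall w, Cmod (w - z) < delta ->
      Cmod (f w - f z - l * (w - z)) <= eps * Cmod (w - z).
Proof.
  split.
  - intros [_ H] eps he.
    assert (H1 := H z (fun P h => h) (mkposreal eps he)).
    destruct H1 as [d hd].
    exists d; split; [apply cond_pos|].
    intros w hw. specialize (hd w hw). simpl in hd.
    unfold norm in hd; simpl in hd. unfold abs in hd; simpl in hd.
    replace (f w - f z - l * (w - z))%C with (minus (minus (f w) (f z)) (scal (minus w z) l)).
    exact hd.
    unfold minus, plus, opp, scal; simpl. unfold mult; simpl. ring.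
  - intros H; split; [apply is_linear_scal_l|].
    intros x hx eps.
    assert (hzx : z = x).
    { apply (is_filter_lim_locally_unique (K := C_AbsRing) (V := AbsRing_NormedModule C_AbsRing)); exact hx. }
    subst x.
    destruct (H eps (cond_pos eps)) as [d [hd1 hd2]].
    exists (mkposreal d hd1); intros w hw.
    specialize (hd2 w hw).
    unfold norm; simpl. unfold abs; simpl.
    refine (eq_rect _ (fun c => Cmod c <= eps * Cmod (w - z)%C) hd2 _ _).
    unfold minus, plus, opp, scal; simpl. unfold mult; simpl. ring.
Qed.

Lemma locally_C_eps (z : C) (P : C -> Prop) :
  @locally C_UniformSpace z P <->
  exists d, 0 < d /\ forall w, Cmod (w - z) < d -> P w.
Proof.
  rewrite locally_C. split.
  - intros [d hd]; exists d; split; [apply cond_pos|]. intros w hw; apply hd; exact hw.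
  - intros [d [h1 h2]]; exists (mkposreal d h1); intros w hw; apply h2; exact hw.
Qed.

Lemma locally'_C_eps (z : C) (P : C -> Prop) :
  @locally' C_UniformSpace z P <->
  exists d, 0 < d /\ forall w, Cmod (w - z) < d -> w <> z -> P w.
Proof. unfold locally', within. apply locally_C_eps. Qed.

Lemma locally_AC_eps (z : C) (P : C -> Prop) :
  @locally (AbsRing_UniformSpace C_AbsRing) z P <->
  exists d, 0 < d /\ forall w, Cmod (w - z) < d -> P w.
Proof. rewrite <- locally_C. apply locally_C_eps. Qed.

Ltac rring := cbv beta; match goal with |- @eq _ ?a ?b => change (@eq R a b) end; ring.

Ltac cring := cbv beta; match goal with |- @eq _ ?a ?b => change (@eq C a b) end; ring.

Lemma C_ext (z w : C) : Re z = Re w -> Im z = Im w -> z = w.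
Proof. destruct z, w; simpl; intros -> ->; reflexivity. Qed.

Lemma im_le_Cmod (c : C) : Rabs (Im c) <= Cmod c.
Proof.
  eapply Rle_trans; [|apply Rmax_Cmod]. apply Rmax_r.
Qed.

Lemma Cmod_le_abs (c : C) : Cmod c <= Rabs (Re c) + Rabs (Im c).
Proof.
  destruct c as [a b]; simpl.
  replace ((a, b) : C) with (RtoC a + Ci * RtoC b)%C by (apply C_ext; simpl; ring).
  eapply Rle_trans; [apply Cmod_triangle|].
  rewrite Cmod_mult, Cmod_Ci, !Cmod_R; lra.
Qed.

Lemma Cmod_minus_sym (a b : C) : Cmod (a - b) = Cmod (b - a).
Proof. rewrite <- Cmod_opp. f_equal. ring. Qed.

Lemma Cmod_triangle_minus (a b : C) : Cmod a - Cmod b <= Cmod (a - b).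
Proof.
  replace a with ((a - b) + b)%C at 1 by ring.
  generalize (Cmod_triangle (a - b) b); lra.
Qed.

Notation ccont f x := (@continuous R_UniformSpace C_UniformSpace f x).

Lemma ccont_pair (f : R -> C) (x : R) :
  continuous (fun t => Re (f t)) x -> continuous (fun t => Im (f t)) x -> ccont f x.
Proof.
  intros h1 h2.
  apply continuous_ext with (fun t => (Re (f t), Im (f t)) : C).
  - intros t; destruct (f t); reflexivity.
  - intros P [d hd].
    assert (h1' := h1 (ball (Re (f x)) d) (locally_ball _ _)).
    assert (h2' := h2 (ball (Im (f x)) d) (locally_ball _ _)).
    assert (hh : locally x (fun y => ball (Re (f x)) d (Re (f y)) /\ ball (Im (f x)) d (Im (f y))))
      by (apply filter_and; assumption).
    destruct hh as [e he]. exists e. intros y hy. apply hd. destruct (he y hy). split; assumption.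
Qed.

Lemma ccont_re (f : R -> C) (x : R) : ccont f x -> continuous (fun t => Re (f t)) x.
Proof. intros h. apply (continuous_comp f (fun z : C => fst z)); auto. apply continuous_fst. Qed.

Lemma ccont_im (f : R -> C) (x : R) : ccont f x -> continuous (fun t => Im (f t)) x.
Proof. intros h. apply (continuous_comp f (fun z : C => snd z)); auto. apply continuous_snd. Qed.

Lemma ccont_plus (f g : R -> C) (x : R) :
  ccont f x -> ccont g x -> ccont (fun t => f t + g t)%C x.
Proof.
  intros hf hg; apply ccont_pair; simpl.
  - apply (continuous_plus (fun t => Re (f t)) (fun t => Re (g t))); apply ccont_re; auto.
  - apply (continuous_plus (fun t => Im (f t)) (fun t => Im (g t))); apply ccont_im; auto.
Qed.

Lemma ccont_mult (f g : R -> C) (x : R) :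
  ccont f x -> ccont g x -> ccont (fun t => f t * g t)%C x.
Proof.
  intros hf hg; apply ccont_pair; simpl.
  - apply (continuous_minus (fun t => Re (f t) * Re (g t)) (fun t => Im (f t) * Im (g t)));
    apply @continuous_mult; (apply ccont_re + apply ccont_im); auto.
  - apply (continuous_plus (fun t => Re (f t) * Im (g t)) (fun t => Im (f t) * Re (g t)));
    apply @continuous_mult; (apply ccont_re + apply ccont_im); auto.
Qed.

Lemma ccont_const (c : C) (x : R) : ccont (fun _ => c) x.
Proof. apply continuous_const. Qed.

Lemma ccont_RtoC (f : R -> R) (x : R) : continuous f x -> ccont (fun t => RtoC (f t)) x.
Proof. intros h; apply ccont_pair; simpl; auto. apply continuous_const. Qed.

Lemma ccont_minus (f g : R -> C) (x : R) :
  ccont f x -> ccont g x -> ccont (fun t => f t - g t)%C x.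
Proof.
  intros hf hg.
  apply continuous_ext with (fun t => f t + (RtoC (-1)) * g t)%C.
  - intros t. replace (RtoC (-1)) with (Copp 1) by (rewrite <- RtoC_opp; reflexivity). cring.
  - apply ccont_plus; auto. apply ccont_mult; auto. apply ccont_const.
Qed.

Lemma ccont_eps (f : R -> C) (x : R) :
  ccont f x <-> forall eps, 0 < eps -> exists d, 0 < d /\
    forall y, Rabs (y - x) < d -> Cmod (f y - f x) < eps.
Proof.
  split.
  - intros h eps he.
    assert (k : @locally C_UniformSpace (f x) (fun w => Cmod (w - f x) < eps)).
    { apply locally_C_eps. exists eps; auto. }
    destruct (h _ k) as [d hd]. exists d; split; [apply cond_pos|]. intros y hy; apply hd, hy.
  - intros h P hP. apply locally_C_eps in hP. destruct hP as [e [he hP]].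
    destruct (h e he) as [d [hd hh]]. exists (mkposreal d hd). intros y hy; apply hP, hh, hy.
Qed.

Definition CInt (f : R -> C) (a b : R) : C := @RInt C_R_CompleteNormedModule f a b.

Definition ex_CInt (f : R -> C) (a b : R) : Prop := @ex_RInt C_R_NormedModule f a b.

Definition is_CInt (f : R -> C) (a b : R) (l : C) : Prop := @is_RInt C_R_NormedModule f a b l.

Lemma is_CInt_pair (f : R -> C) (a b : R) (l : C) :
  is_CInt f a b l <->
  is_RInt (fun t => Re (f t)) a b (Re l) /\ is_RInt (fun t => Im (f t)) a b (Im l).
Proof.
  split.
  - intros h; split.
    + apply (is_RInt_fct_extend_fst (U := R_NormedModule) (V := R_NormedModule) f a b l h).
    + apply (is_RInt_fct_extend_snd (U := R_NormedModule) (V := R_NormedModule) f a b l h).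
  - intros [h1 h2]. destruct l as [l1 l2].
    apply (is_RInt_fct_extend_pair (U := R_NormedModule) (V := R_NormedModule) f a b l1 l2); assumption.
Qed.

Lemma is_CInt_unique f a b l : is_CInt f a b l -> CInt f a b = l.
Proof. apply (is_RInt_unique (V := C_R_CompleteNormedModule)). Qed.

Lemma CInt_correct f a b : ex_CInt f a b -> is_CInt f a b (CInt f a b).
Proof. apply (RInt_correct (V := C_R_CompleteNormedModule)). Qed.

Lemma ex_CInt_cont (f : R -> C) a b :
  (forall z, Rmin a b <= z <= Rmax a b -> ccont f z) -> ex_CInt f a b.
Proof. apply (ex_RInt_continuous (V := C_R_CompleteNormedModule)). Qed.

Lemma is_CInt_plus f g a b l m :
  is_CInt f a b l -> is_CInt g a b m -> is_CInt (fun t => f t + g t)%C a b (l + m)%C.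
Proof. apply (is_RInt_plus (V := C_R_NormedModule)). Qed.

Lemma is_CInt_minus f g a b l m :
  is_CInt f a b l -> is_CInt g a b m -> is_CInt (fun t => f t - g t)%C a b (l - m)%C.
Proof. apply (is_RInt_minus (V := C_R_NormedModule)). Qed.

Lemma is_CInt_scal (c : C) f a b l :
  is_CInt f a b l -> is_CInt (fun t => c * f t)%C a b (c * l)%C.
Proof.
  rewrite !is_CInt_pair. intros [h1 h2]. simpl. split.
  - apply (is_RInt_minus (V := R_NormedModule)).
    + apply (is_RInt_scal (V := R_NormedModule) _ _ _ (fst c) (Re l)), h1.
    + apply (is_RInt_scal (V := R_NormedModule) _ _ _ (snd c) (Im l)), h2.
  - apply (is_RInt_plus (V := R_NormedModule)).
    + apply (is_RInt_scal (V := R_NormedModule) _ _ _ (fst c) (Im l)), h2.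
    + apply (is_RInt_scal (V := R_NormedModule) _ _ _ (snd c) (Re l)), h1.
Qed.

Lemma is_CInt_ext f g a b l :
  (forall x, Rmin a b < x < Rmax a b -> f x = g x) -> is_CInt f a b l -> is_CInt g a b l.
Proof. apply (is_RInt_ext (V := C_R_NormedModule)). Qed.

Lemma is_CInt_Chasles f a b c l m :
  is_CInt f a b l -> is_CInt f b c m -> is_CInt f a c (l + m)%C.
Proof. apply (is_RInt_Chasles (V := C_R_NormedModule)). Qed.

Lemma CInt_Chasles f a b c :
  ex_CInt f a b -> ex_CInt f b c -> CInt f a c = (CInt f a b + CInt f b c)%C.
Proof.
  intros h1 h2. apply is_CInt_unique, is_CInt_Chasles with b; apply CInt_correct; auto.
Qed.

Lemma CInt_ext f g a b :
  (forall x, Rmin a b < x < Rmax a b -> f x = g x) -> CInt f a b = CInt g a b.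
Proof. apply (RInt_ext (V := C_R_CompleteNormedModule)). Qed.

Lemma CInt_minus f g a b : ex_CInt f a b -> ex_CInt g a b ->
  CInt (fun t => f t - g t)%C a b = (CInt f a b - CInt g a b)%C.
Proof. intros; apply is_CInt_unique, is_CInt_minus; apply CInt_correct; auto. Qed.

Lemma CInt_scal c f a b : ex_CInt f a b ->
  CInt (fun t => c * f t)%C a b = (c * CInt f a b)%C.
Proof. intros; apply is_CInt_unique, is_CInt_scal, CInt_correct; auto. Qed.

Lemma Cmod_is_CInt_le f (g : R -> R) a b l lg :
  a <= b -> (forall x, a <= x <= b -> Cmod (f x) <= g x) ->
  is_CInt f a b l -> is_RInt g a b lg -> Cmod l <= lg.
Proof.
  intros hab h1 h2 h3. rewrite Cmod_norm.
  apply (norm_RInt_le (V := C_R_NormedModule) f g a b l lg hab); auto.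
  intros x hx; rewrite <- Cmod_norm; auto.
Qed.

Lemma Cmod_CInt_le_const f a b M :
  a <= b -> (forall x, a <= x <= b -> Cmod (f x) <= M) ->
  ex_CInt f a b -> Cmod (CInt f a b) <= (b - a) * M.
Proof.
  intros hab hM hf. rewrite Cmod_norm.
  apply (norm_RInt_le_const (V := C_R_NormedModule) f a b _ M hab).
  - intros x hx; rewrite <- Cmod_norm; auto.
  - apply CInt_correct; auto.
Qed.

Definition is_rcderive (f : R -> C) (t : R) (l : C) :=
  is_derive (fun t => Re (f t)) t (Re l) /\ is_derive (fun t => Im (f t)) t (Im l).

Lemma is_rcderive_cont f t l : is_rcderive f t l -> ccont f t.
Proof.
  intros [h1 h2]. apply ccont_pair.
  - apply (ex_derive_continuous (fun t => Re (f t))); eexists; eauto.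
  - apply (ex_derive_continuous (fun t => Im (f t))); eexists; eauto.
Qed.

Lemma is_CInt_derive f df a b :
  (forall x, Rmin a b <= x <= Rmax a b -> is_rcderive f x (df x)) ->
  (forall x, Rmin a b <= x <= Rmax a b -> ccont df x) ->
  is_CInt df a b (f b - f a)%C.
Proof.
  intros h1 h2. apply is_CInt_pair. split.
  - apply (is_RInt_derive (fun t => Re (f t)) (fun t => Re (df t))).
    + intros x hx; apply h1; auto.
    + intros x hx; apply ccont_re, h2; auto.
  - apply (is_RInt_derive (fun t => Im (f t)) (fun t => Im (df t))).
    + intros x hx; apply h1; auto.
    + intros x hx; apply ccont_im, h2; auto.
Qed.

Lemma is_derive_eps (f : R -> R) x l :
  is_derive f x l <-> forall eps, 0 < eps -> exists d, 0 < d /\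
   forall y, Rabs (y - x) < d -> Rabs (f y - f x - l * (y - x)) <= eps * Rabs (y - x).
Proof.
  split.
  - intros [_ H] eps he.
    destruct (H x (fun P h => h) (mkposreal eps he)) as [d hd].
    exists d; split; [apply cond_pos|]. intros y hy. specialize (hd y hy).
    refine (eq_rect _ (fun c => Rabs c <= eps * Rabs (y - x)) hd _ _).
    unfold minus, plus, opp, scal; simpl. unfold mult; simpl. ring.
  - intros H; split; [apply is_linear_scal_l|].
    intros z hz eps.
    assert (hzx : x = z) by (apply is_filter_lim_locally_unique; exact hz).
    subst z.
    destruct (H eps (cond_pos eps)) as [d [hd1 hd2]].
    exists (mkposreal d hd1); intros w hw. specialize (hd2 w hw).
    refine (eq_rect _ (fun c => Rabs c <= eps * Rabs (w - x)) hd2 _ _).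
    unfold minus, plus, opp, scal; simpl. unfold mult; simpl. ring.
Qed.

Lemma is_rcderive_eps (f : R -> C) t l :
  (forall eps, 0 < eps -> exists d, 0 < d /\
   forall y, Rabs (y - t) < d -> Cmod (f y - f t - l * RtoC (y - t)) <= eps * Rabs (y - t)) ->
  is_rcderive f t l.
Proof.
  intros H; split; apply is_derive_eps; intros eps he; destruct (H eps he) as [d [hd h]];
    exists d; split; auto; intros y hy; eapply Rle_trans; try apply (h y hy).
  - eapply Rle_trans; [|apply re_le_Cmod]. right; f_equal. unfold Re, Im; simpl. ring.
  - eapply Rle_trans; [|apply im_le_Cmod]. right; f_equal. unfold Re, Im; simpl. ring.
Qed.

Lemma is_rcderive_line (F : C -> C) (p v l : C) (t : R) :
  is_cderive F (p + RtoC t * v)%C l -> is_rcderive (fun t => F (p + RtoC t * v)%C) t (v * l)%C.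
Proof.
  intros h. apply is_rcderive_eps. intros eps he.
  destruct (Ceq_dec v 0) as [hv|hv].
  { exists 1; split; [lra|]. intros y _. subst v.
    replace (F (p + y * 0) - F (p + t * 0) - 0 * l * RtoC (y - t))%C with (RtoC 0).
    2: { replace (p + y * 0)%C with (p + t * 0)%C by ring. ring. }
    rewrite Cmod_0.
    apply Rmult_le_pos; [lra|apply Rabs_pos]. }
  assert (hm : 0 < Cmod v) by (apply Cmod_gt_0; auto).
  rewrite is_cderive_eps in h.
  destruct (h (eps / Cmod v)) as [d [hd hh]]. { apply Rdiv_lt_0_compat; auto. }
  exists (d / Cmod v); split. { apply Rdiv_lt_0_compat; auto. }
  intros y hy. specialize (hh (p + y * v)%C).
  assert (k : (p + y * v - (p + t * v))%C = (RtoC (y - t) * v)%C).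
  { rewrite RtoC_minus; ring. }
  rewrite k, Cmod_mult, Cmod_R in hh.
  eapply Rle_trans; [|eapply Rle_trans; [apply hh|]].
  - right; f_equal. ring.
  - apply Rmult_lt_reg_r with (/ Cmod v); [apply Rinv_0_lt_compat; auto|].
    rewrite Rmult_assoc, Rinv_r, Rmult_1_r by lra. exact hy.
  - right; field; lra.
Qed.

Lemma is_cderive_plus (f g : C -> C) (z a b : C) :
  is_cderive f z a -> is_cderive g z b -> is_cderive (fun w => f w + g w)%C z (a + b)%C.
Proof. apply @is_derive_plus. Qed.

Lemma is_cderive_minus (f g : C -> C) (z a b : C) :
  is_cderive f z a -> is_cderive g z b -> is_cderive (fun w => f w - g w)%C z (a - b)%C.
Proof. apply @is_derive_minus. Qed.

Lemma is_cderive_const (c z : C) : is_cderive (fun _ => c) z (RtoC 0).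
Proof. apply @is_derive_const. Qed.

Lemma is_cderive_id (z : C) : is_cderive (fun w => w) z (RtoC 1).
Proof. apply is_cderive_eps. intros eps he; exists 1; split; [lra|].
  intros w _. replace (w - z - 1 * (w - z))%C with (RtoC 0) by ring. rewrite Cmod_0.
  apply Rmult_le_pos; [lra|apply Cmod_ge_0]. Qed.

Lemma is_cderive_ext_loc (f g : C -> C) (z l : C) (d : R) :
  0 < d -> (forall w, Cmod (w - z) < d -> f w = g w) -> is_cderive f z l -> is_cderive g z l.
Proof.
  intros hd h. apply (is_derive_ext_loc (V := C_NormedModule)).
  apply locally_AC_eps. exists d; auto.
Qed.

Lemma is_cderive_val (f : C -> C) (z a b : C) : is_cderive f z a -> a = b -> is_cderive f z b.
Proof. intros h <-; exact h. Qed.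

Lemma is_cderive_cont (f : C -> C) (z l : C) : is_cderive f z l ->
  forall eps, 0 < eps -> exists d, 0 < d /\ forall w, Cmod (w - z) < d -> Cmod (f w - f z) < eps.
Proof.
  intros h eps he. rewrite is_cderive_eps in h.
  destruct (h 1 Rlt_0_1) as [d [hd hh]].
  assert (hl := Cmod_ge_0 l).
  exists (Rmin d (eps / (2 + Cmod l))). split.
  { apply Rmin_pos; auto. apply Rdiv_lt_0_compat; lra. }
  intros w hw.
  assert (h1 : Cmod (w - z) < d) by (eapply Rlt_le_trans; [exact hw|apply Rmin_l]).
  assert (h2 : Cmod (w - z) < eps / (2 + Cmod l)) by (eapply Rlt_le_trans; [exact hw|apply Rmin_r]).
  specialize (hh w h1).
  replace (f w - f z)%C with ((f w - f z - l * (w - z)) + l * (w - z))%C by ring.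
  eapply Rle_lt_trans; [apply Cmod_triangle|]. rewrite Cmod_mult.
  assert (hp := Cmod_ge_0 (w - z)).
  apply Rle_lt_trans with ((1 + Cmod l) * Cmod (w - z)); [nra|].
  apply Rle_lt_trans with ((2 + Cmod l) * Cmod (w - z)); [nra|].
  apply Rmult_lt_reg_r with (/ (2 + Cmod l)); [apply Rinv_0_lt_compat; lra|].
  replace ((2 + Cmod l) * Cmod (w - z) * / (2 + Cmod l)) with (Cmod (w - z)) by (field; lra).
  exact h2.
Qed.

Lemma is_cderive_mult (f g : C -> C) (z a b : C) :
  is_cderive f z a -> is_cderive g z b ->
  is_cderive (fun w => f w * g w)%C z (a * g z + f z * b)%C.
Proof.
  intros hf hg.
  destruct (is_cderive_cont _ _ _ hg 1 Rlt_0_1) as [d0 [hd0 hc]].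
  assert (hc' := is_cderive_cont _ _ _ hg).
  rewrite is_cderive_eps in *. intros eps he.
  assert (ha := Cmod_ge_0 a). assert (hfz := Cmod_ge_0 (f z)). assert (hgz := Cmod_ge_0 (g z)).
  set (M := 3 + Cmod a + Cmod (f z) + Cmod (g z)).
  assert (hM : 0 < M) by (unfold M; lra).
  set (e := eps / M). assert (he' : 0 < e) by (apply Rdiv_lt_0_compat; auto).
  destruct (hf e he') as [d1 [hd1 h1]].
  destruct (hg e he') as [d2 [hd2 h2]].
  destruct (hc' e he') as [d3 [hd3 h3]].
  exists (Rmin (Rmin d0 d1) (Rmin d2 d3)). split.
  { repeat apply Rmin_pos; auto. }
  intros w hw. apply Rmin_Rgt_l in hw as [hw1 hw2].
  apply Rmin_Rgt_l in hw1 as [k0 k1]. apply Rmin_Rgt_l in hw2 as [k2 k3].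
  specialize (hc w k0). specialize (h1 w k1). specialize (h2 w k2). specialize (h3 w k3).
  assert (hp := Cmod_ge_0 (w - z)). set (r := Cmod (w - z)) in *.
  replace (f w * g w - f z * g z - (a * g z + f z * b) * (w - z))%C
    with ((f w - f z - a * (w - z)) * g w + a * (w - z) * (g w - g z)
          + f z * (g w - g z - b * (w - z)))%C by ring.
  eapply Rle_trans; [apply Cmod_triangle|].
  eapply Rle_trans; [apply Rplus_le_compat_r, Cmod_triangle|].
  rewrite !Cmod_mult. fold r.
  assert (hgw : Cmod (g w) <= Cmod (g z) + 1).
  { replace (g w) with (g z + (g w - g z))%C by ring.
    eapply Rle_trans; [apply Cmod_triangle|]. lra. }
  assert (hgw0 := Cmod_ge_0 (g w)).
  apply Rle_trans with (e * r * (Cmod (g z) + 1) + Cmod a * r * e + Cmod (f z) * (e * r)).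
  - apply Rplus_le_compat; [apply Rplus_le_compat|].
    + apply Rmult_le_compat; auto. apply Cmod_ge_0.
    + apply Rmult_le_compat_l; [nra|lra].
    + apply Rmult_le_compat_l; auto.
  - apply Rle_trans with (e * M * r).
    + unfold M. assert (0 <= e * r) by nra. nra.
    + unfold e. right. field. lra.
Qed.

Lemma is_cderive_comp (f g : C -> C) (z a b : C) :
  is_cderive f (g z) a -> is_cderive g z b -> is_cderive (fun w => f (g w)) z (a * b)%C.
Proof.
  intros hf hg.
  assert (hc := is_cderive_cont _ _ _ hg).
  rewrite is_cderive_eps in *. intros eps he.
  assert (ha := Cmod_ge_0 a). assert (hb := Cmod_ge_0 b).
  set (M := 3 + Cmod a + Cmod b).
  set (e := Rmin 1 (eps / M)).
  assert (he' : 0 < e) by (apply Rmin_pos; [lra|apply Rdiv_lt_0_compat; unfold M; lra]).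
  assert (he1 : e <= 1) by apply Rmin_l.
  assert (heM : e * M <= eps).
  { apply Rle_trans with (eps / M * M).
    apply Rmult_le_compat_r; [unfold M; lra|apply Rmin_r]. right; field; unfold M; lra. }
  destruct (hf e he') as [d1 [hd1 h1]].
  destruct (hg e he') as [d2 [hd2 h2]].
  destruct (hc d1 hd1) as [d3 [hd3 h3]].
  exists (Rmin d2 d3). split; [apply Rmin_pos; auto|].
  intros w hw. apply Rmin_Rgt_l in hw as [k2 k3].
  specialize (h2 w k2). specialize (h3 w k3). specialize (h1 (g w) h3).
  assert (hp := Cmod_ge_0 (w - z)). set (r := Cmod (w - z)) in *.
  replace (f (g w) - f (g z) - a * b * (w - z))%C with
   ((f (g w) - f (g z) - a * (g w - g z)) + a * (g w - g z - b * (w - z)))%C by ring.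
  eapply Rle_trans; [apply Cmod_triangle|]. rewrite Cmod_mult.
  assert (hd : Cmod (g w - g z) <= (1 + Cmod b) * r).
  { replace (g w - g z)%C with ((g w - g z - b * (w - z)) + b * (w - z))%C by ring.
    eapply Rle_trans; [apply Cmod_triangle|]. rewrite Cmod_mult. fold r. nra. }
  apply Rle_trans with (e * ((1 + Cmod b) * r) + Cmod a * (e * r)).
  - apply Rplus_le_compat.
    + eapply Rle_trans; [apply h1|]. apply Rmult_le_compat_l; lra.
    + apply Rmult_le_compat_l; auto.
  - apply Rle_trans with (e * M * r); [unfold M|].
    + assert (0 <= e * r) by nra. nra.
    + apply Rmult_le_compat_r; auto.
Qed.

Lemma is_cderive_inv (z : C) : z <> 0 -> is_cderive Cinv z (- / (z * z))%C.
Proof.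
  intros hz. assert (hm : 0 < Cmod z) by (apply Cmod_gt_0; auto).
  apply is_cderive_eps. intros eps he.
  set (m := Cmod z) in *.
  exists (Rmin (m / 2) (eps * (m * m * m) / 2)). split.
  { apply Rmin_pos; [lra|]. apply Rdiv_lt_0_compat; [|lra]. repeat apply Rmult_lt_0_compat; auto. }
  intros w hw. apply Rmin_Rgt_l in hw as [k1 k2].
  assert (hwm : m / 2 <= Cmod w).
  { generalize (Cmod_triangle_minus z w). rewrite Cmod_minus_sym in k1. fold m. lra. }
  assert (hw0 : w <> 0). { intros ->. rewrite Cmod_0 in hwm. lra. }
  replace (/ w - / z - - / (z * z) * (w - z))%C with ((w - z) * (w - z) * / (w * z * z))%C
    by (field; split; auto).
  rewrite !Cmod_mult, Cmod_inv, !Cmod_mult by (repeat apply Cmult_neq_0; auto).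
  fold m. set (r := Cmod (w - z)) in *. assert (hr : 0 <= r) by apply Cmod_ge_0.
  set (n := Cmod w) in *.
  replace (r * r * / (n * m * m)) with (r / (n * m * m) * r) by (field; split; lra).
  apply Rmult_le_compat_r; auto.
  apply Rle_div_l. { apply Rlt_gt. repeat apply Rmult_lt_0_compat; lra. }
  apply Rle_trans with (eps * (m * m * m) / 2); [lra|].
  assert (0 < eps * (m * m)) by (repeat apply Rmult_lt_0_compat; lra). nra.
Qed.

Lemma is_cderive_div (f g : C -> C) (z a b : C) :
  g z <> 0 -> is_cderive f z a -> is_cderive g z b ->
  is_cderive (fun w => f w / g w)%C z ((a * g z - f z * b) / (g z * g z))%C.
Proof.
  intros hz hf hg.
  eapply is_cderive_val.
  - apply (is_cderive_mult f (fun w => / g w)%C z); [exact hf|].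
    apply (is_cderive_comp Cinv g); [|exact hg]. apply is_cderive_inv, hz.
  - field; auto.
Qed.

Lemma is_cderive_scal (c : C) (f : C -> C) (z a : C) :
  is_cderive f z a -> is_cderive (fun w => c * f w)%C z (c * a)%C.
Proof.
  intros hf. eapply is_cderive_val.
  apply (is_cderive_mult (fun _ => c) f); [apply is_cderive_const|exact hf]. ring.
Qed.

Lemma is_cderive_pow (f : C -> C) (z a : C) (n : nat) :
  is_cderive f z a -> exists l, is_cderive (fun w => f w ^ n)%C z l.
Proof.
  intros hf. induction n as [|n [l hl]].
  - exists (RtoC 0). exact (is_cderive_const (RtoC 1) z).
  - eexists. apply (is_cderive_mult f (fun w => f w ^ n)%C); eauto.
Qed.

Lemma Cexp_plus (a b : C) : Cexp (a + b) = (Cexp a * Cexp b)%C.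
Proof.
  apply C_ext; unfold Cexp, Re, Im; simpl; rewrite exp_plus; [rewrite cos_plus|rewrite sin_plus]; ring.
Qed.

Lemma Cexp_0 : Cexp 0 = 1%C.
Proof. apply C_ext; unfold Cexp, Re, Im; simpl; rewrite exp_0, ?cos_0, ?sin_0; ring. Qed.

Lemma Cexp_RtoC (x : R) : Cexp (RtoC x) = RtoC (exp x).
Proof. apply C_ext; unfold Cexp, Re, Im; simpl; rewrite ?cos_0, ?sin_0; ring. Qed.

Lemma Cmod_Cexp (z : C) : Cmod (Cexp z) = exp (Re z).
Proof.
  assert (h : (Cmod (Cexp z))² = (exp (Re z))²).
  { unfold Rsqr at 1. replace (Cmod (Cexp z) * Cmod (Cexp z)) with (Cmod (Cexp z) ^ 2) by ring.
    rewrite Cmod2_alt. unfold Cexp; simpl.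
    generalize (sin2_cos2 (Im z)). unfold Rsqr, Im, Re. intros h.
    replace (exp (fst z) * exp (fst z)) with (exp (fst z) * exp (fst z) *
       (sin (snd z) * sin (snd z) + cos (snd z) * cos (snd z))) by (rewrite h; ring). ring. }
  apply Rsqr_inj; auto. apply Cmod_ge_0. left; apply exp_pos.
Qed.

Lemma Cexp_neq_0 (z : C) : Cexp z <> RtoC 0.
Proof. intros h. assert (k := Cmod_Cexp z). rewrite h, Cmod_0 in k. generalize (exp_pos (Re z)); lra. Qed.

Lemma Cexp_opp (z : C) : Cexp (- z) = (/ Cexp z)%C.
Proof.
  assert (h : (Cexp z * Cexp (- z))%C = 1%C).
  { rewrite <- Cexp_plus, <- Cexp_0. f_equal. ring. }
  assert (k := Cexp_neq_0 z).
  replace (Cexp (- z)) with (/ Cexp z * (Cexp z * Cexp (- z)))%C by (field; auto).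
  rewrite h. ring.
Qed.

Lemma exp_le (x y : R) : x <= y -> exp x <= exp y.
Proof. intros [h| ->]; [left; apply exp_increasing, h|right; auto]. Qed.

Lemma is_rcderive_Cexp_line (w : C) (t : R) :
  is_rcderive (fun t => Cexp (t * w)) t (w * Cexp (t * w)).
Proof.
  split; unfold Cexp, Re, Im; simpl; auto_derive; auto; unfold Rminus; ring.
Qed.

Lemma Cexp_bound1 (w : C) : Cmod (Cexp w - 1) <= Cmod w * exp (Cmod w).
Proof.
  assert (hi : is_CInt (fun t => w * Cexp (t * w))%C 0 1 (Cexp w - 1)%C).
  { replace (Cexp w - 1)%C with (Cexp (1 * w) - Cexp (0 * w))%C.
    - apply (is_CInt_derive (fun t => Cexp (t * w))).
      + intros x _. apply is_rcderive_Cexp_line.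
      + intros x _. apply ccont_mult; [apply ccont_const|].
        eapply is_rcderive_cont, is_rcderive_Cexp_line.
    - rewrite Cmult_0_l, Cmult_1_l, Cexp_0. ring. }
  rewrite <- (Rmult_1_l (Cmod w * exp (Cmod w))). replace 1 with (1 - 0) at 2 by ring.
  rewrite <- (is_CInt_unique _ _ _ _ hi).
  apply Cmod_CInt_le_const; [lra| |eexists; exact hi].
  intros t ht. rewrite Cmod_mult, Cmod_Cexp. apply Rmult_le_compat_l; [apply Cmod_ge_0|].
  apply exp_le. eapply Rle_trans; [apply Rle_abs|]. eapply Rle_trans; [apply re_le_Cmod|].
  rewrite Cmod_mult, Cmod_R, Rabs_pos_eq by lra. generalize (Cmod_ge_0 w); nra.
Qed.

Lemma Cexp_bound2 (w : C) : Cmod (Cexp w - 1 - w) <= Cmod w ^ 2 * exp (Cmod w).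
Proof.
  assert (hi : is_CInt (fun t => w * Cexp (t * w) - w)%C 0 1 (Cexp w - 1 - w)%C).
  { replace (Cexp w - 1 - w)%C with ((Cexp (1 * w) - 1 * w) - (Cexp (0 * w) - 0 * w))%C.
    - apply (is_CInt_derive (fun t => Cexp (t * w) - t * w)%C).
      + intros x _. split; unfold Cexp, Re, Im; simpl; auto_derive; auto; unfold Rminus; ring.
      + intros x _. apply ccont_minus; [|apply ccont_const].
        apply ccont_mult; [apply ccont_const|].
        eapply is_rcderive_cont, is_rcderive_Cexp_line.
    - rewrite !Cmult_0_l, !Cmult_1_l, Cexp_0. ring. }
  rewrite <- (Rmult_1_l (Cmod w ^ 2 * exp (Cmod w))). replace 1 with (1 - 0) at 2 by ring.
  rewrite <- (is_CInt_unique _ _ _ _ hi).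
  apply Cmod_CInt_le_const; [lra| |eexists; exact hi].
  intros t ht. replace (w * Cexp (t * w) - w)%C with (w * (Cexp (t * w) - 1))%C by ring.
  rewrite Cmod_mult. simpl. rewrite Rmult_1_r, Rmult_assoc.
  assert (h0 := Cmod_ge_0 w). apply Rmult_le_compat_l; auto.
  eapply Rle_trans; [apply Cexp_bound1|].
  rewrite Cmod_mult, Cmod_R, Rabs_pos_eq by lra.
  assert (t * Cmod w <= Cmod w) by nra.
  apply Rmult_le_compat; try nra. left; apply exp_pos. apply exp_le; auto.
Qed.

Lemma is_cderive_Cexp (z : C) : is_cderive Cexp z (Cexp z).
Proof.
  apply is_cderive_eps. intros eps he.
  assert (hm : 0 < Cmod (Cexp z) * exp 1).
  { rewrite Cmod_Cexp. apply Rmult_lt_0_compat; apply exp_pos. }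
  exists (Rmin 1 (eps / (Cmod (Cexp z) * exp 1))). split.
  { apply Rmin_pos; [lra|]. apply Rdiv_lt_0_compat; auto. }
  intros w hw. apply Rmin_Rgt_l in hw as [k1 k2].
  replace (Cexp w - Cexp z - Cexp z * (w - z))%C with (Cexp z * (Cexp (w - z) - 1 - (w - z)))%C.
  2: { replace (Cexp w) with (Cexp (z + (w - z))) by (f_equal; ring). rewrite Cexp_plus. ring. }
  rewrite Cmod_mult. set (r := Cmod (w - z)) in *. assert (hr : 0 <= r) by apply Cmod_ge_0.
  apply Rle_trans with (Cmod (Cexp z) * (r ^ 2 * exp 1)).
  - apply Rmult_le_compat_l; [apply Cmod_ge_0|].
    eapply Rle_trans; [apply Cexp_bound2|]. fold r. apply Rmult_le_compat_l; [nra|].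
    apply exp_le; lra.
  - replace (Cmod (Cexp z) * (r ^ 2 * exp 1)) with ((Cmod (Cexp z) * exp 1) * r * r) by ring.
    apply Rmult_le_compat_r; auto. rewrite Rmult_comm. apply Rle_div_r; [exact hm|]. lra.
Qed.

(** * Goursat's theorem on rectangles *)

Definition boundary_int (f : C -> C) (a b c d : R) : C :=
  (CInt (fun x => f (x, c)) a b + Ci * CInt (fun y => f (b, y)) c d
   - CInt (fun x => f (x, d)) a b - Ci * CInt (fun y => f (a, y)) c d)%C.

Definition holo_rect (f : C -> C) (a b c d : R) : Prop :=
  forall x y, a <= x <= b -> c <= y <= d -> exists l, is_cderive f (x, y) l.

Lemma Cmod_pair_h (x x' y : R) : Cmod ((x, y) - (x', y))%C = Rabs (x - x').
Proof.
  rewrite <- Cmod_R. f_equal. apply C_ext; simpl; ring.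
Qed.

Lemma Cmod_pair_v (x y y' : R) : Cmod ((x, y) - (x, y'))%C = Rabs (y - y').
Proof.
  replace ((x, y) - (x, y'))%C with (Ci * RtoC (y - y'))%C by (apply C_ext; simpl; ring).
  rewrite Cmod_mult, Cmod_Ci, Cmod_R; ring.
Qed.

Lemma ccont_horizontal (f : C -> C) x y l : is_cderive f (x, y) l -> ccont (fun t => f (t, y)) x.
Proof.
  intros h. apply ccont_eps. intros eps he.
  destruct (is_cderive_cont _ _ _ h eps he) as [d [hd hh]].
  exists d; split; auto. intros t ht. apply hh. rewrite Cmod_pair_h. exact ht.
Qed.

Lemma ccont_vertical (f : C -> C) x y l : is_cderive f (x, y) l -> ccont (fun t => f (x, t)) y.
Proof.
  intros h. apply ccont_eps. intros eps he.
  destruct (is_cderive_cont _ _ _ h eps he) as [d [hd hh]].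
  exists d; split; auto. intros t ht. apply hh. rewrite Cmod_pair_v. exact ht.
Qed.

Lemma holo_rect_ex_h f a b c d y a' b' : holo_rect f a b c d -> a <= a' -> a' <= b' -> b' <= b ->
  c <= y <= d -> ex_CInt (fun t => f (t, y)) a' b'.
Proof.
  intros h ha hab hb hy. apply ex_CInt_cont. rewrite Rmin_left, Rmax_right by lra.
  intros z hz. destruct (h z y) as [l hl]; try lra. eapply ccont_horizontal; eauto.
Qed.

Lemma holo_rect_ex_v f a b c d x c' d' : holo_rect f a b c d -> c <= c' -> c' <= d' -> d' <= d ->
  a <= x <= b -> ex_CInt (fun t => f (x, t)) c' d'.
Proof.
  intros h ha hab hb hy. apply ex_CInt_cont. rewrite Rmin_left, Rmax_right by lra.
  intros z hz. destruct (h x z) as [l hl]; try lra. eapply ccont_vertical; eauto.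
Qed.

Lemma boundary_int_split_v (f : C -> C) a m b c d : holo_rect f a b c d -> a <= m <= b -> c <= d ->
  boundary_int f a b c d = (boundary_int f a m c d + boundary_int f m b c d)%C.
Proof.
  intros h hm hcd. unfold boundary_int.
  rewrite (CInt_Chasles (fun x => f (x, c)) a m b), (CInt_Chasles (fun x => f (x, d)) a m b);
    try (apply holo_rect_ex_h with a b c d; auto; lra).
  ring.
Qed.

Lemma boundary_int_split_h (f : C -> C) a b c m d : holo_rect f a b c d -> a <= b -> c <= m <= d ->
  boundary_int f a b c d = (boundary_int f a b c m + boundary_int f a b m d)%C.
Proof.
  intros h hm hcd. unfold boundary_int.
  rewrite (CInt_Chasles (fun x => f (a, x)) c m d), (CInt_Chasles (fun x => f (b, x)) c m d);
    try (apply holo_rect_ex_v with a b c d; auto; lra).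
  ring.
Qed.

Lemma boundary_int_primitive (F f : C -> C) (a b c d : R) : a <= b -> c <= d ->
  (forall x y, a <= x <= b -> c <= y <= d -> is_cderive F (x, y) (f (x, y))) ->
  holo_rect f a b c d -> boundary_int f a b c d = 0%C.
Proof.
  intros hab hcd hF hf. unfold boundary_int.
  assert (hh : forall y, c <= y <= d -> CInt (fun x => f (x, y)) a b = (F (b, y) - F (a, y))%C).
  { intros y hy. apply is_CInt_unique.
    apply (is_CInt_derive (fun x => F (x, y))); rewrite Rmin_left, Rmax_right by lra.
    - intros x hx.
      assert (e : forall t : R, @eq C (t, y) (RtoC 0 + Ci * y + t * 1)%C)
        by (intros t; apply C_ext; simpl; ring).
      destruct (is_rcderive_line F (0 + Ci * y) 1 (f (x, y)) x) as [h1 h2].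
      { rewrite <- e. auto. }
      rewrite Cmult_1_l in *.
      split; [eapply is_derive_ext; [|exact h1]|eapply is_derive_ext; [|exact h2]];
        intros t; rewrite e; reflexivity.
    - intros x hx. destruct (hf x y) as [l hl]; auto. eapply ccont_horizontal; eauto. }
  assert (hv : forall x, a <= x <= b -> (Ci * CInt (fun y => f (x, y)) c d)%C = (F (x, d) - F (x, c))%C).
  { intros x hx. rewrite <- CInt_scal by (apply holo_rect_ex_v with a b c d; auto; lra).
    apply is_CInt_unique.
    apply (is_CInt_derive (fun y => F (x, y))); rewrite Rmin_left, Rmax_right by lra.
    - intros y hy.
      assert (e : forall t : R, @eq C (x, t) (RtoC x + t * Ci)%C)
        by (intros t; apply C_ext; simpl; ring).
      destruct (is_rcderive_line F x Ci (f (x, y)) y) as [h1 h2].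
      { rewrite <- e. auto. }
      split; [eapply is_derive_ext; [|exact h1]|eapply is_derive_ext; [|exact h2]];
        intros t; rewrite e; reflexivity.
    - intros y hy. apply ccont_mult; [apply ccont_const|].
      destruct (hf x y) as [l hl]; auto. eapply ccont_vertical; eauto. }
  rewrite !hh, !hv by lra. ring.
Qed.

Lemma boundary_int_minus (f : C -> C) g a b c d : a <= b -> c <= d ->
  holo_rect f a b c d -> holo_rect g a b c d ->
  boundary_int (fun z => f z - g z)%C a b c d
  = (boundary_int f a b c d - boundary_int g a b c d)%C.
Proof.
  intros hab hcd hf hg. unfold boundary_int.
  assert (h1 : forall y, c <= y <= d -> CInt (fun x => f (x, y) - g (x, y))%C a b
     = (CInt (fun x => f (x, y)) a b - CInt (fun x => g (x, y)) a b)%C).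
  { intros y hy. apply (CInt_minus (fun x => f (x, y)) (fun x => g (x, y)));
    apply holo_rect_ex_h with a b c d; auto; lra. }
  assert (h2 : forall x, a <= x <= b -> CInt (fun y => f (x, y) - g (x, y))%C c d
     = (CInt (fun y => f (x, y)) c d - CInt (fun y => g (x, y)) c d)%C).
  { intros x hx. apply (CInt_minus (fun y => f (x, y)) (fun y => g (x, y)));
    apply holo_rect_ex_v with a b c d; auto; lra. }
  rewrite (h1 c), (h1 d), (h2 a), (h2 b) by lra. ring.
Qed.

Lemma Cmod_boundary_int_le f a b c d M : a <= b -> c <= d -> holo_rect f a b c d ->
  (forall x y, a <= x <= b -> c <= y <= d -> Cmod (f (x, y)) <= M) ->
  Cmod (boundary_int f a b c d) <= 2 * ((b - a) + (d - c)) * M.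
Proof.
  intros hab hcd hf hM. unfold boundary_int, Cminus.
  assert (h1 : forall y, c <= y <= d -> Cmod (CInt (fun x => f (x, y)) a b) <= (b - a) * M).
  { intros y hy. apply Cmod_CInt_le_const; auto. apply holo_rect_ex_h with a b c d; auto; lra. }
  assert (h2 : forall x, a <= x <= b -> Cmod (CInt (fun y => f (x, y)) c d) <= (d - c) * M).
  { intros x hx. apply Cmod_CInt_le_const; auto. apply holo_rect_ex_v with a b c d; auto; lra. }
  eapply Rle_trans; [apply Cmod_triangle|]. rewrite Cmod_opp, Cmod_mult, Cmod_Ci.
  assert (k := Cmod_triangle (CInt (fun x => f (x, c)) a b + Ci * CInt (fun y => f (b, y)) c d)
    (- CInt (fun x => f (x, d)) a b)).
  assert (k' := Cmod_triangle (CInt (fun x => f (x, c)) a b) (Ci * CInt (fun y => f (b, y)) c d)).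
  rewrite Cmod_opp in k. rewrite Cmod_mult, Cmod_Ci in k'.
  generalize (h1 c ltac:(lra)) (h1 d ltac:(lra)) (h2 a ltac:(lra)) (h2 b ltac:(lra)). lra.
Qed.

Lemma holo_rect_sub f a b c d a' b' c' d' : holo_rect f a b c d ->
  a <= a' -> b' <= b -> c <= c' -> d' <= d -> holo_rect f a' b' c' d'.
Proof. intros h h1 h2 h3 h4 x y hx hy. apply h; lra. Qed.

Lemma boundary_int_quarter f a c w h e : 0 <= w -> 0 <= h ->
  holo_rect f a (a + w) c (c + h) ->
  e * (w * h) < Cmod (boundary_int f a (a + w) c (c + h)) ->
  exists a' c', a <= a' <= a + w / 2 /\ c <= c' <= c + h / 2 /\
  e * (w / 2 * (h / 2)) < Cmod (boundary_int f a' (a' + w / 2) c' (c' + h / 2)).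
Proof.
  intros hw hh hf he. apply NNPP. intros hn.
  assert (k : forall a' c', a <= a' <= a + w / 2 -> c <= c' <= c + h / 2 ->
    Cmod (boundary_int f a' (a' + w / 2) c' (c' + h / 2)) <= e * (w / 2 * (h / 2))).
  { intros a' c' h1 h2. apply Rnot_lt_le. intros h3. apply hn. exists a', c'. auto. }
  rewrite (boundary_int_split_v f a (a + w / 2)) in he by (auto; lra).
  rewrite (boundary_int_split_h f a _ c (c + h / 2)) in he
    by (try lra; apply holo_rect_sub with a (a + w) c (c + h); auto; lra).
  rewrite (boundary_int_split_h f (a + w / 2) _ c (c + h / 2)) in he
    by (try lra; apply holo_rect_sub with a (a + w) c (c + h); auto; lra).
  assert (k1 := k a c). assert (k2 := k a (c + h / 2)).
  assert (k3 := k (a + w / 2) c). assert (k4 := k (a + w / 2) (c + h / 2)).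
  replace (a + w / 2 + w / 2) with (a + w) in * by lra.
  replace (c + h / 2 + h / 2) with (c + h) in * by lra.
  specialize (k1 ltac:(lra) ltac:(lra)). specialize (k2 ltac:(lra) ltac:(lra)).
  specialize (k3 ltac:(lra) ltac:(lra)). specialize (k4 ltac:(lra) ltac:(lra)).
  match type of he with _ < Cmod (?p + ?q + (?r + ?s)) =>
    generalize (Cmod_triangle (p + q) (r + s)) (Cmod_triangle p q) (Cmod_triangle r s) end.
  lra.
Qed.

Lemma nested_point (x : nat -> R) (w : R) : 0 <= w ->
  (forall n, x n <= x (S n) <= x n + w / 2 ^ (S n)) ->
  exists l, forall n, x n <= l <= x n + w / 2 ^ n.
Proof.
  intros hw h.
  assert (hp : forall n, 0 < 2 ^ n) by (intros n; apply pow_lt; lra).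
  assert (h1 : forall n k, x n <= x (n + k)%nat /\ x (n + k)%nat + w / 2 ^ (n + k) <= x n + w / 2 ^ n).
  { intros n k; induction k as [|k IH].
    - rewrite Nat.add_0_r; lra.
    - rewrite Nat.add_succ_r. specialize (h (n + k)%nat).
      assert (w / 2 ^ S (n + k) + w / 2 ^ S (n + k) = w / 2 ^ (n + k)).
      { simpl. field. generalize (hp (n + k)%nat); lra. }
      lra. }
  assert (hx : forall n m, x m <= x n + w / 2 ^ n).
  { intros n m. destruct (Nat.le_ge_cases n m) as [hnm|hnm].
    - replace m with (n + (m - n))%nat by lia. specialize (h1 n (m - n)%nat).
      assert (0 <= w / 2 ^ (n + (m - n))) by (apply Rdiv_le_0_compat; auto). lra.
    - replace n with (m + (n - m))%nat by lia. specialize (h1 m (n - m)%nat).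
      assert (0 <= w / 2 ^ (m + (n - m))) by (apply Rdiv_le_0_compat; auto). lra. }
  destruct (completeness (fun r => exists n, r = x n)) as [l [hl1 hl2]].
  - exists (x 0%nat + w / 2 ^ 0). intros r [n ->]. apply hx.
  - exists (x 0%nat), 0%nat; auto.
  - exists l. intros n. split.
    + apply hl1. exists n; auto.
    + apply hl2. intros r [m ->]. apply hx.
Qed.

Theorem goursat_rect f a b c d : a < b -> c < d -> holo_rect f a b c d ->
  boundary_int f a b c d = 0%C.
Proof.
  intros hab hcd hf. apply NNPP. intros hn.
  set (w := b - a). set (h := d - c).
  assert (hw : 0 < w) by (unfold w; lra). assert (hh : 0 < h) by (unfold h; lra).
  assert (hwh : 0 < w * h) by nra.
  replace b with (a + w) in * by (unfold w; ring). replace d with (c + h) in * by (unfold h; ring).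
  set (e := Cmod (boundary_int f a (a + w) c (c + h)) / (2 * (w * h))).
  assert (hm : 0 < Cmod (boundary_int f a (a + w) c (c + h))) by (apply Cmod_gt_0; auto).
  assert (he : 0 < e) by (apply Rdiv_lt_0_compat; lra).
  assert (hp : forall n, 0 < 2 ^ n) by (intros n; apply pow_lt; lra).
  set (good := fun (n : nat) (p : R * R) =>
    a <= fst p /\ fst p + w / 2 ^ n <= a + w /\ c <= snd p /\ snd p + h / 2 ^ n <= c + h /\
    e * (w / 2 ^ n * (h / 2 ^ n)) <
      Cmod (boundary_int f (fst p) (fst p + w / 2 ^ n) (snd p) (snd p + h / 2 ^ n))).
  set (step := fun (n : nat) (p p' : R * R) =>
    good (S n) p' /\ fst p <= fst p' <= fst p + w / 2 ^ S n /\
    snd p <= snd p' <= snd p + h / 2 ^ S n).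
  assert (hs : forall n p, good n p -> exists p', step n p p').
  { intros n p [g1 [g2 [g3 [g4 g5]]]].
    assert (0 <= w / 2 ^ n) by (apply Rdiv_le_0_compat; auto; lra).
    assert (0 <= h / 2 ^ n) by (apply Rdiv_le_0_compat; auto; lra).
    destruct (boundary_int_quarter f (fst p) (snd p) (w / 2 ^ n) (h / 2 ^ n) e) as [a' [c' [q1 [q2 q3]]]]; auto.
    { apply holo_rect_sub with a (a + w) c (c + h); auto. }
    assert (ew : w / 2 ^ n / 2 = w / 2 ^ S n) by (simpl; field; generalize (hp n); lra).
    assert (eh : h / 2 ^ n / 2 = h / 2 ^ S n) by (simpl; field; generalize (hp n); lra).
    rewrite ew, eh in *.
    assert (w / 2 ^ S n + w / 2 ^ S n = w / 2 ^ n) by (simpl; field; generalize (hp n); lra).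
    assert (h / 2 ^ S n + h / 2 ^ S n = h / 2 ^ n) by (simpl; field; generalize (hp n); lra).
    exists (a', c'). unfold step, good; simpl fst; simpl snd. repeat split; try lra. }
  set (next := fun n p => epsilon (inhabits (0, 0)) (step n p)).
  set (P := fix P n := match n with O => (a, c) | S n => next n (P n) end).
  assert (hg : forall n, good n (P n)).
  { intros n; induction n as [|n IH].
    - unfold good; simpl. rewrite !Rdiv_1_r. repeat split; try lra.
      unfold e. apply Rle_lt_trans with (Cmod (boundary_int f a (a + w) c (c + h)) / 2); [right; field; lra|lra].
    - simpl. apply (epsilon_spec (inhabits (0, 0)) (step n (P n)) (hs n _ IH)). }
  assert (hst : forall n, step n (P n) (P (S n))).
  { intros n. apply (epsilon_spec (inhabits (0, 0)) (step n (P n)) (hs n _ (hg n))). }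
  destruct (nested_point (fun n => fst (P n)) w) as [x hx]; [lra|intros n; apply hst|].
  destruct (nested_point (fun n => snd (P n)) h) as [y hy]; [lra|intros n; apply hst|].
  destruct (hf x y) as [l hl].
  { generalize (hx 0%nat); simpl; rewrite Rdiv_1_r; lra. }
  { generalize (hy 0%nat); simpl; rewrite Rdiv_1_r; lra. }
  rewrite is_cderive_eps in hl.
  set (D := w + h). assert (hD : 0 < D) by (unfold D; lra).
  set (eta := e * (w * h) / (2 * (D * D))).
  assert (heta : 0 < eta). { apply Rdiv_lt_0_compat; nra. }
  destruct (hl eta heta) as [dl [hdl hlin]].
  destruct (pow_lt_1_zero (/ 2) ltac:(rewrite Rabs_pos_eq; lra) (dl / D) ltac:(apply Rdiv_lt_0_compat; auto)) as [N hN].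
  specialize (hN N (le_n N)). rewrite Rabs_pos_eq, pow_inv in hN by (apply pow_le; lra).
  assert (hN' : D / 2 ^ N < dl).
  { apply Rmult_lt_compat_l with (r := D) in hN; auto.
    replace (D * (dl / D)) with dl in hN by (field; lra). exact hN. }
  destruct (hg N) as [g1 [g2 [g3 [g4 g5]]]].
  set (p := fst (P N)) in *. set (q := snd (P N)) in *.
  set (wn := w / 2 ^ N) in *. set (hn' := h / 2 ^ N) in *.
  assert (hwn : 0 < wn) by (apply Rdiv_lt_0_compat; auto).
  assert (hhn : 0 < hn') by (apply Rdiv_lt_0_compat; auto).
  assert (hDn : D / 2 ^ N = wn + hn') by (unfold D, wn, hn', Rdiv; ring).
  set (z0 := (x, y) : C) in *.
  set (g := fun z : C => (f z0 + l * (z - z0))%C).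
  assert (hgd : forall z, is_cderive g z l).
  { intros z. eapply is_cderive_val.
    - apply is_cderive_plus; [apply is_cderive_const|].
      apply is_cderive_scal. apply is_cderive_minus; [apply is_cderive_id|apply is_cderive_const].
    - ring. }
  assert (hfN : holo_rect f p (p + wn) q (q + hn')) by (apply holo_rect_sub with a (a + w) c (c + h); auto).
  assert (hgN : holo_rect g p (p + wn) q (q + hn')) by (intros ? ? _ _; exists l; auto).
  assert (hg0 : boundary_int g p (p + wn) q (q + hn') = 0%C).
  { apply (boundary_int_primitive (fun z => f z0 * z + l * / 2 * ((z - z0) * (z - z0)))%C); try lra; auto.
    intros u v _ _. eapply is_cderive_val.
    - apply is_cderive_plus; [apply is_cderive_scal, is_cderive_id|].
      apply is_cderive_scal. apply is_cderive_mult;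
      (apply is_cderive_minus; [apply is_cderive_id|apply is_cderive_const]).
    - unfold g. field. }
  assert (hb := Cmod_boundary_int_le (fun z => f z - g z)%C p (p + wn) q (q + hn') (eta * (D / 2 ^ N))).
  rewrite boundary_int_minus, hg0 in hb by (auto; lra).
  specialize (hb ltac:(lra) ltac:(lra)).
  assert (hc : Cmod (boundary_int f p (p + wn) q (q + hn')) <= 2 * (wn + hn') * (eta * (wn + hn'))).
  { rewrite <- hDn. replace (boundary_int f p (p + wn) q (q + hn')) with (boundary_int f p (p + wn) q (q + hn') - 0)%C by ring.
    rewrite hDn at 1. replace (wn + hn') with ((p + wn - p) + (q + hn' - q)) by ring. apply hb.
    - intros u v hu hv. destruct (hfN u v) as [l1 hl1]; auto. eexists. apply is_cderive_minus; eauto.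
    - intros u v hu hv.
      assert (hdist : Cmod ((u, v) - z0) <= D / 2 ^ N).
      { eapply Rle_trans; [apply Cmod_le_abs|]. simpl. rewrite hDn.
        specialize (hx N). specialize (hy N). fold p wn in hx. fold q hn' in hy.
        apply Rplus_le_compat; apply Rabs_le; lra. }
      replace (f (u, v) - g (u, v))%C with (f (u, v) - f z0 - l * ((u, v) - z0))%C by (unfold g; ring).
      eapply Rle_trans; [apply hlin; lra|]. apply Rmult_le_compat_l; lra. }
  assert (hfin : e * (wn * hn') < 2 * (wn + hn') * (eta * (wn + hn'))) by lra.
  rewrite <- hDn in hfin. unfold eta, wn, hn' in hfin.
  assert (e * (w / 2 ^ N * (h / 2 ^ N)) = 2 * (D / 2 ^ N) * (e * (w * h) / (2 * (D * D)) * (D / 2 ^ N))).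
  { field. generalize (hp N); intros; repeat split; lra. }
  lra.
Qed.

(** * The identity theorem on a disc *)

(* The kernels [(1 + (cos y - cos d) / 2) ^ m] concentrate at [0]: they grow
   like [m] for [|y| < d] and stay in [0, 1] elsewhere. *)
Lemma concentration_le_0 (phi : R -> R) :
  (forall y, - PI <= y <= PI -> continuous phi y) ->
  (forall a m, RInt (fun y => phi y * (cos y / 2 + a) ^ m) (- PI) PI = 0) ->
  phi 0 <= 0.
Proof.
  intros hc hi. apply Rnot_lt_le. intros h0.
  assert (hpi := PI_RGT_0).
  assert (hd : exists d, 0 < d < PI /\ forall y, Rabs y <= d -> phi 0 / 2 <= phi y).
  { assert (k := hc 0 ltac:(lra)).
    assert (hb : 0 < phi 0 / 2) by lra.
    destruct (k (ball (phi 0) (mkposreal _ hb)) (locally_ball _ _)) as [d hd].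
    exists (Rmin (d / 2) (PI / 2)). assert (hd0 := cond_pos d). split.
    - split; [apply Rmin_pos; lra|]. eapply Rle_lt_trans; [apply Rmin_r|]; lra.
    - intros y hy. assert (hy' : Rabs y <= d / 2) by (eapply Rle_trans; [exact hy|apply Rmin_l]).
      specialize (hd y). assert (q : ball 0 d y).
      { unfold ball; simpl; unfold AbsRing_ball, abs, minus, plus, opp; simpl. rewrite Ropp_0, Rplus_0_r. lra. }
      specialize (hd q). unfold ball in hd; simpl in hd. unfold AbsRing_ball, abs, minus, plus, opp in hd; simpl in hd.
      apply Rabs_lt_between in hd. lra. }
  destruct hd as [d [hd hphi]].
  assert (hM : exists M, forall y, - PI <= y <= PI -> Rabs (phi y) <= M).
  { destruct (continuity_ab_maj (fun y => Rabs (phi y)) (- PI) PI) as [x [hx _]]; [lra| |].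
    - intros c hcc. apply continuity_pt_filterlim.
      apply (continuous_comp phi Rabs); [apply hc; auto|apply continuous_Rabs].
    - exists (Rabs (phi x)). exact hx. }
  destruct hM as [M hM].
  assert (hM0 : 0 <= M) by (eapply Rle_trans; [apply Rabs_pos|apply (hM 0); lra]).
  set (a := 1 - cos d / 2).
  set (k := fun y => cos y / 2 + a).
  assert (hck : forall y, continuous k y).
  { intros y. apply (ex_derive_continuous k). unfold k. auto_derive. auto. }
  assert (hckm : forall m y, - PI <= y <= PI -> continuous (fun y => phi y * k y ^ m) y).
  { intros m y hy. apply @continuous_mult; auto.
    apply (continuous_comp k (fun z => z ^ m)); auto.
    apply (ex_derive_continuous (fun z => z ^ m)). auto_derive; auto. }
  assert (hex : forall m u v, - PI <= u -> u <= v -> v <= PI -> ex_RInt (fun y => phi y * k y ^ m) u v).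
  { intros m u v h1 h2 h3. apply (ex_RInt_continuous (V := R_CompleteNormedModule)).
    rewrite Rmin_left, Rmax_right by lra. intros z hz. apply hckm; lra. }
  assert (hkout : forall y, - PI <= y <= PI -> d <= Rabs y -> 0 <= k y <= 1).
  { intros y hy hyd. unfold k, a.
    assert (cos y <= cos d).
    { destruct (Rle_lt_dec 0 y) as [h|h].
      - rewrite Rabs_pos_eq in hyd by auto. apply cos_decr_1; lra.
      - rewrite Rabs_left in hyd by auto. rewrite <- cos_neg. apply cos_decr_1; lra. }
    generalize (COS_bound y) (COS_bound d); lra. }
  assert (hcin : forall y, Rabs y < d -> cos d < cos y).
  { intros y hy. destruct (Rle_lt_dec 0 y) as [h|h].
    - rewrite Rabs_pos_eq in hy by auto. apply cos_decreasing_1; lra.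
    - rewrite Rabs_left in hy by auto. rewrite <- (cos_neg y). apply cos_decreasing_1; lra. }
  assert (hcin' : forall y, Rabs y <= d -> cos d <= cos y).
  { intros y [h|h]; [left; auto|]. unfold Rabs in h. destruct (Rcase_abs y);
    rewrite <- h; [rewrite cos_neg|]; lra. }
  set (J := RInt (fun y => (cos y - cos d) / 2) (- d) d).
  assert (hexJ : ex_RInt (fun y => (cos y - cos d) / 2) (- d) d).
  { apply (ex_RInt_continuous (V := R_CompleteNormedModule)). intros z _.
    apply (ex_derive_continuous (fun y => (cos y - cos d) / 2)). auto_derive; auto. }
  assert (hJ : 0 < J).
  { apply RInt_gt_0; [lra| |].
    - intros x hx. assert (Rabs x < d) by (apply Rabs_def1; lra). generalize (hcin x H). lra.
    - intros x hx. apply (ex_derive_continuous (fun y => (cos y - cos d) / 2)). auto_derive; auto. }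
  destruct (nfloor_ex (2 * PI * M / (phi 0 / 2 * J))) as [m hm].
  { apply Rdiv_le_0_compat; nra. }
  set (m' := S m).
  assert (hm' : 2 * PI * M < phi 0 / 2 * (INR m' * J)).
  { unfold m'. rewrite S_INR. destruct hm as [_ hm].
    apply Rlt_div_l in hm; [|nra]. lra. }
  clearbody m'.
  specialize (hi a m'). fold k in hi.
  change (fun y => phi y * (cos y / 2 + a) ^ m') with (fun y => phi y * k y ^ m') in hi.
  assert (x1 : ex_RInt (fun y => phi y * k y ^ m') (- PI) (- d)) by (apply hex; lra).
  assert (x2 : ex_RInt (fun y => phi y * k y ^ m') (- d) d) by (apply hex; lra).
  assert (x3 : ex_RInt (fun y => phi y * k y ^ m') d PI) by (apply hex; lra).
  assert (x4 : ex_RInt (fun y => phi y * k y ^ m') (- d) PI) by (apply hex; lra).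
  assert (e1 := RInt_Chasles (V := R_CompleteNormedModule) (fun y => phi y * k y ^ m') (- PI) (- d) PI x1 x4).
  assert (e2 := RInt_Chasles (V := R_CompleteNormedModule) (fun y => phi y * k y ^ m') (- d) d PI x2 x3).
  unfold plus in e1, e2; simpl in e1, e2.
  assert (hout : forall u v, - PI <= u -> u <= v -> v <= PI -> (forall y, u <= y <= v -> d <= Rabs y) ->
     - ((v - u) * M) <= RInt (fun y => phi y * k y ^ m') u v).
  { intros u v h1 h2 h3 h4.
    assert (q : Rabs (RInt (fun y => phi y * k y ^ m') u v) <= (v - u) * M).
    { apply abs_RInt_le_const; auto.
      intros t ht. rewrite Rabs_mult. rewrite <- (Rmult_1_r M).
      destruct (hkout t) as [q1 q2]; [lra|apply h4; lra|].
      apply Rmult_le_compat; try apply Rabs_pos. apply hM; lra.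
      rewrite <- RPow_abs, Rabs_pos_eq by auto. rewrite <- (pow1 m'). apply pow_incr; lra. }
    apply Rabs_le_between in q. lra. }
  assert (q1 := hout (- PI) (- d) ltac:(lra) ltac:(lra) ltac:(lra)).
  assert (q3 := hout d PI ltac:(lra) ltac:(lra) ltac:(lra)).
  assert (q1' : forall y, - PI <= y <= - d -> d <= Rabs y) by (intros y hy; rewrite Rabs_left; lra).
  assert (q3' : forall y, d <= y <= PI -> d <= Rabs y) by (intros y hy; rewrite Rabs_pos_eq; lra).
  specialize (q1 q1'). specialize (q3 q3').
  assert (q2 : phi 0 / 2 * (INR m' * J) <= RInt (fun y => phi y * k y ^ m') (- d) d).
  { unfold J. replace (phi 0 / 2 * (INR m' * _)) with ((phi 0 / 2 * INR m') * RInt (fun y => (cos y - cos d) / 2) (- d) d) by ring.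
    assert (hs := RInt_scal (V := R_CompleteNormedModule) (fun y => (cos y - cos d) / 2) (- d) d (phi 0 / 2 * INR m') hexJ).
    unfold scal in hs; simpl in hs; unfold mult in hs; simpl in hs.
    rewrite <- hs. apply RInt_le; [lra| | apply hex; lra |].
    - apply (ex_RInt_scal (V := R_NormedModule) _ _ _ (phi 0 / 2 * INR m')), hexJ.
    - intros x hx. assert (hxd : Rabs x < d) by (apply Rabs_def1; lra).
      assert (hb := poly m' ((cos x - cos d) / 2)). generalize (hcin x hxd). intros hcx.
      assert (hxd' : Rabs x <= d) by lra. specialize (hphi x hxd').
      replace (k x) with (1 + (cos x - cos d) / 2) by (unfold k, a; field).
      assert (0 <= INR m') by apply pos_INR.
      destruct (Rle_lt_dec ((cos x - cos d) / 2) 0); [lra|].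
      assert (hv : 0 < (cos x - cos d) / 2) by lra. specialize (hb hv). rewrite Rmult_assoc. apply Rmult_le_compat; try lra.
      apply Rmult_le_pos; lra. }
  rewrite hi in e1. assert (0 <= d * M) by (apply Rmult_le_pos; lra). lra.
Qed.

Lemma concentration_eq_0 (phi : R -> R) :
  (forall y, - PI <= y <= PI -> continuous phi y) ->
  (forall a m, RInt (fun y => phi y * (cos y / 2 + a) ^ m) (- PI) PI = 0) ->
  phi 0 = 0.
Proof.
  intros hc hi. apply Rle_antisym.
  - apply concentration_le_0; auto.
  - assert (h : - phi 0 <= 0); [|lra].
    apply (concentration_le_0 (fun y => - phi y)).
    + intros y hy. apply @continuous_opp. auto.
    + intros a m. rewrite <- Ropp_0, <- (hi a m).
      rewrite <- (RInt_opp (V := R_CompleteNormedModule)).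
      * apply RInt_ext. intros x _. unfold opp; simpl. ring.
      * apply (ex_RInt_continuous (V := R_CompleteNormedModule)).
        assert (hpi := PI_RGT_0).
        rewrite Rmin_left, Rmax_right by lra. intros z hz.
        apply @continuous_mult; auto.
        apply (ex_derive_continuous (fun y => (cos y / 2 + a) ^ m)). auto_derive; auto.
Qed.

Lemma Cexp_2PI (x : R) : Cexp (x, PI) = Cexp (x, - PI).
Proof. unfold Cexp; simpl. rewrite cos_neg, sin_neg, sin_PI. f_equal; ring. Qed.

(* In the logarithmic coordinate [z = e^zeta] the circle [|z| = rho] is a
   vertical segment; Cauchy's theorem applied to [f(e^zeta)] times a power of
   a [2 i pi]-periodic entire function shows that [f] is orthogonal on that
   circle to every concentration kernel. *)
Lemma vanish_at_radius (f : C -> C) (R0 eps rho : R) : 0 < eps -> 0 < rho < R0 ->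
  (forall z, Cmod z < R0 -> exists l, is_cderive f z l) ->
  (forall z, Cmod z < eps -> f z = 0%C) -> f (RtoC rho) = 0%C.
Proof.
  intros he hrho hf h0. assert (hpi := PI_RGT_0).
  set (x1 := ln rho). assert (hx1 : exp x1 = rho) by (apply exp_ln; lra).
  set (x0 := Rmin (ln (eps / 2)) (x1 - 1)).
  assert (hx01 : x0 < x1) by (unfold x0; eapply Rle_lt_trans; [apply Rmin_r|lra]).
  assert (hx0 : exp x0 < eps).
  { apply Rle_lt_trans with (exp (ln (eps / 2))); [apply exp_le, Rmin_l|]. rewrite exp_ln; lra. }
  set (phi := fun y => f (Cexp (x1, y))).
  assert (hd : forall z, Re z <= x1 -> exists l, is_cderive (fun z => f (Cexp z)) z l).
  { intros z hz. destruct (hf (Cexp z)) as [l hl].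
    - rewrite Cmod_Cexp. apply Rle_lt_trans with rho; [rewrite <- hx1; apply exp_le, hz|lra].
    - eexists. apply (is_cderive_comp f Cexp); [exact hl|apply is_cderive_Cexp]. }
  assert (hphi : forall y, ccont phi y).
  { intros y. destruct (hd (x1, y)) as [l hl]; [simpl; lra|].
    apply (ccont_vertical (fun z => f (Cexp z)) x1 y l hl). }
  assert (hmain : forall a m, is_CInt (fun y => phi y * RtoC ((cos y / 2 + a) ^ m))%C (- PI) PI 0%C).
  { intros a m.
    set (k := fun z : C => ((Cexp (z - x1) + Cexp (- (z - x1))) / 4 + RtoC a)%C).
    set (u := fun z : C => (f (Cexp z) * k z ^ m)%C).
    assert (hk : forall z, exists l, is_cderive (fun z => k z ^ m)%C z l).
    { intros z. eapply (is_cderive_pow k). unfold k.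
      apply is_cderive_plus; [|apply is_cderive_const].
      apply is_cderive_div; [intros h; apply RtoC_inj in h; lra| |apply is_cderive_const].
      assert (hid : is_cderive (fun z => z - x1)%C z (1 - 0)%C)
        by (apply is_cderive_minus; [apply is_cderive_id|apply is_cderive_const]).
      apply is_cderive_plus.
      - apply (is_cderive_comp Cexp (fun z => z - x1)%C); [apply is_cderive_Cexp|exact hid].
      - apply (is_cderive_comp Cexp (fun z => - (z - x1))%C); [apply is_cderive_Cexp|].
        apply (@is_derive_opp C_AbsRing C_NormedModule), hid. }
    assert (hu : holo_rect u x0 x1 (- PI) PI).
    { intros x y hx hy. destruct (hk (x, y)) as [l hl]. destruct (hd (x, y)) as [l' hl']; [simpl; lra|].
      eexists. apply (is_cderive_mult (fun z => f (Cexp z)) (fun z => k z ^ m)%C); eauto. }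
    assert (hg := goursat_rect u x0 x1 (- PI) PI hx01 ltac:(lra) hu).
    unfold boundary_int in hg.
    assert (hkper : forall x, k (x, PI) = k (x, - PI)).
    { intros x. unfold k.
      replace ((x, PI) - x1)%C with (((x - x1)%R, PI) : C) by (apply C_ext; simpl; ring).
      replace ((x, (- PI)%R) - x1)%C with (((x - x1)%R, (- PI)%R) : C) by (apply C_ext; simpl; ring).
      rewrite !Cexp_opp, Cexp_2PI. reflexivity. }
    assert (e1 : CInt (fun x => u (x, PI)) x0 x1 = CInt (fun x => u (x, - PI)) x0 x1).
    { apply CInt_ext. intros x _. unfold u. rewrite hkper, Cexp_2PI. reflexivity. }
    assert (e2 : CInt (fun y => u (x0, y)) (- PI) PI = 0%C).
    { apply is_CInt_unique. apply is_CInt_ext with (fun _ => RtoC 0).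
      - intros y _. unfold u. rewrite h0; [ring|]. rewrite Cmod_Cexp. exact hx0.
      - replace (RtoC 0) with (RtoC (PI - - PI) * 0)%C at 2 by ring.
        apply is_CInt_pair; simpl. split.
        + evar_last. apply (is_RInt_const (V := R_NormedModule)). unfold scal; simpl; unfold mult; simpl. ring.
        + evar_last. apply (is_RInt_const (V := R_NormedModule)). unfold scal; simpl; unfold mult; simpl. ring. }
    rewrite e1, e2 in hg.
    assert (e3 : CInt (fun y => u (x1, y)) (- PI) PI = 0%C).
    { replace (CInt (fun y => u (x1, y)) (- PI) PI) with (- Ci * (Ci * CInt (fun y => u (x1, y)) (- PI) PI))%C.
      2: { replace (- Ci * (Ci * CInt (fun y => u (x1, y)) (- PI) PI))%C
            with (- (Ci * Ci) * CInt (fun y => u (x1, y)) (- PI) PI)%C by ring.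
           replace (Ci * Ci)%C with (RtoC (-1)) by (apply C_ext; simpl; ring).
           rewrite <- RtoC_opp. replace (- -1) with 1 by ring. ring. }
      match type of hg with ?l = _ => replace (Ci * CInt (fun y => u (x1, y)) (- PI) PI)%C with l by ring end.
      rewrite hg. ring. }
    rewrite <- e3. apply is_CInt_ext with (fun y => u (x1, y)).
    - intros y _. unfold u, phi. f_equal. rewrite RtoC_pow. f_equal. unfold k.
      replace ((x1, y) - x1)%C with ((0, y) : C) by (apply C_ext; simpl; ring).
      apply C_ext; unfold Cexp, Re, Im; simpl; rewrite ?Ropp_0, exp_0, ?cos_neg, ?sin_neg; field.
    - apply CInt_correct. apply holo_rect_ex_v with x0 x1 (- PI) PI; auto; lra. }
  assert (hre : Re (phi 0) = 0).
  { apply (concentration_eq_0 (fun y => Re (phi y))).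
    - intros y _. apply ccont_re; auto.
    - intros a m. apply is_RInt_unique. destruct (proj1 (is_CInt_pair _ _ _ _) (hmain a m)) as [h _].
      eapply is_RInt_ext; [|exact h]. intros y _. unfold Re; simpl. ring. }
  assert (him : Im (phi 0) = 0).
  { apply (concentration_eq_0 (fun y => Im (phi y))).
    - intros y _. apply ccont_im; auto.
    - intros a m. apply is_RInt_unique. destruct (proj1 (is_CInt_pair _ _ _ _) (hmain a m)) as [_ h].
      eapply is_RInt_ext; [|exact h]. intros y _. unfold Im; simpl. ring. }
  replace (RtoC rho) with (Cexp (x1, 0)).
  - apply C_ext; auto.
  - change (x1, 0) with (RtoC x1). rewrite Cexp_RtoC, hx1. reflexivity.
Qed.

Lemma identity_disc (f : C -> C) (c : C) (R0 eps : R) : 0 < eps ->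
  (forall z, Cmod (z - c) < R0 -> exists l, is_cderive f z l) ->
  (forall z, Cmod (z - c) < eps -> f z = 0%C) ->
  forall z, Cmod (z - c) < R0 -> f z = 0%C.
Proof.
  intros he hf h0 z hz.
  destruct (Rlt_le_dec (Cmod (z - c)) eps) as [h|h]; auto.
  set (rho := Cmod (z - c)) in *. assert (hr : 0 < rho) by lra.
  set (v := ((z - c) / RtoC rho)%C).
  assert (hrc : RtoC rho <> 0) by (intros q; apply RtoC_inj in q; lra).
  assert (hv : Cmod v = 1).
  { unfold v. rewrite Cmod_div by auto. rewrite Cmod_R, Rabs_pos_eq by lra. fold rho. field; lra. }
  replace z with (c + RtoC rho * v)%C by (unfold v; field; auto).
  apply (vanish_at_radius (fun w => f (c + w * v)%C) R0 eps rho he ltac:(lra)).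
  - intros w hw. destruct (hf (c + w * v)%C) as [l hl].
    { replace (c + w * v - c)%C with (w * v)%C by ring. rewrite Cmod_mult, hv. lra. }
    eexists. apply (is_cderive_comp f (fun w => c + w * v)%C); [exact hl|].
    apply is_cderive_plus; [apply is_cderive_const|].
    apply is_cderive_mult; [apply is_cderive_id|apply is_cderive_const].
  - intros w hw. apply h0. replace (c + w * v - c)%C with (w * v)%C by ring. rewrite Cmod_mult, hv. lra.
Qed.

Lemma Cmult_integral (a b : C) : (a * b)%C = RtoC 0 -> a = RtoC 0 \/ b = RtoC 0.
Proof.
  intros h. destruct (Ceq_dec a 0) as [k|k]; auto. destruct (Ceq_dec b 0) as [k'|k']; auto.
  exfalso. revert h. apply Cmult_neq_0; auto.
Qed.

Lemma is_sum_unique {T : Type} (f : T -> C) (v w : C) : is_sum f v -> is_sum f w -> v = w.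
Proof.
  intros h1 h2.
  apply (filterlim_locally_unique (V := C_NormedModule) (fun l => Iter.iter Cplus (RtoC 0) l f) v w h1 h2).
Qed.

Lemma meromorphic_at_eps (f : C -> C) (p : C) : meromorphic_at f p ->
  exists n g d, 0 < d /\ (forall w, Cmod (w - p) < d -> exists l, is_cderive g w l) /\
    (forall w, Cmod (w - p) < d -> w <> p -> g w = ((w - p) ^ n * f w)%C).
Proof.
  intros [n [g [h1 h2]]]. unfold holomorphic_at in h1. rewrite locally_C_eps in h1.
  rewrite locally'_C_eps in h2.
  destruct h1 as [d1 [k1 h1]]. destruct h2 as [d2 [k2 h2]].
  exists n, g, (Rmin d1 d2). split; [apply Rmin_pos; auto|]. split.
  - intros w hw. apply h1. apply Rmin_Rgt_l in hw. tauto.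
  - intros w hw. apply h2. apply Rmin_Rgt_l in hw. tauto.
Qed.

(** * Uniqueness of the continuation *)

Definition agree_near (F G : C -> C) (p : C) : Prop :=
  exists d, 0 < d /\ forall w, Cmod (w - p) < d -> w <> p -> F w = G w.

Lemma agree_near_propagate (F G : C -> C) (p : C) :
  meromorphic_at F p -> meromorphic_at G p ->
  exists r, 0 < r /\ forall q q', Cmod (q - p) < r -> agree_near F G q ->
    Cmod (q' - p) < r -> agree_near F G q'.
Proof.
  intros hF hG.
  destruct (meromorphic_at_eps _ _ hF) as [n1 [g1 [d1 [hd1 [a1 b1]]]]].
  destruct (meromorphic_at_eps _ _ hG) as [n2 [g2 [d2 [hd2 [a2 b2]]]]].
  set (R0 := Rmin d1 d2). assert (hR : 0 < R0) by (apply Rmin_pos; auto).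
  set (r := R0 / 4). exists r. split; [unfold r; lra|].
  intros q q' hq [d [hd hag]] hq'.
  assert (hall : forall w, Cmod (w - p) < r -> w <> p -> F w = G w).
  { assert (heta : exists eta, 0 < eta <= d /\ eta <= r /\
       forall w, Cmod (w - q) < eta -> w <> q -> w <> p).
    { assert (hr : 0 < r) by (unfold r; lra).
      destruct (Ceq_dec q p) as [e|hqp].
      - exists (Rmin d r). split; [split; [apply Rmin_pos; auto|apply Rmin_l]|].
        split; [apply Rmin_r|]. intros w _. subst q. auto.
      - assert (hm : 0 < Cmod (q - p)).
        { apply Cmod_gt_0. intros h. apply hqp. replace q with ((q - p) + p)%C by ring. rewrite h. ring. }
        exists (Rmin (Cmod (q - p)) (Rmin d r)). split; [split|split].
        + repeat apply Rmin_pos; auto.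
        + eapply Rle_trans; [apply Rmin_r|apply Rmin_l].
        + eapply Rle_trans; [apply Rmin_r|apply Rmin_r].
        + intros w hw _ e. subst w. apply Rmin_Rgt_l in hw as [hw _].
          rewrite Cmod_minus_sym in hw. lra. }
    destruct heta as [eta [[he1 he2] [he3 he4]]].
    set (y := (q + RtoC (eta / 2))%C).
    set (g := fun w => ((w - p) ^ n2 * g1 w - (w - p) ^ n1 * g2 w)%C).
    assert (hgF : forall w, Cmod (w - p) < R0 -> w <> p ->
        g w = ((w - p) ^ n1 * (w - p) ^ n2 * (F w - G w))%C).
    { intros w hw hwp. apply Rmin_Rgt_l in hw as [w1 w2]. unfold g. rewrite b1, b2 by auto. ring. }
    assert (hyq : Cmod (y - q) = eta / 2).
    { unfold y. replace (q + RtoC (eta / 2) - q)%C with (RtoC (eta / 2)) by ring.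
      rewrite Cmod_R, Rabs_pos_eq; lra. }
    assert (hyp : Cmod (y - p) < 3 / 2 * r).
    { replace (y - p)%C with ((y - q) + (q - p))%C by ring.
      eapply Rle_lt_trans; [apply Cmod_triangle|]. lra. }
    assert (hin : forall w, Cmod (w - y) < R0 - Cmod (y - p) -> Cmod (w - p) < R0).
    { intros w hw. replace (w - p)%C with ((w - y) + (y - p))%C by ring.
      eapply Rle_lt_trans; [apply Cmod_triangle|]. lra. }
    assert (hg0 : forall w, Cmod (w - y) < R0 - Cmod (y - p) -> g w = 0%C).
    { apply (identity_disc g y (R0 - Cmod (y - p)) (eta / 2)); [lra| |].
      - intros w hw. apply hin in hw. apply Rmin_Rgt_l in hw as [w1 w2].
        destruct (a1 w w1) as [l1 hl1]. destruct (a2 w w2) as [l2 hl2].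
        assert (hpw : forall n, exists l, is_cderive (fun w => (w - p) ^ n)%C w l).
        { intros n. eapply (is_cderive_pow (fun w => w - p)%C).
          apply is_cderive_minus; [apply is_cderive_id|apply is_cderive_const]. }
        destruct (hpw n1) as [m1 hm1]. destruct (hpw n2) as [m2 hm2].
        eexists. apply is_cderive_minus; apply is_cderive_mult; eauto.
      - intros w hw.
        assert (hwq : Cmod (w - q) < eta).
        { replace (w - q)%C with ((w - y) + (y - q))%C by ring.
          eapply Rle_lt_trans; [apply Cmod_triangle|]. lra. }
        assert (hwq' : w <> q). { intros e. subst w. rewrite Cmod_minus_sym in hw. lra. }
        rewrite hgF.
        + rewrite (hag w) by (auto; lra). ring.
        + replace (w - p)%C with ((w - q) + (q - p))%C by ring.
          eapply Rle_lt_trans; [apply Cmod_triangle|]. unfold r in *; lra.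
        + apply (he4 w); auto. }
    intros w hw hwp.
    assert (hwp' : (w - p)%C <> 0).
    { intros h. apply hwp. replace w with ((w - p) + p)%C by ring. rewrite h. ring. }
    assert (k : g w = 0%C).
    { apply hg0. replace (w - y)%C with ((w - p) - (y - p))%C by ring.
      eapply Rle_lt_trans; [apply Cmod_triangle|]. rewrite Cmod_opp. unfold r in *; lra. }
    rewrite hgF in k by (auto; unfold r in *; lra).
    apply Cmult_integral in k as [k|k].
    - exfalso. apply Cmult_integral in k as [k|k]; revert k; apply Cpow_nz; auto.
    - replace (F w) with ((F w - G w) + G w)%C by ring. rewrite k. ring. }
  destruct (Ceq_dec q' p) as [e|hqp].
  - subst q'. exists r. split; [unfold r; lra|]. auto.
  - assert (hm : 0 < Cmod (q' - p)).
    { apply Cmod_gt_0. intros h. apply hqp. replace q' with ((q' - p) + p)%C by ring. rewrite h. ring. }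
    exists (Rmin (Cmod (q' - p)) (r - Cmod (q' - p))). split; [apply Rmin_pos; lra|].
    intros w hw _. apply Rmin_Rgt_l in hw as [w1 w2]. apply hall.
    + replace (w - p)%C with ((w - q') + (q' - p))%C by ring.
      eapply Rle_lt_trans; [apply Cmod_triangle|]. lra.
    + intros e. subst w. rewrite Cmod_minus_sym in w1. lra.
Qed.

Lemma agree_near_connected (F G : C -> C) (T : R) : 0 <= T ->
  (forall p, meromorphic_at F p) -> (forall p, meromorphic_at G p) ->
  agree_near F G (RtoC T) -> agree_near F G (RtoC 0).
Proof.
  intros hT hF hG h0.
  destruct (completeness (fun t => 0 <= t <= T /\ forall y, T - t <= y <= T -> agree_near F G (RtoC y)))
    as [l [hl1 hl2]].
  - exists T. intros t ht; lra.
  - exists 0. split; [lra|]. intros y hy. replace y with T by lra. auto.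
  - assert (hl0 : 0 <= l).
    { apply hl1. split; [lra|]. intros y hy. replace y with T by lra. auto. }
    assert (hlT : l <= T) by (apply hl2; intros t ht; lra).
    destruct (agree_near_propagate F G (RtoC (T - l)) (hF _) (hG _)) as [r [hr hprop]].
    assert (ht : exists t, l - r < t /\ 0 <= t <= T /\ forall y, T - t <= y <= T -> agree_near F G (RtoC y)).
    { apply NNPP. intros hn. assert (l <= l - r); [|lra].
      apply hl2. intros t ht. apply Rnot_lt_le. intros h. apply hn. exists t. auto. }
    destruct ht as [t [t1 [t2 t3]]].
    assert (tl : t <= l) by (apply hl1; auto).
    assert (k : agree_near F G (RtoC (T - t))) by (apply t3; lra).
    assert (hdist : forall x, Cmod (RtoC x - RtoC (T - l)) = Rabs (x - (T - l))).
    { intros x. rewrite <- RtoC_minus, Cmod_R. reflexivity. }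
    assert (hnear : forall y, T - l - r < y -> y <= T -> agree_near F G (RtoC y)).
    { intros y hy hyT. destruct (Rle_lt_dec (T - t) y) as [h|h]; [apply t3; lra|].
      apply (hprop (RtoC (T - t))); auto.
      - rewrite hdist. apply Rabs_def1; lra.
      - rewrite hdist. apply Rabs_def1; lra. }
    destruct (Req_dec l T) as [e|e].
    + apply hnear; lra.
    + assert (Rmin T (l + r / 2) <= l).
      { apply hl1. split.
        - split; [apply Rmin_glb; lra|apply Rmin_l].
        - intros y hy. apply hnear; [|lra]. generalize (Rmin_r T (l + r / 2)); lra. }
      revert H. apply Rmin_case; lra.
Qed.

Lemma EH_continuation_germ (a1 a2 l1 l2 : R) (F G : C -> C) :
  is_EH_continuation a1 a2 l1 l2 F -> is_EH_continuation a1 a2 l1 l2 G ->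
  exists d, 0 < d /\ forall w, Cmod (w - 0) < d -> F w = G w.
Proof.
  intros [F1 [F2 F3]] [G1 [G2 G3]].
  destruct (agree_near_connected F G 2 ltac:(lra) F2 G2) as [d [hd hag]].
  { exists 1. split; [lra|]. intros w hw _.
    assert (hre : 1 < Re w).
    { assert (k := re_le_Cmod (w - RtoC 2)).
      replace (Re (w - RtoC 2)) with (Re w - 2) in k by (unfold Re; simpl; ring).
      assert (k' : Rabs (Re w - 2) < 1) by lra. apply Rabs_lt_between in k'. lra. }
    destruct (F1 w hre) as [v [h1 ->]]. destruct (G1 w hre) as [v' [h2 ->]].
    rewrite (is_sum_unique _ _ _ h1 h2). reflexivity. }
  exists d. split; auto. intros w hw.
  destruct (Ceq_dec w 0) as [e|e]; [|apply hag; auto].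
  subst w.
  unfold holomorphic_at in F3, G3. rewrite locally_C_eps in F3, G3.
  destruct F3 as [dF [hdF F3]]. destruct G3 as [dG [hdG G3]].
  assert (h00 : Cmod (0 - 0) = 0) by (replace (0 - 0)%C with (RtoC 0) by ring; apply Cmod_0).
  destruct (F3 0%C ltac:(rewrite h00; auto)) as [lF HF]. destruct (G3 0%C ltac:(rewrite h00; auto)) as [lG HG].
  assert (cF := is_cderive_cont _ _ _ HF). assert (cG := is_cderive_cont _ _ _ HG).
  apply NNPP. intros hne.
  assert (hm : 0 < Cmod (F 0%C - G 0%C)).
  { apply Cmod_gt_0. intros h. apply hne. replace (F (RtoC 0)) with ((F 0%C - G 0%C) + G 0%C)%C by ring. rewrite h. ring. }
  set (e := Cmod (F 0%C - G 0%C) / 2). assert (he : 0 < e) by (unfold e; lra).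
  destruct (cF e he) as [e1 [he1 q1]]. destruct (cG e he) as [e2 [he2 q2]].
  set (x := Rmin d (Rmin e1 e2) / 2).
  assert (hx0 : 0 < Rmin d (Rmin e1 e2)) by (repeat apply Rmin_pos; auto).
  assert (hx : Cmod (RtoC x - 0) < Rmin d (Rmin e1 e2)).
  { replace (RtoC x - 0)%C with (RtoC x) by ring. rewrite Cmod_R, Rabs_pos_eq; unfold x; lra. }
  apply Rmin_Rgt_l in hx as [x1 hx]. apply Rmin_Rgt_l in hx as [x2 x3].
  specialize (q1 _ x2). specialize (q2 _ x3).
  rewrite (hag (RtoC x)) in q1; auto.
  2: { intros h. apply RtoC_inj in h. unfold x in h; lra. }
  assert (hc : Cmod (F 0%C - G 0%C) < e + e).
  { replace (F 0%C - G 0%C)%C with ((G (RtoC x) - G 0%C) - (G (RtoC x) - F 0%C))%C by ring.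
    eapply Rle_lt_trans; [apply Cmod_triangle|]. rewrite Cmod_opp. lra. }
  unfold e in hc. lra.
Qed.

(** * Complex powers and truncated Mellin transforms *)

Lemma RCpow_plus x s t : RCpow x (s + t) = (RCpow x s * RCpow x t)%C.
Proof. unfold RCpow. rewrite <- Cexp_plus. f_equal. ring. Qed.

Lemma RCpow_mult_base x y s : 0 < x -> 0 < y -> RCpow (x * y) s = (RCpow x s * RCpow y s)%C.
Proof. intros hx hy. unfold RCpow. rewrite <- Cexp_plus, ln_mult, RtoC_plus by auto. f_equal. ring. Qed.

Lemma Cmod_RCpow x s : Cmod (RCpow x s) = Rpower x (Re s).
Proof. unfold RCpow, Rpower. rewrite Cmod_Cexp. f_equal. unfold Re; simpl. ring. Qed.

Lemma RCpow_RtoC x a : RCpow x (RtoC a) = RtoC (Rpower x a).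
Proof. unfold RCpow, Rpower. rewrite <- RtoC_mult, Cexp_RtoC. reflexivity. Qed.

Lemma RCpow_nat x n : 0 < x -> RCpow x (RtoC (INR n)) = RtoC (x ^ n).
Proof. intros hx. rewrite RCpow_RtoC, Rpower_pow; auto. Qed.

Lemma RCpow_inv x s : 0 < x -> RCpow (/ x) s = RCpow x (- s).
Proof. intros hx. unfold RCpow. rewrite ln_Rinv, RtoC_opp by auto. f_equal. ring. Qed.

Lemma RCpow_sqr x s : 0 < x -> RCpow (x ^ 2) s = RCpow x (2 * s).
Proof.
  intros hx. unfold RCpow. f_equal.
  replace (x ^ 2) with (x * x) by ring. rewrite ln_mult, RtoC_plus by auto.
  replace (RtoC 2) with (1 + 1)%C by (rewrite <- RtoC_plus; f_equal; ring). ring.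
Qed.

Lemma is_cderive_RCpow x s : is_cderive (RCpow x) s (RtoC (ln x) * RCpow x s)%C.
Proof.
  unfold RCpow. eapply is_cderive_val.
  - apply (is_cderive_comp Cexp (fun s => s * RtoC (ln x))%C); [apply is_cderive_Cexp|].
    apply is_cderive_mult; [apply is_cderive_id|apply is_cderive_const].
  - cring.
Qed.

Lemma ccont_RCpow s x : 0 < x -> ccont (fun x => RCpow x s) x.
Proof.
  intros hx.
  apply ccont_pair; unfold RCpow, Cexp, Re, Im; simpl.
  - apply (ex_derive_continuous (fun t => exp (fst s * ln t - snd s * 0) * cos (fst s * 0 + snd s * ln t))).
    auto_derive. auto.
  - apply (ex_derive_continuous (fun t => exp (fst s * ln t - snd s * 0) * sin (fst s * 0 + snd s * ln t))).
    auto_derive. auto.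
Qed.

Lemma sqr_le_exp (t : R) : 0 <= t -> t ^ 2 <= 4 * exp t.
Proof.
  intros ht.
  assert (h := exp_ineq1_le (t / 2)).
  replace t with (t / 2 + t / 2) at 2 by field. rewrite exp_plus.
  assert (0 <= t / 2) by lra. nra.
Qed.

Lemma exp_abs_ln_le x d : 0 < x -> 0 <= d ->
  exp (d * Rabs (ln x)) <= Rpower x d + Rpower x (- d).
Proof.
  intros hx hd. unfold Rpower. assert (h1 := exp_pos (d * ln x)). assert (h2 := exp_pos (- d * ln x)).
  unfold Rabs; destruct (Rcase_abs (ln x)).
  - replace (d * - ln x) with (- d * ln x) by ring. lra.
  - lra.
Qed.

Lemma RCpow_second_order x s h d : 0 < x -> 0 < d -> Cmod h <= d ->
  Cmod (RCpow x (s + h) - RCpow x s - RtoC (ln x) * RCpow x s * h)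
  <= Cmod h ^ 2 * (4 / d ^ 2 * (Rpower x (Re s + 2 * d) + Rpower x (Re s - 2 * d))).
Proof.
  intros hx hd hh.
  rewrite RCpow_plus. unfold RCpow at 2.
  replace (RCpow x s * Cexp (h * ln x) - RCpow x s - ln x * RCpow x s * h)%C
    with (RCpow x s * (Cexp (h * ln x) - 1 - h * ln x))%C by ring.
  rewrite Cmod_mult, Cmod_RCpow.
  assert (hb := Cexp_bound2 (h * ln x)). rewrite Cmod_mult, Cmod_R in hb.
  set (L := Rabs (ln x)) in *. assert (hL : 0 <= L) by apply Rabs_pos.
  assert (h0 := Cmod_ge_0 h). set (r := Cmod h) in *.
  assert (e1 : exp (r * L) <= exp (d * L)) by (apply exp_le, Rmult_le_compat_r; auto).
  assert (e2 : (d * L) ^ 2 <= 4 * exp (d * L)) by (apply sqr_le_exp; nra).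
  assert (e3 : exp (d * L) * exp (d * L) <= Rpower x (2 * d) + Rpower x (- (2 * d))).
  { rewrite <- exp_plus. replace (d * L + d * L) with (2 * d * L) by ring. apply exp_abs_ln_le; auto; lra. }
  assert (hp : 0 < Rpower x (Re s)) by apply exp_pos.
  replace (Rpower x (Re s + 2 * d)) with (Rpower x (Re s) * Rpower x (2 * d)) by (rewrite Rpower_plus; auto).
  replace (Rpower x (Re s - 2 * d)) with (Rpower x (Re s) * Rpower x (- (2 * d)))
    by (rewrite <- Rpower_plus; f_equal; ring).
  apply Rle_trans with (Rpower x (Re s) * (r ^ 2 * (4 / d ^ 2 * (exp (d * L) * exp (d * L))))).
  - apply Rmult_le_compat_l; [lra|]. eapply Rle_trans; [exact hb|].
    rewrite Rpow_mult_distr, Rmult_assoc. apply Rmult_le_compat_l; [nra|].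
    assert (hd2 : 0 < d ^ 2) by nra.
    assert (e4 : L ^ 2 <= 4 / d ^ 2 * exp (d * L)).
    { apply Rmult_le_reg_l with (d ^ 2); auto.
      replace (d ^ 2 * (4 / d ^ 2 * exp (d * L))) with (4 * exp (d * L)) by (field; lra).
      replace (d ^ 2 * L ^ 2) with ((d * L) ^ 2) by ring. exact e2. }
    rewrite <- Rmult_assoc. apply Rmult_le_compat; auto. nra. left; apply exp_pos.
  - replace (r ^ 2 * (4 / d ^ 2 * (Rpower x (Re s) * Rpower x (2 * d) + Rpower x (Re s) * Rpower x (- (2 * d)))))
     with (Rpower x (Re s) * (r ^ 2 * (4 / d ^ 2 * (Rpower x (2 * d) + Rpower x (- (2 * d)))))) by ring.
    apply Rmult_le_compat_l; [lra|]. apply Rmult_le_compat_l; [nra|].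
    apply Rmult_le_compat_l; auto. apply Rdiv_le_0_compat; nra.
Qed.

Lemma Rpower_le_1 x a : 0 < x <= 1 -> 0 <= a -> Rpower x a <= 1.
Proof.
  intros hx ha. unfold Rpower. rewrite <- exp_0. apply exp_le.
  assert (ln x <= 0) by (rewrite <- ln_1; apply ln_le; lra). nra.
Qed.

Lemma Rpower_anti x a b : 0 < x <= 1 -> a <= b -> Rpower x b <= Rpower x a.
Proof.
  intros hx hab. unfold Rpower. apply exp_le.
  assert (ln x <= 0) by (rewrite <- ln_1; apply ln_le; lra). nra.
Qed.

Lemma Rpower_small a eps : 0 < a -> 0 < eps -> exists d, 0 < d <= 1 /\ forall x, 0 < x < d -> Rpower x a < eps.
Proof.
  intros ha he. exists (Rmin 1 (Rpower eps (/ a))). split.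
  - split; [apply Rmin_pos; [lra|apply exp_pos]|apply Rmin_l].
  - intros x [h1 h2]. apply Rlt_le_trans with (Rpower (Rpower eps (/ a)) a).
    + unfold Rpower at 1 2. apply exp_increasing. apply Rmult_lt_compat_l; auto. apply ln_increasing; auto.
      eapply Rlt_le_trans; [exact h2|apply Rmin_r].
    + rewrite Rpower_mult, Rinv_l, Rpower_1; lra.
Qed.

(* The integrand may take any (junk) value at [0]; it only has to tend to [0] there. *)
Lemma ex_CInt_vanishing (f : R -> C) (K a b : R) : 0 < a -> 0 <= b ->
  (forall x, 0 < x <= b -> ccont f x) ->
  (forall x, 0 < x <= 1 -> Cmod (f x) <= K * Rpower x a) -> ex_CInt f 0 b.
Proof.
  intros ha hb hc hK.
  set (f0 := fun x => if Rle_dec x 0 then RtoC 0 else f x).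
  assert (h : ex_CInt f0 0 b).
  { apply ex_CInt_cont. rewrite Rmin_left, Rmax_right by lra. intros z hz.
    destruct (Req_dec z 0) as [e|e].
    - subst z. apply ccont_eps. intros eps he.
      destruct (Rpower_small a (eps / (Rabs K + 1)) ha) as [d [hd1 hd2]].
      { apply Rdiv_lt_0_compat; auto. generalize (Rabs_pos K); lra. }
      exists d. split; [lra|]. intros y hy. rewrite Rminus_0_r in hy.
      unfold f0. destruct (Rle_dec 0 0) as [_|n]; [|lra].
      destruct (Rle_dec y 0) as [h|h].
      + replace (0 - 0)%C with (RtoC 0) by ring. rewrite Cmod_0. auto.
      + replace (f y - 0)%C with (f y) by ring.
        rewrite Rabs_pos_eq in hy by lra.
        assert (hp := hd2 y ltac:(lra)). assert (hf := hK y ltac:(lra)).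
        assert (hK0 := Rle_abs K). assert (hp0 : 0 < Rpower y a) by apply exp_pos.
        assert (hK1 := Rabs_pos K).
        apply Rle_lt_trans with ((Rabs K + 1) * Rpower y a); [nra|].
        apply Rlt_le_trans with ((Rabs K + 1) * (eps / (Rabs K + 1))).
        * apply Rmult_lt_compat_l; lra.
        * right; field; lra.
    - apply (continuous_ext_loc _ f).
      + exists (mkposreal z ltac:(lra)). intros y hy. unfold f0.
        destruct (Rle_dec y 0) as [h|h]; auto.
        exfalso. unfold ball in hy; simpl in hy; unfold AbsRing_ball, abs, minus, plus, opp in hy; simpl in hy.
        apply Rabs_lt_between in hy. lra.
      + apply hc. lra. }
  destruct h as [l hl]. exists l. apply is_CInt_ext with f0; auto.
  rewrite Rmin_left, Rmax_right by lra. intros x hx. unfold f0. destruct (Rle_dec x 0); auto; lra.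
Qed.

Definition mellin (g : R -> R) (s : C) : C := CInt (fun x => RCpow x s * RtoC (g x))%C 0 1.

Lemma ccont_mellin g s x : 0 < x -> continuous g x -> ccont (fun x => RCpow x s * RtoC (g x))%C x.
Proof. intros hx hg. apply ccont_mult; [apply ccont_RCpow; auto|apply ccont_RtoC; auto]. Qed.

Lemma Cmod_mellin_le g K N s x : 0 < x <= 1 -> Rabs (g x) <= K * Rpower x N ->
  Cmod (RCpow x s * RtoC (g x)) <= K * Rpower x (Re s + N).
Proof.
  intros hx hg. rewrite Cmod_mult, Cmod_RCpow, Cmod_R, Rpower_plus.
  assert (0 < Rpower x (Re s)) by apply exp_pos. nra.
Qed.

Lemma ex_mellin g K N s : (forall x, 0 < x <= 1 -> continuous g x) ->
  (forall x, 0 < x <= 1 -> Rabs (g x) <= K * Rpower x N) -> 0 < Re s + N ->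
  ex_CInt (fun x => RCpow x s * RtoC (g x))%C 0 1.
Proof.
  intros hc hg hs. apply ex_CInt_vanishing with K (Re s + N); auto; [lra| |].
  - intros x hx. apply ccont_mellin; [lra|apply hc; auto].
  - intros x hx. apply Cmod_mellin_le; auto.
Qed.

Lemma mellin_derive g K N s : (forall x, 0 < x <= 1 -> continuous g x) ->
  (forall x, 0 < x <= 1 -> Rabs (g x) <= K * Rpower x N) -> 0 < Re s + N ->
  exists l, is_cderive (mellin g) s l.
Proof.
  intros hc hg hs.
  set (d := (Re s + N) / 4). assert (hd : 0 < d) by (unfold d; lra).
  set (dg := fun x => (RtoC (ln x) * (RCpow x s * RtoC (g x)))%C).
  assert (hK : 0 <= K).
  { assert (h := hg 1 ltac:(lra)). unfold Rpower in h. rewrite ln_1, Rmult_0_r, exp_0 in h.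
    generalize (Rabs_pos (g 1)); lra. }
  assert (hex : ex_CInt dg 0 1).
  { apply ex_CInt_vanishing with (/ d * K) (Re s + N - d); [unfold d; lra|lra| |].
    - intros x hx. apply ccont_mult; [|apply ccont_mellin; [lra|apply hc; auto]].
      apply ccont_RtoC. apply (ex_derive_continuous ln). auto_derive. lra.
    - intros x hx. unfold dg. rewrite Cmod_mult, Cmod_R.
      assert (hb := Cmod_mellin_le g K N s x hx (hg x hx)).
      assert (hl : Rabs (ln x) <= / d * Rpower x (- d)).
      { assert (ln x <= 0) by (rewrite <- ln_1; apply ln_le; lra).
        rewrite Rabs_left1 by auto. unfold Rpower.
        apply Rmult_le_reg_l with d; auto. rewrite <- Rmult_assoc, Rinv_r, Rmult_1_l by lra.
        generalize (exp_ineq1_le (- d * ln x)); lra. }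
      apply Rle_trans with (/ d * Rpower x (- d) * (K * Rpower x (Re s + N))).
      + apply Rmult_le_compat; auto. apply Rabs_pos. apply Cmod_ge_0.
      + right. replace (Re s + N - d) with (- d + (Re s + N)) by ring.
        rewrite (Rpower_plus (- d)). ring. }
  exists (CInt dg 0 1). apply is_cderive_eps. intros eps he.
  set (M := 4 / d ^ 2 * (2 * K) + 1).
  assert (hM : 0 < M). { unfold M. assert (0 <= 4 / d ^ 2) by (apply Rdiv_le_0_compat; nra). nra. }
  exists (Rmin d (eps / M)). split; [apply Rmin_pos; auto; apply Rdiv_lt_0_compat; auto|].
  intros w hw. apply Rmin_Rgt_l in hw as [w1 w2].
  set (h := (w - s)%C) in *. assert (hw : w = (s + h)%C) by (unfold h; ring).
  assert (hexs : ex_CInt (fun x => RCpow x s * RtoC (g x))%C 0 1) by (apply ex_mellin with K N; auto).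
  assert (hexw : ex_CInt (fun x => RCpow x w * RtoC (g x))%C 0 1).
  { apply ex_mellin with K N; auto. rewrite hw.
    assert (k := re_le_Cmod h). replace (Re (s + h)) with (Re s + Re h) by reflexivity.
    assert (k' : Rabs (Re h) < d) by lra. apply Rabs_lt_between in k'. unfold d in *. lra. }
  assert (hd' : is_CInt (fun x => RCpow x w * RtoC (g x) - RCpow x s * RtoC (g x) - h * dg x)%C 0 1
     (mellin g w - mellin g s - h * CInt dg 0 1)%C).
  { apply is_CInt_minus; [apply is_CInt_minus|apply is_CInt_scal]; apply CInt_correct; auto. }
  replace (mellin g w - mellin g s - CInt dg 0 1 * h)%C with (mellin g w - mellin g s - h * CInt dg 0 1)%C by ring.
  rewrite <- (is_CInt_unique _ _ _ _ hd').
  set (r := Cmod h) in *. assert (hr : 0 <= r) by apply Cmod_ge_0.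
  apply Rle_trans with ((1 - 0) * (r ^ 2 * M)).
  2: { replace ((1 - 0) * (r ^ 2 * M)) with (M * r * r) by ring. apply Rmult_le_compat_r; auto.
       rewrite Rmult_comm. apply Rle_div_r; auto. lra. }
  (* the value at the left end point is irrelevant: bound on (0, 1] *)
  rewrite (CInt_ext _ (fun x => if Rle_dec x 0 then RtoC 0 else
     (RCpow x w * RtoC (g x) - RCpow x s * RtoC (g x) - h * dg x)%C)).
  2: { rewrite Rmin_left, Rmax_right by lra. intros x hx. destruct (Rle_dec x 0); auto; lra. }
  apply Cmod_CInt_le_const; [lra| |].
  - intros x hx. destruct (Rle_dec x 0) as [hx0|hx0].
    + rewrite Cmod_0. apply Rmult_le_pos; [nra|lra].
    + replace (RCpow x w * RtoC (g x) - RCpow x s * RtoC (g x) - h * dg x)%C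
       with ((RCpow x (s + h) - RCpow x s - RtoC (ln x) * RCpow x s * h) * RtoC (g x))%C
       by (unfold dg; rewrite <- hw; ring).
      rewrite Cmod_mult, Cmod_R.
      assert (h2 := RCpow_second_order x s h d ltac:(lra) hd ltac:(unfold r in *; lra)). fold r in h2.
      assert (hgx := hg x ltac:(lra)).
      assert (q1 : Rpower x (Re s + 2 * d) * Rpower x N <= 1).
      { rewrite <- Rpower_plus. apply Rpower_le_1; [lra|unfold d; lra]. }
      assert (q2 : Rpower x (Re s - 2 * d) * Rpower x N <= 1).
      { rewrite <- Rpower_plus. apply Rpower_le_1; [lra|unfold d; lra]. }
      assert (p2 : 0 <= 4 / d ^ 2) by (apply Rdiv_le_0_compat; nra).
      eapply Rle_trans. { apply Rmult_le_compat; [apply Cmod_ge_0|apply Rabs_pos|exact h2|exact hgx]. }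
      unfold M.
      replace (r ^ 2 * (4 / d ^ 2 * (Rpower x (Re s + 2 * d) + Rpower x (Re s - 2 * d))) * (K * Rpower x N))
       with (r ^ 2 * (4 / d ^ 2 * K * (Rpower x (Re s + 2 * d) * Rpower x N + Rpower x (Re s - 2 * d) * Rpower x N)))
       by ring.
      apply Rmult_le_compat_l; [nra|].
      assert (0 <= 4 / d ^ 2 * K) by nra. nra.
  - eexists. eapply is_CInt_ext; [|exact hd'].
    rewrite Rmin_left, Rmax_right by lra. intros x hx. simpl. destruct (Rle_dec x 0); auto; lra.
Qed.

(* Improper integrand at [0], integrable because [x^(a-1)] is. *)
Lemma Cmod_CInt_tail_le (f : R -> C) (K a eta : R) : 0 < a -> 0 < eta -> 0 <= K ->
  ex_CInt f 0 eta -> (forall x, 0 < x <= eta -> Cmod (f x) <= K * Rpower x (a - 1)) ->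
  Cmod (CInt f 0 eta) <= K * Rpower eta a / a.
Proof.
  intros ha he hK hex hf.
  assert (hsub : forall y, 0 < y < eta -> Cmod (CInt f y eta) <= K * Rpower eta a / a).
  { intros y hy.
    assert (hP : is_RInt (fun x => K * Rpower x (a - 1)) y eta (K * Rpower eta a / a - K * Rpower y a / a)).
    { apply (is_RInt_derive (V := R_CompleteNormedModule) (fun x => K * Rpower x a / a)).
      - rewrite Rmin_left, Rmax_right by lra. intros x hx. unfold Rpower. auto_derive; [lra|].
        replace ((a - 1) * ln x) with (a * ln x + - ln x) by ring.
        rewrite exp_plus, exp_Ropp, exp_ln by lra. field. split; lra.
      - rewrite Rmin_left, Rmax_right by lra. intros x hx.
        apply (ex_derive_continuous (fun x => K * Rpower x (a - 1))). unfold Rpower. auto_derive. lra. }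
    apply Rle_trans with (K * Rpower eta a / a - K * Rpower y a / a).
    - apply Cmod_is_CInt_le with f (fun x => K * Rpower x (a - 1)) y eta; [lra| | |exact hP].
      + intros x hx. apply hf. lra.
      + apply CInt_correct. apply (ex_RInt_Chasles_2 (V := C_R_CompleteNormedModule) f 0 y eta); [lra|exact hex].
    - assert (0 <= K * Rpower y a / a); [|lra].
      apply Rdiv_le_0_compat; auto. apply Rmult_le_pos; auto. left; apply exp_pos. }
  destruct (ex_RInt_ub (V := C_R_NormedModule) f 0 eta hex) as [B hB].
  rewrite Rmin_left, Rmax_right in hB by lra.
  apply le_epsilon. intros eps heps.
  assert (hB0 : 0 <= B). { eapply Rle_trans; [apply (Cmod_ge_0 (f 0))|]. rewrite Cmod_norm. apply hB; lra. }
  set (y := Rmin (eta / 2) (eps / (B + 1))).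
  assert (hy : 0 < y) by (apply Rmin_pos; [lra|apply Rdiv_lt_0_compat; lra]).
  assert (hy2 : y < eta) by (eapply Rle_lt_trans; [apply Rmin_l|lra]).
  assert (ex1 : ex_CInt f 0 y) by (apply (ex_RInt_Chasles_1 (V := C_R_CompleteNormedModule) f 0 y eta); [lra|exact hex]).
  assert (ex2 : ex_CInt f y eta) by (apply (ex_RInt_Chasles_2 (V := C_R_CompleteNormedModule) f 0 y eta); [lra|exact hex]).
  rewrite (CInt_Chasles f 0 y eta ex1 ex2).
  eapply Rle_trans; [apply Cmod_triangle|]. rewrite Rplus_comm. apply Rplus_le_compat; [apply hsub; lra|].
  apply Rle_trans with ((y - 0) * B).
  - apply Cmod_CInt_le_const; [lra| |exact ex1]. intros x hx. rewrite Cmod_norm. apply hB. lra.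
  - assert (y * (B + 1) <= eps); [|nra]. apply Rle_div_r; [lra|]. apply Rmin_r.
Qed.

(** * Partial sums and Tannery's theorem *)

Fixpoint csum (f : nat -> C) (n : nat) : C :=
  match n with O => RtoC 0 | S m => (csum f m + f m)%C end.

Fixpoint rsum (f : nat -> R) (n : nat) : R :=
  match n with O => 0 | S m => rsum f m + f m end.

Lemma csum_S f n : csum f (S n) = (csum f n + f n)%C.
Proof. reflexivity. Qed.

Lemma rsum_S f n : rsum f (S n) = rsum f n + f n.
Proof. reflexivity. Qed.

Lemma csum_ext f g n : (forall k, (k < n)%nat -> f k = g k) -> csum f n = csum g n.
Proof.
  induction n as [|n IH]; intros h; simpl; auto. rewrite IH, h; auto.
Qed.

Lemma csum_plus f g n : csum (fun k => f k + g k)%C n = (csum f n + csum g n)%C.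
Proof. induction n as [|n IH]; simpl; [|rewrite IH]; ring. Qed.

Lemma csum_scal c f n : csum (fun k => c * f k)%C n = (c * csum f n)%C.
Proof. induction n as [|n IH]; simpl; [|rewrite IH]; ring. Qed.

Lemma csum_split f m n : csum f (m + n) = (csum f m + csum (fun k => f (m + k)%nat) n)%C.
Proof.
  induction n as [|n IH]; [rewrite Nat.add_0_r; simpl; ring|].
  rewrite Nat.add_succ_r. simpl. rewrite IH. ring.
Qed.

Lemma csum_rev f n : csum (fun k => f (n - 1 - k)%nat) n = csum f n.
Proof.
  induction n as [|n IH]; auto.
  change (csum (fun k => f (S n - 1 - k)%nat) (1 + n) = csum f (S n)).
  rewrite csum_split. simpl csum at 1. simpl csum at 2. rewrite <- IH.
  rewrite (csum_ext (fun k => f (S n - 1 - (1 + k))%nat) (fun k => f (n - 1 - k)%nat)).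
  - simpl. rewrite !Nat.sub_0_r. ring.
  - intros k hk. f_equal. lia.
Qed.

Lemma rsum_ext f g n : (forall k, (k < n)%nat -> f k = g k) -> rsum f n = rsum g n.
Proof. induction n as [|n IH]; intros h; simpl; auto. rewrite IH, h; auto. Qed.

Lemma rsum_le f g n : (forall k, (k < n)%nat -> f k <= g k) -> rsum f n <= rsum g n.
Proof. induction n as [|n IH]; intros h; simpl; [lra|]. apply Rplus_le_compat; auto. Qed.

Lemma rsum_scal c f n : rsum (fun k => c * f k) n = c * rsum f n.
Proof. induction n as [|n IH]; simpl; [|rewrite IH]; ring. Qed.

Lemma rsum_plus f g n : rsum (fun k => f k + g k) n = rsum f n + rsum g n.
Proof. induction n as [|n IH]; simpl; [|rewrite IH]; ring. Qed.

Lemma rsum_split f m n : rsum f (m + n) = rsum f m + rsum (fun k => f (m + k)%nat) n.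
Proof.
  induction n as [|n IH]; [rewrite Nat.add_0_r; simpl; ring|].
  rewrite Nat.add_succ_r. simpl. rewrite IH. ring.
Qed.

Lemma rsum_nonneg f n : (forall k, (k < n)%nat -> 0 <= f k) -> 0 <= rsum f n.
Proof.
  induction n as [|n IH]; intros h; simpl; [lra|]. apply Rplus_le_le_0_compat; auto.
Qed.

Lemma Cmod_csum_le f b n : (forall k, (k < n)%nat -> Cmod (f k) <= b k) -> Cmod (csum f n) <= rsum b n.
Proof.
  induction n as [|n IH]; intros h; simpl; [rewrite Cmod_0; lra|].
  eapply Rle_trans; [apply Cmod_triangle|]. apply Rplus_le_compat; auto.
Qed.

Definition Clim (u : nat -> C) (l : C) : Prop :=
  forall eps, 0 < eps -> exists N, forall n, (N <= n)%nat -> Cmod (u n - l) < eps.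

Lemma Clim_const c : Clim (fun _ => c) c.
Proof. intros e he; exists 0%nat; intros n _. replace (c - c)%C with (RtoC 0) by ring. rewrite Cmod_0; auto. Qed.

Lemma Clim_unique u a b : Clim u a -> Clim u b -> a = b.
Proof.
  intros ha hb. apply NNPP. intros hn.
  assert (hm : 0 < Cmod (a - b)).
  { apply Cmod_gt_0. intros h. apply hn. replace a with ((a - b) + b)%C by ring. rewrite h. ring. }
  destruct (ha (Cmod (a - b) / 2)) as [N1 h1]; [lra|]. destruct (hb (Cmod (a - b) / 2)) as [N2 h2]; [lra|].
  specialize (h1 (N1 + N2)%nat ltac:(lia)). specialize (h2 (N1 + N2)%nat ltac:(lia)).
  set (x := u (N1 + N2)%nat) in *.
  assert (k := Cmod_triangle (x - b) (- (x - a))). rewrite Cmod_opp in k.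
  replace (x - b + - (x - a))%C with (a - b)%C in k by ring. lra.
Qed.

Lemma Clim_ext u v l : (forall n, u n = v n) -> Clim u l -> Clim v l.
Proof. intros h hu e he. destruct (hu e he) as [N hN]. exists N; intros n hn. rewrite <- h; auto. Qed.

Lemma Clim_plus u v a b : Clim u a -> Clim v b -> Clim (fun n => u n + v n)%C (a + b)%C.
Proof.
  intros ha hb e he. destruct (ha (e / 2)) as [N1 h1]; [lra|]. destruct (hb (e / 2)) as [N2 h2]; [lra|].
  exists (N1 + N2)%nat. intros n hn. specialize (h1 n ltac:(lia)). specialize (h2 n ltac:(lia)).
  replace (u n + v n - (a + b))%C with ((u n - a) + (v n - b))%C by ring.
  eapply Rle_lt_trans; [apply Cmod_triangle|]. lra.
Qed.

Lemma Clim_mult u v a b : Clim u a -> Clim v b -> Clim (fun n => u n * v n)%C (a * b)%C.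
Proof.
  intros ha hb e he.
  assert (p1 := Cmod_ge_0 a). assert (p2 := Cmod_ge_0 b).
  set (M := 2 + Cmod a + Cmod b).
  set (d := Rmin 1 (e / M)). assert (hM : 0 < M) by (unfold M; lra).
  assert (hd : 0 < d) by (apply Rmin_pos; [lra|apply Rdiv_lt_0_compat; auto]).
  destruct (ha d hd) as [N1 h1]. destruct (hb d hd) as [N2 h2].
  exists (N1 + N2)%nat. intros n hn. specialize (h1 n ltac:(lia)). specialize (h2 n ltac:(lia)).
  replace (u n * v n - a * b)%C with ((u n - a) * (v n - b) + (u n - a) * b + a * (v n - b))%C by ring.
  eapply Rle_lt_trans; [apply Cmod_triangle|].
  eapply Rle_lt_trans; [apply Rplus_le_compat_r, Cmod_triangle|]. rewrite !Cmod_mult.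
  assert (q1 := Cmod_ge_0 (u n - a)). assert (q2 := Cmod_ge_0 (v n - b)).
  assert (hd1 : d <= 1) by apply Rmin_l. assert (hdM : d * M <= e).
  { apply Rle_trans with (e / M * M); [apply Rmult_le_compat_r; [lra|apply Rmin_r]|right; field; lra]. }
  apply Rlt_le_trans with (d * M); auto. unfold M.
  apply Rle_lt_trans with (d * 1 + d * Cmod b + Cmod a * d); [|lra].
  repeat apply Rplus_le_compat; try (apply Rmult_le_compat; lra).
Qed.

Lemma Clim_scal c u a : Clim u a -> Clim (fun n => c * u n)%C (c * a)%C.
Proof. intros h. apply Clim_mult; auto. apply Clim_const. Qed.

Lemma Clim_opp u a : Clim u a -> Clim (fun n => - u n)%C (- a)%C.
Proof.
  intros h e he. destruct (h e he) as [N hN]. exists N. intros n hn.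
  replace (- u n - - a)%C with (- (u n - a))%C by ring. rewrite Cmod_opp. auto.
Qed.

Lemma Clim_minus u v a b : Clim u a -> Clim v b -> Clim (fun n => u n - v n)%C (a - b)%C.
Proof. intros ha hb. apply Clim_plus; auto. apply Clim_opp; auto. Qed.

Lemma Clim_inv u a : a <> RtoC 0 -> Clim u a -> Clim (fun n => / u n)%C (/ a)%C.
Proof.
  intros ha h e he. assert (hm : 0 < Cmod a) by (apply Cmod_gt_0; auto).
  set (m := Cmod a) in *.
  destruct (h (Rmin (m / 2) (e * (m * m) / 2))) as [N hN].
  { apply Rmin_pos; [lra|]. apply Rdiv_lt_0_compat; [|lra]. repeat apply Rmult_lt_0_compat; auto. }
  exists N. intros n hn. specialize (hN n hn). apply Rmin_Rgt_l in hN as [k1 k2].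
  assert (hw : m / 2 <= Cmod (u n)).
  { generalize (Cmod_triangle_minus a (u n)). rewrite Cmod_minus_sym in k1. fold m. lra. }
  assert (hu : u n <> RtoC 0). { intros e0. rewrite e0, Cmod_0 in hw. lra. }
  replace (/ u n - / a)%C with ((a - u n) * / (u n * a))%C by (field; auto).
  rewrite Cmod_mult, Cmod_inv, Cmod_mult by (apply Cmult_neq_0; auto). fold m.
  rewrite Cmod_minus_sym. set (r := Cmod (u n - a)) in *. set (w := Cmod (u n)) in *.
  apply Rle_lt_trans with (r * / (m / 2 * m)).
  - apply Rmult_le_compat_l; [apply Cmod_ge_0|]. apply Rinv_le_contravar; nra.
  - apply Rmult_lt_reg_r with (m / 2 * m); [nra|]. rewrite Rmult_assoc, Rinv_l by nra. lra.
Qed.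

Lemma Clim_squeeze0 u (b : nat -> R) : (forall n, Cmod (u n) <= b n) -> is_lim_seq b 0 -> Clim u (RtoC 0).
Proof.
  intros h hb e he. apply is_lim_seq_spec in hb. destruct (hb (mkposreal e he)) as [N hN].
  exists N. intros n hn. specialize (hN n hn). simpl in hN. rewrite Rminus_0_r in hN.
  replace (u n - 0)%C with (u n) by ring. specialize (h n). generalize (Rle_abs (b n)); lra.
Qed.

Lemma Clim_RtoC (u : nat -> R) (l : R) : is_lim_seq u l <-> Clim (fun n => RtoC (u n)) (RtoC l).
Proof.
  rewrite <- is_lim_seq_spec. split.
  - intros h e he. destruct (h (mkposreal e he)) as [N hN]. exists N. intros n hn.
    rewrite <- RtoC_minus, Cmod_R. apply hN; auto.
  - intros h e. destruct (h e (cond_pos e)) as [N hN]. exists N. intros n hn.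
    specialize (hN n hn). rewrite <- RtoC_minus, Cmod_R in hN. exact hN.
Qed.

Lemma Clim_Im u l : Clim u l -> is_lim_seq (fun n => Im (u n)) (Im l).
Proof.
  intros h. apply is_lim_seq_spec. intros e. destruct (h e (cond_pos e)) as [N hN]. exists N. intros n hn.
  eapply Rle_lt_trans; [|apply (hN n hn)]. eapply Rle_trans; [|apply im_le_Cmod].
  right; reflexivity.
Qed.

Lemma Clim_subseq u l (N : nat -> nat) : (forall J, exists M, forall m, (M <= m)%nat -> (J <= N m)%nat) ->
  Clim u l -> Clim (fun n => u (N n)) l.
Proof. intros hN h e he. destruct (h e he) as [J hJ]. destruct (hN J) as [M hM]. exists M. auto. Qed.

Lemma Clim_csum (f : nat -> nat -> C) (g : nat -> C) n :
  (forall j, Clim (fun m => f m j) (g j)) -> Clim (fun m => csum (f m) n) (csum g n).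
Proof.
  intros h. induction n as [|n IH]; simpl; [apply Clim_const|]. apply Clim_plus; auto.
Qed.

Lemma rsum_inv_sqr_tail (J n : nat) : (1 <= J)%nat ->
  rsum (fun k => / INR (J + k) ^ 2) n <= / (INR J - / 2).
Proof.
  intros hJ. assert (h1 : 1 <= INR J) by (apply (le_INR 1); auto).
  assert (h : rsum (fun k => / INR (J + k) ^ 2) n <= / (INR J - / 2) - / (INR (J + n) - / 2)).
  { induction n as [|n IH]; simpl rsum; [rewrite Nat.add_0_r; lra|].
    rewrite Nat.add_succ_r, S_INR. assert (hx : 1 <= INR (J + n)) by (apply (le_INR 1); lia).
    set (x := INR (J + n)) in *.
    assert (/ x ^ 2 <= / (x - / 2) - / (x + 1 - / 2)); [|change (rsum (fun k => / INR (J + k) ^ 2) n + / x ^ 2 <= / (INR J - / 2) - / (x + 1 - / 2)); lra].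
    replace (/ (x - / 2) - / (x + 1 - / 2)) with (/ ((x - / 2) * (x + 1 - / 2))) by (field; lra).
    apply Rinv_le_contravar; nra. }
  assert (0 < / (INR (J + n) - / 2)); [|lra].
  apply Rinv_0_lt_compat. assert (1 <= INR (J + n)) by (apply (le_INR 1); lia). lra.
Qed.

Lemma tannery (f : nat -> nat -> C) (g : nat -> C) (K : R) (N : nat -> nat) (L : C) :
  (forall J, exists M, forall m, (M <= m)%nat -> (J <= N m)%nat) ->
  (forall m j, (1 <= j < N m)%nat -> Cmod (f m j) <= K * / INR j ^ 2) ->
  (forall j, (1 <= j)%nat -> Cmod (g j) <= K * / INR j ^ 2) ->
  (forall j, Clim (fun m => f m j) (g j)) ->
  (forall m, csum (f m) (N m) = L) -> Clim (csum g) L.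
Proof.
  intros hN hf hg hlim hL e he.
  assert (hK : 0 <= K).
  { specialize (hg 1%nat (le_n _)). generalize (Cmod_ge_0 (g 1%nat)).
    replace (/ INR 1 ^ 2) with 1 in hg by (simpl; field). lra. }
  destruct (nfloor_ex (4 * K / e + 1)) as [J' [_ hJ']].
  { assert (0 <= 4 * K / e) by (apply Rdiv_le_0_compat; lra). lra. }
  set (J := S J').
  assert (hJ : K * / (INR J - / 2) < e / 3).
  { unfold J. rewrite S_INR. assert (h0 : 0 <= 4 * K / e) by (apply Rdiv_le_0_compat; lra).
    apply Rmult_lt_reg_r with (INR J' + 1 - / 2); [lra|]. rewrite Rmult_assoc, Rinv_l by lra.
    assert (h1 : 4 * K / e < INR J' + 1 - / 2) by lra.
    apply Rlt_div_l in h1; [|lra]. lra. }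
  assert (tail : forall (u : nat -> C) n, (forall k, (k < n)%nat -> Cmod (u (J + k)%nat) <= K * / INR (J + k) ^ 2) ->
     Cmod (csum (fun k => u (J + k)%nat) n) < e / 3).
  { intros u n hu. eapply Rle_lt_trans; [apply Cmod_csum_le; exact hu|].
    rewrite rsum_scal. eapply Rle_lt_trans; [|exact hJ]. apply Rmult_le_compat_l; auto.
    apply rsum_inv_sqr_tail. unfold J; lia. }
  destruct (Clim_csum f g J hlim (e / 3)) as [M1 hM1]; [lra|].
  destruct (hN J) as [M2 hM2].
  exists J. intros n hn.
  set (m := (M1 + M2)%nat). specialize (hM1 m ltac:(unfold m; lia)). specialize (hM2 m ltac:(unfold m; lia)).
  assert (e1 := csum_split g J (n - J)). replace (J + (n - J))%nat with n in e1 by lia.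
  assert (e2 := csum_split (f m) J (N m - J)). replace (J + (N m - J))%nat with (N m) in e2 by lia.
  rewrite hL in e2. rewrite e1, e2.
  assert (t1 := tail g (n - J)%nat). assert (t2 := tail (f m) (N m - J)%nat).
  match goal with |- Cmod (?a + ?b - (?c + ?d)) < _ =>
    replace (a + b - (c + d))%C with (b + (- (c - a)) + - d)%C by ring end.
  eapply Rle_lt_trans; [apply Cmod_triangle|].
  eapply Rle_lt_trans; [apply Rplus_le_compat_r, Cmod_triangle|]. rewrite !Cmod_opp.
  assert (t1' := t1 ltac:(intros k hk; apply hg; unfold J; lia)).
  assert (t2' := t2 ltac:(intros k hk; apply hf; unfold J in *; lia)).
  lra.
Qed.

(** * The partial fraction expansion of the cotangent *)

Definition nome (z : C) : C := Cexp (RtoC (2 * PI) * Ci * z).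

Definition pi_cot (z : C) : C := (RtoC PI * Ci * ((nome z + 1) / (nome z - 1)))%C.

Definition nonint (z : C) : Prop := forall k : Z, z <> RtoC (IZR k).

Lemma C_minus_neq0 (a b : C) : a <> b -> (a - b)%C <> RtoC 0.
Proof. intros h k. apply h. replace a with ((a - b) + b)%C by ring. rewrite k. ring. Qed.

Lemma Cmod_Cexp_minus_1_sqr (w : C) :
  Cmod (Cexp w - 1) ^ 2 = (exp (Re w) - 1) ^ 2 + 4 * exp (Re w) * sin (Im w / 2) ^ 2.
Proof.
  rewrite Cmod2_alt. unfold Cexp. simpl. fold (Re w) (Im w).
  assert (h : cos (Im w) = 1 - 2 * sin (Im w / 2) ^ 2).
  { replace (Im w) with (2 * (Im w / 2)) at 1 by field. rewrite cos_2a_sin. ring. }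
  assert (h2 := sin2_cos2 (Im w)). unfold Rsqr in h2.
  unfold Re at 1, Im at 1; simpl. fold (Re w) (Im w).
  set (e := exp (Re w)). set (s := sin (Im w)) in *. set (c := cos (Im w)) in *.
  replace ((e * c + - (1)) * ((e * c + - (1)) * 1) + (e * s + - 0) * ((e * s + - 0) * 1))
    with (e * e * (s * s + c * c) - 2 * e * c + 1) by ring.
  rewrite h2, h. ring.
Qed.

Lemma Cmod_Cexp_minus_1_ge (w : C) :
  2 * exp (Re w / 2) * Rabs (sin (Im w / 2)) <= Cmod (Cexp w - 1).
Proof.
  assert (h := Cmod_Cexp_minus_1_sqr w).
  apply Rsqr_incr_0; [|repeat apply Rmult_le_pos; try lra; [left; apply exp_pos|apply Rabs_pos]|apply Cmod_ge_0].
  replace (Rsqr (Cmod (Cexp w - 1))) with (Cmod (Cexp w - 1) ^ 2) by (unfold Rsqr; ring).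
  rewrite h. rewrite !Rsqr_mult, <- Rsqr_abs.
  replace (Rsqr (exp (Re w / 2))) with (exp (Re w)).
  2: { unfold Rsqr. rewrite <- exp_plus. f_equal. field. }
  unfold Rsqr. assert (0 <= (exp (Re w) - 1) ^ 2) by apply pow2_ge_0. lra.
Qed.

Lemma nome_re (z : C) : Re (RtoC (2 * PI) * Ci * z) = - (2 * PI * Im z).
Proof. unfold Re, Im; simpl. ring. Qed.

Lemma nome_im (z : C) : Im (RtoC (2 * PI) * Ci * z) = 2 * PI * Re z.
Proof. unfold Re, Im; simpl. ring. Qed.

Lemma nome_neq_1 (z : C) : nonint z -> nome z <> RtoC 1.
Proof.
  intros hz h. assert (hpi := PI_RGT_0).
  assert (k := Cmod_Cexp_minus_1_sqr (RtoC (2 * PI) * Ci * z)). fold (nome z) in k.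
  rewrite h in k. replace (1 - 1)%C with (RtoC 0) in k by ring. rewrite Cmod_0, nome_re, nome_im in k.
  replace (2 * PI * Re z / 2) with (PI * Re z) in k by field.
  set (e := exp (- (2 * PI * Im z))) in *. assert (he : 0 < e) by apply exp_pos.
  set (s := sin (PI * Re z)) in *.
  assert (h0 : 0 <= 4 * e * s ^ 2) by (apply Rmult_le_pos; [lra|apply pow2_ge_0]).
  assert (h00 := pow2_ge_0 (e - 1)).
  assert (h1 : (e - 1) ^ 2 = 0) by lra.
  assert (h2 : 4 * e * s ^ 2 = 0) by lra.
  assert (e1 : e = 1) by (assert (e - 1 = 0) by (apply Rsqr_0_uniq; unfold Rsqr; lra); lra).
  assert (s0 : s = 0). { rewrite e1 in h2. apply Rsqr_0_uniq. unfold Rsqr. lra. }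
  assert (hi : Im z = 0).
  { unfold e in e1. rewrite <- exp_0 in e1. apply exp_inv in e1. nra. }
  apply sin_eq_0_0 in s0. destruct s0 as [n hn].
  apply (hz n). apply C_ext; simpl; auto.
  apply Rmult_eq_reg_l with PI; lra.
Qed.

Lemma nome_plus (a b : C) : nome (a + b) = (nome a * nome b)%C.
Proof. unfold nome. rewrite <- Cexp_plus. f_equal. ring. Qed.

Lemma nome_1 : nome 1 = RtoC 1.
Proof.
  unfold nome, Cexp. rewrite nome_re, nome_im. simpl.
  replace (- (2 * PI * 0)) with 0 by ring. rewrite exp_0, !Rmult_1_r, cos_2PI, sin_2PI.
  apply C_ext; simpl; ring.
Qed.

Lemma nome_half : nome (/ 2) = (- (1))%C.
Proof.
  unfold nome.
  replace (RtoC (2 * PI) * Ci * / 2)%C with (Ci * RtoC PI)%C.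
  - unfold Cexp. apply C_ext; simpl.
    + replace (0 * PI - 1 * 0) with 0 by ring. replace (0 * 0 + 1 * PI) with PI by ring.
      rewrite exp_0, cos_PI; ring.
    + replace (0 * PI - 1 * 0) with 0 by ring. replace (0 * 0 + 1 * PI) with PI by ring.
      rewrite exp_0, sin_PI; ring.
  - rewrite RtoC_mult. field.
Qed.

Lemma pi_cot_periodic (z : C) : pi_cot (z + 1) = pi_cot z.
Proof. unfold pi_cot. rewrite nome_plus, nome_1, Cmult_1_r. reflexivity. Qed.

Lemma RtoC_2_neq0 : RtoC 2 <> RtoC 0.
Proof. intros h; apply RtoC_inj in h; lra. Qed.

Lemma RtoC_2_eq : RtoC 2 = (1 + 1)%C.
Proof. rewrite <- RtoC_plus. reflexivity. Qed.

Lemma pi_cot_double (z : C) : nonint z ->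
  (pi_cot (z / 2) + pi_cot ((z + 1) / 2) = 2 * pi_cot z)%C.
Proof.
  intros hz. assert (h := nome_neq_1 z hz).
  unfold pi_cot.
  assert (h2 := RtoC_2_neq0).
  replace ((z + 1) / 2)%C with (z / 2 + / 2)%C by (field; auto).
  rewrite nome_plus, nome_half.
  replace z with (z / 2 + z / 2)%C in h by (field; auto).
  replace (nome z) with (nome (z / 2) * nome (z / 2))%C
    by (rewrite <- nome_plus; f_equal; field; auto).
  rewrite nome_plus in h. set (r := nome (z / 2)) in *.
  assert (k1 : (r - 1)%C <> RtoC 0).
  { intros k. apply h. replace r with ((r - 1) + 1)%C by ring. rewrite k. ring. }
  assert (k2 : (r + 1)%C <> RtoC 0).
  { intros k. apply h. replace r with ((r + 1) - 1)%C by ring. rewrite k. ring. }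
  rewrite RtoC_2_eq. field. repeat split; auto.
  - apply C_minus_neq0; auto.
  - replace (RtoC (-1)) with (Copp 1) by (rewrite <- RtoC_opp; reflexivity).
    replace (r * - (1) - 1)%C with (- (r + 1))%C by ring. intros k. apply k2.
    replace (r + 1)%C with (- - (r + 1))%C by ring. rewrite k. ring.
Qed.

Lemma nonint_div (z : C) (k n : nat) : (0 < n)%nat -> nonint z -> nonint ((z + RtoC (INR k)) / RtoC (INR n)).
Proof.
  intros hn hz l hl. apply (hz (l * Z.of_nat n - Z.of_nat k)%Z).
  rewrite minus_IZR, mult_IZR, <- !INR_IZR_INZ.
  assert (hn' : RtoC (INR n) <> RtoC 0).
  { intros e. apply RtoC_inj in e. apply lt_INR in hn. simpl in hn. lra. }
  rewrite RtoC_minus, RtoC_mult, <- hl. field. auto.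
Qed.

Lemma pi_cot_multiplication (m : nat) (z : C) : nonint z ->
  csum (fun k => pi_cot ((z + RtoC (INR k)) / RtoC (INR (2 ^ m)))) (2 ^ m)
  = (RtoC (INR (2 ^ m)) * pi_cot z)%C.
Proof.
  intros hz. induction m as [|m IH].
  - simpl. rewrite Cplus_0_l, Cmult_1_l. f_equal. rewrite Cplus_0_r. field.
  - set (n := (2 ^ m)%nat) in *.
    assert (hn : (0 < n)%nat) by (unfold n; apply Nat.neq_0_lt_0, Nat.pow_nonzero; lia).
    assert (hn' : RtoC (INR n) <> RtoC 0).
    { intros e. apply RtoC_inj in e. apply lt_INR in hn. simpl in hn. lra. }
    replace (2 ^ S m)%nat with (n + n)%nat by (unfold n; simpl; lia).
    rewrite csum_split, <- csum_plus.
    rewrite (csum_ext _ (fun k => 2 * pi_cot ((z + RtoC (INR k)) / RtoC (INR n)))%C).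
    + rewrite csum_scal, IH. rewrite plus_INR, RtoC_plus, RtoC_2_eq. ring.
    + intros k _. rewrite <- pi_cot_double by (apply nonint_div; auto).
      rewrite !plus_INR, !RtoC_plus. f_equal; f_equal; rewrite ?RtoC_2_eq; field;
        rewrite <- ?RtoC_2_eq; split; auto; try apply RtoC_2_neq0.
      all: intros e; apply hn'; rewrite <- RtoC_plus in e; apply RtoC_inj in e; f_equal; lra.
Qed.

Lemma pi_cot_folded (m : nat) (z : C) : nonint z ->
  csum (fun j => pi_cot ((z + RtoC (INR j)) / RtoC (INR (2 ^ S m)))
               + pi_cot ((z - 1 - RtoC (INR j)) / RtoC (INR (2 ^ S m))))%C (2 ^ m)
  = (RtoC (INR (2 ^ S m)) * pi_cot z)%C.
Proof.
  intros hz. rewrite <- pi_cot_multiplication by auto.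
  set (M := (2 ^ S m)%nat).
  assert (hM : M = (2 ^ m + 2 ^ m)%nat) by (unfold M; simpl; lia).
  assert (hM' : RtoC (INR M) <> RtoC 0).
  { intros e. apply RtoC_inj in e. assert (0 < M)%nat by (unfold M; apply Nat.neq_0_lt_0, Nat.pow_nonzero; lia).
    apply lt_INR in H. simpl in H. lra. }
  rewrite csum_plus.
  match goal with |- _ = csum ?G ?N => replace (csum G N) with (csum G (2 ^ m + 2 ^ m)%nat)
    by (f_equal; symmetry; exact hM) end.
  rewrite csum_split. f_equal.
  rewrite <- (csum_rev _ (2 ^ m)). apply csum_ext. intros k hk.
  rewrite <- pi_cot_periodic. f_equal.
  assert (e : INR (2 ^ m + k) = INR M - 1 - INR (2 ^ m - 1 - k)).
  { rewrite hM. rewrite !minus_INR, !plus_INR by lia. simpl (INR 1). ring. }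
  rewrite e, !RtoC_minus. field. auto.
Qed.

Lemma sin_ge_third (t : R) : 0 <= t <= PI / 2 -> t / 3 <= sin t.
Proof.
  intros ht. assert (hpi := PI_RGT_0).
  assert (h1 : forall u, 0 <= u <= PI / 3 -> u / 2 <= sin u).
  { intros u hu. destruct (Req_dec u 0) as [->|hu0]; [rewrite sin_0; lra|].
    destruct (MVT_cor2 sin cos 0 u) as [c [hc1 hc2]]; [lra|intros c _; apply derivable_pt_lim_sin|].
    rewrite sin_0 in hc1. assert (1 / 2 <= cos c).
    { rewrite <- cos_PI3. apply cos_decr_1; lra. }
    nra. }
  destruct (Rle_lt_dec t (PI / 3)) as [h|h].
  - specialize (h1 t ltac:(lra)). lra.
  - assert (k := h1 (PI / 3) ltac:(lra)).
    assert (sin (PI / 3) <= sin t) by (apply sin_incr_1; lra). lra.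
Qed.

Lemma pow2_INR_ge (m : nat) : INR m <= INR (2 ^ m).
Proof. apply le_INR. apply Nat.lt_le_incl, Nat.pow_gt_lin_r. lia. Qed.

Lemma pow2_S_pos (m : nat) : 0 < INR (2 ^ m).
Proof. apply (lt_INR 0). apply Nat.neq_0_lt_0, Nat.pow_nonzero; lia. Qed.

Lemma pow2_INR_lim (K : R) : is_lim_seq (fun m => K * / INR (2 ^ S m)) 0.
Proof.
  replace (Finite 0) with (Rbar_mult K (Finite 0)) by (simpl; f_equal; ring).
  apply is_lim_seq_scal_l.
  replace (Finite 0) with (Rbar_inv p_infty) by reflexivity.
  apply is_lim_seq_inv; [|discriminate].
  apply is_lim_seq_le_p_loc with INR; [|apply is_lim_seq_INR].
  exists 0%nat. intros n _. apply Rle_trans with (INR (S n)); [apply le_INR; lia|apply pow2_INR_ge].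
Qed.

Lemma Cmod_2PI_Ci (z : C) : Cmod (RtoC (2 * PI) * Ci * z) = 2 * PI * Cmod z.
Proof.
  rewrite !Cmod_mult, Cmod_Ci, Cmod_R, Rabs_pos_eq; [ring|]. generalize PI_RGT_0; lra.
Qed.

Lemma Ci_neq0 : Ci <> RtoC 0.
Proof. intros h. apply (f_equal Im) in h. unfold Im in h; simpl in h. lra. Qed.

Lemma Cinv_0 : Cinv (RtoC 0) = RtoC 0.
Proof. unfold Cinv, Rdiv. apply C_ext; simpl; ring. Qed.

Lemma Cinv_mult (a b : C) : Cinv (a * b) = (/ a * / b)%C.
Proof.
  destruct (Ceq_dec a 0) as [->|ha]; [rewrite Cmult_0_l, Cinv_0; ring|].
  destruct (Ceq_dec b 0) as [->|hb]; [rewrite Cmult_0_r, Cinv_0; ring|].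
  field; auto.
Qed.

Lemma Clim_of_diff u l : Clim (fun n => u n - l)%C (RtoC 0) -> Clim u l.
Proof.
  intros h e he. destruct (h e he) as [N hN]. exists N. intros n hn.
  replace (u n - l)%C with (u n - l - 0)%C by ring. auto.
Qed.

Lemma pi_cot_small (z : C) : z <> RtoC 0 ->
  Clim (fun m => / RtoC (INR (2 ^ S m)) * pi_cot (z / RtoC (INR (2 ^ S m))))%C (/ z)%C.
Proof.
  intros hz. assert (hpi := PI_RGT_0).
  set (c := (RtoC (2 * PI) * Ci * z)%C).
  set (n := fun m => RtoC (INR (2 ^ S m))).
  assert (hn : forall m, n m <> RtoC 0).
  { intros m h. apply RtoC_inj in h. generalize (pow2_S_pos (S m)); lra. }
  assert (hw : forall m, (RtoC (2 * PI) * Ci * (z / n m))%C = (c / n m)%C) by (intros m; unfold c; field; auto).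
  assert (hcw : forall m, Cmod (c / n m) = Cmod c * / INR (2 ^ S m)).
  { intros m. unfold Cdiv, n. rewrite Cmod_mult, Cmod_inv, Cmod_R, Rabs_pos_eq; auto.
    left; apply pow2_S_pos. apply hn. }
  assert (hc0 := Cmod_ge_0 c).
  assert (hle : forall m, Cmod (c / n m) <= Cmod c).
  { intros m. rewrite hcw. rewrite <- (Rmult_1_r (Cmod c)) at 2. apply Rmult_le_compat_l; auto.
    rewrite <- Rinv_1. apply Rinv_le_contravar; [lra|]. apply (le_INR 1).
    apply Nat.neq_0_lt_0, Nat.pow_nonzero; lia. }
  assert (hq : Clim (fun m => nome (z / n m)) (RtoC 1)).
  { apply Clim_of_diff.
    apply Clim_squeeze0 with (fun m => (Cmod c * exp (Cmod c)) * / INR (2 ^ S m)); [|apply pow2_INR_lim].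
    intros m. unfold nome. rewrite hw. eapply Rle_trans; [apply Cexp_bound1|].
    rewrite hcw at 1. specialize (hle m). apply exp_le in hle.
    assert (0 < / INR (2 ^ S m)) by apply Rinv_0_lt_compat, pow2_S_pos.
    assert (0 <= Cmod c * / INR (2 ^ S m)) by nra. nra. }
  assert (hq2 : Clim (fun m => (nome (z / n m) - 1) * n m)%C c).
  { apply Clim_of_diff.
    apply Clim_ext with (fun m => (n m * (nome (z / n m) - 1 - c / n m)))%C; [intros m; field; auto|].
    apply Clim_squeeze0 with (fun m => (Cmod c ^ 2 * exp (Cmod c)) * / INR (2 ^ S m)); [|apply pow2_INR_lim].
    intros m. rewrite Cmod_mult. unfold nome. rewrite hw.
    assert (hb := Cexp_bound2 (c / n m)). specialize (hle m). apply exp_le in hle.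
    unfold n at 1. rewrite Cmod_R, Rabs_pos_eq by (left; apply pow2_S_pos).
    rewrite hcw in hb at 1. set (N := INR (2 ^ S m)) in *. assert (hN : 0 < N) by apply pow2_S_pos.
    apply Rle_trans with (N * ((Cmod c * / N) ^ 2 * exp (Cmod c))).
    - apply Rmult_le_compat_l; [lra|]. eapply Rle_trans; [exact hb|]. apply Rmult_le_compat_l; auto. apply pow2_ge_0.
    - right. field. lra. }
  assert (hc : c <> RtoC 0).
  { unfold c. repeat apply Cmult_neq_0; auto. intros h; apply RtoC_inj in h; lra. apply Ci_neq0. }
  apply Clim_ext with (fun m => (RtoC PI * Ci) * ((nome (z / n m) + 1) * / ((nome (z / n m) - 1) * n m)))%C.
  - intros m. unfold pi_cot. fold (n m). unfold Cdiv. rewrite Cinv_mult. ring.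
  - replace (/ z)%C with ((RtoC PI * Ci) * ((1 + 1) * / c))%C.
    + apply Clim_scal. apply Clim_mult; [apply Clim_plus; auto; apply Clim_const|]. apply Clim_inv; auto.
    + unfold c. rewrite RtoC_mult, RtoC_2_eq. field. repeat split; auto.
      * apply Ci_neq0.
      * intros h; apply RtoC_inj in h; lra.
Qed.

Lemma nome_minus_1_ge (z : C) (n j : R) : 1 <= n -> 0 < j -> j <= Rabs (Re z) -> Rabs (Re z) <= n / 2 ->
  2 * PI / 3 * exp (- (PI * Rabs (Im z))) * j / n <= Cmod (nome (z / RtoC n) - 1).
Proof.
  intros hn hj h1 h2. assert (hpi := PI_RGT_0).
  unfold nome. eapply Rle_trans; [|apply Cmod_Cexp_minus_1_ge].
  assert (hn0 : RtoC n <> RtoC 0) by (intros h; apply RtoC_inj in h; lra).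
  replace (z / RtoC n)%C with (RtoC (/ n) * z)%C by (rewrite RtoC_inv by lra; field; auto).
  rewrite nome_re, nome_im.
  replace (Im (RtoC (/ n) * z)) with (/ n * Im z) by (unfold Im; simpl; ring).
  replace (Re (RtoC (/ n) * z)) with (/ n * Re z) by (unfold Re; simpl; ring).
  assert (hn1 : 0 < / n <= 1) by (split; [apply Rinv_0_lt_compat; lra|rewrite <- Rinv_1; apply Rinv_le_contravar; lra]).
  assert (e1 : exp (- (PI * Rabs (Im z))) <= exp (- (2 * PI * (/ n * Im z)) / 2)).
  { apply exp_le. assert (hi := Rle_abs (Im z)). assert (hi2 := Rabs_pos (Im z)).
    assert (/ n * Im z <= Rabs (Im z)) by nra. nra. }
  assert (e2 : PI * j / n / 3 <= Rabs (sin (2 * PI * (/ n * Re z) / 2))).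
  { replace (2 * PI * (/ n * Re z) / 2) with (PI / n * Re z) by (field; lra).
    assert (hp : 0 < PI / n) by (apply Rdiv_lt_0_compat; lra).
    assert (hs : Rabs (sin (PI / n * Re z)) = Rabs (sin (PI / n * Rabs (Re z)))).
    { unfold Rabs at 3. destruct (Rcase_abs (Re z)); auto.
      replace (PI / n * - Re z) with (- (PI / n * Re z)) by ring. rewrite sin_neg, Rabs_Ropp. auto. }
    rewrite hs. eapply Rle_trans; [|apply Rle_abs].
    assert (hb : PI / n * Rabs (Re z) <= PI / 2).
    { replace (PI / 2) with (PI / n * (n / 2)) by (field; lra). apply Rmult_le_compat_l; lra. }
    eapply Rle_trans; [|apply sin_ge_third; split; [|exact hb]].
    - replace (PI * j / n / 3) with (PI / n * j / 3) by (field; lra).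
      apply Rmult_le_compat_r; [lra|]. apply Rmult_le_compat_l; lra.
    - apply Rmult_le_pos; [lra|apply Rabs_pos]. }
  replace (2 * PI / 3 * exp (- (PI * Rabs (Im z))) * j / n) with
    (2 * exp (- (PI * Rabs (Im z))) * (PI * j / n / 3)) by (field; lra).
  apply Rmult_le_compat.
  - generalize (exp_pos (- (PI * Rabs (Im z)))); lra.
  - apply Rmult_le_pos; [|lra]. apply Rmult_le_pos; [nra|lra].
  - lra.
  - exact e2.
Qed.

(* Iterating the duplication [cot w = (cot (w / 2) + cot ((w + PI) / 2)) / 2] writes the
   cotangent as a finite sum, to which Tannery's theorem applies. *)
Theorem pi_cot_series (z : C) : nonint z -> 0 <= Re z <= 1 ->
  Clim (csum (fun j => / (z + RtoC (INR j)) + / (z - 1 - RtoC (INR j))))%C (pi_cot z).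
Proof.
  intros hz hre. assert (hpi := PI_RGT_0).
  assert (nz1 : forall j, (z + RtoC (INR j))%C <> RtoC 0).
  { intros j h. apply (hz (- Z.of_nat j)%Z). rewrite opp_IZR, <- INR_IZR_INZ, RtoC_opp.
    replace z with ((z + RtoC (INR j)) - RtoC (INR j))%C by ring. rewrite h. ring. }
  assert (nz2 : forall j, (z - 1 - RtoC (INR j))%C <> RtoC 0).
  { intros j h. apply (hz (Z.of_nat j + 1)%Z). rewrite plus_IZR, <- INR_IZR_INZ, RtoC_plus.
    replace z with ((z - 1 - RtoC (INR j)) + RtoC (INR j) + 1)%C by ring. rewrite h. ring. }
  set (D := Cmod (2 * z - 1)). assert (hD : 0 <= D) by apply Cmod_ge_0.
  set (E := exp (- (PI * Rabs (Im z)))). assert (hE : 0 < E) by apply exp_pos.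
  set (K1 := 2 * PI * (2 * PI * D * exp (2 * PI * D)) / (2 * PI / 3 * E) ^ 2).
  assert (hX : 0 < 2 * PI / 3 * E) by (apply Rmult_lt_0_compat; lra).
  assert (hK1 : 0 <= K1).
  { apply Rdiv_le_0_compat; [|apply pow_lt; auto].
    generalize (exp_pos (2 * PI * D)); intros he.
    assert (h1 : 0 <= 2 * PI * D) by (apply Rmult_le_pos; lra).
    assert (h2 : 0 <= 2 * PI * D * exp (2 * PI * D)) by (apply Rmult_le_pos; lra).
    apply Rmult_le_pos; lra. }
  apply (tannery (fun m j => / RtoC (INR (2 ^ S m)) * (pi_cot ((z + RtoC (INR j)) / RtoC (INR (2 ^ S m)))
               + pi_cot ((z - 1 - RtoC (INR j)) / RtoC (INR (2 ^ S m)))))%C _ (K1 + D) (fun m => 2 ^ m)%nat).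
  - intros J. exists J. intros m hm. apply Nat.le_trans with m; auto. apply Nat.lt_le_incl, Nat.pow_gt_lin_r. lia.
  - intros m j hj. set (n := INR (2 ^ S m)).
    assert (hn : 0 < n) by apply pow2_S_pos.
    assert (hn1 : 1 <= n) by (apply (le_INR 1); apply Nat.neq_0_lt_0, Nat.pow_nonzero; lia).
    assert (hn0 : RtoC n <> RtoC 0) by (intros h; apply RtoC_inj in h; lra).
    assert (hj1 : 1 <= INR j) by (apply (le_INR 1); lia).
    assert (hj2 : INR j + 1 <= n / 2).
    { unfold n. simpl (2 ^ S m)%nat. rewrite !plus_INR. simpl (INR 0).
      assert (k : INR (j + 1) <= INR (2 ^ m)) by (apply le_INR; lia). rewrite plus_INR in k. simpl (INR 1) in k. lra. }
    set (A := ((z + RtoC (INR j)) / RtoC n)%C). set (B := ((z - 1 - RtoC (INR j)) / RtoC n)%C).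
    assert (bA : 2 * PI / 3 * E * INR j / n <= Cmod (nome A - 1)).
    { unfold A. replace E with (exp (- (PI * Rabs (Im (z + RtoC (INR j)))))).
      apply nome_minus_1_ge; auto; try lra.
      - unfold Re; simpl. fold (Re z). rewrite Rabs_pos_eq; lra.
      - unfold Re; simpl. fold (Re z). rewrite Rabs_pos_eq; lra.
      - unfold E. do 4 f_equal. unfold Im; simpl; ring. }
    assert (bB : 2 * PI / 3 * E * INR j / n <= Cmod (nome B - 1)).
    { unfold B. replace E with (exp (- (PI * Rabs (Im (z - 1 - RtoC (INR j)))))).
      apply nome_minus_1_ge; auto; try lra.
      - unfold Re; simpl. fold (Re z). rewrite Rabs_left; lra.
      - unfold Re; simpl. fold (Re z). rewrite Rabs_left; lra.
      - unfold E. do 4 f_equal. unfold Im; simpl; ring. }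
    assert (hpos : 0 < 2 * PI / 3 * E * INR j / n).
    { apply Rdiv_lt_0_compat; auto. apply Rmult_lt_0_compat; lra. }
    assert (qA : (nome A - 1)%C <> RtoC 0) by (intros h; rewrite h, Cmod_0 in bA; lra).
    assert (qB : (nome B - 1)%C <> RtoC 0) by (intros h; rewrite h, Cmod_0 in bB; lra).
    assert (e : (pi_cot A + pi_cot B)%C = (RtoC PI * Ci * (2 * (nome (A + B) - 1)) * / ((nome A - 1) * (nome B - 1)))%C).
    { unfold pi_cot. rewrite nome_plus, RtoC_2_eq. field. split; auto. }
    rewrite e, !Cmod_mult, !Cmod_inv, !Cmod_mult, Cmod_Ci, !Cmod_R by (auto; apply Cmult_neq_0; auto).
    rewrite (Rabs_pos_eq n), (Rabs_pos_eq PI), (Rabs_pos_eq 2) by lra.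
    assert (bN : Cmod (nome (A + B) - 1) <= 2 * PI * D / n * exp (2 * PI * D)).
    { unfold nome. eapply Rle_trans; [apply Cexp_bound1|]. rewrite Cmod_2PI_Ci.
      replace (A + B)%C with ((2 * z - 1) / RtoC n)%C by (unfold A, B; rewrite RtoC_2_eq; field; auto).
      unfold Cdiv. rewrite Cmod_mult, Cmod_inv, Cmod_R, Rabs_pos_eq by (auto; lra). fold D.
      assert (hn2 : 0 < / n <= 1) by (split; [apply Rinv_0_lt_compat; lra|rewrite <- Rinv_1; apply Rinv_le_contravar; lra]).
      apply Rmult_le_compat.
      - apply Rmult_le_pos; [lra|]. apply Rmult_le_pos; lra.
      - left; apply exp_pos.
      - right. field; lra.
      - apply exp_le. assert (D * / n <= D) by nra. nra. }
    set (a := Cmod (nome A - 1)) in *. set (b := Cmod (nome B - 1)) in *.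
    set (x := 2 * PI / 3 * E * INR j / n) in *.
    assert (hab : / (a * b) <= / (x * x)) by (apply Rinv_le_contravar; [nra|apply Rmult_le_compat; lra]).
    assert (hab0 : 0 < / (a * b)) by (apply Rinv_0_lt_compat; nra).
    apply Rle_trans with (K1 * / INR j ^ 2).
    + apply Rle_trans with (/ n * (PI * 1 * (2 * (2 * PI * D / n * exp (2 * PI * D))) * / (x * x))).
      * apply Rmult_le_compat_l; [left; apply Rinv_0_lt_compat; auto|].
        apply Rmult_le_compat; try lra.
        -- assert (0 <= Cmod (nome (A + B) - 1)) by apply Cmod_ge_0. nra.
        -- apply Rmult_le_compat_l; lra.
      * right. unfold x, K1. field. repeat split; lra.
    + apply Rmult_le_compat_r; [|lra]. left; apply Rinv_0_lt_compat, pow_lt; lra.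
  - intros j hj. assert (hj1 : 1 <= INR j) by (apply (le_INR 1); lia).
    replace (/ (z + RtoC (INR j)) + / (z - 1 - RtoC (INR j)))%C with
      ((2 * z - 1) * / ((z + RtoC (INR j)) * (z - 1 - RtoC (INR j))))%C.
    2: { rewrite RtoC_2_eq. field. split; auto. }
    rewrite Cmod_mult, Cmod_inv, Cmod_mult by (apply Cmult_neq_0; auto). fold D.
    assert (b1 : INR j <= Cmod (z + RtoC (INR j))).
    { eapply Rle_trans; [|apply re_le_Cmod]. unfold Re; simpl. fold (Re z). rewrite Rabs_pos_eq; lra. }
    assert (b2 : INR j <= Cmod (z - 1 - RtoC (INR j))).
    { eapply Rle_trans; [|apply re_le_Cmod]. unfold Re; simpl. fold (Re z). rewrite Rabs_left; lra. }
    apply Rmult_le_compat; auto; try lra.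
    + left; apply Rinv_0_lt_compat. nra.
    + apply Rinv_le_contravar; nra.
  - intros j. apply Clim_ext with (fun m => / RtoC (INR (2 ^ S m)) * pi_cot ((z + RtoC (INR j)) / RtoC (INR (2 ^ S m)))
               + / RtoC (INR (2 ^ S m)) * pi_cot ((z - 1 - RtoC (INR j)) / RtoC (INR (2 ^ S m))))%C.
    + intros m. ring.
    + apply Clim_plus; apply pi_cot_small; auto.
  - intros m. rewrite csum_scal, pi_cot_folded by auto. field.
    intros h; apply RtoC_inj in h. generalize (pow2_S_pos (S m)); lra.
Qed.

(** * One-dimensional lattice sums *)

Definition rho (t : R) : R := exp (- (2 * PI * t)).

(* [den l t = |1 - exp (2 PI i l - 2 PI t)|^2]. *)
Definition den (l t : R) : R := 1 - 2 * rho t * cos (2 * PI * l) + rho t ^ 2.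

Definition psi (l t : R) : R := (1 - rho t ^ 2) / den l t.

(* Closed form of the sum over [k : Z] of [1 / ((k + l)^2 + t^2)]. *)
Definition phi (l t : R) : R := PI / t * psi l t.

Definition dpsi (l t : R) : R :=
  (4 * PI * rho t ^ 2 * den l t
   - (1 - rho t ^ 2) * (4 * PI * rho t * cos (2 * PI * l) - 4 * PI * rho t ^ 2)) / den l t ^ 2.

(* [X = - phi' / (2 t)], the closed form of the sum over [k : Z] of
   [1 / ((k + l)^2 + t^2)^2]. *)
Definition X (l t : R) : R := PI / (2 * t ^ 3) * psi l t - PI / (2 * t ^ 2) * dpsi l t.

(* Sums over [k : Z] of a function of [(k + l)^2] are folded into sums over
   [j : nat], the indices [k = j] and [k = - j - 1] being grouped. *)
Definition fold (l : R) (f : R -> R) (j : nat) : R :=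
  f ((INR j + l) ^ 2) + f ((INR j + 1 - l) ^ 2).

Definition phi_sum (l T : R) : nat -> R := rsum (fold l (fun a => / (a + T))).

Definition X_sum (l T : R) : nat -> R := rsum (fold l (fun a => / (a + T) ^ 2)).

Lemma rho_pos t : 0 < rho t.
Proof. apply exp_pos. Qed.

Lemma rho_lt_1 t : 0 < t -> rho t < 1.
Proof.
  intros ht. unfold rho. rewrite <- exp_0. apply exp_increasing.
  assert (hpi := PI_RGT_0). assert (0 < PI * t) by (apply Rmult_lt_0_compat; auto). lra.
Qed.

Lemma den_pos l t : 0 < t -> 0 < den l t.
Proof.
  intros ht. unfold den. assert (h1 := rho_pos t). assert (h2 := rho_lt_1 t ht).
  assert (h3 := COS_bound (2 * PI * l)). set (c := cos (2 * PI * l)) in *. set (r := rho t) in *.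
  assert (0 < (1 - r) * (1 - r)) by nra. assert (0 <= r * (1 - c)) by nra. nra.
Qed.

Lemma phi_series l t : 0 <= l <= 1 -> 0 < t -> is_lim_seq (phi_sum l (t ^ 2)) (phi l t).
Proof.
  intros hl ht. set (z := (l, t) : C).
  assert (hz : nonint z). { intros k h. apply (f_equal Im) in h. unfold Im in h; simpl in h. lra. }
  assert (h := Clim_Im _ _ (pi_cot_series z hz hl)).
  assert (hpos : forall a, 0 < a * a + t * t) by (intros a; nra).
  assert (e : forall n, Im (csum (fun j => / (z + RtoC (INR j)) + / (z - 1 - RtoC (INR j)))%C n)
     = - t * phi_sum l (t ^ 2) n).
  { intros n. unfold phi_sum. rewrite <- rsum_scal. induction n as [|n IH]; [reflexivity|].
    rewrite csum_S, rsum_S, <- IH.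
    match goal with |- Im (?a + ?b) = _ => change (Im (a + b)) with (Im a + Im b) end.
    f_equal. unfold fold, z, Im; simpl.
    assert (k1 := hpos (l + INR n)). assert (k2 := hpos (l - 1 - INR n)).
    field. repeat split; try nra. }
  assert (e2 : Im (pi_cot z) = - t * phi l t).
  { assert (hn : nome z = (rho t * cos (2 * PI * l), rho t * sin (2 * PI * l))).
    { unfold nome, Cexp. rewrite nome_re, nome_im. reflexivity. }
    unfold phi, psi. assert (hd := den_pos l t ht). unfold den in *.
    unfold pi_cot. rewrite hn. set (c := cos (2 * PI * l)) in *. set (s := sin (2 * PI * l)) in *.
    assert (hcs : s * s + c * c = 1) by (apply (sin2_cos2 (2 * PI * l))).
    set (r := rho t) in *.
    assert (hD : (r * c - 1) ^ 2 + (r * s) ^ 2 = 1 - 2 * r * c + r ^ 2).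
    { replace ((r * c - 1) ^ 2 + (r * s) ^ 2) with (r ^ 2 * (s * s + c * c) - 2 * r * c + 1) by ring.
      rewrite hcs. ring. }
    replace (- t * (PI / t * ((1 - r ^ 2) / (1 - 2 * r * c + r ^ 2)))) with
      (- PI * ((1 - r ^ 2 * (s * s + c * c)) / ((r * c - 1) ^ 2 + (r * s) ^ 2))).
    2: { rewrite hD, hcs. field. split; lra. }
    unfold Im; simpl. field. rewrite <- hD in hd. repeat split; nra. }
  rewrite e2 in h.
  apply is_lim_seq_ext with (fun n => / - t * (- t * phi_sum l (t ^ 2) n)).
  { intros n. field. lra. }
  replace (phi l t) with (/ - t * (- t * phi l t)) by (field; lra).
  apply (is_lim_seq_scal_l _ (/ - t) (Finite (- t * phi l t))).
  eapply is_lim_seq_ext; [|exact h]. intros n. simpl. apply e.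
Qed.

Lemma fold_pos l f j : (forall a, 0 <= a -> 0 <= f a) -> 0 <= fold l f j.
Proof. intros h. unfold fold. apply Rplus_le_le_0_compat; apply h, pow2_ge_0. Qed.

Lemma fold_le l f g j : (forall a, 0 <= a -> f a <= g a) -> fold l f j <= fold l g j.
Proof. intros h. unfold fold. apply Rplus_le_compat; apply h, pow2_ge_0. Qed.

Lemma is_lim_seq_incr_le (u : nat -> R) (l : R) (n : nat) :
  (forall n, u n <= u (S n)) -> is_lim_seq u l -> u n <= l.
Proof. intros h1 h2. apply (is_lim_seq_incr_compare u l h2 h1). Qed.

Lemma rsum_incr f : (forall n, 0 <= f n) -> forall n, rsum f n <= rsum f (S n).
Proof. intros h n. simpl. specialize (h n). lra. Qed.

Lemma inv_nonneg a T : 0 <= a -> 0 < T -> 0 <= / (a + T).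
Proof. intros. left. apply Rinv_0_lt_compat. lra. Qed.

Lemma inv2_nonneg a T : 0 <= a -> 0 <= T -> 0 <= / (a + T) ^ 2.
Proof. intros ha hT. destruct (Req_dec (a + T) 0) as [e|e].
  - rewrite e. replace (0 ^ 2) with 0 by ring. rewrite Rinv_0. lra.
  - left. apply Rinv_0_lt_compat, pow_lt. lra. Qed.

Lemma X_sum_le_phi l t n : 0 < t -> X_sum l (t ^ 2) n <= / t ^ 2 * phi_sum l (t ^ 2) n.
Proof.
  intros ht. unfold X_sum, phi_sum. rewrite <- rsum_scal. apply rsum_le. intros k _.
  unfold fold. rewrite Rmult_plus_distr_l.
  assert (h : forall a, 0 <= a -> / (a + t ^ 2) ^ 2 <= / t ^ 2 * / (a + t ^ 2)).
  { intros a ha. assert (0 < t ^ 2) by nra. rewrite <- Rinv_mult. apply Rinv_le_contravar; nra. }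
  apply Rplus_le_compat; apply h, pow2_ge_0.
Qed.

Lemma rational_second_order a t h : 0 <= a -> 0 < t -> Rabs h <= t / 2 ->
  Rabs (/ (a + (t + h) ^ 2) - / (a + t ^ 2) + 2 * t * h * / (a + t ^ 2) ^ 2) <= 20 * h ^ 2 * / (a + t ^ 2) ^ 2.
Proof.
  intros ha ht hh. apply Rabs_le_between in hh.
  set (A := a + t ^ 2). set (B := a + (t + h) ^ 2).
  assert (hA : t ^ 2 <= A) by (unfold A; lra). assert (ht2 : 0 < t ^ 2) by nra.
  assert (hB : A / 4 <= B) by (unfold A, B; nra).
  replace (/ B - / A + 2 * t * h * / A ^ 2) with (h ^ 2 * (2 * t * (2 * t + h) - A) * (/ B * / A ^ 2)).
  2: { unfold A, B in *. field. split; lra. }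
  assert (hiB : 0 < / B <= 4 / A).
  { split; [apply Rinv_0_lt_compat; lra|]. replace (4 / A) with (/ (A / 4)) by (field; lra).
    apply Rinv_le_contravar; lra. }
  assert (hiA : 0 < / A ^ 2) by (apply Rinv_0_lt_compat; nra).
  rewrite !Rabs_mult, (Rabs_pos_eq (h ^ 2)), (Rabs_pos_eq (/ B)), (Rabs_pos_eq (/ A ^ 2)) by (try lra; apply pow2_ge_0).
  assert (hn : Rabs (2 * t * (2 * t + h) - A) <= 5 * A) by (apply Rabs_le; nra).
  rewrite <- Rmult_assoc. apply Rmult_le_compat_r; [lra|].
  rewrite Rmult_assoc. replace (20 * h ^ 2) with (h ^ 2 * 20) by ring.
  apply Rmult_le_compat_l; [apply pow2_ge_0|].
  apply Rle_trans with (5 * A * (4 / A)).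
  - apply Rmult_le_compat; try lra. apply Rabs_pos.
  - right. field. lra.
Qed.

Lemma phi_sum_second_order l t h n : 0 < t -> Rabs h <= t / 2 ->
  Rabs (phi_sum l ((t + h) ^ 2) n - phi_sum l (t ^ 2) n + 2 * t * h * X_sum l (t ^ 2) n)
   <= 20 * h ^ 2 * X_sum l (t ^ 2) n.
Proof.
  intros ht hh. unfold phi_sum, X_sum. induction n as [|n IH]; [simpl rsum|rewrite !rsum_S].
  - rewrite !Rmult_0_r, Rminus_0_r, Rplus_0_r, Rabs_R0; lra.
  - unfold fold in *.
    assert (k1 := rational_second_order ((INR n + l) ^ 2) t h (pow2_ge_0 _) ht hh).
    assert (k2 := rational_second_order ((INR n + 1 - l) ^ 2) t h (pow2_ge_0 _) ht hh).
    match goal with |- Rabs ?x <= _ => match type of IH with Rabs ?y <= _ =>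
     match type of k1 with Rabs ?z <= _ => match type of k2 with Rabs ?w <= _ =>
      replace x with (y + (z + w)) by ring;
      generalize (Rabs_triang y (z + w)) (Rabs_triang z w) end end end end.
    lra.
Qed.

Lemma is_derive_den l t : is_derive (den l) t (4 * PI * rho t * cos (2 * PI * l) - 4 * PI * rho t ^ 2).
Proof.
  unfold den, rho. auto_derive; auto. ring.
Qed.

Lemma is_derive_psi l t : 0 < t -> is_derive (psi l) t (dpsi l t).
Proof.
  intros ht. assert (hd := den_pos l t ht).
  assert (hN : is_derive (fun t => 1 - rho t ^ 2) t (4 * PI * rho t ^ 2)).
  { unfold rho. auto_derive; auto. ring. }
  apply (is_derive_div (fun t => 1 - rho t ^ 2) (den l)); [exact hN|apply is_derive_den|lra].
Qed.

Lemma is_derive_phi l t : 0 < t -> is_derive (phi l) t (- (2 * t) * X l t).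
Proof.
  intros ht.
  assert (hN : is_derive (fun t => PI / t) t (- PI / t ^ 2)) by (auto_derive; [lra|field; lra]).
  evar_last.
  - apply (is_derive_mult (fun t => PI / t) (psi l)); [exact hN|apply is_derive_psi; auto|intros; apply Rmult_comm].
  - unfold X, mult, plus; simpl. unfold mult; simpl. field. lra.
Qed.

Lemma X_series l t : 0 <= l <= 1 -> 0 < t -> is_lim_seq (X_sum l (t ^ 2)) (X l t).
Proof.
  intros hl ht. assert (ht2 : 0 < t ^ 2) by nra.
  assert (hinc : forall n, X_sum l (t ^ 2) n <= X_sum l (t ^ 2) (S n)).
  { apply rsum_incr. intros n. apply fold_pos. intros a ha. apply inv2_nonneg; lra. }
  assert (hphi : forall n, phi_sum l (t ^ 2) n <= phi l t).
  { intros n. apply is_lim_seq_incr_le; [|apply phi_series; auto].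
    apply rsum_incr. intros k. apply fold_pos. intros a ha. apply inv_nonneg; auto. }
  assert (hbd : forall n, X_sum l (t ^ 2) n <= / t ^ 2 * phi l t).
  { intros n. eapply Rle_trans; [apply X_sum_le_phi; auto|]. apply Rmult_le_compat_l; auto.
    left; apply Rinv_0_lt_compat; auto. }
  destruct (ex_finite_lim_seq_incr _ _ hinc hbd) as [x hx].
  enough (x = X l t) by (subst; auto).
  assert (hd : is_derive (phi l) t (- (2 * t) * x)).
  { apply is_derive_eps. intros eps he.
    set (K := 20 * (Rabs x + 1)). assert (hK : 0 < K) by (unfold K; generalize (Rabs_pos x); lra).
    exists (Rmin (t / 2) (eps / K)). split; [apply Rmin_pos; [lra|apply Rdiv_lt_0_compat; auto]|].
    intros y hy. apply Rmin_Rgt_l in hy as [y1 y2].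
    set (h := y - t) in *. replace y with (t + h) by (unfold h; ring).
    assert (hth : 0 < t + h). { apply Rabs_lt_between in y1. lra. }
    assert (k : Rabs (phi l (t + h) - phi l t + 2 * t * h * x) <= 20 * h ^ 2 * x).
    { apply (is_lim_seq_le (fun n => Rabs (phi_sum l ((t + h) ^ 2) n - phi_sum l (t ^ 2) n + 2 * t * h * X_sum l (t ^ 2) n))
        (fun n => 20 * h ^ 2 * X_sum l (t ^ 2) n)
        (Finite (Rabs (phi l (t + h) - phi l t + 2 * t * h * x))) (Finite (20 * h ^ 2 * x))).
      - intros n. apply phi_sum_second_order; auto. lra.
      - apply (is_lim_seq_abs _ (Finite (phi l (t + h) - phi l t + 2 * t * h * x))). apply is_lim_seq_plus'.
        + apply is_lim_seq_minus'; apply phi_series; auto.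
        + apply (is_lim_seq_scal_l _ (2 * t * h) (Finite x)), hx.
      - apply (is_lim_seq_scal_l _ (20 * h ^ 2) (Finite x)), hx. }
    replace (phi l (t + h) - phi l t - - (2 * t) * x * h) with (phi l (t + h) - phi l t + 2 * t * h * x) by ring.
    eapply Rle_trans; [exact k|].
    assert (hx' := Rle_abs x).
    replace (h ^ 2) with (Rabs h * Rabs h) by (rewrite <- Rabs_mult, Rabs_pos_eq; [ring|nra]).
    assert (hh := Rabs_pos h).
    apply Rle_trans with (K * Rabs h * Rabs h).
    - unfold K. assert (0 <= Rabs h * Rabs h) by nra. nra.
    - apply Rmult_le_compat_r; auto. rewrite Rmult_comm. apply Rle_div_r; [exact hK|]. lra. }
  assert (h1 := is_derive_unique _ _ _ hd). assert (h2 := is_derive_unique _ _ _ (is_derive_phi l t ht)).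
  rewrite h1 in h2. apply Rmult_eq_reg_l with (- (2 * t)); lra.
Qed.

Lemma rho_le_half t : 1 <= t -> rho t <= / 2.
Proof.
  intros ht. unfold rho. rewrite exp_Ropp. apply Rinv_le_contravar; [lra|].
  assert (h := PI2_3_2). generalize (exp_ineq1_le (2 * PI * t)). nra.
Qed.

Lemma psi_near_1 l t : 1 <= t -> Rabs (psi l t - 1) <= 16 * rho t.
Proof.
  intros ht. assert (h1 := rho_pos t). assert (h2 := rho_le_half t ht).
  assert (h3 := COS_bound (2 * PI * l)). assert (hd : / 4 <= den l t) by (unfold den; nra).
  replace (psi l t - 1) with ((2 * rho t * cos (2 * PI * l) - 2 * rho t ^ 2) / den l t).
  2: { unfold psi. unfold den in *. field. lra. }
  unfold Rdiv. rewrite Rabs_mult, (Rabs_pos_eq (/ den l t)) by (left; apply Rinv_0_lt_compat; lra).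
  assert (hi : / den l t <= 4). { replace 4 with (/ / 4) by field. apply Rinv_le_contravar; lra. }
  replace (16 * rho t) with (4 * rho t * 4) by ring. apply Rmult_le_compat; auto.
  - apply Rabs_pos.
  - left; apply Rinv_0_lt_compat; lra.
  - apply Rabs_le. nra.
Qed.

Lemma dpsi_small l t : 1 <= t -> Rabs (dpsi l t) <= 640 * PI * rho t.
Proof.
  intros ht. assert (h1 := rho_pos t). assert (h2 := rho_le_half t ht). assert (hpi := PI_RGT_0).
  assert (h3 := COS_bound (2 * PI * l)). assert (hd : / 4 <= den l t <= 4) by (unfold den; nra).
  unfold dpsi. set (r := rho t) in *. set (c := cos (2 * PI * l)) in *. set (D := den l t) in *.
  replace (4 * PI * r ^ 2 * D - (1 - r ^ 2) * (4 * PI * r * c - 4 * PI * r ^ 2))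
    with (4 * PI * r * (r * D - (1 - r ^ 2) * (c - r))) by ring.
  unfold Rdiv. rewrite !Rabs_mult, (Rabs_pos_eq 4), (Rabs_pos_eq PI), (Rabs_pos_eq r) by lra.
  rewrite (Rabs_pos_eq (/ D ^ 2)) by (left; apply Rinv_0_lt_compat; nra).
  assert (hi : / D ^ 2 <= 16). { replace 16 with (/ / 16) by field. apply Rinv_le_contravar; nra. }
  assert (hi0 : 0 < / D ^ 2) by (apply Rinv_0_lt_compat; nra).
  assert (hb : Rabs (r * D - (1 - r ^ 2) * (c - r)) <= 10) by (apply Rabs_le; nra).
  assert (hb0 := Rabs_pos (r * D - (1 - r ^ 2) * (c - r))).
  replace (640 * PI * r) with (4 * PI * r * 10 * 16) by ring.
  apply Rmult_le_compat; try lra.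
  - apply Rmult_le_pos; auto. nra.
  - apply Rmult_le_compat_l; auto. nra.
Qed.

Definition X_error_const : R := PI / 2 * (16 + 640 * PI).

Lemma X_error_const_pos : 0 < X_error_const.
Proof. unfold X_error_const. assert (h := PI_RGT_0). nra. Qed.

Lemma X_asymptotic l t : 1 <= t -> Rabs (X l t - PI / (2 * t ^ 3)) <= X_error_const * rho t.
Proof.
  intros ht. assert (k1 := psi_near_1 l t ht). assert (k2 := dpsi_small l t ht).
  assert (hpi := PI_RGT_0). assert (h1 := rho_pos t).
  unfold X. replace (PI / (2 * t ^ 3) * psi l t - PI / (2 * t ^ 2) * dpsi l t - PI / (2 * t ^ 3))
    with (PI / 2 * (/ t ^ 3 * (psi l t - 1)) + - (PI / 2 * (/ t ^ 2 * dpsi l t))) by (field; lra).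
  eapply Rle_trans; [apply Rabs_triang|]. rewrite Rabs_Ropp, !Rabs_mult.
  assert (t3 : 0 < / t ^ 3 <= 1).
  { split; [apply Rinv_0_lt_compat, pow_lt; lra|]. rewrite <- Rinv_1. apply Rinv_le_contravar; [lra|].
    apply pow_R1_Rle; auto. }
  assert (t2 : 0 < / t ^ 2 <= 1).
  { split; [apply Rinv_0_lt_compat, pow_lt; lra|]. rewrite <- Rinv_1. apply Rinv_le_contravar; [lra|].
    apply pow_R1_Rle; auto. }
  rewrite (Rabs_pos_eq (PI / 2)), (Rabs_pos_eq (/ t ^ 3)), (Rabs_pos_eq (/ t ^ 2)) by lra.
  unfold X_error_const. rewrite Rmult_assoc, <- Rmult_plus_distr_l. apply Rmult_le_compat_l; [lra|].
  assert (q1 := Rabs_pos (psi l t - 1)). assert (q2 := Rabs_pos (dpsi l t)).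
  assert (/ t ^ 3 * Rabs (psi l t - 1) <= Rabs (psi l t - 1)) by nra.
  assert (/ t ^ 2 * Rabs (dpsi l t) <= Rabs (dpsi l t)) by nra. lra.
Qed.

Lemma continuous_X l t : 0 < t -> continuous (X l) t.
Proof.
  intros ht. assert (hd := den_pos l t ht).
  assert (c1 : continuous (psi l) t) by (apply (ex_derive_continuous (psi l)); eexists; apply is_derive_psi; auto).
  assert (c2 : continuous (dpsi l) t).
  { apply (ex_derive_continuous (dpsi l)). unfold dpsi, den, rho. auto_derive. unfold den, rho in hd.
    apply Rgt_not_eq. assert (0 < (1 - 2 * exp (- (2 * PI * t)) * cos (2 * PI * l) + exp (- (2 * PI * t)) ^ 2) ^ 2) by (apply pow_lt; auto).
    simpl in *. lra. }
  apply (continuous_minus (fun t => PI / (2 * t ^ 3) * psi l t) (fun t => PI / (2 * t ^ 2) * dpsi l t)).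
  - apply (continuous_mult (fun t => PI / (2 * t ^ 3)) (psi l)); auto.
    apply (ex_derive_continuous (fun t => PI / (2 * t ^ 3))). auto_derive.
    assert (0 < t ^ 3) by (apply pow_lt; auto). simpl in *. lra.
  - apply (continuous_mult (fun t => PI / (2 * t ^ 2)) (dpsi l)); auto.
    apply (ex_derive_continuous (fun t => PI / (2 * t ^ 2))). auto_derive.
    assert (0 < t ^ 2) by (apply pow_lt; auto). simpl in *. lra.
Qed.

Lemma atan_le_id y : 0 <= y -> 0 <= atan y <= y.
Proof.
  intros hy. destruct (Req_dec y 0) as [->|h]; [rewrite atan_0; lra|].
  destruct (MVT_cor2 atan (fun x => / (1 + x ^ 2)) 0 y) as [c [hc1 hc2]]; [lra|intros; apply derivable_pt_lim_atan|].
  rewrite atan_0 in hc1. replace (c ^ 2) with (c * c) in hc1 by ring.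
  assert (0 < / (1 + c * c) <= 1).
  { split; [apply Rinv_0_lt_compat; nra|]. rewrite <- Rinv_1. apply Rinv_le_contravar; nra. }
  nra.
Qed.

Definition inv_sqr_int (V p : R) : R := V / (2 * p * (p + V ^ 2)) + atan (V / sqrt p) / (2 * p * sqrt p).

Lemma is_RInt_inv_sqr V p : 0 < p -> 0 <= V -> is_RInt (fun v => / (p + v ^ 2) ^ 2) 0 V (inv_sqr_int V p).
Proof.
  intros hp hV. assert (hs := sqrt_lt_R0 p hp). assert (hss := sqrt_sqrt p (Rlt_le _ _ hp)).
  evar_last.
  - apply (is_RInt_derive (V := R_CompleteNormedModule) (fun v => inv_sqr_int v p)).
    + intros x _. unfold inv_sqr_int. auto_derive.
      * assert (0 <= x ^ 2) by apply pow2_ge_0. repeat split; try lra.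
        apply Rgt_not_eq. apply Rmult_lt_0_compat; simpl in *; lra.
      * assert (0 <= x ^ 2) by apply pow2_ge_0.
        set (s := sqrt p) in *. rewrite <- hss. field. rewrite hss. repeat split; try lra; try nra.
    + intros x _. apply (ex_derive_continuous (fun v => / (p + v ^ 2) ^ 2)). auto_derive.
      assert (0 <= x ^ 2) by apply pow2_ge_0. simpl in *. apply Rgt_not_eq.
      repeat apply Rmult_lt_0_compat; lra.
  - unfold minus, plus, opp; simpl. unfold inv_sqr_int. replace (0 / sqrt p) with 0 by (field; lra). rewrite atan_0.
    simpl. field. simpl in *. repeat split; try lra. assert (0 <= V ^ 2) by apply pow2_ge_0. simpl in *. lra.
Qed.

Lemma inv_sqr_int_bound V p : 0 < p -> 0 < V ->
  PI / (4 * (p * sqrt p)) - / (p * V) <= inv_sqr_int V p <= PI / (4 * (p * sqrt p)) + / (p * V).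
Proof.
  intros hp hV. assert (hs := sqrt_lt_R0 p hp). assert (hss := sqrt_sqrt p (Rlt_le _ _ hp)).
  assert (h1 : 0 <= V / (2 * p * (p + V ^ 2)) <= / 2 * / (p * V)).
  { assert (0 < V ^ 2) by nra. split; [apply Rdiv_le_0_compat; nra|].
    replace (/ 2 * / (p * V)) with (V / (2 * p * (V ^ 2))) by (field; split; nra).
    unfold Rdiv. apply Rmult_le_compat_l; [lra|]. apply Rinv_le_contravar; nra. }
  assert (h2 : atan (V / sqrt p) = PI / 2 - atan (sqrt p / V)).
  { replace (V / sqrt p) with (/ (sqrt p / V)) by (field; lra). apply atan_inv. apply Rdiv_lt_0_compat; auto. }
  assert (h3 := atan_le_id (sqrt p / V) ltac:(left; apply Rdiv_lt_0_compat; auto)).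
  unfold inv_sqr_int. rewrite h2.
  replace ((PI / 2 - atan (sqrt p / V)) / (2 * p * sqrt p)) with
   (PI / (4 * (p * sqrt p)) - atan (sqrt p / V) * / (2 * p * sqrt p)) by (field; lra).
  assert (h4 : 0 < / (2 * p * sqrt p)) by (apply Rinv_0_lt_compat; repeat apply Rmult_lt_0_compat; lra).
  assert (h5 : atan (sqrt p / V) * / (2 * p * sqrt p) <= / 2 * / (p * V)).
  { apply Rle_trans with (sqrt p / V * / (2 * p * sqrt p)).
    - apply Rmult_le_compat_r; lra.
    - right. field. repeat split; lra. }
  assert (h6 : 0 <= atan (sqrt p / V) * / (2 * p * sqrt p)) by (apply Rmult_le_pos; lra).
  lra.
Qed.

Lemma fold_plus l f g j : fold l (fun a => f a + g a) j = fold l f j + fold l g j.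
Proof. unfold fold. ring. Qed.

Lemma fold_scal l c f j : fold l (fun a => c * f a) j = c * fold l f j.
Proof. unfold fold. ring. Qed.

Lemma X_tail_mono l t0 t n : 0 <= l <= 1 -> 0 < t0 -> t0 <= t ->
  0 <= X l t - X_sum l (t ^ 2) n <= X l t0 - X_sum l (t0 ^ 2) n.
Proof.
  intros hl ht0 ht. split.
  - assert (X_sum l (t ^ 2) n <= X l t); [|lra]. apply is_lim_seq_incr_le; [|apply X_series; auto; lra].
    apply rsum_incr. intros k. apply fold_pos. intros a ha. apply inv2_nonneg; auto. apply pow2_ge_0.
  - assert (h1 := X_series l t hl ltac:(lra)). assert (h2 := X_series l t0 hl ht0).
    apply (is_lim_seq_incr_n _ n) in h1. apply (is_lim_seq_incr_n _ n) in h2.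
    apply (is_lim_seq_le (fun k => X_sum l (t ^ 2) (k + n) - X_sum l (t ^ 2) n)
      (fun k => X_sum l (t0 ^ 2) (k + n) - X_sum l (t0 ^ 2) n)
      (Finite (X l t - X_sum l (t ^ 2) n)) (Finite (X l t0 - X_sum l (t0 ^ 2) n))).
    + intros k. unfold X_sum. rewrite (Nat.add_comm k n), !rsum_split.
      match goal with |- ?a + ?b - ?a <= ?c + ?d - ?c => enough (b <= d) by lra end.
      apply rsum_le. intros i _. apply fold_le. intros a ha.
      assert (0 < t0 ^ 2) by nra. apply Rinv_le_contravar; [apply pow_lt; lra|]. apply pow_incr. nra.
    + apply is_lim_seq_minus'; auto. apply is_lim_seq_const.
    + apply is_lim_seq_minus'; auto. apply is_lim_seq_const.
Qed.

Lemma sqrt_sum_sqr_bounds W v : 0 <= W -> 0 <= v ->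
  W <= sqrt (W ^ 2 + v ^ 2) /\ v <= sqrt (W ^ 2 + v ^ 2) /\ sqrt (W ^ 2 + v ^ 2) <= W + v.
Proof.
  intros hW hv. repeat split.
  - rewrite <- (sqrt_pow2 W) at 1 by auto. apply sqrt_le_1_alt. nra.
  - rewrite <- (sqrt_pow2 v) at 1 by auto. apply sqrt_le_1_alt. nra.
  - rewrite <- (sqrt_pow2 (W + v)) by lra. apply sqrt_le_1_alt. nra.
Qed.

Lemma sqrt_sum_sqr_pow2 W v : sqrt (W ^ 2 + v ^ 2) ^ 2 = W ^ 2 + v ^ 2.
Proof. apply pow2_sqrt. generalize (pow2_ge_0 W) (pow2_ge_0 v); lra. Qed.

Lemma continuous_X_hyp l W v : 0 < W -> 0 <= v -> continuous (fun v => X l (sqrt (W ^ 2 + v ^ 2))) v.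
Proof.
  intros hW hv. assert (h := sqrt_sum_sqr_bounds W v ltac:(lra) hv).
  apply (continuous_comp (fun v => sqrt (W ^ 2 + v ^ 2)) (X l)).
  - apply (ex_derive_continuous (fun v => sqrt (W ^ 2 + v ^ 2))). auto_derive.
    assert (0 < W ^ 2) by nra. assert (0 <= v ^ 2) by apply pow2_ge_0. simpl in *. lra.
  - apply continuous_X. lra.
Qed.

Lemma X_sum_int l W V n : 0 < W -> 0 <= V ->
  is_RInt (fun v => X_sum l (W ^ 2 + v ^ 2) n) 0 V (rsum (fold l (fun a => inv_sqr_int V (a + W ^ 2))) n).
Proof.
  intros hW hV. induction n as [|n IH].
  - unfold X_sum; simpl. evar_last. apply (is_RInt_const (V := R_NormedModule)). unfold scal; simpl; unfold mult; simpl; ring.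
  - rewrite rsum_S.
    assert (h : forall b, is_RInt (fun v => / (b ^ 2 + (W ^ 2 + v ^ 2)) ^ 2) 0 V (inv_sqr_int V (b ^ 2 + W ^ 2))).
    { intros b. eapply is_RInt_ext; [|apply is_RInt_inv_sqr; auto].
      - intros x _. simpl. do 2 f_equal; ring.
      - generalize (pow2_ge_0 b); nra. }
    assert (k := is_RInt_plus (V := R_NormedModule) _ _ _ _ _ _ IH
      (is_RInt_plus (V := R_NormedModule) _ _ _ _ _ _ (h (INR n + l)) (h (INR n + 1 - l)))).
    exact k.
Qed.

Lemma is_RInt_X_main W V : 0 < W -> 0 <= V ->
  is_RInt (fun v => PI / (2 * sqrt (W ^ 2 + v ^ 2) ^ 3)) 0 V (PI / 2 * (V / (W ^ 2 * sqrt (W ^ 2 + V ^ 2)))).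
Proof.
  intros hW hV. assert (hW2 : 0 < W ^ 2) by nra.
  assert (hp : forall x, 0 < W ^ 2 + x ^ 2) by (intros x; generalize (pow2_ge_0 x); lra).
  assert (hs : forall x, 0 < sqrt (W ^ 2 + x ^ 2)) by (intros x; apply sqrt_lt_R0; auto).
  evar_last.
  - apply (is_RInt_derive (V := R_CompleteNormedModule) (fun v => PI / 2 * (v / (W ^ 2 * sqrt (W ^ 2 + v ^ 2))))).
    + intros x _. specialize (hp x). specialize (hs x). auto_derive.
      * simpl in *. repeat split; auto. apply Rgt_not_eq. nra.
      * assert (e := sqrt_sum_sqr_pow2 W x).
        replace (W * (W * 1) + x * (x * 1)) with (W ^ 2 + x ^ 2) by ring.
        set (s := sqrt (W ^ 2 + x ^ 2)) in *.
        assert (e' : W ^ 2 = s ^ 2 - x ^ 2) by lra.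
        replace (W * (W * 1)) with (W ^ 2) by ring. rewrite e'. field. split; lra.
    + intros x _. specialize (hp x). specialize (hs x).
      apply (ex_derive_continuous (fun v => PI / (2 * sqrt (W ^ 2 + v ^ 2) ^ 3))). auto_derive.
      simpl in *. split; auto. split; auto. apply Rgt_not_eq. repeat apply Rmult_lt_0_compat; lra.
  - unfold minus, plus, opp; simpl. unfold Rdiv. rewrite Rmult_0_l. ring.
Qed.

Lemma X_int_bound l W V : 0 <= l <= 1 -> 1 <= W -> 0 < V ->
  Rabs (RInt (fun v => X l (sqrt (W ^ 2 + v ^ 2))) 0 V - PI / (2 * W ^ 2))
  <= X_error_const / PI * exp (- (PI * W)) + PI / (2 * W) / V.
Proof.
  intros hl hW hV. assert (hpi := PI_RGT_0). assert (hK := X_error_const_pos).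
  assert (exX : ex_RInt (fun v => X l (sqrt (W ^ 2 + v ^ 2))) 0 V).
  { apply (ex_RInt_continuous (V := R_CompleteNormedModule)). rewrite Rmin_left, Rmax_right by lra.
    intros z hz. apply continuous_X_hyp; lra. }
  assert (hm := is_RInt_X_main W V ltac:(lra) ltac:(lra)).
  set (I := RInt (fun v => X l (sqrt (W ^ 2 + v ^ 2))) 0 V).
  set (J := PI / 2 * (V / (W ^ 2 * sqrt (W ^ 2 + V ^ 2)))) in *.
  assert (h1 : Rabs (I - J) <= X_error_const / PI * exp (- (PI * W)) - X_error_const / PI * exp (- (PI * (W + V)))).
  { assert (hI : is_RInt (fun v => X l (sqrt (W ^ 2 + v ^ 2))) 0 V I) by (apply (RInt_correct (V := R_CompleteNormedModule)); exact exX).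
    assert (hd := is_RInt_minus (V := R_NormedModule) _ _ _ _ _ _ hI hm).
    assert (hg : is_RInt (fun v => X_error_const * exp (- (PI * (W + v)))) 0 V
       (X_error_const / PI * exp (- (PI * W)) - X_error_const / PI * exp (- (PI * (W + V))))).
    { evar_last.
      - apply (is_RInt_derive (V := R_CompleteNormedModule) (fun v => - (X_error_const / PI) * exp (- (PI * (W + v))))).
        + intros x _. auto_derive; auto. field. lra.
        + intros x _. apply (ex_derive_continuous (fun v => X_error_const * exp (- (PI * (W + v))))). auto_derive; auto.
      - unfold minus, plus, opp; simpl. rewrite Rplus_0_r. ring. }
    apply (norm_RInt_le (V := R_NormedModule)
      (fun v => minus (X l (sqrt (W ^ 2 + v ^ 2))) (PI / (2 * sqrt (W ^ 2 + v ^ 2) ^ 3)))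
      (fun v => X_error_const * exp (- (PI * (W + v)))) 0 V (minus I J) _); [lra| |exact hd|exact hg].
    intros v hv.
    change (Rabs (X l (sqrt (W ^ 2 + v ^ 2)) - PI / (2 * sqrt (W ^ 2 + v ^ 2) ^ 3)) <= X_error_const * exp (- (PI * (W + v)))).
    assert (hs := sqrt_sum_sqr_bounds W v ltac:(lra) ltac:(lra)).
    eapply Rle_trans; [apply X_asymptotic; lra|]. apply Rmult_le_compat_l; [lra|].
    unfold rho. apply exp_le. nra. }
  assert (h2 : Rabs (J - PI / (2 * W ^ 2)) <= PI / (2 * W) / V).
  { unfold J. assert (hs := sqrt_sum_sqr_bounds W V ltac:(lra) ltac:(lra)).
    set (s := sqrt (W ^ 2 + V ^ 2)) in *.
    replace (PI / 2 * (V / (W ^ 2 * s)) - PI / (2 * W ^ 2)) with (- (PI / (2 * W ^ 2) * ((s - V) / s))) by (field; lra).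
    assert (0 <= (s - V) / s <= W / V).
    { split; [apply Rdiv_le_0_compat; lra|]. unfold Rdiv. apply Rmult_le_compat; try lra.
      left; apply Rinv_0_lt_compat; lra. apply Rinv_le_contravar; lra. }
    assert (0 < PI / (2 * W ^ 2)) by (apply Rdiv_lt_0_compat; nra).
    rewrite Rabs_Ropp, Rabs_pos_eq by nra.
    apply Rle_trans with (PI / (2 * W ^ 2) * (W / V)); [nra|]. right. field. lra. }
  replace (I - PI / (2 * W ^ 2)) with ((I - J) + (J - PI / (2 * W ^ 2))) by ring.
  eapply Rle_trans; [apply Rabs_triang|].
  assert (0 < X_error_const / PI * exp (- (PI * (W + V)))).
  { apply Rmult_lt_0_compat; [apply Rdiv_lt_0_compat; auto|apply exp_pos]. }
  lra.
Qed.

Definition main_term (W a : R) : R := PI / (4 * ((a + W ^ 2) * sqrt (a + W ^ 2))).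

(* [1/p^(3/2)] is a multiple of the integral of [1/(p + v^2)^2] over [v > 0],
   which reduces the sum to the closed form of [X]. *)
Lemma main_sum_asymptotic l W : 0 <= l <= 1 -> 1 <= W ->
  exists S : R, is_lim_seq (rsum (fold l (main_term W))) S /\
    Rabs (S - PI / (2 * W ^ 2)) <= X_error_const / PI * exp (- (PI * W)).
Proof.
  intros hl hW. assert (hpi := PI_RGT_0).
  set (u := rsum (fold l (main_term W))).
  set (I := fun V => RInt (fun v => X l (sqrt (W ^ 2 + v ^ 2))) 0 V).
  assert (exX : forall V, 0 < V -> ex_RInt (fun v => X l (sqrt (W ^ 2 + v ^ 2))) 0 V).
  { intros V hV. apply (ex_RInt_continuous (V := R_CompleteNormedModule)). rewrite Rmin_left, Rmax_right by lra.
    intros z hz. apply continuous_X_hyp; lra. }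
  assert (hphi0 : forall n, phi_sum l (W ^ 2) n <= phi l W).
  { intros n. apply is_lim_seq_incr_le; [|apply phi_series; auto; lra].
    apply rsum_incr. intros k. apply fold_pos. intros a ha. apply inv_nonneg; auto. nra. }
  assert (hFV : forall V n, 0 < V ->
     u n - phi l W / V <= rsum (fold l (fun a => inv_sqr_int V (a + W ^ 2))) n <= u n + phi l W / V).
  { intros V n hV.
    assert (hp : forall a, 0 <= a -> main_term W a + - / V * / (a + W ^ 2) <= inv_sqr_int V (a + W ^ 2) <= main_term W a + / V * / (a + W ^ 2)).
    { intros a ha. unfold main_term. assert (hpos : 0 < a + W ^ 2) by nra.
      destruct (inv_sqr_int_bound V (a + W ^ 2) hpos hV) as [b1 b2].
      replace (/ V * / (a + W ^ 2)) with (/ ((a + W ^ 2) * V)) by (field; split; lra).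
      replace (- / V * / (a + W ^ 2)) with (- / ((a + W ^ 2) * V)) by (field; split; lra). lra. }
    assert (hV' : 0 < / V) by (apply Rinv_0_lt_compat; auto).
    assert (hphi' : / V * phi_sum l (W ^ 2) n <= phi l W / V).
    { unfold Rdiv. rewrite (Rmult_comm (phi l W)). apply Rmult_le_compat_l; auto; lra. }
    split.
    - apply Rle_trans with (u n + - / V * phi_sum l (W ^ 2) n); [lra|].
      unfold u, phi_sum. rewrite <- rsum_scal, <- rsum_plus. apply rsum_le. intros k _.
      rewrite <- fold_scal, <- fold_plus. apply fold_le. intros a ha. apply hp; auto.
    - apply Rle_trans with (u n + / V * phi_sum l (W ^ 2) n); [|lra].
      unfold u, phi_sum. rewrite <- rsum_scal, <- rsum_plus. apply rsum_le. intros k _.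
      rewrite <- fold_scal, <- fold_plus. apply fold_le. intros a ha. apply hp; auto. }
  assert (hup : forall V n, 0 < V -> rsum (fold l (fun a => inv_sqr_int V (a + W ^ 2))) n <= I V).
  { intros V n hV.
    apply (is_RInt_le (fun v => X_sum l (W ^ 2 + v ^ 2) n) (fun v => X l (sqrt (W ^ 2 + v ^ 2))) 0 V); [lra| | |].
    - apply X_sum_int; lra.
    - apply (RInt_correct (V := R_CompleteNormedModule)), exX; auto.
    - intros v hv.
      assert (hs := sqrt_sum_sqr_bounds W v ltac:(lra) ltac:(lra)).
      assert (ht := X_tail_mono l W (sqrt (W ^ 2 + v ^ 2)) n hl ltac:(lra) ltac:(lra)).
      rewrite sqrt_sum_sqr_pow2 in ht. lra. }
  assert (hlow : forall V n, 0 < V -> I V - V * (X l W - X_sum l (W ^ 2) n) <= rsum (fold l (fun a => inv_sqr_int V (a + W ^ 2))) n).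
  { intros V n hV. set (e := X l W - X_sum l (W ^ 2) n).
    assert (hc : is_RInt (fun _ => e) 0 V (V * e)).
    { evar_last. apply (is_RInt_const (V := R_NormedModule)). unfold scal; simpl; unfold mult; simpl; ring. }
    assert (k := is_RInt_minus (V := R_NormedModule) _ _ _ _ _ _ (RInt_correct (V := R_CompleteNormedModule) _ _ _ (exX V hV)) hc).
    apply (is_RInt_le _ (fun v => X_sum l (W ^ 2 + v ^ 2) n) 0 V) with (2 := k); [lra| |].
    - apply X_sum_int; lra.
    - intros v hv.
      change (X l (sqrt (W ^ 2 + v ^ 2)) - e <= X_sum l (W ^ 2 + v ^ 2) n).
      assert (hs := sqrt_sum_sqr_bounds W v ltac:(lra) ltac:(lra)).
      assert (ht := X_tail_mono l W (sqrt (W ^ 2 + v ^ 2)) n hl ltac:(lra) ltac:(lra)).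
      rewrite sqrt_sum_sqr_pow2 in ht. unfold e. lra. }
  assert (hinc : forall n, u n <= u (S n)).
  { apply rsum_incr. intros k. apply fold_pos. intros a ha. unfold main_term.
    assert (0 < a + W ^ 2) by nra. apply Rdiv_le_0_compat; [lra|].
    assert (0 < sqrt (a + W ^ 2)) by (apply sqrt_lt_R0; auto). nra. }
  assert (hbd : forall n, u n <= I 1 + phi l W / 1).
  { intros n. specialize (hFV 1 n Rlt_0_1). specialize (hup 1 n Rlt_0_1). lra. }
  destruct (ex_finite_lim_seq_incr _ _ hinc hbd) as [S hS]. exists S. split; auto.
  assert (hSV : forall V, 0 < V -> Rabs (S - I V) <= phi l W / V).
  { intros V hV. apply Rabs_le. split.
    - assert (I V - phi l W / V <= S); [|lra].
      assert (hl1 : is_lim_seq (fun n => I V - V * (X l W - X_sum l (W ^ 2) n) - phi l W / V) (I V - V * (X l W - X l W) - phi l W / V)).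
      { apply is_lim_seq_minus'; [|apply is_lim_seq_const]. apply is_lim_seq_minus'; [apply is_lim_seq_const|].
        apply (is_lim_seq_scal_l _ V (Finite (X l W - X l W))). apply is_lim_seq_minus'; [apply is_lim_seq_const|].
        apply X_series; auto; lra. }
      replace (I V - phi l W / V) with (I V - V * (X l W - X l W) - phi l W / V) by ring.
      apply (is_lim_seq_le _ u (Finite (I V - V * (X l W - X l W) - phi l W / V)) (Finite S)) with (2 := hl1); auto.
      intros n. specialize (hFV V n hV). specialize (hlow V n hV). lra.
    - assert (S <= I V + phi l W / V); [|lra].
      apply (is_lim_seq_le u (fun _ => I V + phi l W / V) (Finite S) (Finite (I V + phi l W / V))); auto.
      + intros n. specialize (hFV V n hV). specialize (hup V n hV). lra.
      + apply is_lim_seq_const. }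
  apply le_epsilon. intros eps heps.
  assert (hphi1 : 0 <= phi l W).
  { eapply Rle_trans; [|apply (hphi0 0%nat)]. unfold phi_sum; simpl; lra. }
  set (C := phi l W + PI / (2 * W) + 1).
  assert (hC : 0 < C). { assert (0 < PI / (2 * W)) by (apply Rdiv_lt_0_compat; lra). unfold C; lra. }
  set (V := C / eps). assert (hV : 0 < V) by (apply Rdiv_lt_0_compat; auto).
  specialize (hSV V hV). assert (k := X_int_bound l W V hl hW hV). fold (I V) in k.
  assert (tri := Rabs_triang (S - I V) (I V - PI / (2 * W ^ 2))).
  replace (S - I V + (I V - PI / (2 * W ^ 2))) with (S - PI / (2 * W ^ 2)) in tri by ring.
  eapply Rle_trans; [exact tri|].
  assert (phi l W / V + PI / (2 * W) / V <= eps).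
  { replace (phi l W / V + PI / (2 * W) / V) with ((phi l W + PI / (2 * W)) / V) by (field; lra).
    apply Rle_div_l; [exact hV|]. unfold V. replace (eps * (C / eps)) with C by (field; lra). unfold C; lra. }
  apply Rle_trans with (phi l W / V + (X_error_const / PI * exp (- (PI * W)) + PI / (2 * W) / V)); [|lra].
  apply Rplus_le_compat; [exact hSV|exact k].
Qed.

(** * The lattice sum *)

Definition admissible (bt l1 l2 : R) : Prop :=
  0 < bt /\ 0 <= l1 <= 1 /\ 0 <= l2 <= 1 /\ ((l1 <> 0 /\ l1 <> 1) \/ (l2 <> 0 /\ l2 <> 1)).

Lemma fold_Z l f j : fold l f j = f ((IZR (Z.of_nat j) + l) ^ 2) + f ((IZR (- Z.of_nat j - 1) + l) ^ 2).
Proof.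
  unfold fold. rewrite minus_IZR, opp_IZR, <- INR_IZR_INZ. f_equal. f_equal. ring.
Qed.

Lemma fold_le_Z l f g j : (forall k : Z, f ((IZR k + l) ^ 2) <= g ((IZR k + l) ^ 2)) -> fold l f j <= fold l g j.
Proof. intros h. rewrite !fold_Z. apply Rplus_le_compat; auto. Qed.

Lemma sqr_shift_ge (l : R) (k : Z) : 0 <= l <= 1 -> Rmin (l ^ 2) ((1 - l) ^ 2) <= (IZR k + l) ^ 2.
Proof.
  intros hl. destruct (Z_lt_le_dec k 0) as [h|h].
  - eapply Rle_trans; [apply Rmin_r|]. assert (IZR k <= -1) by (apply IZR_le; lia). nra.
  - eapply Rle_trans; [apply Rmin_l|]. assert (0 <= IZR k) by (apply IZR_le; lia). nra.
Qed.

Lemma min_sqr_pos l : 0 <= l <= 1 -> l <> 0 -> l <> 1 -> 0 < Rmin (l ^ 2) ((1 - l) ^ 2).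
Proof. intros h h0 h1. apply Rmin_pos; apply pow_lt; lra. Qed.

Lemma quad_form_min bt l1 l2 : admissible bt l1 l2 ->
  exists qm, 0 < qm /\ forall k n : Z, qm <= (IZR k + l1) ^ 2 + bt ^ 2 * (IZR n + l2) ^ 2.
Proof.
  intros [hb [h1 [h2 [[e1 e2]|[e1 e2]]]]].
  - exists (Rmin (l1 ^ 2) ((1 - l1) ^ 2)). split; [apply min_sqr_pos; auto|]. intros k n.
    assert (h := sqr_shift_ge l1 k h1). assert (0 <= bt ^ 2 * (IZR n + l2) ^ 2) by (apply Rmult_le_pos; apply pow2_ge_0). lra.
  - exists (bt ^ 2 * Rmin (l2 ^ 2) ((1 - l2) ^ 2)). split.
    + apply Rmult_lt_0_compat; [nra|apply min_sqr_pos; auto].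
    + intros k n. assert (h := sqr_shift_ge l2 n h2). assert (0 <= (IZR k + l1) ^ 2) by apply pow2_ge_0.
      assert (bt ^ 2 * Rmin (l2 ^ 2) ((1 - l2) ^ 2) <= bt ^ 2 * (IZR n + l2) ^ 2) by (apply Rmult_le_compat_l; auto; nra). lra.
Qed.

(* Partial sum, over the box [-N <= k, n < N], of [1 / (q(k, n) + u^2)^2] where
   [q(k, n) = (k + l1)^2 + bt^2 (n + l2)^2]. *)
Definition Ybox (bt l1 l2 : R) (N : nat) (u : R) : R :=
  rsum (fold l2 (fun a => X_sum l1 (bt ^ 2 * a + u ^ 2) N)) N.

(* The same double sum with the sum over [k] carried out. *)
Definition Yiter (bt l1 l2 : R) (u : R) : nat -> R :=
  rsum (fold l2 (fun a => X l1 (sqrt (bt ^ 2 * a + u ^ 2)))).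

Lemma rsum_mono_n f m n : (m <= n)%nat -> (forall k, 0 <= f k) -> rsum f m <= rsum f n.
Proof.
  intros h hf. replace n with (m + (n - m))%nat by lia. rewrite rsum_split.
  assert (0 <= rsum (fun k => f (m + k)%nat) (n - m)) by (apply rsum_nonneg; auto). lra.
Qed.

Lemma Ybox_term_nonneg bt l1 l2 u N k : 0 <= fold l2 (fun a => X_sum l1 (bt ^ 2 * a + u ^ 2) N) k.
Proof.
  apply fold_pos. intros a ha. apply rsum_nonneg. intros j _. apply fold_pos. intros c hc. apply inv2_nonneg; auto.
  assert (0 <= bt ^ 2) by apply pow2_ge_0. assert (0 <= u ^ 2) by apply pow2_ge_0. nra.
Qed.

Lemma Ybox_incr bt l1 l2 u N : Ybox bt l1 l2 N u <= Ybox bt l1 l2 (S N) u.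
Proof.
  unfold Ybox. apply Rle_trans with (rsum (fold l2 (fun a => X_sum l1 (bt ^ 2 * a + u ^ 2) (S N))) N).
  - apply rsum_le. intros k _. apply fold_le. intros a ha. apply rsum_incr. intros j. apply fold_pos.
    intros c hc. apply inv2_nonneg; auto.
    assert (0 <= bt ^ 2) by apply pow2_ge_0. assert (0 <= u ^ 2) by apply pow2_ge_0. nra.
  - apply rsum_mono_n; [lia|]. intros k. apply Ybox_term_nonneg.
Qed.

Lemma Ybox_compare bt l1 l2 u0 : admissible bt l1 l2 -> exists C, 0 < C /\
  forall N u, Ybox bt l1 l2 N u <= C * Ybox bt l1 l2 N u0.
Proof.
  intros hadm. destruct (quad_form_min bt l1 l2 hadm) as [qm [hqm hq]].
  assert (hu0 := pow2_ge_0 u0).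
  set (c := (qm + u0 ^ 2) / qm). assert (hc : 0 < c) by (apply Rdiv_lt_0_compat; lra).
  exists (c ^ 2). split; [apply pow_lt; auto|]. intros N u.
  unfold Ybox. rewrite <- rsum_scal. apply rsum_le. intros m _. rewrite <- fold_scal. apply fold_le_Z. intros n.
  unfold X_sum. rewrite <- rsum_scal. apply rsum_le. intros j _. rewrite <- fold_scal. apply fold_le_Z. intros k.
  specialize (hq k n). rewrite <- !Rplus_assoc. set (q := (IZR k + l1) ^ 2 + bt ^ 2 * (IZR n + l2) ^ 2) in *.
  assert (hu := pow2_ge_0 u).
  apply Rle_trans with (/ q ^ 2).
  - apply Rinv_le_contravar; [apply pow_lt; lra|]. apply pow_incr. lra.
  - replace (c ^ 2 * / (q + u0 ^ 2) ^ 2) with (/ ((q + u0 ^ 2) / c) ^ 2) by (field; split; lra).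
    apply Rinv_le_contravar.
    + apply pow_lt. apply Rdiv_lt_0_compat; lra.
    + apply pow_incr. split; [apply Rdiv_le_0_compat; lra|]. apply Rle_div_l; [lra|].
      unfold c. apply Rmult_le_reg_r with qm; auto. replace (q * ((qm + u0 ^ 2) / qm) * qm) with (q * (qm + u0 ^ 2)) by (field; lra). nra.
Qed.

Lemma sqrt_pos_arg bt a u : 0 <= a -> 0 < u -> 0 < bt ^ 2 * a + u ^ 2 /\ u <= sqrt (bt ^ 2 * a + u ^ 2)
   /\ sqrt (bt ^ 2 * a + u ^ 2) ^ 2 = bt ^ 2 * a + u ^ 2.
Proof.
  intros ha hu. assert (0 <= bt ^ 2 * a) by (apply Rmult_le_pos; auto; apply pow2_ge_0).
  assert (0 < u ^ 2) by nra. repeat split; [lra| |apply pow2_sqrt; lra].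
  rewrite <- (sqrt_pow2 u) at 1 by lra. apply sqrt_le_1_alt. lra.
Qed.

Lemma X_sum_le_X l T n : 0 <= l <= 1 -> 0 < T -> X_sum l T n <= X l (sqrt T).
Proof.
  intros hl hT. assert (hs := sqrt_lt_R0 T hT).
  assert (h := X_tail_mono l (sqrt T) (sqrt T) n hl hs (Rle_refl _)). rewrite pow2_sqrt in h by lra. lra.
Qed.

Lemma X_nonneg l t : 0 <= l <= 1 -> 0 < t -> 0 <= X l t.
Proof.
  intros hl ht. assert (h := X_tail_mono l t t 0 hl ht (Rle_refl _)). unfold X_sum in h; simpl in h. lra.
Qed.

Lemma Ybox_le_Yiter bt l1 l2 N u : admissible bt l1 l2 -> 0 < u -> Ybox bt l1 l2 N u <= Yiter bt l1 l2 u N.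
Proof.
  intros [hb [h1 [h2 _]]] hu. apply rsum_le. intros k _. apply fold_le. intros a ha.
  destruct (sqrt_pos_arg bt a u ha hu) as [p1 _]. apply X_sum_le_X; auto.
Qed.

Lemma Yiter_incr bt l1 l2 u N : admissible bt l1 l2 -> 0 < u -> Yiter bt l1 l2 u N <= Yiter bt l1 l2 u (S N).
Proof.
  intros [hb [h1 [h2 _]]] hu. apply rsum_incr. intros k. apply fold_pos. intros a ha.
  destruct (sqrt_pos_arg bt a u ha hu) as [p1 [p2 p3]]. apply X_nonneg; auto; lra.
Qed.

Lemma Yiter_le_lim bt l1 l2 u M (y : R) : admissible bt l1 l2 -> 0 < u ->
  is_lim_seq (fun N => Ybox bt l1 l2 N u) y -> Yiter bt l1 l2 u M <= y.
Proof.
  intros [hb [h1 [h2 _]]] hu hy.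
  assert (hx : is_lim_seq (fun N => rsum (fold l2 (fun a => X_sum l1 (bt ^ 2 * a + u ^ 2) N)) M) (Yiter bt l1 l2 u M)).
  { unfold Yiter. induction M as [|M IH]; [apply is_lim_seq_const|].
    apply is_lim_seq_ext with (fun N => rsum (fold l2 (fun a => X_sum l1 (bt ^ 2 * a + u ^ 2) N)) M
       + fold l2 (fun a => X_sum l1 (bt ^ 2 * a + u ^ 2) N) M); [reflexivity|].
    rewrite rsum_S. apply is_lim_seq_plus'; auto.
    assert (hs : forall a, 0 <= a -> is_lim_seq (fun N => X_sum l1 (bt ^ 2 * a + u ^ 2) N) (X l1 (sqrt (bt ^ 2 * a + u ^ 2)))).
    { intros a ha. destruct (sqrt_pos_arg bt a u ha hu) as [p1 [p2 p3]].
      assert (q := X_series l1 _ h1 (Rlt_le_trans _ _ _ hu p2)). rewrite p3 in q. exact q. }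
    unfold fold. apply is_lim_seq_plus'; apply hs, pow2_ge_0. }
  apply (is_lim_seq_le_loc (fun N => rsum (fold l2 (fun a => X_sum l1 (bt ^ 2 * a + u ^ 2) N)) M)
    (fun N => Ybox bt l1 l2 N u) (Finite (Yiter bt l1 l2 u M)) (Finite y)); auto.
  exists M. intros N hN. unfold Ybox. apply rsum_mono_n; auto. intros k. apply Ybox_term_nonneg.
Qed.

Lemma geometric_bound r n : 0 < r < 1 -> rsum (fun k => r ^ k) n <= / (1 - r).
Proof.
  intros hr. assert (h : rsum (fun k => r ^ k) n = (1 - r ^ n) / (1 - r)).
  { induction n as [|n IH]; [simpl; field; lra|]. rewrite rsum_S, IH. simpl. field. lra. }
  rewrite h. unfold Rdiv. rewrite <- (Rmult_1_l (/ (1 - r))) at 2. apply Rmult_le_compat_r.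
  left; apply Rinv_0_lt_compat; lra. assert (0 < r ^ n) by (apply pow_lt; lra). lra.
Qed.

Lemma exp_fold_sum c l n : 0 < c -> 0 <= l <= 1 ->
  rsum (fold l (fun a => exp (- (c * sqrt a)))) n <= 2 * / (1 - exp (- c)).
Proof.
  intros hc hl. assert (hr : 0 < exp (- c) < 1).
  { split; [apply exp_pos|]. rewrite <- exp_0. apply exp_increasing. lra. }
  eapply Rle_trans; [|apply Rmult_le_compat_l; [lra|apply (geometric_bound _ n hr)]].
  rewrite <- rsum_scal. apply rsum_le. intros k _.
  assert (e : exp (- c) ^ k = exp (- (c * INR k))).
  { rewrite <- Rpower_pow by apply exp_pos. unfold Rpower. rewrite ln_exp. f_equal. ring. }
  rewrite e. unfold fold. assert (hk := pos_INR k).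
  rewrite !sqrt_pow2 by lra.
  assert (exp (- (c * (INR k + l))) <= exp (- (c * INR k))) by (apply exp_le; nra).
  assert (exp (- (c * (INR k + 1 - l))) <= exp (- (c * INR k))) by (apply exp_le; nra). lra.
Qed.

Lemma rho_sqrt_le bt a u : 0 < bt -> 0 <= a -> 0 < u ->
  rho (sqrt (bt ^ 2 * a + u ^ 2)) <= exp (- (PI * u)) * exp (- (PI * bt * sqrt a)).
Proof.
  intros hb ha hu. assert (hpi := PI_RGT_0). unfold rho. rewrite <- exp_plus. apply exp_le.
  assert (hs := sqrt_sum_sqr_bounds (bt * sqrt a) u ltac:(apply Rmult_le_pos; [lra|apply sqrt_pos]) ltac:(lra)).
  replace ((bt * sqrt a) ^ 2) with (bt ^ 2 * a) in hs by (rewrite Rpow_mult_distr, pow2_sqrt; auto).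
  nra.
Qed.

Lemma Yiter_asymptotic bt l1 l2 : admissible bt l1 l2 -> exists K c, 0 < c /\ 0 <= K /\
  forall u, 1 <= u -> bt <= u -> exists y : R, is_lim_seq (Yiter bt l1 l2 u) y /\
    Rabs (y - PI / bt / u ^ 2) <= K * exp (- (c * u)).
Proof.
  intros hadm. assert (hadm' := hadm). destruct hadm' as [hb [h1 [h2 _]]].
  assert (hpi := PI_RGT_0). assert (hK0 := X_error_const_pos).
  set (G := 2 * / (1 - exp (- (PI * bt)))).
  assert (hG : 0 < G).
  { unfold G. apply Rmult_lt_0_compat; [lra|]. apply Rinv_0_lt_compat.
    assert (exp (- (PI * bt)) < 1); [|lra]. rewrite <- exp_0. apply exp_increasing. nra. }
  set (K := 2 / bt ^ 3 * (X_error_const / PI) + X_error_const * G).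
  assert (hb3 : 0 < 2 / bt ^ 3) by (apply Rdiv_lt_0_compat; [lra|apply pow_lt; auto]).
  assert (hKp : 0 < X_error_const / PI) by (apply Rdiv_lt_0_compat; auto).
  exists K, (Rmin (PI / bt) PI).
  split; [apply Rmin_pos; auto; apply Rdiv_lt_0_compat; auto|]. split; [unfold K; nra|].
  intros u hu hbu. set (W := u / bt).
  assert (hW : 1 <= W). { unfold W. apply Rle_div_r; lra. }
  destruct (main_sum_asymptotic l2 W h2 hW) as [S [hS1 hS2]].
  set (E := fun a => X l1 (sqrt (bt ^ 2 * a + u ^ 2)) - 2 / bt ^ 3 * main_term W a).
  assert (hE : forall a, 0 <= a -> Rabs (E a) <= X_error_const * exp (- (PI * u)) * exp (- (PI * bt * sqrt a))).
  { intros a ha. destruct (sqrt_pos_arg bt a u ha ltac:(lra)) as [p1 [p2 p3]].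
    unfold E. set (t := sqrt (bt ^ 2 * a + u ^ 2)) in *.
    replace (2 / bt ^ 3 * main_term W a) with (PI / (2 * t ^ 3)).
    - eapply Rle_trans; [apply X_asymptotic; lra|]. rewrite Rmult_assoc. apply Rmult_le_compat_l; [lra|].
      apply rho_sqrt_le; auto; lra.
    - assert (hp : 0 < a + W ^ 2) by nra.
      assert (ht : t = bt * sqrt (a + W ^ 2)).
      { unfold t. rewrite <- (sqrt_pow2 bt) at 2 by lra. rewrite <- sqrt_mult by (try apply pow2_ge_0; lra).
        f_equal. unfold W. field. lra. }
      unfold main_term. rewrite ht. assert (hs := sqrt_lt_R0 _ hp). assert (hss := sqrt_sqrt _ (Rlt_le _ _ hp)).
      set (s := sqrt (a + W ^ 2)) in *. rewrite <- hss. field. split; lra. }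
  set (D := rsum (fold l2 E)).
  assert (hD : forall n m, Rabs (D (n + m)%nat - D n) <= rsum (fun k => X_error_const * exp (- (PI * u)) * fold l2 (fun a => exp (- (PI * bt * sqrt a))) (n + k)%nat) m).
  { intros n m. unfold D. rewrite rsum_split.
    match goal with |- Rabs (?a + ?b - ?a) <= _ => replace (a + b - a) with b by ring end.
    induction m as [|m IH]; [simpl; rewrite Rabs_R0; lra|].
    rewrite !rsum_S. eapply Rle_trans; [apply Rabs_triang|]. apply Rplus_le_compat; auto.
    unfold fold at 1. eapply Rle_trans; [apply Rabs_triang|].
    unfold fold. rewrite Rmult_plus_distr_l. apply Rplus_le_compat; apply hE, pow2_ge_0. }
  set (g := fun n => rsum (fold l2 (fun a => exp (- (PI * bt * sqrt a)))) n).
  assert (hg : forall n, g n <= G) by (intros n; apply exp_fold_sum; auto; nra).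
  assert (hginc : forall n, g n <= g (Datatypes.S n)).
  { apply rsum_incr. intros k. apply fold_pos. intros a _. left; apply exp_pos. }
  destruct (ex_finite_lim_seq_incr g G hginc hg) as [gl hgl].
  assert (hDlim : ex_finite_lim_seq D).
  { apply ex_lim_seq_cauchy_corr. intros eps.
    assert (hgc : ex_lim_seq_cauchy g) by (apply ex_lim_seq_cauchy_corr; exists gl; auto).
    set (c0 := X_error_const * exp (- (PI * u))). assert (hc0 : 0 < c0) by (apply Rmult_lt_0_compat; auto; apply exp_pos).
    assert (he : 0 < eps / c0) by (apply Rdiv_lt_0_compat; auto; apply cond_pos).
    destruct (hgc (mkposreal _ he)) as [N hN]. exists N.
    assert (key : forall n m, (N <= n)%nat -> Rabs (D (n + m)%nat - D n) < eps).
    { intros n m hn. eapply Rle_lt_trans; [apply hD|]. rewrite rsum_scal. fold c0.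
      specialize (hN (n + m)%nat n ltac:(lia) hn). simpl in hN. unfold g in hN. rewrite rsum_split in hN.
      match type of hN with Rabs (?a + ?b - ?a) < _ => replace (a + b - a) with b in hN by ring end.
      rewrite Rmult_comm. apply Rlt_div_r; [exact hc0|]. eapply Rle_lt_trans; [apply Rle_abs|exact hN]. }
    intros n m hn hm. destruct (Nat.le_ge_cases n m) as [h|h].
    - replace m with (n + (m - n))%nat by lia. rewrite Rabs_minus_sym. apply key; auto.
    - replace n with (m + (n - m))%nat by lia. apply key; auto. }
  destruct hDlim as [d hd].
  assert (hdb : Rabs d <= X_error_const * exp (- (PI * u)) * G).
  { apply (is_lim_seq_le (fun n => Rabs (D n)) (fun _ => X_error_const * exp (- (PI * u)) * G) (Finite (Rabs d)) (Finite (X_error_const * exp (- (PI * u)) * G))).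
    - intros n. assert (h := hD 0%nat n). rewrite Nat.add_0_l in h. replace (D 0%nat) with 0 in h by reflexivity.
      rewrite Rminus_0_r in h. eapply Rle_trans; [exact h|]. rewrite rsum_scal. apply Rmult_le_compat_l.
      + apply Rmult_le_pos; [lra|left; apply exp_pos].
      + apply hg.
    - apply (is_lim_seq_abs D (Finite d)), hd.
    - apply is_lim_seq_const. }
  exists (2 / bt ^ 3 * S + d). split.
  - apply is_lim_seq_ext with (fun n => 2 / bt ^ 3 * rsum (fold l2 (main_term W)) n + D n).
    + intros n. unfold D, Yiter. rewrite <- rsum_scal, <- rsum_plus. apply rsum_ext. intros k _.
      rewrite <- fold_scal, <- fold_plus. unfold fold, E. ring.
    + apply is_lim_seq_plus'; auto. apply (is_lim_seq_scal_l _ (2 / bt ^ 3) (Finite S)), hS1.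
  - replace (2 / bt ^ 3 * S + d - PI / bt / u ^ 2) with (2 / bt ^ 3 * (S - PI / (2 * W ^ 2)) + d).
    2: { unfold W. field. split; lra. }
    eapply Rle_trans; [apply Rabs_triang|]. rewrite Rabs_mult, (Rabs_pos_eq (2 / bt ^ 3)) by lra.
    set (c := Rmin (PI / bt) PI).
    assert (e1 : exp (- (PI * W)) <= exp (- (c * u))).
    { apply exp_le. assert (c <= PI / bt) by apply Rmin_l. unfold W.
      replace (PI * (u / bt)) with (PI / bt * u) by (field; lra). nra. }
    assert (e2 : exp (- (PI * u)) <= exp (- (c * u))).
    { apply exp_le. assert (c <= PI) by apply Rmin_r. nra. }
    apply Rle_trans with (2 / bt ^ 3 * (X_error_const / PI * exp (- (c * u))) + X_error_const * exp (- (c * u)) * G).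
    + apply Rplus_le_compat.
      * apply Rmult_le_compat_l; [lra|]. eapply Rle_trans; [exact hS2|]. apply Rmult_le_compat_l; lra.
      * eapply Rle_trans; [exact hdb|]. apply Rmult_le_compat_r; [lra|]. apply Rmult_le_compat_l; lra.
    + unfold K. right. ring.
Qed.

Lemma continuous_rsum (f : nat -> R -> R) n u :
  (forall k, continuous (f k) u) -> continuous (fun u => rsum (fun k => f k u) n) u.
Proof.
  intros h. induction n as [|n IH]; [apply continuous_const|].
  apply (continuous_plus (fun u => rsum (fun k => f k u) n) (f n)); auto.
Qed.

Lemma Ybox_continuous bt l1 l2 N u : admissible bt l1 l2 -> continuous (Ybox bt l1 l2 N) u.
Proof.
  intros hadm. destruct (quad_form_min bt l1 l2 hadm) as [qm [hqm hq]].
  assert (hc : forall k n : Z, continuous (fun u => / ((IZR k + l1) ^ 2 + (bt ^ 2 * (IZR n + l2) ^ 2 + u ^ 2)) ^ 2) u).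
  { intros k n. specialize (hq k n). set (q1 := (IZR k + l1) ^ 2) in *. set (q2 := bt ^ 2 * (IZR n + l2) ^ 2) in *.
    apply (ex_derive_continuous (fun u => / (q1 + (q2 + u ^ 2)) ^ 2)). auto_derive.
    assert (h := pow2_ge_0 u). simpl in h. apply Rgt_not_eq. repeat apply Rmult_lt_0_compat; lra. }
  assert (hX : forall n : Z, continuous (fun u => X_sum l1 (bt ^ 2 * (IZR n + l2) ^ 2 + u ^ 2) N) u).
  { intros n. unfold X_sum. apply (continuous_rsum (fun k u => fold l1 (fun a => / (a + (bt ^ 2 * (IZR n + l2) ^ 2 + u ^ 2)) ^ 2) k)).
    intros k. eapply continuous_ext; [intros x; symmetry; apply fold_Z|].
    apply (continuous_plus (fun u => / ((IZR (Z.of_nat k) + l1) ^ 2 + (bt ^ 2 * (IZR n + l2) ^ 2 + u ^ 2)) ^ 2)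
      (fun u => / ((IZR (- Z.of_nat k - 1) + l1) ^ 2 + (bt ^ 2 * (IZR n + l2) ^ 2 + u ^ 2)) ^ 2)); apply hc. }
  unfold Ybox. apply (continuous_rsum (fun k u => fold l2 (fun a => X_sum l1 (bt ^ 2 * a + u ^ 2) N) k)).
  intros k. eapply continuous_ext; [intros x; symmetry; apply fold_Z|].
  apply (continuous_plus (fun u => X_sum l1 (bt ^ 2 * (IZR (Z.of_nat k) + l2) ^ 2 + u ^ 2) N)
      (fun u => X_sum l1 (bt ^ 2 * (IZR (- Z.of_nat k - 1) + l2) ^ 2 + u ^ 2) N)); apply hX.
Qed.

Lemma rsum_minus f g n : rsum (fun k => f k - g k) n = rsum f n - rsum g n.
Proof. induction n as [|n IH]; simpl; [|rewrite IH]; ring. Qed.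

Lemma fold_minus l f g j : fold l (fun a => f a - g a) j = fold l f j - fold l g j.
Proof. unfold fold. ring. Qed.

Lemma rsum_diff_le f g f' g' m n : (m <= n)%nat ->
  (forall k, (k < m)%nat -> f k - g k <= f' k - g' k) -> (forall k, (m <= k)%nat -> f k <= f' k) ->
  rsum f n - rsum g m <= rsum f' n - rsum g' m.
Proof.
  intros hmn h1 h2. replace n with (m + (n - m))%nat by lia. rewrite !rsum_split.
  assert (rsum (fun k => f k - g k) m <= rsum (fun k => f' k - g' k) m) by (apply rsum_le; auto).
  rewrite !rsum_minus in H.
  assert (rsum (fun k => f (m + k)%nat) (n - m) <= rsum (fun k => f' (m + k)%nat) (n - m)).
  { apply rsum_le. intros k _. apply h2. lia. }
  lra.
Qed.

Lemma Ybox_tail_le bt l1 l2 m n u : admissible bt l1 l2 -> (m <= n)%nat ->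
  Ybox bt l1 l2 n u - Ybox bt l1 l2 m u <= Ybox bt l1 l2 n 0 - Ybox bt l1 l2 m 0.
Proof.
  intros hadm hmn. destruct (quad_form_min bt l1 l2 hadm) as [qm [hqm hq]].
  assert (hterm : forall k i : Z, / ((IZR k + l1) ^ 2 + (bt ^ 2 * (IZR i + l2) ^ 2 + u ^ 2)) ^ 2
     <= / ((IZR k + l1) ^ 2 + (bt ^ 2 * (IZR i + l2) ^ 2 + 0 ^ 2)) ^ 2).
  { intros k i. specialize (hq k i). assert (h := pow2_ge_0 u).
    apply Rinv_le_contravar; [apply pow_lt; lra|]. apply pow_incr. lra. }
  unfold Ybox. apply rsum_diff_le; auto.
  - intros j _. rewrite <- !fold_minus. apply fold_le_Z. intros i. unfold X_sum.
    apply rsum_diff_le; auto.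
    + intros k _. rewrite <- !fold_minus. apply fold_le_Z. intros p. lra.
    + intros k _. apply fold_le_Z. intros p. apply hterm.
  - intros j _. apply fold_le_Z. intros i. unfold X_sum. apply rsum_le. intros k _. apply fold_le_Z. intros p. apply hterm.
Qed.

Lemma Y_exists bt l1 l2 : admissible bt l1 l2 -> exists Y : R -> R,
  (forall u, is_lim_seq (fun N => Ybox bt l1 l2 N u) (Y u)) /\
  (forall N u, 0 <= Y u - Ybox bt l1 l2 N u <= Y 0 - Ybox bt l1 l2 N 0) /\
  (forall u, continuous Y u) /\
  exists K c u0, 0 < c /\ 0 <= K /\ 1 <= u0 /\
    forall u, u0 <= u -> Rabs (Y u - PI / bt / u ^ 2) <= K * exp (- (c * u)).
Proof.
  intros hadm. destruct (Yiter_asymptotic bt l1 l2 hadm) as [K [c [hc [hK hY]]]].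
  set (u0 := Rmax 1 bt). assert (hu1 : 1 <= u0) by apply Rmax_l. assert (hu2 : bt <= u0) by apply Rmax_r.
  destruct (Ybox_compare bt l1 l2 u0 hadm) as [C [hC hcmp]].
  assert (hbox : forall u y N, 1 <= u -> is_lim_seq (Yiter bt l1 l2 u) (Finite y) -> Ybox bt l1 l2 N u <= y).
  { intros u y N hu hy. apply Rle_trans with (Yiter bt l1 l2 u N); [apply Ybox_le_Yiter; auto; lra|].
    apply is_lim_seq_incr_le; auto. intros n. apply Yiter_incr; auto; lra. }
  assert (hex : forall u, exists y : R, is_lim_seq (fun N => Ybox bt l1 l2 N u) y).
  { intros u. destruct (hY u0 hu1 hu2) as [y0 [hy0 _]].
    destruct (ex_finite_lim_seq_incr (fun N => Ybox bt l1 l2 N u) (C * y0)) as [y hy].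
    - intros n. apply Ybox_incr.
    - intros n. eapply Rle_trans; [apply hcmp|]. apply Rmult_le_compat_l; [lra|]. apply hbox; auto.
    - exists y; auto. }
  destruct (choice _ hex) as [Y hlim].
  exists Y. split; [exact hlim|].
  assert (htail : forall N u, 0 <= Y u - Ybox bt l1 l2 N u <= Y 0 - Ybox bt l1 l2 N 0).
  { intros N u. split.
    - assert (Ybox bt l1 l2 N u <= Y u); [|lra]. apply (is_lim_seq_incr_le (fun N => Ybox bt l1 l2 N u)); auto.
      intros n; apply Ybox_incr.
    - apply (is_lim_seq_le_loc (fun n => Ybox bt l1 l2 n u - Ybox bt l1 l2 N u) (fun n => Ybox bt l1 l2 n 0 - Ybox bt l1 l2 N 0)
        (Finite (Y u - Ybox bt l1 l2 N u)) (Finite (Y 0 - Ybox bt l1 l2 N 0))).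
      + exists N. intros n hn. apply Ybox_tail_le; auto.
      + apply is_lim_seq_minus'; auto. apply is_lim_seq_const.
      + apply is_lim_seq_minus'; auto. apply is_lim_seq_const. }
  split; [exact htail|]. split.
  - intros u P hP. destruct hP as [e hP].
    assert (he := cond_pos e).
    assert (hl0 := hlim 0). apply is_lim_seq_spec in hl0. destruct (hl0 (mkposreal (e / 3) ltac:(lra))) as [N hN].
    specialize (hN N (le_n N)). simpl in hN.
    assert (hcont := Ybox_continuous bt l1 l2 N u hadm).
    destruct (hcont (ball (Ybox bt l1 l2 N u) (mkposreal (e / 3) ltac:(lra))) (locally_ball _ _)) as [d hd].
    exists d. intros y hy. apply hP. specialize (hd y hy).
    unfold ball in *; simpl in *. unfold AbsRing_ball, abs, minus, plus, opp in *; simpl in *.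
    assert (t1 := htail N u). assert (t2 := htail N y).
    apply Rabs_lt_between in hd. apply Rabs_lt_between in hN. apply Rabs_lt_between. lra.
  - exists K, c, u0. split; [auto|]. split; [auto|]. split; [auto|]. intros u hu.
    destruct (hY u ltac:(lra) ltac:(lra)) as [y [hy1 hy2]].
    replace (Y u) with y; auto. apply Rle_antisym.
    + apply (is_lim_seq_le (Yiter bt l1 l2 u) (fun _ => Y u) (Finite y) (Finite (Y u))); auto; [|apply is_lim_seq_const].
      intros n. apply Yiter_le_lim; auto. lra.
    + apply (is_lim_seq_le (fun N => Ybox bt l1 l2 N u) (fun _ => y) (Finite (Y u)) (Finite y)); auto; [|apply is_lim_seq_const].
      intros n. apply hbox; auto. lra.
Qed.

(** * Euler-Maclaurin summation *)

Lemma integrate_power_bound (g dg : R -> R) (M : R) (n : nat) : 0 <= M -> g 0 = 0 ->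
  (forall x, 0 <= x <= 1 -> is_derive g x (dg x)) ->
  (forall x, 0 <= x <= 1 -> Rabs (dg x) <= M * x ^ n) ->
  forall x, 0 <= x <= 1 -> Rabs (g x) <= M * x ^ S n.
Proof.
  intros hM h0 hd hb x hx. destruct (Req_dec x 0) as [->|hx0].
  { rewrite h0, Rabs_R0. simpl. lra. }
  destruct (MVT_cor2 g dg 0 x) as [c [hc1 hc2]]; [lra| |].
  - intros c hc. apply is_derive_Reals. apply hd. lra.
  - rewrite h0, !Rminus_0_r in hc1. rewrite hc1, Rabs_mult, (Rabs_pos_eq x) by lra.
    replace (M * x ^ S n) with (M * x ^ n * x) by (simpl; ring). apply Rmult_le_compat_r; [lra|].
    eapply Rle_trans; [apply hb; lra|]. apply Rmult_le_compat_l; auto. apply pow_incr. lra.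
Qed.

(* The second-order Euler-Maclaurin formula on one cell, symmetrised under
   [l <-> 1 - l] so that the first Bernoulli polynomial drops out. *)
Lemma euler_maclaurin_cell (F f f1 f2 f3 : R -> R) (M l : R) : 0 <= M -> 0 <= l <= 1 ->
  (forall x, 0 <= x <= 1 -> is_derive F x (f x)) ->
  (forall x, 0 <= x <= 1 -> is_derive f x (f1 x)) ->
  (forall x, 0 <= x <= 1 -> is_derive f1 x (f2 x)) ->
  (forall x, 0 <= x <= 1 -> is_derive f2 x (f3 x)) ->
  (forall x, 0 <= x <= 1 -> Rabs (f3 x) <= M) ->
  Rabs (f l + f (1 - l) - 2 * (F 1 - F 0) - B2 l * (f1 1 - f1 0)) <= 5 * M.
Proof.
  intros hM hl d0 d1 d2 d3 hb.
  assert (r2 : forall x, 0 <= x <= 1 -> Rabs (f2 x - f2 0) <= M * x ^ 1).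
  { apply (integrate_power_bound (fun x => f2 x - f2 0) f3 M 0); auto; [ring| |].
    - intros x hx. apply (is_derive_ext (fun x => plus (f2 x) (- f2 0))); [reflexivity|].
      evar_last. apply (is_derive_plus f2 (fun _ => - f2 0)); [apply d3; auto|apply @is_derive_const].
      unfold plus, zero; simpl; ring.
    - intros x hx. simpl. rewrite Rmult_1_r. auto. }
  assert (r1 : forall x, 0 <= x <= 1 -> Rabs (f1 x - f1 0 - f2 0 * x) <= M * x ^ 2).
  { apply (integrate_power_bound (fun x => f1 x - f1 0 - f2 0 * x) (fun x => f2 x - f2 0) M 1); auto; [ring|].
    intros x hx. apply (is_derive_ext (fun x => plus (f1 x) (- f1 0 - f2 0 * x))); [intros t; unfold plus; simpl; ring|].
    evar_last. apply (is_derive_plus f1 (fun x => - f1 0 - f2 0 * x)); [apply d2; auto|auto_derive; auto; reflexivity].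
    unfold plus; simpl; ring. }
  assert (r0 : forall x, 0 <= x <= 1 -> Rabs (f x - f 0 - f1 0 * x - f2 0 * x ^ 2 / 2) <= M * x ^ 3).
  { apply (integrate_power_bound (fun x => f x - f 0 - f1 0 * x - f2 0 * x ^ 2 / 2) (fun x => f1 x - f1 0 - f2 0 * x) M 2); auto; [field|].
    intros x hx. apply (is_derive_ext (fun x => plus (f x) (- f 0 - f1 0 * x - f2 0 * x ^ 2 / 2))); [intros t; unfold plus; simpl; field|].
    evar_last. apply (is_derive_plus f (fun x => - f 0 - f1 0 * x - f2 0 * x ^ 2 / 2)); [apply d1; auto|auto_derive; auto; reflexivity].
    unfold plus; simpl; field. }
  assert (rF : forall x, 0 <= x <= 1 -> Rabs (F x - F 0 - f 0 * x - f1 0 * x ^ 2 / 2 - f2 0 * x ^ 3 / 6) <= M * x ^ 4).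
  { apply (integrate_power_bound (fun x => F x - F 0 - f 0 * x - f1 0 * x ^ 2 / 2 - f2 0 * x ^ 3 / 6) (fun x => f x - f 0 - f1 0 * x - f2 0 * x ^ 2 / 2) M 3); auto; [field|].
    intros x hx. apply (is_derive_ext (fun x => plus (F x) (- F 0 - f 0 * x - f1 0 * x ^ 2 / 2 - f2 0 * x ^ 3 / 6))); [intros t; unfold plus; simpl; field|].
    evar_last. apply (is_derive_plus F (fun x => - F 0 - f 0 * x - f1 0 * x ^ 2 / 2 - f2 0 * x ^ 3 / 6)); [apply d0; auto|auto_derive; auto; reflexivity].
    unfold plus; simpl; field. }
  assert (pw : forall x n, 0 <= x <= 1 -> M * x ^ n <= M).
  { intros x n hx. rewrite <- (Rmult_1_r M) at 2. apply Rmult_le_compat_l; auto. rewrite <- (pow1 n). apply pow_incr; lra. }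
  assert (a1 := r0 l hl). assert (a2 := r0 (1 - l) ltac:(lra)). assert (a3 := rF 1 ltac:(lra)). assert (a4 := r1 1 ltac:(lra)).
  assert (q1 := pw l 3%nat hl). assert (q2 := pw (1 - l) 3%nat ltac:(lra)).
  assert (q3 := pw 1 4%nat ltac:(lra)). assert (q4 := pw 1 2%nat ltac:(lra)).
  assert (hB : Rabs (B2 l) <= 1) by (unfold B2; apply Rabs_le; nra).
  set (e1 := f l - f 0 - f1 0 * l - f2 0 * l ^ 2 / 2) in *.
  set (e2 := f (1 - l) - f 0 - f1 0 * (1 - l) - f2 0 * (1 - l) ^ 2 / 2) in *.
  set (e3 := F 1 - F 0 - f 0 * 1 - f1 0 * 1 ^ 2 / 2 - f2 0 * 1 ^ 3 / 6) in *.
  set (e4 := f1 1 - f1 0 - f2 0 * 1) in *.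
  replace (f l + f (1 - l) - 2 * (F 1 - F 0) - B2 l * (f1 1 - f1 0))
    with (e1 + e2 + (- (2 * e3) + - (B2 l * e4))) by (unfold e1, e2, e3, e4, B2; field).
  assert (t1 := Rabs_triang (e1 + e2) (- (2 * e3) + - (B2 l * e4))).
  assert (t2 := Rabs_triang e1 e2). assert (t3 := Rabs_triang (- (2 * e3)) (- (B2 l * e4))).
  rewrite !Rabs_Ropp, !Rabs_mult, (Rabs_pos_eq 2) in t3 by lra.
  assert (t4 : Rabs (B2 l) * Rabs e4 <= 1 * M) by (apply Rmult_le_compat; try apply Rabs_pos; lra).
  lra.
Qed.

(* [PI * em_g U b] is, up to exponentially small terms, the integral over [0, U] of
   [u^3 X l (sqrt (u^2 + b^2))], without the term [ln |1 - exp (2 PI i l - 2 PI b)|] from [u = 0]. *)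
Definition em_g (U y : R) : R := sqrt (U ^ 2 + y ^ 2) - y - U ^ 2 / (2 * sqrt (U ^ 2 + y ^ 2)).

Definition em_G (U y : R) : R := (y * sqrt (U ^ 2 + y ^ 2) - y ^ 2) / 2.

Definition em_g1 (U y : R) : R := y / sqrt (U ^ 2 + y ^ 2) + U ^ 2 * y / (2 * sqrt (U ^ 2 + y ^ 2) ^ 3) - 1.

Definition em_g2 (U y : R) : R := 3 * U ^ 4 / (2 * sqrt (U ^ 2 + y ^ 2) ^ 5).

Definition em_g3 (U y : R) : R := - (15 * U ^ 4 * y / (2 * sqrt (U ^ 2 + y ^ 2) ^ 7)).

Lemma em_derivatives U y : 0 < U ->
  is_derive (em_G U) y (em_g U y) /\ is_derive (em_g U) y (em_g1 U y) /\
  is_derive (em_g1 U) y (em_g2 U y) /\ is_derive (em_g2 U) y (em_g3 U y).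
Proof.
  intros hU. assert (hp : 0 < U ^ 2 + y ^ 2) by (generalize (pow2_ge_0 y); nra).
  assert (hs := sqrt_lt_R0 _ hp). assert (e := sqrt_sum_sqr_pow2 U y).
  assert (e' : U ^ 2 = sqrt (U ^ 2 + y ^ 2) ^ 2 - y ^ 2) by lra.
  assert (e4 : U ^ 4 = (sqrt (U ^ 2 + y ^ 2) ^ 2 - y ^ 2) ^ 2) by (rewrite <- e'; ring).
  assert (hne : forall n, sqrt (U ^ 2 + y ^ 2) ^ n <> 0) by (intros n; apply pow_nonzero; lra).
  refine (conj _ (conj _ (conj _ _))).
  - unfold em_G, em_g. auto_derive.
    + simpl in *; auto.
    + replace (U * (U * 1) + y * (y * 1)) with (U ^ 2 + y ^ 2) by ring. set (s := sqrt (U ^ 2 + y ^ 2)) in *.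
      rewrite e'. field. lra.
  - unfold em_g, em_g1. auto_derive.
    + simpl in *. repeat split; auto. lra.
    + replace (U * (U * 1) + y * (y * 1)) with (U ^ 2 + y ^ 2) by ring. set (s := sqrt (U ^ 2 + y ^ 2)) in *.
      replace (U * (U * 1)) with (U ^ 2) by ring. rewrite ?e'. field. lra.
  - unfold em_g1, em_g2. auto_derive.
    + simpl in *. repeat split; auto; try lra. apply Rgt_not_eq. repeat apply Rmult_lt_0_compat; lra.
    + replace (U * (U * 1) + y * (y * 1)) with (U ^ 2 + y ^ 2) by ring. set (s := sqrt (U ^ 2 + y ^ 2)) in *.
      replace (U * (U * 1)) with (U ^ 2) by ring. rewrite ?e4, ?e'. field. lra.
  - unfold em_g2, em_g3. auto_derive.
    + simpl in *. repeat split; auto; try lra. apply Rgt_not_eq. repeat apply Rmult_lt_0_compat; lra.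
    + replace (U * (U * 1) + y * (y * 1)) with (U ^ 2 + y ^ 2) by ring. set (s := sqrt (U ^ 2 + y ^ 2)) in *.
      field. lra.
Qed.

Lemma em_g3_bound U x y : 0 < U -> 0 <= x <= y -> Rabs (em_g3 U y) <= 15 / 2 * / (U ^ 2 + x ^ 2).
Proof.
  intros hU hxy. unfold em_g3. rewrite Rabs_Ropp.
  assert (hb := sqrt_sum_sqr_bounds U y ltac:(lra) ltac:(lra)). assert (e := sqrt_sum_sqr_pow2 U y).
  set (s := sqrt (U ^ 2 + y ^ 2)) in *. assert (hs : 0 < s) by lra.
  assert (hx : 0 < U ^ 2 + x ^ 2 <= s ^ 2) by (rewrite e; split; nra).
  assert (hU4 : 0 < U ^ 4) by (apply pow_lt; auto).
  rewrite Rabs_pos_eq.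
  - apply Rle_trans with (15 * s ^ 4 * s / (2 * s ^ 7)).
    + unfold Rdiv. apply Rmult_le_compat_r; [left; apply Rinv_0_lt_compat; assert (0 < s ^ 7) by (apply pow_lt; auto); lra|].
      apply Rmult_le_compat; try lra. apply Rmult_le_compat_l; [lra|]. apply pow_incr; lra.
    + replace (15 * s ^ 4 * s / (2 * s ^ 7)) with (15 / 2 * / s ^ 2) by (field; lra).
      apply Rmult_le_compat_l; [lra|]. apply Rinv_le_contravar; lra.
  - apply Rdiv_le_0_compat; [|assert (0 < s ^ 7) by (apply pow_lt; auto); lra].
    apply Rmult_le_pos; lra.
Qed.

Lemma euler_maclaurin_sum bt l U M : 0 < bt -> 0 <= l <= 1 -> 0 < U ->
  Rabs (rsum (fold l (fun a => em_g U (bt * sqrt a))) M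
        - 2 / bt * (em_G U (bt * INR M) - em_G U 0) - B2 l * (bt * (em_g1 U (bt * INR M) - em_g1 U 0)))
  <= 75 / 2 * bt ^ 3 * rsum (fun j => / (U ^ 2 + (bt * INR j) ^ 2)) M.
Proof.
  intros hb hl hU. assert (hb2 : 0 < bt ^ 2) by nra. assert (hb3 : 0 < bt ^ 3) by (apply pow_lt; auto).
  induction M as [|M IH].
  - simpl. rewrite !Rmult_0_r, !Rminus_diag, !Rmult_0_r, !Rminus_0_r, Rabs_R0. lra.
  - rewrite !rsum_S. set (j := INR M) in *. assert (hj : 0 <= j) by apply pos_INR.
    assert (hlin : forall x, is_derive (fun x => bt * (j + x)) x bt) by (intros x; auto_derive; auto; ring).
    assert (hcomp : forall (h : R -> R) d x, is_derive h (bt * (j + x)) d -> is_derive (fun x => h (bt * (j + x))) x (bt * d)).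
    { intros h d x hd. apply (is_derive_comp h (fun x => bt * (j + x)) x d bt); auto. }
    assert (k := euler_maclaurin_cell (fun x => / bt * em_G U (bt * (j + x))) (fun x => em_g U (bt * (j + x)))
      (fun x => bt * em_g1 U (bt * (j + x))) (fun x => bt ^ 2 * em_g2 U (bt * (j + x))) (fun x => bt ^ 3 * em_g3 U (bt * (j + x)))
      (bt ^ 3 * (15 / 2 * / (U ^ 2 + (bt * j) ^ 2))) l).
    assert (hpos : 0 < / (U ^ 2 + (bt * j) ^ 2)) by (apply Rinv_0_lt_compat; generalize (pow2_ge_0 (bt * j)); nra).
    specialize (k ltac:(nra) hl).
    assert (D0 : forall x, is_derive (fun x => / bt * em_G U (bt * (j + x))) x (em_g U (bt * (j + x)))).
    { intros x. evar_last.
      - apply (is_derive_scal (fun x => em_G U (bt * (j + x))) x _ (bt * em_g U (bt * (j + x)))).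
        apply hcomp. apply (em_derivatives U (bt * (j + x)) hU).
      - field; lra. }
    assert (D1 : forall x, is_derive (fun x => em_g U (bt * (j + x))) x (bt * em_g1 U (bt * (j + x)))).
    { intros x. apply hcomp. apply (em_derivatives U (bt * (j + x)) hU). }
    assert (D2 : forall x, is_derive (fun x => bt * em_g1 U (bt * (j + x))) x (bt ^ 2 * em_g2 U (bt * (j + x)))).
    { intros x. evar_last.
      - apply (is_derive_scal (fun x => em_g1 U (bt * (j + x))) x _ (bt * em_g2 U (bt * (j + x)))).
        apply hcomp. apply (em_derivatives U (bt * (j + x)) hU).
      - ring. }
    assert (D3 : forall x, is_derive (fun x => bt ^ 2 * em_g2 U (bt * (j + x))) x (bt ^ 3 * em_g3 U (bt * (j + x)))).
    { intros x. evar_last.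
      - apply (is_derive_scal (fun x => em_g2 U (bt * (j + x))) x _ (bt * em_g3 U (bt * (j + x)))).
        apply hcomp. apply (em_derivatives U (bt * (j + x)) hU).
      - ring. }
    assert (k' := k (fun x _ => D0 x) (fun x _ => D1 x) (fun x _ => D2 x) (fun x _ => D3 x)).
    cbv beta in k'.
    assert (D4 : forall x, 0 <= x <= 1 -> Rabs (bt ^ 3 * em_g3 U (bt * (j + x))) <= bt ^ 3 * (15 / 2 * / (U ^ 2 + (bt * j) ^ 2))).
    { intros x hx. rewrite Rabs_mult, (Rabs_pos_eq (bt ^ 3)) by lra.
      apply Rmult_le_compat_l; [lra|apply em_g3_bound; auto; split; nra]. }
    specialize (k' D4).
    clear k.
    assert (ef : fold l (fun a => em_g U (bt * sqrt a)) M = em_g U (bt * (j + l)) + em_g U (bt * (j + (1 - l)))).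
    { unfold fold. fold j. rewrite !sqrt_pow2 by lra. f_equal. f_equal. ring. }
    rewrite ef. rewrite S_INR. fold j. rewrite Rplus_0_r in k'.
    match goal with |- Rabs ?a <= _ => match type of IH with Rabs ?b <= _ => match type of k' with Rabs ?c <= _ =>
      replace a with (b + c) by (field; lra); generalize (Rabs_triang b c) end end end.
    lra.
Qed.

Lemma em_tail_sum bt U M : 0 < bt -> 1 <= U / bt -> rsum (fun j => / (U ^ 2 + (bt * INR j) ^ 2)) M <= 17 * PI / (bt * U).
Proof.
  intros hb hU. set (t := U / bt) in *. assert (hpi := PI_RGT_0).
  assert (hphi : phi_sum 0 (t ^ 2) M <= phi 0 t).
  { apply is_lim_seq_incr_le; [|apply phi_series; lra].
    apply rsum_incr. intros k. apply fold_pos. intros a ha. apply inv_nonneg; auto. nra. }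
  assert (hpsi : phi 0 t <= 17 * PI / t).
  { unfold phi. assert (h := psi_near_1 0 t hU). assert (h' := rho_le_half t hU).
    apply Rabs_le_between in h. replace (17 * PI / t) with (PI / t * 17) by (field; lra).
    apply Rmult_le_compat_l; [apply Rdiv_le_0_compat; lra|]. lra. }
  apply Rle_trans with (/ bt ^ 2 * phi_sum 0 (t ^ 2) M).
  - unfold phi_sum. rewrite <- rsum_scal. apply rsum_le. intros k _. unfold fold. rewrite Rplus_0_r, Rminus_0_r.
    assert (0 < t ^ 2) by nra.
    assert (h1 : 0 < / (INR k ^ 2 + t ^ 2)) by (apply Rinv_0_lt_compat; generalize (pow2_ge_0 (INR k)); lra).
    assert (h2 : 0 < / ((INR k + 1) ^ 2 + t ^ 2)) by (apply Rinv_0_lt_compat; generalize (pow2_ge_0 (INR k + 1)); lra).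
    replace (/ (U ^ 2 + (bt * INR k) ^ 2)) with (/ bt ^ 2 * / (INR k ^ 2 + t ^ 2)).
    + apply Rmult_le_compat_l; [|lra]. left; apply Rinv_0_lt_compat; nra.
    + unfold t. field. assert (0 < U). { replace U with (t * bt) by (unfold t; field; lra). nra. }
      split; [|lra]. generalize (pow2_ge_0 (bt * INR k)); nra.
  - replace (17 * PI / (bt * U)) with (/ bt ^ 2 * (17 * PI / t)).
    + apply Rmult_le_compat_l; [|lra]. left; apply Rinv_0_lt_compat; nra.
    + assert (0 < U). { replace U with (t * bt) by (unfold t; field; lra). nra. }
      unfold t. field. lra.
Qed.

(** * The regularised moment of the lattice sum *)

(* [ell l t = ln |1 - exp (2 PI i l - 2 PI t)|]. *)
Definition ell (l t : R) : R := ln (den l t) / 2.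

Lemma abs_ln_le x m : 0 < m <= 1 -> m <= x -> Rabs (ln x) <= Rabs (x - 1) / m.
Proof.
  intros hm hx.
  assert (h1 : ln x <= x - 1) by (generalize (exp_ineq1_le (ln x)); rewrite exp_ln by lra; lra).
  assert (h2 : ln (/ x) <= / x - 1).
  { generalize (exp_ineq1_le (ln (/ x))). rewrite exp_ln by (apply Rinv_0_lt_compat; lra). lra. }
  rewrite ln_Rinv in h2 by lra.
  assert (hp := Rabs_pos (x - 1)). assert (hr := Rle_abs (x - 1)). assert (hr' := Rle_abs (- (x - 1))). rewrite Rabs_Ropp in hr'.
  assert (hm1 : Rabs (x - 1) <= Rabs (x - 1) / m).
  { apply Rle_div_r; [lra|]. nra. }
  apply Rabs_le. split; [|lra].
  assert (h3 : 1 - / x = (x - 1) / x) by (field; lra).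
  assert (- (Rabs (x - 1) / m) <= (x - 1) / x); [|lra].
  destruct (Rle_lt_dec 1 x) as [h|h].
  - assert (0 <= (x - 1) / x) by (apply Rdiv_le_0_compat; lra). assert (0 <= Rabs (x - 1) / m) by lra. lra.
  - assert ((1 - x) / x <= Rabs (x - 1) / m).
    { assert (0 < / x) by (apply Rinv_0_lt_compat; lra). assert (/ x <= / m) by (apply Rinv_le_contravar; lra).
      unfold Rdiv. apply Rmult_le_compat; lra. }
    replace ((x - 1) / x) with (- ((1 - x) / x)) by (field; lra). lra.
Qed.

Lemma ell_small l t : 1 <= t -> Rabs (ell l t) <= 6 * rho t.
Proof.
  intros ht. assert (h1 := rho_pos t). assert (h2 := rho_le_half t ht).
  assert (h3 := COS_bound (2 * PI * l)). assert (hd : / 4 <= den l t) by (unfold den; nra).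
  assert (h := abs_ln_le (den l t) (/ 4) ltac:(lra) hd).
  assert (hd1 : Rabs (den l t - 1) <= 3 * rho t) by (unfold den; apply Rabs_le; nra).
  unfold ell. unfold Rdiv. rewrite Rabs_mult, (Rabs_pos_eq (/ 2)) by lra.
  replace (Rabs (den l t - 1) / / 4) with (4 * Rabs (den l t - 1)) in h by field. lra.
Qed.

Lemma den_lower l t : 0 <= t -> (1 - rho t) ^ 2 <= den l t /\ 2 * rho t * (1 - cos (2 * PI * l)) <= den l t.
Proof.
  intros ht. unfold den. assert (h1 := rho_pos t). assert (h3 := COS_bound (2 * PI * l)).
  split; [nra|]. generalize (pow2_ge_0 (1 - rho t)). nra.
Qed.

Lemma cos_2PI_lt_1 l : 0 <= l <= 1 -> l <> 0 -> l <> 1 -> cos (2 * PI * l) < 1.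
Proof.
  intros hl h0 h1. assert (hpi := PI_RGT_0).
  replace (2 * PI * l) with (2 * (PI * l)) by ring. rewrite cos_2a_sin.
  assert (0 < sin (PI * l)) by (apply sin_gt_0; nra). nra.
Qed.

Lemma ell_summable bt l1 l2 : admissible bt l1 l2 -> exists C, 0 <= C /\ forall n : Z,
  0 < den l1 (bt * sqrt ((IZR n + l2) ^ 2)) /\
  Rabs (ell l1 (bt * sqrt ((IZR n + l2) ^ 2))) <= C * exp (- (2 * PI * bt * sqrt ((IZR n + l2) ^ 2))).
Proof.
  intros [hb [h1 [h2 hl]]]. assert (hpi := PI_RGT_0).
  assert (hd : exists d0, 0 < d0 <= 1 /\ forall n : Z, d0 <= den l1 (bt * sqrt ((IZR n + l2) ^ 2)) \/ 1 <= bt * sqrt ((IZR n + l2) ^ 2)).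
  { destruct hl as [[e0 e1]|[e0 e1]].
    - assert (hc := cos_2PI_lt_1 l1 h1 e0 e1).
      assert (hp : 0 < 2 * exp (- (2 * PI)) * (1 - cos (2 * PI * l1))).
      { assert (0 < exp (- (2 * PI))) by apply exp_pos. nra. }
      exists (Rmin 1 (2 * exp (- (2 * PI)) * (1 - cos (2 * PI * l1)))).
      split; [split; [apply Rmin_pos; lra|apply Rmin_l]|]. intros n.
      set (t := bt * sqrt ((IZR n + l2) ^ 2)).
      assert (ht : 0 <= t) by (apply Rmult_le_pos; [lra|apply sqrt_pos]).
      destruct (Rle_lt_dec 1 t) as [h|h]; [right; auto|left].
      eapply Rle_trans; [apply Rmin_r|]. destruct (den_lower l1 t ht) as [_ hh].
      eapply Rle_trans; [|exact hh]. apply Rmult_le_compat_r; [lra|]. apply Rmult_le_compat_l; [lra|].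
      unfold rho. apply exp_le. nra.
    - set (m := bt * sqrt (Rmin (l2 ^ 2) ((1 - l2) ^ 2))).
      assert (hm : 0 < m). { apply Rmult_lt_0_compat; auto. apply sqrt_lt_R0. apply min_sqr_pos; auto. }
      assert (hr := rho_lt_1 m hm).
      exists (Rmin 1 ((1 - rho m) ^ 2)). split; [split; [apply Rmin_pos; [lra|apply pow_lt; lra]|apply Rmin_l]|].
      intros n. left. set (t := bt * sqrt ((IZR n + l2) ^ 2)).
      assert (ht : m <= t).
      { unfold m, t. apply Rmult_le_compat_l; [lra|]. apply sqrt_le_1_alt. apply sqr_shift_ge; auto. }
      eapply Rle_trans; [apply Rmin_r|]. destruct (den_lower l1 t ltac:(lra)) as [hh _].
      eapply Rle_trans; [|exact hh]. apply pow_incr. split; [lra|].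
      assert (rho t <= rho m); [|lra]. unfold rho. apply exp_le. nra. }
  destruct hd as [d0 [hd0 hd]].
  set (C0 := 3 / d0). assert (hC0 : 0 < C0) by (apply Rdiv_lt_0_compat; lra).
  exists (6 + C0 * exp (2 * PI)). split. { assert (0 < exp (2 * PI)) by apply exp_pos. nra. }
  intros n. specialize (hd n).
  replace (2 * PI * bt * sqrt ((IZR n + l2) ^ 2)) with (2 * PI * (bt * sqrt ((IZR n + l2) ^ 2))) by ring.
  set (t := bt * sqrt ((IZR n + l2) ^ 2)) in *.
  assert (ht : 0 <= t) by (apply Rmult_le_pos; [lra|apply sqrt_pos]).
  assert (he : 0 < exp (2 * PI)) by apply exp_pos. assert (hr := rho_pos t). unfold rho in hr.
  destruct (Rle_lt_dec 1 t) as [h|h].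
  - split; [apply den_pos; lra|]. eapply Rle_trans; [apply ell_small; auto|]. unfold rho.
    apply Rmult_le_compat_r; nra.
  - destruct hd as [hd|hd]; [|lra]. split; [lra|].
    assert (hb2 : Rabs (ln (den l1 t)) <= Rabs (den l1 t - 1) / d0) by (apply abs_ln_le; auto).
    assert (hb3 : Rabs (den l1 t - 1) <= 3).
    { unfold den. assert (k1 := rho_pos t). assert (k2 : rho t <= 1).
      { unfold rho. rewrite <- exp_0. apply exp_le. nra. }
      generalize (COS_bound (2 * PI * l1)). intros. apply Rabs_le. nra. }
    assert (hb4 : Rabs (den l1 t - 1) / d0 <= C0).
    { unfold C0, Rdiv. apply Rmult_le_compat_r; auto. left; apply Rinv_0_lt_compat; lra. }
    unfold ell, Rdiv. rewrite Rabs_mult, (Rabs_pos_eq (/ 2)) by lra.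
    assert (h1e : 1 <= exp (2 * PI) * exp (- (2 * PI * t))).
    { rewrite <- exp_plus, <- exp_0. apply exp_le. nra. }
    assert (hp := Rabs_pos (ln (den l1 t))).
    apply Rle_trans with C0; [lra|]. nra.
Qed.

(* A primitive of [u^3 X l (sqrt (u^2 + b^2))], with limit at [u = 0]
   [PI b + ln |1 - exp (2 PI i l - 2 PI b)|]. *)
Definition cube_X_primitive (l b u : R) : R :=
  PI * sqrt (u ^ 2 + b ^ 2) + ell l (sqrt (u ^ 2 + b ^ 2))
  - PI / 2 * (u ^ 2 / sqrt (u ^ 2 + b ^ 2)) * psi l (sqrt (u ^ 2 + b ^ 2)).

Lemma is_derive_ell l t : 0 < t -> is_derive (ell l) t (PI * psi l t - PI).
Proof.
  intros ht. assert (hd := den_pos l t ht).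
  assert (dl : is_derive ln (den l t) (/ den l t)) by (apply is_derive_Reals, derivable_pt_lim_ln; auto).
  assert (d := is_derive_scal _ t (/ 2) _ (is_derive_comp ln (den l) t _ _ dl (is_derive_den l t))).
  eapply is_derive_ext; [|evar_last; [exact d|]].
  - intros x. unfold ell. simpl. field.
  - unfold scal; simpl; unfold mult; simpl. unfold psi. unfold den in *. field. lra.
Qed.

Lemma is_derive_cube_X_primitive l b u : 0 < u -> is_derive (cube_X_primitive l b) u (u ^ 3 * X l (sqrt (u ^ 2 + b ^ 2))).
Proof.
  intros hu. assert (hp : 0 < u ^ 2 + b ^ 2) by (generalize (pow2_ge_0 b); nra).
  assert (hs := sqrt_lt_R0 _ hp).
  set (T := fun u => sqrt (u ^ 2 + b ^ 2)).
  assert (dT : is_derive T u (u / T u)).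
  { unfold T. auto_derive; [simpl in *; auto|]. simpl in *. field. lra. }
  assert (hT : 0 < T u) by exact hs.
  assert (d1 : is_derive (fun u => ell l (T u)) u (u / T u * (PI * psi l (T u) - PI))).
  { apply (is_derive_comp (ell l) T); auto. apply is_derive_ell; auto. }
  assert (d2 : is_derive (fun u => psi l (T u)) u (u / T u * dpsi l (T u))).
  { apply (is_derive_comp (psi l) T); auto. apply is_derive_psi; auto. }
  assert (d3 : is_derive (fun u => u ^ 2 / T u) u ((2 * u * T u - u ^ 2 * (u / T u)) / T u ^ 2)).
  { apply (is_derive_div (fun u => u ^ 2) T u (2 * u) (u / T u)); [auto_derive; auto; ring|auto|lra]. }
  assert (d4 : is_derive (fun u => u ^ 2 / T u * psi l (T u)) u
    ((2 * u * T u - u ^ 2 * (u / T u)) / T u ^ 2 * psi l (T u) + u ^ 2 / T u * (u / T u * dpsi l (T u)))).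
  { apply (is_derive_mult (fun u => u ^ 2 / T u) (fun u => psi l (T u))); auto. intros; apply Rmult_comm. }
  assert (d5 := is_derive_plus _ _ _ _ _ (is_derive_plus _ _ _ _ _ (is_derive_scal T u PI _ dT) d1)
     (is_derive_scal _ u (- (PI / 2)) _ d4)).
  eapply is_derive_ext; [|evar_last; [exact d5|]].
  - intros x. unfold cube_X_primitive. fold (T x).
    match goal with |- plus (plus ?a1 ?a2) ?a3 = _ => change (a1 + a2 + a3 = PI * T x + ell l (T x) - PI / 2 * (x ^ 2 / T x) * psi l (T x)) end. ring.
  - match goal with |- plus (plus ?a1 ?a2) ?a3 = _ => change (a1 + a2 + a3 = u ^ 3 * X l (T u)) end.
    unfold X. field. lra.
Qed.

Lemma is_lim_seq_squeeze_abs (u v : nat -> R) (l : R) :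
  (forall n, Rabs (u n - l) <= v n) -> is_lim_seq v 0 -> is_lim_seq u l.
Proof.
  intros h hv. apply is_lim_seq_spec. apply is_lim_seq_spec in hv. intros e. destruct (hv e) as [N hN].
  exists N. intros n hn. specialize (hN n hn). specialize (h n). rewrite Rminus_0_r in hN.
  generalize (Rle_abs (v n)); lra.
Qed.

Lemma is_lim_seq_inv_n (K : R) : is_lim_seq (fun n => K / (INR n + 2)) 0.
Proof.
  apply is_lim_seq_ext with (fun n => K * / (INR n + 2)); [reflexivity|].
  replace (Finite 0) with (Rbar_mult K (Finite 0)) by (simpl; f_equal; ring).
  apply is_lim_seq_scal_l.
  replace (Finite 0) with (Rbar_inv p_infty) by reflexivity.
  apply is_lim_seq_inv; [|discriminate].
  apply is_lim_seq_le_p_loc with INR; [|apply is_lim_seq_INR].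
  exists 0%nat. intros n _. lra.
Qed.

Lemma cube_X_primitive_lim_0 l b U : 0 <= b -> 0 < den l b -> 0 < U ->
  is_lim_seq (fun n => cube_X_primitive l b (U / (INR n + 2))) (PI * b + ell l b).
Proof.
  intros hb hd hU. set (e := fun n => U / (INR n + 2)).
  assert (he : forall n, 0 < e n) by (intros n; apply Rdiv_lt_0_compat; auto; generalize (pos_INR n); lra).
  assert (hel := is_lim_seq_inv_n U). fold e in hel.
  set (T := fun n => sqrt (e n ^ 2 + b ^ 2)).
  assert (hT : is_lim_seq T b).
  { apply is_lim_seq_squeeze_abs with e; auto. intros n. specialize (he n).
    assert (h := sqrt_sum_sqr_bounds (e n) b ltac:(lra) hb). fold (T n) in h. rewrite Rabs_pos_eq; lra. }
  assert (hell : is_lim_seq (fun n => ell l (T n)) (ell l b)).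
  { apply (is_lim_seq_continuous (ell l)); auto. apply continuity_pt_filterlim.
    apply (ex_derive_continuous (ell l)). unfold ell. unfold den, rho in *. auto_derive. simpl in *. auto. }
  assert (hpsi : is_lim_seq (fun n => psi l (T n)) (psi l b)).
  { apply (is_lim_seq_continuous (psi l)); auto. apply continuity_pt_filterlim.
    apply (ex_derive_continuous (psi l)). unfold psi. unfold den, rho in *. auto_derive. simpl in *. lra. }
  assert (h3 : is_lim_seq (fun n => PI / 2 * (e n ^ 2 / T n) * psi l (T n)) 0).
  { replace (Finite 0) with (Finite (0 * psi l b)) by (f_equal; ring).
    apply is_lim_seq_mult'; auto.
    apply is_lim_seq_squeeze_abs with (fun n => PI / 2 * e n).
    - intros n. specialize (he n). assert (hpi := PI_RGT_0).
      assert (h := sqrt_sum_sqr_bounds (e n) b ltac:(lra) hb). fold (T n) in h.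
      rewrite Rminus_0_r, Rabs_pos_eq.
      + apply Rmult_le_compat_l; [lra|]. apply Rle_div_l; [lra|]. nra.
      + apply Rmult_le_pos; [lra|]. apply Rdiv_le_0_compat; nra.
    - replace (Finite 0) with (Finite (PI / 2 * 0)) by (f_equal; ring). apply (is_lim_seq_scal_l e (PI / 2) (Finite 0)), hel. }
  apply is_lim_seq_ext with (fun n => PI * T n + ell l (T n) - PI / 2 * (e n ^ 2 / T n) * psi l (T n)); [reflexivity|].
  replace (PI * b + ell l b) with (PI * b + ell l b - 0) by ring.
  apply is_lim_seq_minus'; auto. apply is_lim_seq_plus'; auto.
  apply (is_lim_seq_scal_l T PI (Finite b)), hT.
Qed.

Lemma is_lim_seq_rsum (f : nat -> nat -> R) (g : nat -> R) M :
  (forall k, is_lim_seq (fun n => f n k) (g k)) -> is_lim_seq (fun n => rsum (f n) M) (rsum g M).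
Proof.
  intros h. induction M as [|M IH]; [apply is_lim_seq_const|].
  apply (is_lim_seq_plus' (fun n => rsum (f n) M) (fun n => f n M)); auto.
Qed.

Lemma cube_Y_continuous (Y : R -> R) u : continuous Y u -> continuous (fun u => u ^ 3 * Y u) u.
Proof.
  intros h. apply (continuous_mult (fun u => u ^ 3) Y); auto.
  apply (ex_derive_continuous (fun u => u ^ 3)). auto_derive; auto.
Qed.

Lemma RInt_lim_0 (f : R -> R) U : 0 < U -> (forall u, continuous f u) ->
  is_lim_seq (fun n => RInt f (U / (INR n + 2)) U) (RInt f 0 U).
Proof.
  intros hU hc.
  assert (hex : forall a b, ex_RInt f a b).
  { intros a b. apply (ex_RInt_continuous (V := R_CompleteNormedModule)). auto. }
  destruct (ex_RInt_ub (V := R_NormedModule) f 0 U (hex 0 U)) as [B hB]. rewrite Rmin_left, Rmax_right in hB by lra.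
  apply is_lim_seq_squeeze_abs with (fun n => B * (U / (INR n + 2))).
  - intros n. set (e := U / (INR n + 2)).
    assert (he : 0 < e) by (apply Rdiv_lt_0_compat; auto; generalize (pos_INR n); lra).
    assert (heU : e <= U). { unfold e. apply Rle_div_l; [generalize (pos_INR n); lra|]. generalize (pos_INR n); nra. }
    assert (hch := RInt_Chasles (V := R_CompleteNormedModule) f 0 e U (hex _ _) (hex _ _)). unfold plus in hch; simpl in hch.
    rewrite <- hch. replace (RInt f e U - (RInt f 0 e + RInt f e U)) with (- RInt f 0 e) by rring.
    rewrite Rabs_Ropp. replace (B * e) with ((e - 0) * B) by ring. apply abs_RInt_le_const; auto; [lra|].
    intros t ht. apply (hB t). lra.
  - replace (Finite 0) with (Finite (B * 0)) by (f_equal; ring). apply (is_lim_seq_scal_l _ B (Finite 0)), is_lim_seq_inv_n.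
Qed.

Lemma Yiter_cube_int bt l1 l2 M e U : admissible bt l1 l2 -> 0 < e -> e <= U ->
  is_RInt (fun u => u ^ 3 * Yiter bt l1 l2 u M) e U
    (rsum (fold l2 (fun a => cube_X_primitive l1 (bt * sqrt a) U - cube_X_primitive l1 (bt * sqrt a) e)) M).
Proof.
  intros hadm he heU. destruct hadm as [hb [h1 [h2 _]]].
  assert (hterm : forall a, 0 <= a -> is_RInt (fun u => u ^ 3 * X l1 (sqrt (bt ^ 2 * a + u ^ 2))) e U
     (cube_X_primitive l1 (bt * sqrt a) U - cube_X_primitive l1 (bt * sqrt a) e)).
  { intros a ha.
    assert (ea : (bt * sqrt a) ^ 2 = bt ^ 2 * a) by (rewrite Rpow_mult_distr, pow2_sqrt; auto).
    apply (is_RInt_ext (V := R_NormedModule) (fun u => u ^ 3 * X l1 (sqrt (u ^ 2 + (bt * sqrt a) ^ 2)))).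
    { intros u _. rewrite ea. do 3 f_equal. ring. }
    apply (is_RInt_derive (V := R_CompleteNormedModule) (cube_X_primitive l1 (bt * sqrt a))); rewrite Rmin_left, Rmax_right by lra.
    - intros x hx. apply is_derive_cube_X_primitive. lra.
    - intros x hx. apply (continuous_mult (fun u => u ^ 3) (fun u => X l1 (sqrt (u ^ 2 + (bt * sqrt a) ^ 2)))).
      + apply (ex_derive_continuous (fun u => u ^ 3)). auto_derive; auto.
      + assert (hp : 0 < x ^ 2 + (bt * sqrt a) ^ 2) by (generalize (pow2_ge_0 (bt * sqrt a)); nra).
        apply (continuous_comp (fun u => sqrt (u ^ 2 + (bt * sqrt a) ^ 2)) (X l1)).
        * apply (ex_derive_continuous (fun u => sqrt (u ^ 2 + (bt * sqrt a) ^ 2))). auto_derive. simpl in *; auto.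
        * apply continuous_X. apply sqrt_lt_R0; auto. }
  unfold Yiter. induction M as [|M IH].
  - simpl rsum. apply (is_RInt_ext (V := R_NormedModule) (fun _ => 0)); [intros x _; rring|].
    evar_last. apply (is_RInt_const (V := R_NormedModule)). unfold scal; simpl; unfold mult; simpl; ring.
  - rewrite rsum_S.
    apply (is_RInt_ext (V := R_NormedModule) (fun u => u ^ 3 * rsum (fold l2 (fun a => X l1 (sqrt (bt ^ 2 * a + u ^ 2)))) M
      + (u ^ 3 * X l1 (sqrt (bt ^ 2 * ((INR M + l2) ^ 2) + u ^ 2)) + u ^ 3 * X l1 (sqrt (bt ^ 2 * ((INR M + 1 - l2) ^ 2) + u ^ 2))))).
    + intros u _. rewrite rsum_S. unfold fold at 3. rring.
    + apply (is_RInt_plus (V := R_NormedModule)); [exact IH|].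
      apply (is_RInt_plus (V := R_NormedModule)); apply hterm, pow2_ge_0.
Qed.

Lemma Y_cube_integral (bt l1 l2 : R) (Y : R -> R) (U : R) : admissible bt l1 l2 -> 0 < U ->
  (forall u, is_lim_seq (fun N => Ybox bt l1 l2 N u) (Y u)) ->
  (forall N u, 0 <= Y u - Ybox bt l1 l2 N u <= Y 0 - Ybox bt l1 l2 N 0) ->
  (forall u, continuous Y u) ->
  is_lim_seq (rsum (fold l2 (fun a => cube_X_primitive l1 (bt * sqrt a) U - (PI * (bt * sqrt a) + ell l1 (bt * sqrt a)))))
    (RInt (fun u => u ^ 3 * Y u) 0 U).
Proof.
  intros hadm hU hlim htail hc.
  destruct (ell_summable bt l1 l2 hadm) as [Ce [_ hell]].
  assert (hbt : 0 < bt) by apply hadm.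
  set (D := fun a => cube_X_primitive l1 (bt * sqrt a) U - (PI * (bt * sqrt a) + ell l1 (bt * sqrt a))).
  set (e := fun n => U / (INR n + 2)).
  assert (he : forall n, 0 < e n <= U).
  { intros n. split; [apply Rdiv_lt_0_compat; auto; generalize (pos_INR n); lra|].
    apply Rle_div_l; [generalize (pos_INR n); lra|]. generalize (pos_INR n); nra. }
  assert (hD : forall M, is_lim_seq (fun n => rsum (fold l2 (fun a => cube_X_primitive l1 (bt * sqrt a) U - cube_X_primitive l1 (bt * sqrt a) (e n))) M)
     (rsum (fold l2 D) M)).
  { intros M. apply (is_lim_seq_rsum (fun n => fold l2 (fun a => cube_X_primitive l1 (bt * sqrt a) U - cube_X_primitive l1 (bt * sqrt a) (e n)))). intros k.
    apply is_lim_seq_ext with (fun n =>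
      (fun a => cube_X_primitive l1 (bt * sqrt a) U - cube_X_primitive l1 (bt * sqrt a) (e n)) ((IZR (Z.of_nat k) + l2) ^ 2)
      + (fun a => cube_X_primitive l1 (bt * sqrt a) U - cube_X_primitive l1 (bt * sqrt a) (e n)) ((IZR (- Z.of_nat k - 1) + l2) ^ 2)).
    { intros n. symmetry. apply fold_Z. }
    rewrite fold_Z. cbv beta.
    assert (q : forall i : Z, is_lim_seq (fun n => cube_X_primitive l1 (bt * sqrt ((IZR i + l2) ^ 2)) U - cube_X_primitive l1 (bt * sqrt ((IZR i + l2) ^ 2)) (e n)) (D ((IZR i + l2) ^ 2))).
    { intros i. unfold D. apply is_lim_seq_minus'; [apply is_lim_seq_const|]. apply cube_X_primitive_lim_0; auto.
      - apply Rmult_le_pos; [lra|apply sqrt_pos].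
      - apply hell. }
    apply is_lim_seq_plus'; apply q. }
  set (I := RInt (fun u => u ^ 3 * Y u) 0 U).
  assert (hYc : forall u, continuous (fun u => u ^ 3 * Y u) u) by (intros u; apply cube_Y_continuous; auto).
  assert (hYN : forall N u, continuous (fun u => u ^ 3 * Ybox bt l1 l2 N u) u).
  { intros N u; apply cube_Y_continuous. apply Ybox_continuous; auto. }
  assert (hexc : forall f : R -> R, (forall u, continuous f u) -> forall a b, ex_RInt f a b).
  { intros f hf a b. apply (ex_RInt_continuous (V := R_CompleteNormedModule)). auto. }
  assert (hlow : forall M, rsum (fold l2 D) M <= I).
  { intros M. apply (is_lim_seq_le (fun n => rsum (fold l2 (fun a => cube_X_primitive l1 (bt * sqrt a) U - cube_X_primitive l1 (bt * sqrt a) (e n))) M)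
      (fun n => RInt (fun u => u ^ 3 * Y u) (e n) U) (Finite (rsum (fold l2 D) M)) (Finite I)); auto.
    - intros n. apply (is_RInt_le (fun u => u ^ 3 * Yiter bt l1 l2 u M) (fun u => u ^ 3 * Y u) (e n) U); [apply he| | |].
      + apply Yiter_cube_int; auto; apply he.
      + apply (RInt_correct (V := R_CompleteNormedModule)), hexc; auto.
      + intros u hu. specialize (he n). apply Rmult_le_compat_l; [apply pow_le; lra|]. apply Yiter_le_lim; auto; lra.
    - apply RInt_lim_0; auto. }
  assert (hup : forall N, RInt (fun u => u ^ 3 * Ybox bt l1 l2 N u) 0 U <= rsum (fold l2 D) N).
  { intros N. apply (is_lim_seq_le (fun n => RInt (fun u => u ^ 3 * Ybox bt l1 l2 N u) (e n) U)
      (fun n => rsum (fold l2 (fun a => cube_X_primitive l1 (bt * sqrt a) U - cube_X_primitive l1 (bt * sqrt a) (e n))) N)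
      (Finite (RInt (fun u => u ^ 3 * Ybox bt l1 l2 N u) 0 U)) (Finite (rsum (fold l2 D) N))); auto.
    - intros n. apply (is_RInt_le (fun u => u ^ 3 * Ybox bt l1 l2 N u) (fun u => u ^ 3 * Yiter bt l1 l2 u N) (e n) U); [apply he| | |].
      + apply (RInt_correct (V := R_CompleteNormedModule)), hexc; auto.
      + apply Yiter_cube_int; auto; apply he.
      + intros u hu. specialize (he n). apply Rmult_le_compat_l; [apply pow_le; lra|]. apply Ybox_le_Yiter; auto; lra.
    - apply RInt_lim_0; auto. }
  apply is_lim_seq_squeeze_abs with (fun N => U * (U ^ 3 * (Y 0 - Ybox bt l1 l2 N 0))).
  - intros N. assert (hk : I - RInt (fun u => u ^ 3 * Ybox bt l1 l2 N u) 0 U <= U * (U ^ 3 * (Y 0 - Ybox bt l1 l2 N 0))).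
    { assert (hm := RInt_minus (V := R_CompleteNormedModule) (fun u => u ^ 3 * Y u) (fun u => u ^ 3 * Ybox bt l1 l2 N u) 0 U (hexc _ hYc _ _) (hexc _ (hYN N) _ _)).
      unfold I. change (RInt (fun u => u ^ 3 * Y u) 0 U - RInt (fun u => u ^ 3 * Ybox bt l1 l2 N u) 0 U) with
        (minus (RInt (fun u => u ^ 3 * Y u) 0 U) (RInt (fun u => u ^ 3 * Ybox bt l1 l2 N u) 0 U)).
      rewrite <- hm. replace (U * (U ^ 3 * (Y 0 - Ybox bt l1 l2 N 0))) with ((U - 0) * (U ^ 3 * (Y 0 - Ybox bt l1 l2 N 0))) by ring.
      eapply Rle_trans; [apply Rle_abs|]. apply abs_RInt_le_const; [lra| |].
      - apply (ex_RInt_minus (V := R_NormedModule)); apply hexc; auto.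
      - intros t ht. change (Rabs (t ^ 3 * Y t - t ^ 3 * Ybox bt l1 l2 N t) <= U ^ 3 * (Y 0 - Ybox bt l1 l2 N 0)).
        rewrite <- Rmult_minus_distr_l, Rabs_mult. destruct (htail N t) as [t1 t2].
        rewrite !Rabs_pos_eq; [|lra|apply pow_le; lra]. apply Rmult_le_compat; auto; [apply pow_le; lra|]. apply pow_incr; lra. }
    specialize (hlow N). specialize (hup N). fold I. rewrite Rabs_left1; lra.
  - replace (Finite 0) with (Finite (U * (U ^ 3 * (Y 0 - Y 0)))) by (f_equal; ring).
    apply (is_lim_seq_scal_l _ U (Finite (U ^ 3 * (Y 0 - Y 0)))). apply (is_lim_seq_scal_l _ (U ^ 3) (Finite (Y 0 - Y 0))).
    apply is_lim_seq_minus'; auto. apply is_lim_seq_const.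
Qed.

Lemma em_G_lim bt U : 0 < bt -> 0 < U -> is_lim_seq (fun M => em_G U (bt * INR M)) (U ^ 2 / 4).
Proof.
  intros hb hU. apply (is_lim_seq_incr_n _ 2).
  apply is_lim_seq_squeeze_abs with (fun n => (U ^ 3 / (4 * bt)) / (INR n + 2)); [|apply is_lim_seq_inv_n].
  intros n. rewrite plus_INR. simpl (INR 2). assert (hn := pos_INR n).
  set (y := bt * (INR n + (1 + 1))). assert (hy : 0 < y) by (unfold y; nra).
  assert (hs := sqrt_sum_sqr_bounds U y ltac:(lra) ltac:(lra)). assert (e := sqrt_sum_sqr_pow2 U y).
  unfold em_G. set (s := sqrt (U ^ 2 + y ^ 2)) in *.
  replace ((y * s - y ^ 2) / 2 - U ^ 2 / 4) with (- (U ^ 2 * ((s - y) / (4 * (s + y))))).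
  2: { replace (U ^ 2) with (s ^ 2 - y ^ 2) by lra. field. lra. }
  rewrite Rabs_Ropp, Rabs_pos_eq.
  2: { apply Rmult_le_pos; [nra|]. apply Rdiv_le_0_compat; lra. }
  replace (U ^ 3 / (4 * bt) / (INR n + 2)) with (U ^ 2 * (U / (4 * y))) by (unfold y; field; lra).
  apply Rmult_le_compat_l; [nra|].
  assert (0 < / (4 * (s + y))) by (apply Rinv_0_lt_compat; lra).
  assert (/ (4 * (s + y)) <= / (4 * y)) by (apply Rinv_le_contravar; lra).
  unfold Rdiv. apply Rmult_le_compat; lra.
Qed.

Lemma em_g1_lim bt U : 0 < bt -> 0 < U -> is_lim_seq (fun M => em_g1 U (bt * INR M)) 0.
Proof.
  intros hb hU. apply (is_lim_seq_incr_n _ 2).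
  apply is_lim_seq_squeeze_abs with (fun n => (2 * U / bt) / (INR n + 2)); [|apply is_lim_seq_inv_n].
  intros n. rewrite plus_INR. simpl (INR 2). assert (hn := pos_INR n).
  set (y := bt * (INR n + (1 + 1))). assert (hy : 0 < y) by (unfold y; nra).
  assert (hs := sqrt_sum_sqr_bounds U y ltac:(lra) ltac:(lra)).
  unfold em_g1. set (s := sqrt (U ^ 2 + y ^ 2)) in *. rewrite Rminus_0_r.
  replace (2 * U / bt / (INR n + 2)) with (U / y + U / y) by (unfold y; field; lra).
  replace (y / s + U ^ 2 * y / (2 * s ^ 3) - 1) with (- ((s - y) / s) + / 2 * ((U / s) * (U / s) * (y / s))) by (field; lra).
  assert (hi : 0 < / s <= / y) by (split; [apply Rinv_0_lt_compat; lra|apply Rinv_le_contravar; lra]).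
  assert (q1 : 0 <= (s - y) / s <= U / y).
  { split; [apply Rdiv_le_0_compat; lra|]. unfold Rdiv. apply Rmult_le_compat; lra. }
  assert (q2 : 0 <= U / s <= 1). { split; [apply Rdiv_le_0_compat; lra|]. apply Rle_div_l; lra. }
  assert (q3 : U / s <= U / y) by (apply Rmult_le_compat_l; lra).
  assert (q4 : 0 <= y / s <= 1). { split; [apply Rdiv_le_0_compat; lra|]. apply Rle_div_l; lra. }
  assert (q5 : 0 <= U / s * (U / s) <= U / y) by nra.
  assert (q6 : 0 <= U / s * (U / s) * (y / s) <= U / y) by nra.
  apply Rabs_le. lra.
Qed.

Lemma ell_series bt l1 l2 : admissible bt l1 l2 ->
  exists LP : R, is_lim_seq (rsum (fold l2 (fun a => ell l1 (bt * sqrt a)))) LP.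
Proof.
  intros hadm. destruct (ell_summable bt l1 l2 hadm) as [C [hC hell]].
  assert (hb : 0 < bt) by apply hadm. assert (h2 : 0 <= l2 <= 1) by apply hadm. assert (hpi := PI_RGT_0).
  set (E := fun a => C * exp (- (2 * PI * bt * sqrt a))).
  (* |f| <= E, so f + E is a nonnegative series *)
  assert (hE : forall n, rsum (fold l2 E) n <= C * (2 * / (1 - exp (- (2 * PI * bt))))).
  { intros n. unfold E. rewrite (rsum_ext _ (fun k => C * fold l2 (fun a => exp (- (2 * PI * bt * sqrt a))) k)) by (intros; apply fold_scal).
    rewrite rsum_scal. apply Rmult_le_compat_l; auto. apply exp_fold_sum; auto. nra. }
  assert (hEp : forall k, 0 <= fold l2 E k).
  { intros k. apply fold_pos. intros a _. apply Rmult_le_pos; auto. left; apply exp_pos. }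
  destruct (ex_finite_lim_seq_incr (rsum (fold l2 E)) _ (rsum_incr _ hEp) hE) as [x hx].
  assert (hz : forall k, 0 <= fold l2 (fun a => ell l1 (bt * sqrt a) + E a) k <= 2 * fold l2 E k).
  { intros k. rewrite <- fold_scal.
    assert (q : forall i : Z, - E ((IZR i + l2) ^ 2) <= ell l1 (bt * sqrt ((IZR i + l2) ^ 2)) <= E ((IZR i + l2) ^ 2)).
    { intros i. apply Rabs_le_between. apply hell. }
    rewrite !fold_Z. generalize (q (Z.of_nat k)) (q (- Z.of_nat k - 1)%Z). lra. }
  destruct (ex_finite_lim_seq_incr (rsum (fold l2 (fun a => ell l1 (bt * sqrt a) + E a)))
     (2 * (C * (2 * / (1 - exp (- (2 * PI * bt))))))) as [y hy].
  - apply rsum_incr. intros k. apply hz.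
  - intros n. apply Rle_trans with (2 * rsum (fold l2 E) n); [|specialize (hE n); lra].
    rewrite <- rsum_scal. apply rsum_le. intros k _. apply hz.
  - exists (y - x). apply is_lim_seq_ext with (fun n => rsum (fold l2 (fun a => ell l1 (bt * sqrt a) + E a)) n - rsum (fold l2 E) n).
    + intros n. rewrite <- rsum_minus. apply rsum_ext. intros k _. rewrite <- fold_minus. unfold fold. ring.
    + apply is_lim_seq_minus'; auto.
Qed.

Lemma sqr_exp_decay U : 1 <= U -> U ^ 2 * exp (- (PI * U)) <= 4 / U.
Proof.
  intros hU. assert (hpi := PI2_3_2).
  assert (h1 := sqr_le_exp U ltac:(lra)).
  assert (h2 := exp_ineq1_le ((PI - 1) * U)).
  assert (e : exp (PI * U) = exp U * exp ((PI - 1) * U)) by (rewrite <- exp_plus; f_equal; ring).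
  rewrite exp_Ropp. assert (h3 : 0 < exp (PI * U)) by apply exp_pos.
  apply Rmult_le_reg_r with (U * exp (PI * U)); [apply Rmult_lt_0_compat; lra|].
  replace (U ^ 2 * / exp (PI * U) * (U * exp (PI * U))) with (U ^ 2 * U) by (field; lra).
  replace (4 / U * (U * exp (PI * U))) with (4 * exp (PI * U)) by (field; lra).
  rewrite e, <- Rmult_assoc. apply Rmult_le_compat; try nra.
Qed.

Lemma Y_regularized_integral bt l1 l2 (Y : R -> R) : admissible bt l1 l2 ->
  (forall u, is_lim_seq (fun N => Ybox bt l1 l2 N u) (Y u)) ->
  (forall N u, 0 <= Y u - Ybox bt l1 l2 N u <= Y 0 - Ybox bt l1 l2 N 0) ->
  (forall u, continuous Y u) ->
  exists LP K : R, is_lim_seq (rsum (fold l2 (fun a => ell l1 (bt * sqrt a)))) LP /\ 0 <= K /\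
    forall U, 1 <= U -> bt <= U ->
      Rabs (RInt (fun u => u ^ 3 * Y u) 0 U - PI / bt * U ^ 2 / 2 - (PI * bt * B2 l2 - LP)) <= K / U.
Proof.
  intros hadm hlim htail hc.
  destruct (ell_series bt l1 l2 hadm) as [LP hLP].
  assert (hb : 0 < bt) by apply hadm. assert (h2 : 0 <= l2 <= 1) by apply hadm. assert (hpi := PI_RGT_0).
  set (G := 2 * / (1 - exp (- (PI * bt)))).
  assert (hG : 0 < G).
  { unfold G. apply Rmult_lt_0_compat; [lra|]. apply Rinv_0_lt_compat.
    assert (exp (- (PI * bt)) < 1); [|lra]. rewrite <- exp_0. apply exp_increasing. nra. }
  set (K1 := PI * (75 / 2 * bt ^ 3 * (17 * PI / bt))).
  set (K2 := (6 + 8 * PI) * G * 4).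
  assert (hK1 : 0 <= K1).
  { unfold K1. apply Rmult_le_pos; [lra|]. assert (0 < bt ^ 3) by (apply pow_lt; auto).
    assert (0 <= 17 * PI / bt) by (apply Rdiv_le_0_compat; lra). nra. }
  exists LP, (K1 + K2). split; [auto|]. split; [unfold K2; nra|].
  intros U hU hbU.
  assert (hmain := Y_cube_integral bt l1 l2 Y U hadm ltac:(lra) hlim htail hc).
  set (I := RInt (fun u => u ^ 3 * Y u) 0 U) in *.
  set (D := fun a => cube_X_primitive l1 (bt * sqrt a) U - (PI * (bt * sqrt a) + ell l1 (bt * sqrt a))) in *.
  set (rem := fun a => ell l1 (sqrt (U ^ 2 + (bt * sqrt a) ^ 2)) - PI / 2 * (U ^ 2 / sqrt (U ^ 2 + (bt * sqrt a) ^ 2)) * (psi l1 (sqrt (U ^ 2 + (bt * sqrt a) ^ 2)) - 1)).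
  assert (hrem : forall a, 0 <= a -> Rabs (rem a) <= (6 + 8 * PI * U ^ 2) * exp (- (PI * U)) * exp (- (PI * bt * sqrt a))).
  { intros a ha. unfold rem.
    assert (hs := sqrt_sum_sqr_bounds U (bt * sqrt a) ltac:(lra) ltac:(apply Rmult_le_pos; [lra|apply sqrt_pos])).
    assert (hr := rho_sqrt_le bt a U hb ha ltac:(lra)).
    replace (bt ^ 2 * a + U ^ 2) with (U ^ 2 + (bt * sqrt a) ^ 2) in hr by (rewrite Rpow_mult_distr, pow2_sqrt by auto; ring).
    set (T := sqrt (U ^ 2 + (bt * sqrt a) ^ 2)) in *.
    assert (k1 := ell_small l1 T ltac:(lra)). assert (k2 := psi_near_1 l1 T ltac:(lra)).
    assert (hUT : 0 <= U ^ 2 / T <= U ^ 2).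
    { split; [apply Rdiv_le_0_compat; nra|]. apply Rle_div_l; [lra|]. nra. }
    assert (k3 : Rabs (PI / 2 * (U ^ 2 / T) * (psi l1 T - 1)) <= PI / 2 * U ^ 2 * (16 * rho T)).
    { rewrite Rabs_mult, (Rabs_pos_eq (PI / 2 * (U ^ 2 / T))) by nra.
      apply Rmult_le_compat; auto; try nra. apply Rabs_pos. }
    assert (tri := Rabs_triang (ell l1 T) (- (PI / 2 * (U ^ 2 / T) * (psi l1 T - 1)))). rewrite Rabs_Ropp in tri.
    unfold Rminus at 1. eapply Rle_trans; [exact tri|].
    apply Rle_trans with ((6 + 8 * PI * U ^ 2) * rho T); [lra|].
    apply Rle_trans with ((6 + 8 * PI * U ^ 2) * (exp (- (PI * U)) * exp (- (PI * bt * sqrt a)))); [|right; ring].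
    apply Rmult_le_compat_l; [nra|exact hr]. }
  assert (hdec : forall M, rsum (fold l2 D) M = PI * rsum (fold l2 (fun a => em_g U (bt * sqrt a))) M + rsum (fold l2 rem) M
      - rsum (fold l2 (fun a => ell l1 (bt * sqrt a))) M).
  { intros M. rewrite <- rsum_scal, <- rsum_plus, <- rsum_minus. apply rsum_ext. intros k _.
    rewrite <- fold_scal, <- fold_plus, <- fold_minus.
    assert (q : forall a, 0 <= a -> D a = PI * em_g U (bt * sqrt a) + rem a - ell l1 (bt * sqrt a)).
    { intros a ha. unfold D, rem, cube_X_primitive, em_g.
      assert (hs := sqrt_sum_sqr_bounds U (bt * sqrt a) ltac:(lra) ltac:(apply Rmult_le_pos; [lra|apply sqrt_pos])).
      field. lra. }
    unfold fold. rewrite !q by apply pow2_ge_0. reflexivity. }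
  assert (hrsum : forall M, Rabs (rsum (fold l2 rem) M) <= (6 + 8 * PI * U ^ 2) * exp (- (PI * U)) * G).
  { intros M. apply Rle_trans with ((6 + 8 * PI * U ^ 2) * exp (- (PI * U)) * rsum (fold l2 (fun a => exp (- (PI * bt * sqrt a)))) M).
    - rewrite <- rsum_scal. induction M as [|M IH]; [simpl; rewrite Rabs_R0; lra|].
      rewrite !rsum_S. eapply Rle_trans; [apply Rabs_triang|]. apply Rplus_le_compat; auto.
      unfold fold. eapply Rle_trans; [apply Rabs_triang|]. rewrite Rmult_plus_distr_l.
      apply Rplus_le_compat; apply hrem, pow2_ge_0.
    - apply Rmult_le_compat_l; [|apply exp_fold_sum; auto; nra].
      apply Rmult_le_pos; [nra|left; apply exp_pos]. }
  assert (hUb : 1 <= U / bt) by (apply Rle_div_r; lra).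
  assert (hbound : forall M, Rabs (rsum (fold l2 D) M -
     (PI * (2 / bt * (em_G U (bt * INR M) - em_G U 0) + B2 l2 * (bt * (em_g1 U (bt * INR M) - em_g1 U 0)))
       - rsum (fold l2 (fun a => ell l1 (bt * sqrt a))) M)) <= (K1 + K2) / U).
  { intros M. rewrite hdec.
    assert (k := euler_maclaurin_sum bt l2 U M hb h2 ltac:(lra)).
    assert (k' := em_tail_sum bt U M hb hUb).
    set (S1 := rsum (fold l2 (fun a => em_g U (bt * sqrt a))) M) in *.
    set (S2 := rsum (fold l2 rem) M) in *. specialize (hrsum M). fold S2 in hrsum.
    set (S3 := rsum (fold l2 (fun a => ell l1 (bt * sqrt a))) M).
    set (x1 := 2 / bt * (em_G U (bt * INR M) - em_G U 0)) in *.
    set (x2 := B2 l2 * (bt * (em_g1 U (bt * INR M) - em_g1 U 0))) in *.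
    replace (PI * S1 + S2 - S3 - (PI * (x1 + x2) - S3)) with (PI * (S1 - x1 - x2) + S2) by ring.
    eapply Rle_trans; [apply Rabs_triang|]. rewrite Rabs_mult, (Rabs_pos_eq PI) by lra.
    replace ((K1 + K2) / U) with (K1 / U + K2 / U) by (field; lra).
    apply Rplus_le_compat.
    - unfold K1. replace (PI * (75 / 2 * bt ^ 3 * (17 * PI / bt)) / U) with (PI * (75 / 2 * bt ^ 3 * (17 * PI / (bt * U)))) by (field; lra).
      apply Rmult_le_compat_l; [lra|]. eapply Rle_trans; [exact k|]. apply Rmult_le_compat_l; auto.
      assert (0 < bt ^ 3) by (apply pow_lt; auto). lra.
    - eapply Rle_trans; [exact hrsum|]. unfold K2.
      assert (hdc := sqr_exp_decay U hU). assert (he : 0 < exp (- (PI * U))) by apply exp_pos.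
      assert (hU2 : 1 <= U ^ 2) by nra.
      apply Rle_trans with ((6 + 8 * PI) * (U ^ 2 * exp (- (PI * U))) * G).
      + apply Rmult_le_compat_r; [lra|].
        replace ((6 + 8 * PI) * (U ^ 2 * exp (- (PI * U)))) with ((6 + 8 * PI) * U ^ 2 * exp (- (PI * U))) by ring.
        apply Rmult_le_compat_r; nra.
      + replace ((6 + 8 * PI) * G * 4 / U) with ((6 + 8 * PI) * (4 / U) * G) by (field; lra).
        apply Rmult_le_compat_r; [lra|]. apply Rmult_le_compat_l; lra. }
  assert (e0 : em_G U 0 = 0) by (unfold em_G; field).
  assert (e1 : em_g1 U 0 = -1).
  { unfold em_g1. replace (U ^ 2 + 0 ^ 2) with (U ^ 2) by ring. rewrite sqrt_pow2 by lra. field. lra. }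
  assert (hfin : is_lim_seq (fun M => rsum (fold l2 D) M -
     (PI * (2 / bt * (em_G U (bt * INR M) - em_G U 0) + B2 l2 * (bt * (em_g1 U (bt * INR M) - em_g1 U 0)))
       - rsum (fold l2 (fun a => ell l1 (bt * sqrt a))) M))
     (I - (PI * (2 / bt * (U ^ 2 / 4 - em_G U 0) + B2 l2 * (bt * (0 - em_g1 U 0))) - LP))).
  { apply is_lim_seq_minus'; [exact hmain|]. apply is_lim_seq_minus'; auto.
    apply (is_lim_seq_scal_l _ PI (Finite (2 / bt * (U ^ 2 / 4 - em_G U 0) + B2 l2 * (bt * (0 - em_g1 U 0))))).
    apply is_lim_seq_plus'.
    - apply (is_lim_seq_scal_l _ (2 / bt) (Finite (U ^ 2 / 4 - em_G U 0))).
      apply is_lim_seq_minus'; [apply em_G_lim; auto; lra|apply is_lim_seq_const].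
    - apply (is_lim_seq_scal_l _ (B2 l2) (Finite (bt * (0 - em_g1 U 0)))).
      apply (is_lim_seq_scal_l _ bt (Finite (0 - em_g1 U 0))).
      apply is_lim_seq_minus'; [apply em_g1_lim; auto; lra|apply is_lim_seq_const]. }
  rewrite e0, e1 in hfin.
  replace (I - PI / bt * U ^ 2 / 2 - (PI * bt * B2 l2 - LP)) with
    (I - (PI * (2 / bt * (U ^ 2 / 4 - 0) + B2 l2 * (bt * (0 - -1))) - LP)) by (field; lra).
  eapply (is_lim_seq_le (fun M => Rabs _) (fun _ => (K1 + K2) / U) (Finite _) (Finite ((K1 + K2) / U))).
  - intros M. exact (hbound M).
  - rewrite e0, e1. apply (is_lim_seq_abs _ (Finite _)). exact hfin.
  - apply is_lim_seq_const.
Qed.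

(** * The beta integral *)

Lemma is_rcderive_plus f g x a b : is_rcderive f x a -> is_rcderive g x b -> is_rcderive (fun t => f t + g t)%C x (a + b)%C.
Proof.
  intros [f1 f2] [g1 g2]. split.
  - apply (is_derive_plus (fun t => Re (f t)) (fun t => Re (g t))); auto.
  - apply (is_derive_plus (fun t => Im (f t)) (fun t => Im (g t))); auto.
Qed.

Lemma is_rcderive_mult f g x a b : is_rcderive f x a -> is_rcderive g x b ->
  is_rcderive (fun t => f t * g t)%C x (a * g x + f x * b)%C.
Proof.
  intros [f1 f2] [g1 g2].
  assert (hc : forall n m : R_AbsRing, mult n m = mult m n) by (intros; apply Rmult_comm).
  split.
  - evar_last. apply (is_derive_minus (fun t => Re (f t) * Re (g t)) (fun t => Im (f t) * Im (g t)));
      [apply (is_derive_mult (fun t => Re (f t)) (fun t => Re (g t))); eauto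
      |apply (is_derive_mult (fun t => Im (f t)) (fun t => Im (g t))); eauto].
    unfold minus, plus, opp, mult; simpl. unfold Re, Im, mult; simpl. ring.
  - evar_last. apply (is_derive_plus (fun t => Re (f t) * Im (g t)) (fun t => Im (f t) * Re (g t)));
      [apply (is_derive_mult (fun t => Re (f t)) (fun t => Im (g t))); eauto
      |apply (is_derive_mult (fun t => Im (f t)) (fun t => Re (g t))); eauto].
    unfold minus, plus, opp, mult; simpl. unfold Re, Im, mult; simpl. ring.
Qed.

Lemma is_rcderive_const c x : is_rcderive (fun _ => c) x (RtoC 0).
Proof.
  split; [exact (@is_derive_const R_AbsRing R_NormedModule (Re c) x)
  |exact (@is_derive_const R_AbsRing R_NormedModule (Im c) x)].
Qed.

Lemma is_rcderive_RtoC (f : R -> R) (x l : R) : is_derive f x l -> is_rcderive (fun t => RtoC (f t)) x (RtoC l).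
Proof. intros h. split; [exact h|exact (@is_derive_const R_AbsRing R_NormedModule 0 x)]. Qed.

Lemma is_rcderive_val f x a b : is_rcderive f x a -> a = b -> is_rcderive f x b.
Proof. intros h <-; exact h. Qed.

Lemma is_rcderive_scal c f x a : is_rcderive f x a -> is_rcderive (fun t => c * f t)%C x (c * a)%C.
Proof.
  intros h. eapply is_rcderive_val; [apply (is_rcderive_mult (fun _ => c) f); [apply is_rcderive_const|exact h]|]. ring.
Qed.

Lemma RCpow_minus_1 x z : 0 < x -> RCpow x (z - 1) = (RCpow x z * RtoC (/ x))%C.
Proof.
  intros hx. unfold Cminus. rewrite RCpow_plus. f_equal.
  rewrite <- RCpow_inv by auto. rewrite RCpow_RtoC, Rpower_1; auto. apply Rinv_0_lt_compat; auto.
Qed.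

Lemma is_rcderive_RCpow z x : 0 < x -> is_rcderive (fun x => RCpow x z) x (z * RCpow x (z - 1))%C.
Proof.
  intros hx. rewrite RCpow_minus_1 by auto. unfold RCpow, Cexp.
  split; unfold Re, Im; simpl; auto_derive; auto; unfold Rminus; field; lra.
Qed.

Lemma CInt_primitive_0 (f H : R -> C) (K a : R) : 0 < a -> ex_CInt f 0 1 ->
  (forall x, 0 < x <= 1 -> is_rcderive H x (f x)) -> (forall x, 0 < x <= 1 -> ccont f x) ->
  (forall x, 0 < x <= 1 -> Cmod (H x) <= K * Rpower x a) -> CInt f 0 1 = H 1.
Proof.
  intros ha hex hd hc hH.
  destruct (ex_RInt_ub (V := C_R_NormedModule) f 0 1 hex) as [B hB]. rewrite Rmin_left, Rmax_right in hB by lra.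
  assert (hB0 : 0 <= B). { eapply Rle_trans; [apply (Cmod_ge_0 (f 0))|]. rewrite Cmod_norm. apply hB; lra. }
  assert (hK : 0 <= K).
  { specialize (hH 1 ltac:(lra)). unfold Rpower in hH. rewrite ln_1, Rmult_0_r, exp_0 in hH.
    generalize (Cmod_ge_0 (H 1)); lra. }
  apply NNPP. intros hn. apply C_minus_neq0 in hn. apply Cmod_gt_0 in hn.
  set (d := Cmod (CInt f 0 1 - H 1)) in *.
  destruct (Rpower_small a (d / (2 * (K + 1))) ha) as [e1 [he1 hs]]; [apply Rdiv_lt_0_compat; lra|].
  set (e := Rmin (e1 / 2) (d / (2 * (B + 1)))).
  assert (he : 0 < e) by (apply Rmin_pos; [lra|apply Rdiv_lt_0_compat; lra]).
  assert (hee : e <= e1 / 2) by apply Rmin_l. assert (heB : e <= d / (2 * (B + 1))) by apply Rmin_r.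
  assert (ex1 : ex_CInt f 0 e) by (apply (ex_RInt_Chasles_1 (V := C_R_CompleteNormedModule) f 0 e 1); [lra|exact hex]).
  assert (ex2 : ex_CInt f e 1) by (apply (ex_RInt_Chasles_2 (V := C_R_CompleteNormedModule) f 0 e 1); [lra|exact hex]).
  assert (hm : CInt f e 1 = (H 1 - H e)%C).
  { apply is_CInt_unique, is_CInt_derive; rewrite Rmin_left, Rmax_right by lra; intros x hx; [apply hd|apply hc]; lra. }
  assert (h1 : Cmod (CInt f 0 e) <= (e - 0) * B).
  { apply Cmod_CInt_le_const; [lra| |exact ex1]. intros x hx. rewrite Cmod_norm. apply hB. lra. }
  assert (h2 : Cmod (H e) < d / 2).
  { specialize (hH e ltac:(lra)). specialize (hs e ltac:(lra)).
    apply Rle_lt_trans with ((K + 1) * Rpower e a).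
    - assert (0 < Rpower e a) by apply exp_pos. nra.
    - apply Rlt_le_trans with ((K + 1) * (d / (2 * (K + 1)))); [apply Rmult_lt_compat_l; lra|right; field; lra]. }
  assert (h3 : e * B <= d / 2).
  { apply Rle_trans with (d / (2 * (B + 1)) * (B + 1)); [|right; field; lra].
    assert (0 <= d / (2 * (B + 1))) by lra. nra. }
  assert (d < d); [|lra]. unfold d at 1. rewrite (CInt_Chasles f 0 e 1 ex1 ex2), hm.
  replace (CInt f 0 e + (H 1 - H e) - H 1)%C with (CInt f 0 e + - H e)%C by ring.
  eapply Rle_lt_trans; [apply Cmod_triangle|]. rewrite Cmod_opp. lra.
Qed.

Definition beta_f1 (s : C) (x : R) : C := (RCpow x (3 - 2 * s) * RtoC (/ (1 + x ^ 2) ^ 2))%C.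

Definition beta_f2 (s : C) (x : R) : C := (RCpow x (2 * s - 1) * RtoC (/ (1 + x ^ 2) ^ 2))%C.

(* The integral of [u^(3 - 2 s) / (1 + u^2)^2] over [u > 0], with [u > 1] folded back on
   [0, 1] by [u = 1 / x]. *)
Definition beta (s : C) : C := (CInt (beta_f1 s) 0 1 + CInt (beta_f2 s) 0 1)%C.

Lemma re_3_2s s : Re (3 - 2 * s) = 3 - 2 * Re s.
Proof. unfold Re; simpl; ring. Qed.

Lemma re_2s_1 s : Re (2 * s - 1) = 2 * Re s - 1.
Proof. unfold Re; simpl; ring. Qed.

Lemma ccont_RCpow_rational z q r x : 0 < x -> 0 <= q -> 0 <= r -> 0 < q + r ->
  ccont (fun x => RCpow x z * RtoC (/ (q + r * x ^ 2) ^ 2))%C x.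
Proof.
  intros hx hq hr hqr. apply ccont_mellin; auto.
  assert (hp : 0 < q + r * x ^ 2).
  { assert (0 < x ^ 2) by (apply pow_lt; auto). destruct (Req_dec q 0); [assert (0 < r) by lra; nra|nra]. }
  apply (ex_derive_continuous (fun x => / (q + r * x ^ 2) ^ 2)). auto_derive.
  apply Rgt_not_eq. simpl in *. repeat apply Rmult_lt_0_compat; lra.
Qed.

Lemma ex_CInt_RCpow_rational z q r b : 0 < Re z -> 0 < q -> 0 <= r -> 0 <= b ->
  ex_CInt (fun x => RCpow x z * RtoC (/ (q + r * x ^ 2) ^ 2))%C 0 b.
Proof.
  intros hz hq hr hb. apply ex_CInt_vanishing with (/ q ^ 2) (Re z); auto.
  - intros x hx. apply ccont_RCpow_rational; lra.
  - intros x hx. rewrite Cmod_mult, Cmod_RCpow, Cmod_R, Rmult_comm.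
    apply Rmult_le_compat_r; [left; apply exp_pos|].
    assert (0 <= r * x ^ 2) by (apply Rmult_le_pos; auto; apply pow2_ge_0).
    rewrite Rabs_pos_eq by (left; apply Rinv_0_lt_compat, pow_lt; lra).
    apply Rinv_le_contravar; [apply pow_lt; auto|]. apply pow_incr. lra.
Qed.

Lemma ex_beta_f1 s b : Re s < 3 / 2 -> 0 <= b -> ex_CInt (beta_f1 s) 0 b.
Proof.
  intros hs hb. destruct (ex_CInt_RCpow_rational (3 - 2 * s) 1 1 b) as [l hl]; auto; try lra.
  { rewrite re_3_2s; lra. }
  exists l. eapply is_CInt_ext; [|exact hl]. intros x _. unfold beta_f1. cbv beta. do 4 f_equal. ring.
Qed.

Lemma ex_beta_f2 s b : 1 / 2 < Re s -> 0 <= b -> ex_CInt (beta_f2 s) 0 b.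
Proof.
  intros hs hb. destruct (ex_CInt_RCpow_rational (2 * s - 1) 1 1 b) as [l hl]; auto; try lra.
  { rewrite re_2s_1; lra. }
  exists l. eapply is_CInt_ext; [|exact hl]. intros x _. unfold beta_f2. cbv beta. do 4 f_equal. ring.
Qed.

Lemma ccont_beta_f1 s x : 0 < x -> ccont (beta_f1 s) x.
Proof.
  intros hx. apply (continuous_ext (fun x => RCpow x (3 - 2 * s) * RtoC (/ (1 + 1 * x ^ 2) ^ 2))%C).
  - intros y. unfold beta_f1. do 4 f_equal. ring.
  - apply ccont_RCpow_rational; lra.
Qed.

Lemma beta_inversion s a : 1 / 2 < Re s < 3 / 2 -> 0 < a ->
  (CInt (beta_f1 s) 0 (/ a) + CInt (beta_f2 s) 0 a)%C = beta s.
Proof.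
  intros hs ha. unfold beta. assert (ha' : 0 < / a) by (apply Rinv_0_lt_compat; auto).
  assert (hex1 : forall u v, 0 <= u -> 0 <= v -> ex_CInt (beta_f1 s) u v).
  { intros u v hu hv. apply (ex_RInt_Chasles (V := C_R_NormedModule)) with 0; [apply (ex_RInt_swap (V := C_R_NormedModule))|]; apply ex_beta_f1; lra. }
  assert (hex2 : forall u v, 0 <= u -> 0 <= v -> ex_CInt (beta_f2 s) u v).
  { intros u v hu hv. apply (ex_RInt_Chasles (V := C_R_NormedModule)) with 0; [apply (ex_RInt_swap (V := C_R_NormedModule))|]; apply ex_beta_f2; lra. }
  assert (hpos : forall x, Rmin 1 a <= x <= Rmax 1 a -> 0 < x).
  { intros x [hx _]. revert hx. apply Rmin_case; lra. }
  assert (key : CInt (beta_f1 s) 1 (/ a) = (- CInt (beta_f2 s) 1 a)%C).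
  { apply is_CInt_unique.
    assert (hc := is_RInt_comp (V := C_R_CompleteNormedModule) (beta_f1 s) Rinv (fun y => - / y ^ 2) 1 a).
    assert (hc1 : is_CInt (fun y => scal (- / y ^ 2) (beta_f1 s (/ y))) 1 a (CInt (beta_f1 s) (/ 1) (/ a))).
    { apply hc.
      - intros x hx. apply ccont_beta_f1. apply Rinv_0_lt_compat. apply hpos; auto.
      - intros x hx. apply hpos in hx. split.
        + auto_derive; [lra|field; lra].
        + apply (ex_derive_continuous (fun y => - / y ^ 2)). auto_derive. apply Rgt_not_eq. repeat apply Rmult_lt_0_compat; lra. }
    rewrite Rinv_1 in hc1.
    assert (e : CInt (beta_f1 s) 1 (/ a) = (- CInt (beta_f2 s) 1 a)%C).
    { rewrite <- (is_CInt_unique _ _ _ _ hc1). apply is_CInt_unique.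
      apply is_CInt_ext with (fun y => (RtoC (-1)) * beta_f2 s y)%C.
      - intros y hy. assert (hy0 : 0 < y) by (apply hpos; lra).
        unfold beta_f1, beta_f2.
        rewrite RCpow_inv by auto.
        replace (2 * s - 1)%C with (- (3 - 2 * s) + RtoC (INR 2))%C.
        2: { replace (RtoC (INR 2)) with (RtoC 3 - 1)%C by (rewrite <- RtoC_minus; f_equal; simpl; ring). ring. }
        rewrite RCpow_plus, RCpow_nat by auto.
        set (p := RCpow y (- (3 - 2 * s))).
        assert (ep : forall (c : R) (w : C), scal c w = (RtoC c * w)%C).
        { intros c w. apply C_ext; simpl; unfold scal; simpl; unfold mult; simpl; ring. }
        match goal with |- _ = scal ?c ?w => transitivity (RtoC c * w)%C end.
        + assert (hr : -1 * y ^ 2 * / (1 + y ^ 2) ^ 2 = - / y ^ 2 * / (1 + (/ y) ^ 2) ^ 2).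
          { assert (0 < y ^ 2) by (apply pow_lt; auto). field. split; nra. }
          transitivity (p * RtoC (-1 * y ^ 2 * / (1 + y ^ 2) ^ 2))%C.
          * rewrite !RtoC_mult. ring.
          * rewrite hr, RtoC_mult. ring.
        + symmetry. apply ep.
      - replace (- CInt (beta_f2 s) 1 a)%C with (RtoC (-1) * CInt (beta_f2 s) 1 a)%C.
        + apply is_CInt_scal, CInt_correct, hex2; lra.
        + replace (RtoC (-1)) with (Copp 1) by (rewrite <- RtoC_opp; reflexivity). ring. }
    rewrite <- e. apply CInt_correct, hex1; lra. }
  assert (c1 := CInt_Chasles (beta_f1 s) 0 1 (/ a) (hex1 0 1 ltac:(lra) ltac:(lra)) (hex1 1 (/ a) ltac:(lra) ltac:(lra))).
  assert (c2 := CInt_Chasles (beta_f2 s) 0 1 a (hex2 0 1 ltac:(lra) ltac:(lra)) (hex2 1 a ltac:(lra) ltac:(lra))).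
  rewrite c1, c2, key. ring.
Qed.

Lemma beta_scaling s q : 1 / 2 < Re s < 3 / 2 -> 0 < q ->
  (RCpow q (- s) * beta s
   = CInt (fun x => RCpow x (3 - 2 * s) * RtoC (/ (q + x ^ 2) ^ 2)) 0 1
   + CInt (fun x => RCpow x (2 * s - 1) * RtoC (/ (q * x ^ 2 + 1) ^ 2)) 0 1)%C.
Proof.
  intros hs hq. set (r := sqrt q). assert (hr : 0 < r) by (apply sqrt_lt_R0; auto).
  assert (hr2 : r ^ 2 = q) by (apply pow2_sqrt; lra).
  assert (hri : 0 < / r) by (apply Rinv_0_lt_compat; auto).
  rewrite <- (beta_inversion s r hs hr), Cmult_plus_distr_l.
  rewrite <- hr2, RCpow_sqr by auto.
  assert (ep : forall (c : R) (w : C), @scal R_AbsRing C_R_NormedModule c w = (RtoC c * w)%C).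
  { intros c w. apply C_ext; simpl; unfold scal; simpl; unfold mult; simpl; ring. }
  assert (hlin : forall (f : R -> C) (u : R), 0 < u -> ex_CInt f 0 u -> is_CInt (fun y => RtoC u * f (u * y)%R)%C 0 1 (CInt f 0 u)).
  { intros f u hu hex.
    assert (k := is_RInt_comp_lin (V := C_R_NormedModule) f u 0 0 1 (CInt f 0 u)).
    replace (u * 0 + 0) with 0 in k by ring. replace (u * 1 + 0) with u in k by ring.
    specialize (k (CInt_correct _ _ _ hex)). eapply is_CInt_ext; [|exact k].
    intros x _. etransitivity; [apply ep|]. rewrite Rplus_0_r. reflexivity. }
  f_equal; symmetry; apply is_CInt_unique.
  - assert (k := is_CInt_scal (RCpow r (2 * - s)) _ _ _ _ (hlin (beta_f1 s) (/ r) hri (ex_beta_f1 s (/ r) ltac:(lra) ltac:(lra)))).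
    eapply is_CInt_ext; [|exact k]. rewrite Rmin_left, Rmax_right by lra. intros x hx. cbv beta. unfold beta_f1.
    rewrite RCpow_mult_base, RCpow_inv by lra.
    assert (hp : (RCpow r (2 * - s) * RCpow r (- (3 - 2 * s)))%C = RtoC (/ r ^ 3)).
    { rewrite <- RCpow_plus. replace (2 * - s + - (3 - 2 * s))%C with (- RtoC (INR 3))%C.
      - rewrite <- RCpow_inv, RCpow_nat by auto. rewrite pow_inv. reflexivity.
      - replace (RtoC (INR 3)) with (RtoC 3) by (f_equal; simpl; ring). ring. }
    transitivity ((RCpow r (2 * - s) * RCpow r (- (3 - 2 * s))) * (RCpow x (3 - 2 * s) * RtoC (/ r * / (1 + (/ r * x) ^ 2) ^ 2)))%C.
    { rewrite RtoC_mult. ring. }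
    rewrite hp. transitivity (RCpow x (3 - 2 * s) * RtoC (/ r ^ 3 * (/ r * / (1 + (/ r * x) ^ 2) ^ 2)))%C.
    { rewrite (RtoC_mult (/ r ^ 3)). ring. }
    do 2 f_equal. assert (0 <= x ^ 2) by apply pow2_ge_0. assert (0 < r ^ 2) by (apply pow_lt; auto). field. repeat split; nra.
  - assert (k := is_CInt_scal (RCpow r (2 * - s)) _ _ _ _ (hlin (beta_f2 s) r hr (ex_beta_f2 s r ltac:(lra) ltac:(lra)))).
    eapply is_CInt_ext; [|exact k]. rewrite Rmin_left, Rmax_right by lra. intros x hx. cbv beta. unfold beta_f2.
    rewrite RCpow_mult_base by lra.
    assert (hp : (RCpow r (2 * - s) * RCpow r (2 * s - 1))%C = RtoC (/ r)).
    { rewrite <- RCpow_plus. replace (2 * - s + (2 * s - 1))%C with (- RtoC 1)%C by ring.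
      rewrite <- RCpow_inv by auto. rewrite RCpow_RtoC, Rpower_1 by auto. reflexivity. }
    transitivity ((RCpow r (2 * - s) * RCpow r (2 * s - 1)) * (RCpow x (2 * s - 1) * RtoC (r * / (1 + (r * x) ^ 2) ^ 2)))%C.
    { rewrite RtoC_mult. ring. }
    rewrite hp. transitivity (RCpow x (2 * s - 1) * RtoC (/ r * (r * / (1 + (r * x) ^ 2) ^ 2)))%C.
    { rewrite (RtoC_mult (/ r)). ring. }
    do 2 f_equal. assert (0 <= r ^ 2 * x ^ 2) by (apply Rmult_le_pos; apply pow2_ge_0). field. repeat split; nra.
Qed.

Definition Csinpi (s : C) : C := ((Cexp (Ci * RtoC PI * s) - Cexp (- (Ci * RtoC PI * s))) / (2 * Ci))%C.

(* [1 / beta], continued to the whole plane except [1]. *)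
Definition inv_beta (s : C) : C := (- (2) * Csinpi s / (RtoC PI * (s - 1)))%C.

Lemma CInt_RCpow z : 0 < Re z -> CInt (fun x => RCpow x z) 0 1 = (/ (z + 1))%C.
Proof.
  intros hz.
  assert (hz1 : (z + 1)%C <> RtoC 0).
  { intros h. apply (f_equal Re) in h. unfold Re in *; simpl in h. lra. }
  rewrite (CInt_primitive_0 (fun x => RCpow x z) (fun x => / (z + 1) * RCpow x (z + 1))%C (/ Cmod (z + 1)) (Re z + 1)).
  - unfold RCpow. rewrite ln_1, Cmult_0_r, Cexp_0. ring.
  - lra.
  - apply ex_CInt_vanishing with 1 (Re z); auto; try lra.
    + intros x hx. apply ccont_RCpow; lra.
    + intros x hx. rewrite Cmod_RCpow. lra.
  - intros x hx. eapply is_rcderive_val; [apply is_rcderive_scal, is_rcderive_RCpow; lra|].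
    replace (z + 1 - 1)%C with z by ring. field. auto.
  - intros x hx. apply ccont_RCpow; lra.
  - intros x hx. rewrite Cmod_mult, Cmod_inv, Cmod_RCpow by auto. right. f_equal.
Qed.

Definition beta_E (a : C) (x : R) : C := (RCpow x (1 + 2 * a) - RCpow x (1 - 2 * a))%C.

Lemma re_1_2a a : Re (1 + 2 * a) = 1 + 2 * Re a.
Proof. unfold Re; simpl; ring. Qed.

Lemma re_1_m2a a : Re (1 - 2 * a) = 1 - 2 * Re a.
Proof. unfold Re; simpl; ring. Qed.

Lemma Cmod_beta_E_le a x : 0 < Re a < 1 / 2 -> 0 < x <= 1 -> Cmod (beta_E a x) <= 2 * Rpower x (1 - 2 * Re a).
Proof.
  intros ha hx. unfold beta_E, Cminus at 1. eapply Rle_trans; [apply Cmod_triangle|]. rewrite Cmod_opp, !Cmod_RCpow, re_1_2a, re_1_m2a.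
  assert (Rpower x (1 + 2 * Re a) <= Rpower x (1 - 2 * Re a)) by (apply Rpower_anti; lra). lra.
Qed.

Lemma ccont_beta_E a x : 0 < x -> ccont (beta_E a) x.
Proof. intros hx. unfold beta_E. apply ccont_minus; apply ccont_RCpow; auto. Qed.

Lemma ex_beta_E_mult a (g : R -> R) : 0 < Re a < 1 / 2 -> (forall x, 0 < x <= 1 -> continuous g x) ->
  (forall x, 0 < x <= 1 -> Rabs (g x) <= 1) -> ex_CInt (fun x => beta_E a x * RtoC (g x))%C 0 1.
Proof.
  intros ha hc hg. apply ex_CInt_vanishing with 2 (1 - 2 * Re a); try lra.
  - intros x hx. apply ccont_mult; [apply ccont_beta_E; lra|apply ccont_RtoC; auto].
  - intros x hx. rewrite Cmod_mult, Cmod_R. rewrite <- (Rmult_1_r (2 * _)).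
    apply Rmult_le_compat; auto. apply Cmod_ge_0. apply Rabs_pos. apply Cmod_beta_E_le; auto.
Qed.

Lemma beta_by_parts s : 1 < Re s < 3 / 2 ->
  beta s = (/ 2 - (s - 1) * CInt (fun x => beta_E (s - 1) x * RtoC (/ (1 + x ^ 2))) 0 1)%C.
Proof.
  intros hs. set (a := (s - 1)%C). assert (ha : 0 < Re a < 1 / 2) by (unfold a, Re; simpl; fold (Re s); lra).
  assert (e1 : (3 - 2 * s)%C = (1 - 2 * a)%C).
  { unfold a. replace (RtoC 3) with (1 + 2)%C by (rewrite <- RtoC_plus; f_equal; ring). ring. }
  assert (e2 : (2 * s - 1)%C = (1 + 2 * a)%C) by (unfold a; rewrite RtoC_2_eq; ring).
  set (g := fun x => / (1 + x ^ 2)).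
  assert (hp : forall x, 0 < 1 + x ^ 2) by (intros x; generalize (pow2_ge_0 x); lra).
  assert (hexg : ex_CInt (fun x => beta_E a x * RtoC (g x))%C 0 1).
  { apply ex_beta_E_mult; auto.
    - intros x hx. apply (ex_derive_continuous g). unfold g. auto_derive. specialize (hp x). simpl in *. lra.
    - intros x hx. unfold g. specialize (hp x). rewrite Rabs_pos_eq by (left; apply Rinv_0_lt_compat; auto).
      rewrite <- Rinv_1. apply Rinv_le_contravar; [lra|]. generalize (pow2_ge_0 x); lra. }
  set (F := fun x => (beta_f1 s x + beta_f2 s x + a * (beta_E a x * RtoC (g x)))%C).
  set (H := fun x => (RtoC (x ^ 2 / (2 * (1 + x ^ 2))) * (RCpow x (2 * a) + RCpow x (- (2 * a))))%C).
  assert (hF : is_CInt F 0 1 (beta s + a * CInt (fun x => beta_E a x * RtoC (g x))%C 0 1)%C).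
  { unfold F, beta. apply is_CInt_plus; [apply is_CInt_plus|apply is_CInt_scal]; apply CInt_correct; auto.
    - apply ex_beta_f1; lra. - apply ex_beta_f2; lra. }
  assert (hH1 : H 1 = (/ 2)%C).
  { unfold H, RCpow. rewrite ln_1, !Cmult_0_r, Cexp_0. replace (1 ^ 2 / (2 * (1 + 1 ^ 2))) with (/ 2 * / 2) by field.
    rewrite RtoC_mult, RtoC_inv. rewrite RtoC_2_eq. field. first [lra | intros h0; apply RtoC_2_neq0; rewrite RtoC_2_eq; exact h0]. }
  assert (hmain : CInt F 0 1 = H 1).
  { apply (CInt_primitive_0 F H 1 (2 - 2 * Re a)); [lra|eexists; exact hF| | |].
    - intros x hx.
      assert (hd : is_derive (fun x => x ^ 2 / (2 * (1 + x ^ 2))) x (x / (1 + x ^ 2) ^ 2)).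
      { specialize (hp x). auto_derive; [simpl in *; lra|]. simpl in *. field. lra. }
      eapply is_rcderive_val.
      + apply is_rcderive_mult; [apply is_rcderive_RtoC, hd|].
        apply is_rcderive_plus; apply is_rcderive_RCpow; lra.
      + unfold F, beta_f1, beta_f2, beta_E. rewrite e1, e2.
        assert (x0 : 0 < x) by lra. rewrite !RCpow_minus_1 by auto.
        assert (p1 : RCpow x (1 + 2 * a) = (RtoC x * RCpow x (2 * a))%C) by (rewrite RCpow_plus, RCpow_RtoC, Rpower_1; auto).
        assert (p2 : RCpow x (1 - 2 * a) = (RtoC x * RCpow x (- (2 * a)))%C) by (unfold Cminus; rewrite RCpow_plus, RCpow_RtoC, Rpower_1; auto).
        rewrite p1, p2. unfold g. set (u := RCpow x (2 * a)). set (v := RCpow x (- (2 * a))).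
        assert (r1 : x ^ 2 / (2 * (1 + x ^ 2)) * / x = / 2 * (x * / (1 + x ^ 2))) by (specialize (hp x); field; lra).
        transitivity (RtoC (x * / (1 + x ^ 2) ^ 2) * (u + v) + 2 * a * RtoC (x ^ 2 / (2 * (1 + x ^ 2)) * / x) * (u - v))%C.
        * rewrite !RtoC_mult. unfold Rdiv. rewrite !RtoC_mult. ring.
        * assert (h2 : (RtoC 2 * RtoC (/ 2))%C = RtoC 1) by (rewrite <- RtoC_mult; f_equal; field).
          rewrite r1, (RtoC_mult (/ 2)).
          set (W := RtoC (x * / (1 + x ^ 2))).
          replace (2 * a * (RtoC (/ 2) * W) * (u - v))%C with ((RtoC 2 * RtoC (/ 2)) * (a * W * (u - v)))%C by ring.
          unfold W.
          rewrite h2, !RtoC_mult. ring.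
    - intros x hx. unfold F. apply ccont_plus; [apply ccont_plus|apply ccont_mult; [apply ccont_const|]].
      + apply ccont_beta_f1; lra.
      + unfold beta_f2. apply (continuous_ext (fun x => RCpow x (2 * s - 1) * RtoC (/ (1 + 1 * x ^ 2) ^ 2))%C).
        * intros y. do 4 f_equal. ring.
        * apply ccont_RCpow_rational; lra.
      + apply ccont_mult; [apply ccont_beta_E; lra|]. apply ccont_RtoC. apply (ex_derive_continuous g). unfold g. auto_derive.
        specialize (hp x). simpl in *. lra.
    - intros x hx. unfold H. rewrite Cmod_mult, Cmod_R. specialize (hp x).
      assert (0 < x ^ 2) by (apply pow_lt; lra).
      rewrite Rabs_pos_eq by (apply Rdiv_le_0_compat; lra).
      assert (hb : Cmod (RCpow x (2 * a) + RCpow x (- (2 * a))) <= 2 * Rpower x (- (2 * Re a))).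
      { eapply Rle_trans; [apply Cmod_triangle|]. rewrite !Cmod_RCpow.
        replace (Re (2 * a)) with (2 * Re a) by (unfold Re; simpl; ring).
        replace (Re (- (2 * a))) with (- (2 * Re a)) by (unfold Re; simpl; ring).
        assert (Rpower x (2 * Re a) <= Rpower x (- (2 * Re a))) by (apply Rpower_anti; lra). lra. }
      apply Rle_trans with (x ^ 2 / 2 * (2 * Rpower x (- (2 * Re a)))).
      + apply Rmult_le_compat; auto; [apply Rdiv_le_0_compat; lra|apply Cmod_ge_0|].
        unfold Rdiv. apply Rmult_le_compat_l; [lra|]. apply Rinv_le_contravar; lra.
      + right. replace (2 - 2 * Re a) with (INR 2 + - (2 * Re a)) by (simpl; ring).
        rewrite Rpower_plus, Rpower_pow by lra. field. }
  rewrite (is_CInt_unique _ _ _ _ hF), hH1 in hmain.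
  replace (beta s) with (beta s + a * CInt (fun x => beta_E a x * RtoC (g x)) 0 1 - a * CInt (fun x => beta_E a x * RtoC (g x)) 0 1)%C by ring.
  rewrite hmain. reflexivity.
Qed.

Definition beta_e (a : C) (j : nat) : C :=
  (/ (RtoC (INR (2 * j + 1)) + 2 * a + 1) - / (RtoC (INR (2 * j + 1)) - 2 * a + 1))%C.

Lemma is_RInt_pow_01 n : is_RInt (fun x => x ^ n) 0 1 (/ INR (S n)).
Proof.
  assert (hn : INR (S n) <> 0) by (apply not_0_INR; lia).
  evar_last.
  - apply (is_RInt_derive (V := R_CompleteNormedModule) (fun x => / INR (S n) * x ^ S n)).
    + intros x _. evar_last.
      * apply (is_derive_scal (fun x => x ^ S n) x (/ INR (S n)) (INR (S n) * 1 * x ^ n)).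
        apply (is_derive_pow (fun x => x) (S n) x 1). exact (@is_derive_id R_AbsRing x).
      * field. exact hn.
    + intros x _. apply (ex_derive_continuous (fun x => x ^ n)). auto_derive; auto.
  - unfold minus, plus, opp. cbn [AbelianMonoid.plus AbelianGroup.opp]. rewrite pow1, pow_i by lia. simpl. ring.
Qed.

Lemma beta_alternating a : 0 < Re a < 1 / 2 ->
  Clim (csum (fun j => RtoC ((-1) ^ j) * beta_e a j)%C) (CInt (fun x => beta_E a x * RtoC (/ (1 + x ^ 2)))%C 0 1).
Proof.
  intros ha.
  assert (hp : forall x, 0 < 1 + x ^ 2) by (intros x; generalize (pow2_ge_0 x); lra).
  set (J := fun N => CInt (fun x => beta_E a x * RtoC ((- x ^ 2) ^ N * / (1 + x ^ 2)))%C 0 1).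
  assert (hJex : forall N, ex_CInt (fun x => beta_E a x * RtoC ((- x ^ 2) ^ N * / (1 + x ^ 2)))%C 0 1).
  { intros N. apply ex_beta_E_mult; auto.
    - intros x hx. apply (ex_derive_continuous (fun x => (- x ^ 2) ^ N * / (1 + x ^ 2))). auto_derive. specialize (hp x). simpl in *. lra.
    - intros x hx. specialize (hp x). rewrite Rabs_mult, (Rabs_pos_eq (/ (1 + x ^ 2))) by (left; apply Rinv_0_lt_compat; auto).
      rewrite <- RPow_abs, Rabs_Ropp, Rabs_pos_eq by apply pow2_ge_0.
      assert (h2 : 0 <= x ^ 2 <= 1) by (split; [apply pow2_ge_0|nra]).
      assert (h3 : 0 <= (x ^ 2) ^ N <= 1). { split; [apply pow_le; lra|]. rewrite <- (pow1 N). apply pow_incr; lra. }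
      assert (h4 : 0 < / (1 + x ^ 2) <= 1).
      { split; [apply Rinv_0_lt_compat; auto|]. rewrite <- Rinv_1. apply Rinv_le_contravar; lra. }
      nra. }
  assert (hxe : forall x N b, 0 < x -> (RtoC (x ^ (2 * N)) * RCpow x (1 + b))%C = RCpow x (RtoC (INR (2 * N + 1)) + b)).
  { intros x N b hx. rewrite <- RCpow_nat, <- RCpow_plus by auto. f_equal. rewrite plus_INR, RtoC_plus. simpl (INR 1). ring. }
  assert (hxe' : forall x N b, 0 < x -> (RtoC (x ^ (2 * N)) * RCpow x (1 - b))%C = RCpow x (RtoC (INR (2 * N + 1)) - b)).
  { intros x N b hx. apply (hxe x N (- b)%C hx). }
  assert (hstep : forall N, J N = (RtoC ((-1) ^ N) * beta_e a N + J (S N))%C).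
  { intros N. apply is_CInt_unique.
    assert (he : is_CInt (fun x => RtoC ((-1) ^ N) * (RCpow x (RtoC (INR (2 * N + 1)) + 2 * a) - RCpow x (RtoC (INR (2 * N + 1)) - 2 * a)))%C 0 1 (RtoC ((-1) ^ N) * beta_e a N)%C).
    { assert (hre1 : 0 < Re (RtoC (INR (2 * N + 1)) + 2 * a)).
      { rewrite plus_INR. unfold Re; simpl. fold (Re a). generalize (pos_INR (N + (N + 0))); lra. }
      assert (hre2 : 0 < Re (RtoC (INR (2 * N + 1)) - 2 * a)).
      { rewrite plus_INR. unfold Re; simpl. fold (Re a). generalize (pos_INR (N + (N + 0))); lra. }
      assert (hpow : forall z, 0 < Re z -> is_CInt (fun x => RCpow x z) 0 1 (/ (z + 1))%C).
      { intros z hz. rewrite <- CInt_RCpow by auto. apply CInt_correct. apply ex_CInt_vanishing with 1 (Re z); auto; try lra.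
        - intros x hx. apply ccont_RCpow; lra.
        - intros x hx. rewrite Cmod_RCpow. lra. }
      apply is_CInt_scal. unfold beta_e. apply is_CInt_minus; apply hpow; auto. }
    assert (hk := is_CInt_plus _ _ _ _ _ _ he (CInt_correct _ _ _ (hJex (S N)))). fold (J (S N)) in hk.
    eapply is_CInt_ext; [|exact hk]. rewrite Rmin_left, Rmax_right by lra. intros x hx. cbv beta.
    rewrite <- hxe, <- hxe' by lra. unfold beta_E.
    specialize (hp x).
    assert (hw : (-1) ^ N * x ^ (2 * N) = (- x ^ 2) ^ N).
    { replace (- x ^ 2) with (-1 * x ^ 2) by ring. rewrite Rpow_mult_distr, <- pow_mult. ring. }
    replace ((- x ^ 2) ^ S N * / (1 + x ^ 2)) with ((-1) ^ N * x ^ (2 * N) * (- (x ^ 2) * / (1 + x ^ 2)))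
      by (rewrite hw; change ((- x ^ 2) ^ S N) with (- x ^ 2 * (- x ^ 2) ^ N); set (w := (- x ^ 2) ^ N); ring).
    replace ((- x ^ 2) ^ N * / (1 + x ^ 2)) with ((-1) ^ N * x ^ (2 * N) * (1 + - (x ^ 2) * / (1 + x ^ 2)))
      by (rewrite hw; set (w := (- x ^ 2) ^ N); field; lra).
    rewrite !RtoC_mult, RtoC_plus, !RtoC_mult. ring. }
  assert (hsum : forall N, csum (fun j => RtoC ((-1) ^ j) * beta_e a j)%C N = (J O - J N)%C).
  { induction N as [|N IH]; [simpl; ring|]. rewrite csum_S, IH, (hstep N). ring. }
  assert (hJ0 : J O = CInt (fun x => beta_E a x * RtoC (/ (1 + x ^ 2)))%C 0 1).
  { apply CInt_ext. intros x _. simpl pow at 1. rewrite Rmult_1_l. reflexivity. }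
  rewrite <- hJ0.
  apply Clim_ext with (fun N => J O - J N)%C; [intros N; symmetry; apply hsum|].
  assert (hJN : Clim J (RtoC 0)).
  2: { assert (q := Clim_minus _ _ _ _ (Clim_const (J O)) hJN). replace (J O - 0)%C with (J O) in q by ring. exact q. }
  apply Clim_squeeze0 with (fun N => 2 / (INR N + 1)).
  - intros N.
    assert (hR := is_RInt_scal (V := R_NormedModule) _ _ _ 2 _ (is_RInt_pow_01 (2 * N))).
    apply Rle_trans with (2 * / INR (S (2 * N))).
    + apply (Cmod_is_CInt_le (fun x => beta_E a x * RtoC ((- x ^ 2) ^ N * / (1 + x ^ 2)))%C (fun x => 2 * x ^ (2 * N)) 0 1); [lra| |apply CInt_correct, hJex|exact hR].
      intros x hx. destruct (Req_dec x 0) as [->|hx0].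
      * assert (l0 : ln 0 = 0) by (unfold ln; case Rlt_dec; intros h; [exfalso; revert h; apply Rlt_irrefl|reflexivity]).
        unfold beta_E, RCpow. rewrite l0, !Cmult_0_r, Cexp_0.
        replace ((1 - 1) * _)%C with (RtoC 0) by ring. rewrite Cmod_0. apply Rmult_le_pos; [lra|]. apply pow_le; lra.
      * specialize (hp x). assert (hE := Cmod_beta_E_le a x ha ltac:(lra)).
        rewrite Cmod_mult, Cmod_R, Rabs_mult, (Rabs_pos_eq (/ (1 + x ^ 2))) by (left; apply Rinv_0_lt_compat; auto).
        rewrite <- RPow_abs, Rabs_Ropp, Rabs_pos_eq, <- pow_mult by apply pow2_ge_0.
        assert (h1 : Rpower x (1 - 2 * Re a) <= 1) by (apply Rpower_le_1; lra).
        assert (h3 : 0 <= x ^ (2 * N)) by (apply pow_le; lra).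
        assert (h4 : 0 < / (1 + x ^ 2) <= 1).
        { split; [apply Rinv_0_lt_compat; auto|]. rewrite <- Rinv_1. apply Rinv_le_contravar; [lra|]. generalize (pow2_ge_0 x); lra. }
        apply Rmult_le_compat; try lra. apply Cmod_ge_0. apply Rmult_le_pos; lra. nra.
    + unfold Rdiv. apply Rmult_le_compat_l; [lra|]. apply Rinv_le_contravar; [generalize (pos_INR N); lra|].
      rewrite S_INR, mult_INR. simpl. generalize (pos_INR N); lra.
  - apply is_lim_seq_ext_loc with (fun n => 2 * / (INR n + 1)); [exists 0%nat; reflexivity|].
    replace (Finite 0) with (Rbar_mult 2 (Finite 0)) by (simpl; f_equal; ring).
    apply is_lim_seq_scal_l. replace (Finite 0) with (Rbar_inv p_infty) by reflexivity.
    apply is_lim_seq_inv; [|discriminate].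
    apply is_lim_seq_le_p_loc with INR; [|apply is_lim_seq_INR]. exists 0%nat. intros n _. lra.
Qed.

Lemma Re_neq0 (z : C) : Re z <> 0 -> z <> RtoC 0.
Proof. intros h e. apply h. rewrite e. reflexivity. Qed.

Lemma beta_e_even a M : 0 < Re a < 1 / 2 ->
  beta_e a (2 * M) = (/ 2 * (/ (2 * RtoC (INR M) + 1 + a) - / (2 * RtoC (INR M) + 1 - a)))%C.
Proof.
  intros ha. unfold beta_e.
  replace (RtoC (INR (2 * (2 * M) + 1))) with (4 * RtoC (INR M) + 1)%C.
  2: { rewrite plus_INR, !mult_INR, RtoC_plus, !RtoC_mult. simpl (INR 2). simpl (INR 1).
       replace (RtoC 4) with (RtoC (1 + 1) * RtoC (1 + 1))%C by (rewrite <- RtoC_mult; f_equal; ring). ring. }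
  assert (hM := pos_INR M).
  assert (h4 : RtoC 4 = (RtoC 2 * RtoC 2)%C) by (rewrite <- RtoC_mult; f_equal; ring).
  replace (4 * RtoC (INR M) + 1 + 2 * a + 1)%C with (2 * (2 * RtoC (INR M) + 1 + a))%C by (rewrite h4, RtoC_2_eq; ring).
  replace (4 * RtoC (INR M) + 1 - 2 * a + 1)%C with (2 * (2 * RtoC (INR M) + 1 - a))%C by (rewrite h4, RtoC_2_eq; ring).
  rewrite !Cinv_mult. ring.
Qed.

Lemma beta_e_odd a M : 0 < Re a < 1 / 2 ->
  beta_e a (S (2 * M)) = (/ 2 * (/ (2 * RtoC (INR M) + 2 + a) - / (2 * RtoC (INR M) + 2 - a)))%C.
Proof.
  intros ha. unfold beta_e.
  replace (RtoC (INR (2 * S (2 * M) + 1))) with (4 * RtoC (INR M) + 3)%C.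
  2: { replace (2 * S (2 * M) + 1)%nat with (4 * M + 3)%nat by lia.
       rewrite plus_INR, mult_INR, RtoC_plus, RtoC_mult. do 2 f_equal; f_equal; simpl; ring. }
  assert (h4 : RtoC 4 = (RtoC 2 * RtoC 2)%C) by (rewrite <- RtoC_mult; f_equal; ring).
  assert (h3 : RtoC 3 = (RtoC 2 + 1)%C) by (rewrite <- RtoC_plus; f_equal; ring).
  replace (4 * RtoC (INR M) + 3 + 2 * a + 1)%C with (2 * (2 * RtoC (INR M) + 2 + a))%C by (rewrite h4, h3, RtoC_2_eq; ring).
  replace (4 * RtoC (INR M) + 3 - 2 * a + 1)%C with (2 * (2 * RtoC (INR M) + 2 - a))%C by (rewrite h4, h3, RtoC_2_eq; ring).
  rewrite !Cinv_mult. ring.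
Qed.

Lemma half_shift_inv (a : C) (m : C) :
  (/ (a / 2 + m) = 2 * / (a + 2 * m) /\ / (a / 2 - 1 - m) = - (2 * / (2 * m + 2 - a)) /\
   / ((a + 1) / 2 + m) = 2 * / (2 * m + 1 + a) /\ / ((a + 1) / 2 - 1 - m) = - (2 * / (2 * m + 1 - a)))%C.
Proof.
  assert (h2 := RtoC_2_neq0).
  assert (k : forall x, (/ x = 2 * / (2 * x))%C).
  { intros x. rewrite Cinv_mult. transitivity ((2 * / 2) * / x)%C; [rewrite Cinv_r by auto; ring | ring]. }
  repeat split.
  - rewrite k. do 2 f_equal. field. auto.
  - rewrite k. replace (2 * (a / 2 - 1 - m))%C with (- (1) * (2 * m + 2 - a))%C by (rewrite RtoC_2_eq; field; rewrite <- ?RtoC_2_eq; auto).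
    rewrite Cinv_mult. replace (/ - (1))%C with (- (1))%C by (field; intros e; apply (f_equal Re) in e; unfold Re in e; simpl in e; lra). ring.
  - rewrite k. do 2 f_equal. field. auto.
  - rewrite k. replace (2 * ((a + 1) / 2 - 1 - m))%C with (- (1) * (2 * m + 1 - a))%C by (rewrite RtoC_2_eq; field; rewrite <- ?RtoC_2_eq; auto).
    rewrite Cinv_mult. replace (/ - (1))%C with (- (1))%C by (field; intros e; apply (f_equal Re) in e; unfold Re in e; simpl in e; lra). ring.
Qed.

Lemma cot_difference_sum a M : 0 < Re a < 1 / 2 ->
  (csum (fun j => (/ (a / 2 + RtoC (INR j)) + / (a / 2 - 1 - RtoC (INR j)))
      - (/ ((a + 1) / 2 + RtoC (INR j)) + / ((a + 1) / 2 - 1 - RtoC (INR j)))) M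
   = 2 / a - 4 * csum (fun j => RtoC ((-1) ^ j) * beta_e a j) (2 * M) - 2 * / (a + 2 * RtoC (INR M)))%C.
Proof.
  intros ha. assert (h4 : RtoC 4 = (RtoC 2 * RtoC 2)%C) by (rewrite <- RtoC_mult; f_equal; ring).
  induction M as [|M IH].
  - simpl. rewrite Cmult_0_r, !Cmult_0_r, Cplus_0_r. unfold Cdiv. ring.
  - rewrite csum_S, IH. replace (2 * S M)%nat with (S (S (2 * M))) by lia. rewrite !csum_S.
    rewrite beta_e_even, beta_e_odd by auto.
    destruct (half_shift_inv a (RtoC (INR M))) as [q1 [q2 [q3 q4]]]. rewrite q1, q2, q3, q4.
    replace ((-1) ^ (2 * M)) with 1 by (rewrite pow_mult; replace ((-1) ^ 2) with 1 by ring; rewrite pow1; auto).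
    replace ((-1) ^ S (2 * M)) with (-1) by (rewrite <- tech_pow_Rmult, pow_mult; replace ((-1) ^ 2) with 1 by ring; rewrite pow1; ring).
    rewrite S_INR, RtoC_plus.
    replace (a + 2 * (RtoC (INR M) + 1))%C with (2 * RtoC (INR M) + 2 + a)%C by ring.
    replace (RtoC (-1)) with (Copp 1) by (rewrite <- RtoC_opp; reflexivity).
    rewrite h4.
    assert (k : (RtoC 2 * RtoC 2 * / 2)%C = RtoC 2) by (field; apply RtoC_2_neq0).
    set (x1 := (/ (2 * RtoC (INR M) + 1 + a))%C). set (x2 := (/ (2 * RtoC (INR M) + 1 - a))%C).
    set (x3 := (/ (2 * RtoC (INR M) + 2 + a))%C). set (x4 := (/ (2 * RtoC (INR M) + 2 - a))%C).
    set (S0 := csum _ (2 * M)).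
    match goal with |- _ = ?r => replace r with
      (2 / a - 2 * 2 * S0 - (2 * 2 * / 2) * (x1 - x2) + (2 * 2 * / 2) * (x3 - x4) - 2 * x3)%C by ring end.
    rewrite k. ring.
Qed.

Theorem beta_inv_beta s : 1 < Re s < 3 / 2 -> (beta s * inv_beta s)%C = RtoC 1.
Proof.
  intros hs. rewrite beta_by_parts by auto. set (a := (s - 1)%C).
  assert (ha : 0 < Re a < 1 / 2) by (unfold a, Re; simpl; fold (Re s); lra).
  assert (ha0 : a <> RtoC 0) by (apply Re_neq0; lra).
  set (J := CInt (fun x => beta_E a x * RtoC (/ (1 + x ^ 2)))%C 0 1).
  assert (hJ := beta_alternating a ha). fold J in hJ.
  assert (r1 : Re (a / 2) = Re a / 2).
  { replace (a / 2)%C with (RtoC (/ 2) * a)%C by (rewrite RtoC_inv by lra; field; apply RtoC_2_neq0). unfold Re; simpl. field. }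
  assert (r2 : Re ((a + 1) / 2) = (Re a + 1) / 2).
  { replace ((a + 1) / 2)%C with (RtoC (/ 2) * (a + 1))%C by (rewrite RtoC_inv by lra; field; apply RtoC_2_neq0). unfold Re; simpl. field. }
  assert (hni : forall z, 0 < Re z < 1 -> nonint z).
  { intros z hz k e. rewrite e in hz. unfold Re in hz; simpl in hz.
    destruct hz as [z1 z2]. apply lt_IZR in z1. apply lt_IZR in z2. lia. }
  assert (hr1 : 0 < Re (a / 2) < 1) by (split; rewrite r1; lra).
  assert (hr2 : 0 < Re ((a + 1) / 2) < 1) by (split; rewrite r2; lra).
  assert (c1 := pi_cot_series (a / 2) (hni _ hr1) (conj (Rlt_le _ _ (proj1 hr1)) (Rlt_le _ _ (proj2 hr1)))).
  assert (c2 := pi_cot_series ((a + 1) / 2) (hni _ hr2) (conj (Rlt_le _ _ (proj1 hr2)) (Rlt_le _ _ (proj2 hr2)))).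
  set (Q := (pi_cot (a / 2) - pi_cot ((a + 1) / 2))%C).
  assert (hQ1 : Clim (fun M => 2 / a - 4 * csum (fun j => RtoC ((-1) ^ j) * beta_e a j) (2 * M) - 2 * / (a + 2 * RtoC (INR M)))%C Q).
  { eapply Clim_ext; [|apply (Clim_minus _ _ _ _ c1 c2)]. intros M. rewrite <- cot_difference_sum by auto.
    symmetry. cbv beta. induction M as [|M IH]; [simpl; ring|]. rewrite !csum_S, IH. ring. }
  assert (hinv : Clim (fun M => 2 * / (a + 2 * RtoC (INR M)))%C (RtoC 0)).
  { apply Clim_squeeze0 with (fun M => 4 / (INR M + 2) + 4 * Rabs (2 * / Re a) / (INR M + 2)).
    - intros M. assert (hM := pos_INR M).
      assert (hre : Re (a + 2 * RtoC (INR M)) = Re a + 2 * INR M) by (unfold Re; simpl; ring).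
      assert (hn0 : (a + 2 * RtoC (INR M))%C <> RtoC 0) by (apply Re_neq0; rewrite hre; lra).
      rewrite Cmod_mult, Cmod_inv, Cmod_R, Rabs_pos_eq by (auto; lra).
      assert (hl : Re a + 2 * INR M <= Cmod (a + 2 * RtoC (INR M))).
      { eapply Rle_trans; [|apply re_le_Cmod]. rewrite hre. apply Rle_abs. }
      assert (hia : 0 < / Re a) by (apply Rinv_0_lt_compat; lra).
      rewrite (Rabs_pos_eq (2 * / Re a)) by lra.
      apply Rle_trans with (2 * / (Re a + 2 * INR M)).
      + apply Rmult_le_compat_l; [lra|]. apply Rinv_le_contravar; lra.
      + apply Rmult_le_reg_r with ((Re a + 2 * INR M) * (INR M + 2)); [apply Rmult_lt_0_compat; lra|].
        replace (2 * / (Re a + 2 * INR M) * ((Re a + 2 * INR M) * (INR M + 2))) with (2 * (INR M + 2)) by (field; lra).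
        replace ((4 / (INR M + 2) + 4 * (2 * / Re a) / (INR M + 2)) * ((Re a + 2 * INR M) * (INR M + 2)))
         with (4 * Re a + 8 * INR M + 8 + 16 * (/ Re a * INR M)) by (field; lra).
        assert (0 <= / Re a * INR M) by (apply Rmult_le_pos; lra). lra.
    - replace (Finite 0) with (Finite (0 + 0)) by (f_equal; ring).
      assert (hlim : forall K, is_lim_seq (fun n => K / (INR n + 2)) 0).
      { intros K. apply is_lim_seq_ext with (fun n => K * / (INR n + 2)); [reflexivity|].
        replace (Finite 0) with (Rbar_mult K (Finite 0)) by (simpl; f_equal; ring).
        apply is_lim_seq_scal_l. replace (Finite 0) with (Rbar_inv p_infty) by reflexivity.
        apply is_lim_seq_inv; [|discriminate].
        apply is_lim_seq_le_p_loc with INR; [|apply is_lim_seq_INR]. exists 0%nat. intros n _. lra. }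
      apply is_lim_seq_plus'; apply hlim. }
  assert (hQ2 : Clim (fun M => 2 / a - 4 * csum (fun j => RtoC ((-1) ^ j) * beta_e a j) (2 * M) - 2 * / (a + 2 * RtoC (INR M)))%C (2 / a - 4 * J - 0)%C).
  { apply Clim_minus; auto. apply Clim_minus; [apply Clim_const|]. apply Clim_scal.
    apply (Clim_subseq (csum (fun j => RtoC ((-1) ^ j) * beta_e a j)%C) J (fun M => 2 * M)%nat); auto.
    intros N. exists N. intros m hm. lia. }
  assert (hQ := Clim_unique _ _ _ hQ1 hQ2).
  assert (h4 : RtoC 4 = (RtoC 2 * RtoC 2)%C) by (rewrite <- RtoC_mult; f_equal; ring).
  assert (n2 := RtoC_2_neq0).
  assert (hB : (/ 2 - a * J)%C = (a * Q / 4)%C).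
  { rewrite hQ, h4. field. auto. }
  rewrite hB.
  set (r := nome (a / 2)).
  assert (hrr : (r * r)%C <> RtoC 1).
  { unfold r. rewrite <- nome_plus. replace (a / 2 + a / 2)%C with a by (field; auto). apply nome_neq_1, (hni a). lra. }
  assert (hr0 : r <> RtoC 0) by apply Cexp_neq_0.
  assert (hrm : (r - 1)%C <> RtoC 0).
  { intros k. apply hrr. replace r with ((r - 1) + 1)%C by ring. rewrite k. ring. }
  assert (hrp : (r + 1)%C <> RtoC 0).
  { intros k. apply hrr. replace r with ((r + 1) - 1)%C by ring. rewrite k. ring. }
  assert (er : Cexp (Ci * RtoC PI * a) = r).
  { unfold r, nome. f_equal. rewrite RtoC_mult. field. }
  assert (eQ : Q = (RtoC PI * Ci * (4 * r / (r * r - 1)))%C).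
  { unfold Q, pi_cot. replace ((a + 1) / 2)%C with (a / 2 + / 2)%C by (field; auto). rewrite nome_plus, nome_half. fold r.
    replace (r * - (1))%C with (- r)%C by ring.
    replace ((- r + 1) / (- r - 1))%C with ((r - 1) / (r + 1))%C.
    2: { field. split; auto. replace (- r - 1)%C with (- (r + 1))%C by ring. intros k. apply hrp.
         replace (r + 1)%C with (- - (r + 1))%C by ring. rewrite k. ring. }
    rewrite h4, RtoC_2_eq. field. repeat split; auto. apply C_minus_neq0; auto. }
  assert (hpi : RtoC PI <> RtoC 0) by (intros h; apply RtoC_inj in h; generalize PI_RGT_0; lra).
  assert (eS : Csinpi s = (- ((r - / r) / (2 * Ci)))%C).
  { unfold Csinpi. rewrite Cexp_opp.
    replace (Cexp (Ci * RtoC PI * s)) with (- r)%C.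
    - field. repeat split; auto. apply Ci_neq0.
    - replace (Ci * RtoC PI * s)%C with (Ci * RtoC PI * a + RtoC (2 * PI) * Ci * / 2)%C.
      + rewrite Cexp_plus, er. fold (nome (/ 2)). rewrite nome_half. ring.
      + unfold a. rewrite RtoC_mult. field. }
  unfold inv_beta. fold a. rewrite eS, eQ, h4. field. repeat split; auto.
  - apply Ci_neq0.
  - apply C_minus_neq0; auto.
Qed.

(** * Unconditional sums and products *)

Definition lsum {T : Type} (f : T -> C) (l : list T) : C := Iter.iter Cplus (RtoC 0) l f.

Definition lrsum {T : Type} (f : T -> R) (l : list T) : R := Iter.iter Rplus 0 l f.

Lemma lsum_app {T : Type} (f : T -> C) l m : lsum f (l ++ m) = (lsum f l + lsum f m)%C.
Proof. unfold lsum. induction l as [|t l IH]; simpl; [ring|]. rewrite IH. ring. Qed.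

Lemma lrsum_app {T : Type} (f : T -> R) l m : lrsum f (l ++ m) = lrsum f l + lrsum f m.
Proof. unfold lrsum. induction l as [|t l IH]; simpl; [ring|]. rewrite IH. ring. Qed.

Lemma lsum_perm {T : Type} (f : T -> C) l m : Permutation l m -> lsum f l = lsum f m.
Proof.
  intros h. induction h as [| x l m h IH | x y l | l m n h1 IH1 h2 IH2]; unfold lsum in *; simpl; auto.
  - rewrite IH; auto.
  - ring.
  - congruence.
Qed.

Lemma lrsum_perm {T : Type} (f : T -> R) l m : Permutation l m -> lrsum f l = lrsum f m.
Proof.
  intros h. induction h as [| x l m h IH | x y l | l m n h1 IH1 h2 IH2]; unfold lrsum in *; simpl; auto.
  - rewrite IH; auto.
  - ring.
  - congruence.
Qed.

Lemma NoDup_incl_perm {T : Type} (m l : list T) : NoDup m -> incl m l -> exists r, Permutation l (m ++ r).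
Proof.
  revert l. induction m as [|x m IH]; intros l hn hi.
  - exists l. apply Permutation_refl.
  - inversion hn as [|? ? hx hm]; subst.
    destruct (in_split x l) as [l1 [l2 e]]; [apply hi; left; auto|]. subst l.
    destruct (IH (l1 ++ l2)%list hm) as [r hr].
    + intros y hy. assert (h : In y (l1 ++ x :: l2)) by (apply hi; right; auto).
      apply in_app_or in h. apply in_or_app. destruct h as [h|[h|h]]; auto. subst. tauto.
    + exists r. apply Permutation_trans with (x :: l1 ++ l2)%list.
      * apply Permutation_sym, Permutation_middle.
      * simpl. apply perm_skip; auto.
Qed.

Lemma Cmod_lsum_le {T : Type} (f : T -> C) (g : T -> R) l : (forall t, Cmod (f t) <= g t) ->
  Cmod (lsum f l) <= lrsum g l.
Proof.
  intros h. unfold lsum, lrsum. induction l as [|t l IH]; simpl; [rewrite Cmod_0; lra|].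
  eapply Rle_trans; [apply Cmod_triangle|]. assert (k := h t). lra.
Qed.

Lemma lrsum_le {T : Type} (f g : T -> R) l : (forall t, f t <= g t) -> lrsum f l <= lrsum g l.
Proof.
  intros h. unfold lrsum. induction l as [|t l IH]; simpl; [lra|]. assert (k := h t). lra.
Qed.

Lemma lrsum_nonneg {T : Type} (f : T -> R) l : (forall t, 0 <= f t) -> 0 <= lrsum f l.
Proof.
  intros h. unfold lrsum. induction l as [|t l IH]; simpl; [lra|]. assert (k := h t). lra.
Qed.

Lemma lrsum_scal {T : Type} c (f : T -> R) l : lrsum (fun t => c * f t) l = c * lrsum f l.
Proof. unfold lrsum. induction l as [|t l IH]; simpl; [|rewrite IH]; ring. Qed.

Lemma lrsum_ext {T : Type} (f g : T -> R) l : (forall t, f t = g t) -> lrsum f l = lrsum g l.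
Proof. intros h. unfold lrsum. induction l as [|t l IH]; simpl; [|rewrite IH, h]; auto. Qed.

Lemma lsum_ext {T : Type} (f g : T -> C) l : (forall t, f t = g t) -> lsum f l = lsum g l.
Proof. intros h. unfold lsum. induction l as [|t l IH]; simpl; [|rewrite IH, h]; auto. Qed.

Lemma lsum_RtoC {T : Type} (f : T -> R) l : lsum (fun t => RtoC (f t)) l = RtoC (lrsum f l).
Proof. unfold lsum, lrsum. induction l as [|t l IH]; simpl; [|rewrite IH, RtoC_plus]; auto. Qed.

Lemma lsum_diff_le {T : Type} (f : T -> C) (g : T -> R) m l : (forall t, Cmod (f t) <= g t) ->
  NoDup m -> incl m l -> Cmod (lsum f l - lsum f m) <= lrsum g l - lrsum g m.
Proof.
  intros h hn hi. destruct (NoDup_incl_perm m l hn hi) as [r hr].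
  rewrite (lsum_perm f _ _ hr), (lrsum_perm g _ _ hr), lsum_app, lrsum_app.
  replace (lsum f m + lsum f r - lsum f m)%C with (lsum f r) by ring.
  assert (k := Cmod_lsum_le f g r h). lra.
Qed.

Definition exhausts {T : Type} (B : nat -> list T) : Prop :=
  (forall N, NoDup (B N)) /\ (forall N M, (N <= M)%nat -> incl (B N) (B M)) /\ (forall t, exists N, In t (B N)).

Lemma exhausts_incl {T : Type} (B : nat -> list T) l : exhausts B -> exists N, incl l (B N).
Proof.
  intros [h1 [h2 h3]]. induction l as [|t l [N IH]].
  - exists O. intros x [].
  - destruct (h3 t) as [M hM]. exists (max N M). intros x [e|hx].
    + subst. apply (h2 M); [lia|auto].
    + apply (h2 N); [lia|auto].
Qed.

Lemma Ccauchy_lim (u : nat -> C) :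
  (forall eps, 0 < eps -> exists N, forall n, (N <= n)%nat -> Cmod (u n - u N) <= eps) -> exists l, Clim u l.
Proof.
  intros h.
  assert (hc : forall p : C -> R, (forall z w, Rabs (p z - p w) <= Cmod (z - w)) ->
    ex_finite_lim_seq (fun n => p (u n))).
  { intros p hp. apply ex_lim_seq_cauchy_corr. intros [e he]. destruct (h (e / 3)) as [N hN]; [lra|].
    exists N. intros n m hn hm. simpl.
    replace (p (u n) - p (u m)) with ((p (u n) - p (u N)) - (p (u m) - p (u N))) by ring.
    assert (k1 := hp (u n) (u N)). assert (k2 := hp (u m) (u N)). assert (k3 := hN n hn). assert (k4 := hN m hm).
    unfold Rminus at 1. eapply Rle_lt_trans; [apply Rabs_triang|]. rewrite Rabs_Ropp. lra. }
  destruct (hc Re) as [a ha].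
  { intros z w. replace (Re z - Re w) with (Re (z - w)) by (unfold Re; simpl; ring). apply re_le_Cmod. }
  destruct (hc Im) as [b hb].
  { intros z w. replace (Im z - Im w) with (Im (z - w)) by (unfold Im; simpl; ring). apply im_le_Cmod. }
  exists (RtoC a + Ci * RtoC b)%C.
  apply Clim_ext with (fun n => RtoC (Re (u n)) + Ci * RtoC (Im (u n)))%C.
  - intros n. apply C_ext; unfold Re, Im; simpl; ring.
  - apply Clim_plus; [apply Clim_RtoC; auto|]. apply Clim_scal. apply Clim_RtoC; auto.
Qed.

Lemma summable_is_sum {T : Type} (B : nat -> list T) (f : T -> C) (g : T -> R) (M : R) :
  exhausts B -> (forall t, Cmod (f t) <= g t) -> (forall N, lrsum g (B N) <= M) ->
  exists v, is_sum f v /\ Clim (fun N => lsum f (B N)) v.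
Proof.
  intros hB hfg hM. assert (hg : forall t, 0 <= g t) by (intros t; eapply Rle_trans; [apply Cmod_ge_0|apply hfg]).
  destruct hB as [h1 [h2 h3]].
  assert (hinc : forall l m, NoDup m -> incl m l -> lrsum g m <= lrsum g l).
  { intros l m hn hi. assert (k := lsum_diff_le f g m l hfg hn hi).
    assert (k2 := Cmod_ge_0 (lsum f l - lsum f m)). lra. }
  destruct (ex_finite_lim_seq_incr (fun N => lrsum g (B N)) M) as [G hG]; auto.
  assert (hle : forall N, lrsum g (B N) <= G).
  { intros N. apply is_lim_seq_incr_le with (u := fun N => lrsum g (B N)); auto. }
  assert (hev : forall eps, 0 < eps -> exists N, G - lrsum g (B N) < eps).
  { intros eps he. apply is_lim_seq_spec in hG. destruct (hG (mkposreal eps he)) as [N hN]. exists N.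
    specialize (hN N (le_n N)). simpl in hN. apply Rabs_def2 in hN. lra. }
  destruct (Ccauchy_lim (fun N => lsum f (B N))) as [v hv].
  { intros eps he. destruct (hev eps he) as [N hN]. exists N. intros n hn.
    assert (k := lsum_diff_le f g (B N) (B n) hfg (h1 N) (h2 _ _ hn)). assert (k2 := hle n). lra. }
  exists v. split; auto.
  unfold is_sum. intros P hP. rewrite locally_C_eps in hP. destruct hP as [eps [he hP]].
  destruct (hev (eps / 4)) as [N1 hN1]; [lra|]. destruct (hv (eps / 4)) as [N2 hN2]; [lra|].
  set (N := max N1 N2).
  exists (B N). intros l hl hi. apply hP.
  destruct (exhausts_incl B l (conj h1 (conj h2 h3))) as [N' hN'].
  assert (k1 := lsum_diff_le f g (B N) l hfg (h1 N) hi).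
  assert (k2 := hinc (B N') l hl hN'). assert (k3 := hle N').
  assert (k4 : lrsum g (B N1) <= lrsum g (B N)) by (apply hinc; auto; apply h2; unfold N; lia).
  assert (k5 := hN2 N ltac:(unfold N; lia)). cbv beta in k5.
  replace (Iter.iter Cplus (RtoC 0) l f - v)%C with ((lsum f l - lsum f (B N)) + (lsum f (B N) - v))%C by (unfold lsum; ring).
  eapply Rle_lt_trans; [apply Cmod_triangle|]. lra.
Qed.

Fixpoint zrange (N : nat) : list Z :=
  match N with O => nil | S n => Z.of_nat n :: (- Z.of_nat n - 1)%Z :: zrange n end.

Lemma in_zrange N k : In k (zrange N) <-> (- Z.of_nat N <= k < Z.of_nat N)%Z.
Proof. induction N as [|N IH]; simpl zrange; [simpl; lia|]. simpl In. rewrite IH. lia. Qed.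

Lemma exhausts_zrange : exhausts zrange.
Proof.
  repeat split.
  - induction N as [|N IH]; simpl; [constructor|]. repeat constructor; auto.
    + simpl. rewrite in_zrange. lia.
    + rewrite in_zrange. lia.
  - intros N M h k. rewrite !in_zrange. lia.
  - intros t. exists (S (Z.abs_nat t)). rewrite in_zrange. lia.
Qed.

Lemma NoDup_list_prod {S T : Type} (l : list S) (m : list T) : NoDup l -> NoDup m -> NoDup (list_prod l m).
Proof.
  intros hl hm. induction hl as [|x l hx hl IH]; simpl; [constructor|].
  apply NoDup_app; auto.
  - clear IH hl hx. induction hm as [|y m hy hm IH]; simpl; constructor; auto.
    intros h. apply in_map_iff in h. destruct h as [z [e hz]]. congruence.
  - intros [a b] ha hb. apply in_map_iff in ha. destruct ha as [z [e hz]]. apply in_prod_iff in hb.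
    injection e as e1 e2. subst. tauto.
Qed.

Lemma exhausts_prod {S T : Type} (A : nat -> list S) (B : nat -> list T) : exhausts A -> exhausts B ->
  exhausts (fun N => list_prod (A N) (B N)).
Proof.
  intros [a1 [a2 a3]] [b1 [b2 b3]]. repeat split.
  - intros N. apply NoDup_list_prod; auto.
  - intros N M h [x y]. rewrite !in_prod_iff. intros [hx hy]. split; [apply (a2 N)|apply (b2 N)]; auto.
  - intros [x y]. destruct (a3 x) as [N hN]. destruct (b3 y) as [M hM]. exists (max N M).
    apply in_prod_iff. split; [apply (a2 N)|apply (b2 M)]; auto; lia.
Qed.

Lemma lrsum_prod {S T : Type} (f : S -> T -> R) (l : list S) (m : list T) :
  lrsum (fun p => f (fst p) (snd p)) (list_prod l m) = lrsum (fun y => lrsum (fun x => f x y) l) m.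
Proof.
  induction l as [|x l IH].
  - simpl. unfold lrsum at 1; simpl. symmetry. induction m as [|y m IHm]; unfold lrsum in *; simpl; auto. rewrite IHm. ring.
  - simpl. rewrite lrsum_app, IH. clear IH.
    induction m as [|y m IHm]; unfold lrsum in *; simpl in *; [ring|]. lra.
Qed.

Lemma lrsum_zrange (l : R) (f : R -> R) N :
  lrsum (fun k => f ((IZR k + l) ^ 2)) (zrange N) = rsum (fold l f) N.
Proof.
  induction N as [|N IH]; [reflexivity|]. rewrite rsum_S, fold_Z, <- IH. unfold lrsum; cbn [zrange Iter.iter]. ring.
Qed.

Definition zbox (N : nat) : list (Z * Z) := list_prod (zrange N) (zrange N).

Definition lattice_q (bt l1 l2 : R) (p : Z * Z) : R := (IZR (fst p) + l1) ^ 2 + bt ^ 2 * (IZR (snd p) + l2) ^ 2.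

Lemma exhausts_zbox : exhausts zbox.
Proof. apply exhausts_prod; apply exhausts_zrange. Qed.

Lemma lrsum_zbox bt l1 l2 N u :
  lrsum (fun p => / (lattice_q bt l1 l2 p + u ^ 2) ^ 2) (zbox N) = Ybox bt l1 l2 N u.
Proof.
  unfold zbox, lattice_q.
  rewrite (lrsum_prod (fun k n => / ((IZR k + l1) ^ 2 + bt ^ 2 * (IZR n + l2) ^ 2 + u ^ 2) ^ 2)).
  unfold Ybox, X_sum. rewrite <- lrsum_zrange. apply lrsum_ext. intros n.
  rewrite <- lrsum_zrange. apply lrsum_ext. intros k. f_equal. f_equal. ring.
Qed.

Lemma is_prod_exp {T : Type} (B : nat -> list T) (h g : T -> R) (M L : R) :
  exhausts B -> (forall t, Rabs (h t) <= g t) -> (forall N, lrsum g (B N) <= M) ->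
  is_lim_seq (fun N => lrsum h (B N)) L -> is_prod (fun t => exp (h t)) (exp L).
Proof.
  intros hB hg hM hL.
  destruct (summable_is_sum B (fun t => RtoC (h t)) g M hB) as [v [hv hl]]; auto.
  { intros t. rewrite Cmod_R. auto. }
  assert (e : v = RtoC L).
  { apply (Clim_unique _ _ _ hl). apply Clim_ext with (fun N => RtoC (lrsum h (B N))).
    - intros n. symmetry. apply lsum_RtoC.
    - apply Clim_RtoC; auto. }
  subst v. unfold is_prod. intros P [eps hP].
  assert (hc : continuity_pt exp L) by (apply derivable_continuous_pt, derivable_pt_exp).
  destruct (hc eps (cond_pos eps)) as [d [hd hc']].
  destruct (hv (fun z => Cmod (z - RtoC L) < d)) as [l0 hl0].
  { apply locally_C_eps. exists d. split; auto. }
  exists l0. intros l hl1 hl2. apply hP.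
  assert (k := hl0 l hl1 hl2). cbv beta in k.
  change (Iter.iter Cplus (RtoC 0) l (fun t => RtoC (h t))) with (lsum (fun t => RtoC (h t)) l) in k.
  rewrite lsum_RtoC, <- RtoC_minus, Cmod_R in k.
  replace (Iter.iter Rmult 1 l (fun t => exp (h t))) with (exp (lrsum h l)).
  2: { clear. unfold lrsum. induction l as [|t l IH]; simpl; [apply exp_0|]. rewrite exp_plus, IH. reflexivity. }
  change (Rabs (exp (lrsum h l) - exp L) < eps).
  destruct (Req_dec (lrsum h l) L) as [e|e].
  - rewrite e. unfold Rminus. rewrite Rplus_opp_r, Rabs_R0. apply cond_pos.
  - apply hc'. repeat split; auto.
Qed.

Lemma exp_ell l t : 0 < den l t ->
  exp (ell l t) = Cmod (1 - Cexp (RtoC (2 * PI) * Ci * RtoC l) * RtoC (rho t)).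
Proof.
  intros h. unfold ell. replace (exp (ln (den l t) / 2)) with (sqrt (den l t)).
  - assert (e : Cexp (RtoC (2 * PI) * Ci * RtoC l) = (cos (2 * PI * l), sin (2 * PI * l))).
    { unfold Cexp. replace (Re (RtoC (2 * PI) * Ci * RtoC l)) with 0 by (unfold Re, Ci; simpl; ring).
      replace (Im (RtoC (2 * PI) * Ci * RtoC l)) with (2 * PI * l) by (unfold Im, Ci; simpl; ring).
      rewrite exp_0, !Rmult_1_l. reflexivity. }
    rewrite e. unfold Cmod. f_equal. simpl fst. simpl snd. unfold den.
    replace (rho t ^ 2) with (rho t ^ 2 * (Rsqr (sin (2 * PI * l)) + Rsqr (cos (2 * PI * l)))) by (rewrite sin2_cos2; ring).
    unfold Rsqr. ring.
  - rewrite <- Rpower_sqrt by auto. unfold Rpower. f_equal. field.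
Qed.

Lemma is_prod_factor bt l1 l2 (LP : R) : admissible bt l1 l2 ->
  is_lim_seq (rsum (fold l2 (fun a => ell l1 (bt * sqrt a)))) LP ->
  is_prod (fun n : Z => Cmod (1 - Cexp (RtoC (2 * PI) * Ci * RtoC l1)
                   * RtoC (exp (- (2 * PI * bt * Rabs (IZR n + l2)))))%C) (exp LP).
Proof.
  intros ha hL. destruct (ell_summable bt l1 l2 ha) as [C [hC hs]].
  assert (hb : 0 < bt) by apply ha. assert (hpi := PI_RGT_0).
  assert (hc : 0 < 2 * PI * bt) by (apply Rmult_lt_0_compat; lra).
  replace (fun n : Z => Cmod (1 - Cexp (RtoC (2 * PI) * Ci * RtoC l1)
                   * RtoC (exp (- (2 * PI * bt * Rabs (IZR n + l2)))))%C)
    with (fun n : Z => exp (ell l1 (bt * sqrt ((IZR n + l2) ^ 2)))).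
  2: { apply functional_extensionality. intros n. rewrite exp_ell by apply hs.
       unfold rho. do 5 f_equal. rewrite <- Rsqr_pow2, sqrt_Rsqr_abs. ring. }
  apply (is_prod_exp zrange _ (fun n : Z => C * exp (- (2 * PI * bt * sqrt ((IZR n + l2) ^ 2))))
    (C * (2 * / (1 - exp (- (2 * PI * bt)))))).
  - apply exhausts_zrange.
  - intros t. apply hs.
  - intros N. rewrite lrsum_scal. apply Rmult_le_compat_l; auto.
    rewrite (lrsum_zrange l2 (fun a => exp (- (2 * PI * bt * sqrt a)))). apply exp_fold_sum; auto. apply ha.
  - apply is_lim_seq_ext with (2 := hL). intros N. symmetry. apply (lrsum_zrange l2 (fun a => ell l1 (bt * sqrt a))).
Qed.

(** * The Mellin lattice_mellin_lim of the lattice zeta function *)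

Definition is_lattice_sum (bt l1 l2 : R) (Y : R -> R) : Prop :=
  (forall u, is_lim_seq (fun N => Ybox bt l1 l2 N u) (Y u)) /\
  (forall N u, 0 <= Y u - Ybox bt l1 l2 N u <= Y 0 - Ybox bt l1 l2 N 0) /\
  (forall u, continuous Y u) /\
  exists K c u0, 0 < c /\ 0 <= K /\ 1 <= u0 /\
    forall u, u0 <= u -> Rabs (Y u - PI / bt / u ^ 2) <= K * exp (- (c * u)).

Lemma lattice_q_pos bt l1 l2 p : admissible bt l1 l2 -> 0 < lattice_q bt l1 l2 p.
Proof. intros h. destruct (quad_form_min bt l1 l2 h) as [qm [h1 h2]]. unfold lattice_q. specialize (h2 (fst p) (snd p)). lra. Qed.

Lemma lsum_beta {T : Type} (q : T -> R) (l : list T) (s : C) : (forall t, 0 < q t) -> 1 / 2 < Re s < 3 / 2 ->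
  exists a b : C,
    is_CInt (fun x => RCpow x (3 - 2 * s) * RtoC (lrsum (fun t => / (q t + x ^ 2) ^ 2)%R l))%C 0 1 a /\
    is_CInt (fun x => RCpow x (2 * s - 1) * RtoC (lrsum (fun t => / (q t * x ^ 2 + 1) ^ 2)%R l))%C 0 1 b /\
    (lsum (fun t => RCpow (q t) (- s)) l * beta s = a + b)%C.
Proof.
  intros hq hs.
  assert (r1 := re_3_2s s). assert (r2 := re_2s_1 s).
  induction l as [|t l [a [b [ha [hb e]]]]].
  - exists (0 * CInt (fun x => RCpow x (3 - 2 * s) * RtoC (/ (1 + 1 * x ^ 2) ^ 2)) 0 1)%C,
      (0 * CInt (fun x => RCpow x (2 * s - 1) * RtoC (/ (1 + 1 * x ^ 2) ^ 2)) 0 1)%C.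
    refine (conj _ (conj _ _)).
    + eapply is_CInt_ext; [|apply is_CInt_scal, CInt_correct, ex_CInt_RCpow_rational; lra].
      intros x _. unfold lrsum; simpl. ring.
    + eapply is_CInt_ext; [|apply is_CInt_scal, CInt_correct, ex_CInt_RCpow_rational; lra].
      intros x _. unfold lrsum; simpl. ring.
    + unfold lsum; simpl. ring.
  - assert (h1 := ex_CInt_RCpow_rational (3 - 2 * s) (q t) 1 1 ltac:(lra) (hq t) ltac:(lra) ltac:(lra)).
    assert (h2 := ex_CInt_RCpow_rational (2 * s - 1) 1 (q t) 1 ltac:(lra) ltac:(lra) (Rlt_le _ _ (hq t)) ltac:(lra)).
    apply CInt_correct in h1. apply CInt_correct in h2.
    eexists _, _. refine (conj _ (conj _ _)).
    + eapply is_CInt_ext; [|apply is_CInt_plus; [exact h1|exact ha]].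
      intros x _. unfold lrsum; cbn [Iter.iter]. rewrite RtoC_plus, Rmult_1_l. ring.
    + eapply is_CInt_ext; [|apply is_CInt_plus; [exact h2|exact hb]].
      intros x _. unfold lrsum; cbn [Iter.iter]. rewrite RtoC_plus, (Rplus_comm (q t * x ^ 2)). ring.
    + replace (lsum (fun t => RCpow (q t) (- s)) (t :: l)) with (RCpow (q t) (- s) + lsum (fun t => RCpow (q t) (- s)) l)%C by reflexivity.
      rewrite Cmult_plus_distr_r, e, beta_scaling by auto.
      rewrite (CInt_ext (fun x => RCpow x (3 - 2 * s) * RtoC (/ (q t + 1 * x ^ 2) ^ 2))%C (fun x => RCpow x (3 - 2 * s) * RtoC (/ (q t + x ^ 2) ^ 2))%C)
        by (intros x _; rewrite Rmult_1_l; reflexivity).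
      rewrite (CInt_ext (fun x => RCpow x (2 * s - 1) * RtoC (/ (1 + q t * x ^ 2) ^ 2))%C (fun x => RCpow x (2 * s - 1) * RtoC (/ (q t * x ^ 2 + 1) ^ 2))%C)
        by (intros x _; rewrite Rplus_comm; reflexivity).
      ring.
Qed.

Lemma RCpow_shift_4 x s : 0 < x -> RCpow x (2 * s - 5) = (RCpow x (2 * s - 1) * RtoC (/ x ^ 4))%C.
Proof.
  intros hx. replace (2 * s - 5)%C with ((2 * s - 1) + - RtoC (INR 4))%C.
  - rewrite RCpow_plus, <- RCpow_inv, RCpow_nat by (auto; apply Rinv_0_lt_compat; auto).
    rewrite pow_inv. reflexivity.
  - replace (INR 4) with 4 by (simpl; ring). replace (RtoC 5) with (1 + 4)%C by (rewrite <- RtoC_plus; f_equal; ring). ring.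
Qed.

Lemma lrsum_zbox_inv bt l1 l2 N x : admissible bt l1 l2 -> 0 < x ->
  lrsum (fun p => / (lattice_q bt l1 l2 p * x ^ 2 + 1) ^ 2) (zbox N) = / x ^ 4 * Ybox bt l1 l2 N (/ x).
Proof.
  intros ha hx. rewrite <- lrsum_zbox, <- lrsum_scal. apply lrsum_ext. intros p.
  assert (hq := lattice_q_pos bt l1 l2 p ha). assert (0 < lattice_q bt l1 l2 p * x ^ 2) by (apply Rmult_lt_0_compat; auto; apply pow_lt; auto).
  assert (0 < x ^ 2) by (apply pow_lt; auto).
  field. repeat split; lra.
Qed.

Lemma box_representation bt l1 l2 N s : admissible bt l1 l2 -> 1 / 2 < Re s < 3 / 2 ->
  ex_CInt (fun x => RCpow x (3 - 2 * s) * RtoC (Ybox bt l1 l2 N x))%C 0 1 /\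
  ex_CInt (fun x => RCpow x (2 * s - 5) * RtoC (Ybox bt l1 l2 N (/ x)))%C 0 1 /\
  (lsum (fun p => RCpow (lattice_q bt l1 l2 p) (- s)) (zbox N) * beta s
   = mellin (Ybox bt l1 l2 N) (3 - 2 * s) + mellin (fun x => Ybox bt l1 l2 N (/ x)) (2 * s - 5))%C.
Proof.
  intros ha hs.
  destruct (lsum_beta (lattice_q bt l1 l2) (zbox N) s (fun p => lattice_q_pos bt l1 l2 p ha) hs) as [a [b [h1 [h2 e]]]].
  assert (k1 : is_CInt (fun x => RCpow x (3 - 2 * s) * RtoC (Ybox bt l1 l2 N x))%C 0 1 a).
  { eapply is_CInt_ext; [|exact h1]. intros x _. cbv beta. rewrite lrsum_zbox. reflexivity. }
  assert (k2 : is_CInt (fun x => RCpow x (2 * s - 5) * RtoC (Ybox bt l1 l2 N (/ x)))%C 0 1 b).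
  { eapply is_CInt_ext; [|exact h2]. intros x hx. rewrite Rmin_left, Rmax_right in hx by lra. cbv beta.
    rewrite lrsum_zbox_inv, RCpow_shift_4, RtoC_mult by (auto; lra). ring. }
  refine (conj _ (conj _ _)).
  - exists a. exact k1.
  - exists b. exact k2.
  - unfold mellin. rewrite (is_CInt_unique _ _ _ _ k1), (is_CInt_unique _ _ _ _ k2). exact e.
Qed.

(* What remains of [Y (1 / x)] once its main term is removed; it vanishes to all orders at [0]. *)
Definition Wrem (bt : R) (Y : R -> R) (x : R) : R := Y (/ x) - PI / bt * x ^ 2.

Lemma Y_bounds bt l1 l2 Y u : is_lattice_sum bt l1 l2 Y -> 0 <= Y u <= Y 0.
Proof.
  intros [_ [h _]]. specialize (h 0%nat u). unfold Ybox in h. simpl in h. lra.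
Qed.

Lemma exp_inv_le_Rpower c M : 0 < c -> 0 < M -> exists C, 0 <= C /\
  forall x, 0 < x -> exp (- (c * / x)) <= C * Rpower x M.
Proof.
  intros hc hM. exists (exp (- M - M * ln (c / M))). split; [left; apply exp_pos|].
  intros x hx. unfold Rpower. rewrite <- exp_plus. apply exp_le.
  assert (hix : 0 < / x) by (apply Rinv_0_lt_compat; auto).
  assert (hcm : 0 < c / M) by (apply Rdiv_lt_0_compat; auto).
  assert (h := exp_ineq1_le (ln (c / M * / x))).
  rewrite exp_ln in h by (apply Rmult_lt_0_compat; auto).
  rewrite ln_mult, ln_Rinv in h by auto.
  assert (k : M * (1 + (ln (c / M) + - ln x)) <= M * (c / M * / x)) by (apply Rmult_le_compat_l; lra).
  replace (M * (c / M * / x)) with (c * / x) in k by (field; lra). lra.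
Qed.

Lemma Wrem_bound bt l1 l2 Y M : 0 < bt -> is_lattice_sum bt l1 l2 Y -> 0 < M -> exists C, 0 <= C /\
  forall x, 0 < x <= 1 -> Rabs (Wrem bt Y x) <= C * Rpower x M.
Proof.
  intros hb hY hM. destruct (hY) as [_ [_ [_ [K [c [u0 [hc [hK [hu0 h]]]]]]]]].
  destruct (exp_inv_le_Rpower c M hc hM) as [C1 [hC1 hexp]].
  assert (hA : 0 < PI / bt) by (apply Rdiv_lt_0_compat; auto; apply PI_RGT_0).
  assert (hY0 := Y_bounds bt l1 l2 Y 0 hY).
  set (r := Rpower (/ u0) M). assert (hr : 0 < r) by apply exp_pos.
  assert (hir : 0 < / r) by (apply Rinv_0_lt_compat; auto).
  exists (K * C1 + (Y 0 + PI / bt) * / r). split.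
  { apply Rplus_le_le_0_compat; apply Rmult_le_pos; lra. }
  intros x hx. assert (hix : 0 < / x) by (apply Rinv_0_lt_compat; lra).
  assert (hp : 0 < Rpower x M) by apply exp_pos.
  destruct (Rle_dec u0 (/ x)) as [hl|hl].
  - specialize (h (/ x) hl). replace (PI / bt / (/ x) ^ 2) with (PI / bt * x ^ 2) in h by (field; lra).
    fold (Wrem bt Y x) in h. specialize (hexp x ltac:(lra)).
    assert (k : K * exp (- (c * / x)) <= K * (C1 * Rpower x M)) by (apply Rmult_le_compat_l; auto).
    assert (0 <= (Y 0 + PI / bt) * / r * Rpower x M) by (apply Rmult_le_pos; [apply Rmult_le_pos|]; lra).
    lra.
  - assert (hxl : / u0 <= x).
    { rewrite <- (Rinv_inv x). apply Rinv_le_contravar; lra. }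
    assert (hrx : r <= Rpower x M).
    { unfold r. apply Rle_Rpower_l; [lra|]. split; auto. apply Rinv_0_lt_compat; lra. }
    assert (hW : Rabs (Wrem bt Y x) <= Y 0 + PI / bt).
    { unfold Wrem. assert (k := Y_bounds bt l1 l2 Y (/ x) hY).
      assert (0 <= x ^ 2 <= 1) by (split; nra).
      assert (0 <= PI / bt * x ^ 2 <= PI / bt * 1) by (split; [apply Rmult_le_pos|apply Rmult_le_compat_l]; lra).
      apply Rabs_le. lra. }
    assert (k : (Y 0 + PI / bt) * 1 <= (Y 0 + PI / bt) * (/ r * Rpower x M)).
    { apply Rmult_le_compat_l; [lra|]. rewrite <- (Rinv_l r) by lra. apply Rmult_le_compat_l; lra. }
    assert (0 <= K * C1 * Rpower x M) by (apply Rmult_le_pos; [apply Rmult_le_pos|]; lra).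
    lra.
Qed.

Lemma continuous_Wrem bt l1 l2 Y x : is_lattice_sum bt l1 l2 Y -> 0 < x -> continuous (Wrem bt Y) x.
Proof.
  intros [_ [_ [hY _]]] hx. unfold Wrem.
  apply (continuous_minus (V := R_NormedModule) (fun x => Y (/ x)) (fun x => PI / bt * x ^ 2)).
  - apply (continuous_comp (fun x => / x) Y); auto. apply (ex_derive_continuous (fun x => / x)). auto_derive. lra.
  - apply (ex_derive_continuous (fun x => PI / bt * x ^ 2)). auto_derive. auto.
Qed.

Lemma Y_inv_le bt l1 l2 Y : 0 < bt -> is_lattice_sum bt l1 l2 Y -> exists C, 0 <= C /\
  forall x, 0 < x <= 1 -> Y (/ x) <= C * x ^ 2.
Proof.
  intros hb hY. destruct (Wrem_bound bt l1 l2 Y 2 hb hY ltac:(lra)) as [C [hC h]].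
  assert (hA : 0 < PI / bt) by (apply Rdiv_lt_0_compat; auto; apply PI_RGT_0).
  exists (C + PI / bt). split; [lra|]. intros x hx. specialize (h x hx). unfold Wrem in h.
  replace (Rpower x 2) with (x ^ 2) in h by (rewrite <- Rpower_pow by lra; simpl; f_equal; ring).
  apply Rabs_le_between in h. lra.
Qed.

Lemma re_2s_5 s : Re (2 * s - 5) = 2 * Re s - 5.
Proof. unfold Re; simpl; ring. Qed.

Lemma re_2s_2 s : Re (2 * s - 2) = 2 * Re s - 2.
Proof. unfold Re; simpl; ring. Qed.

Lemma ex_mellin_Y bt l1 l2 Y z : is_lattice_sum bt l1 l2 Y -> 0 < Re z -> ex_CInt (fun x => RCpow x z * RtoC (Y x))%C 0 1.
Proof.
  intros hY hz. apply ex_mellin with (Y 0) 0; try lra.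
  - intros x _. apply hY.
  - intros x hx. rewrite Rpower_O by lra. assert (k := Y_bounds bt l1 l2 Y x hY). rewrite Rabs_pos_eq; lra.
Qed.

Lemma ex_mellin_W bt l1 l2 Y z : 0 < bt -> is_lattice_sum bt l1 l2 Y -> ex_CInt (fun x => RCpow x z * RtoC (Wrem bt Y x))%C 0 1.
Proof.
  intros hb hY. set (M := Rabs (Re z) + 1). assert (0 < M) by (unfold M; generalize (Rabs_pos (Re z)); lra).
  destruct (Wrem_bound bt l1 l2 Y M hb hY) as [C [hC h]]; auto.
  apply ex_mellin with C M; auto.
  - intros x hx. apply (continuous_Wrem bt l1 l2); auto; lra.
  - unfold M. assert (k := Rabs_maj2 (Re z)). lra.
Qed.

Lemma CInt_restrict (f : R -> C) eta : 0 < eta < 1 -> (forall x, 0 < x <= 1 -> ccont f x) -> ex_CInt f 0 1 ->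
  ex_CInt f 0 eta /\ ex_CInt f eta 1 /\ CInt f 0 1 = (CInt f 0 eta + CInt f eta 1)%C.
Proof.
  intros he hf hx.
  assert (h1 : ex_CInt f 0 eta) by (apply (ex_RInt_Chasles_1 (V := C_R_CompleteNormedModule) f 0 eta 1); auto; lra).
  assert (h2 : ex_CInt f eta 1) by (apply (ex_RInt_Chasles_2 (V := C_R_CompleteNormedModule) f 0 eta 1); auto; lra).
  repeat split; auto. apply CInt_Chasles; auto.
Qed.

Lemma Rpower_base_1 a : Rpower 1 a = 1.
Proof. unfold Rpower. rewrite ln_1, Rmult_0_r. apply exp_0. Qed.

Lemma Yerr_lim bt l1 l2 Y c : is_lattice_sum bt l1 l2 Y -> is_lim_seq (fun N => (Y 0 - Ybox bt l1 l2 N 0) * c) 0.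
Proof.
  intros [h _]. replace (Finite 0) with (Rbar_mult (Finite (Y 0 - Y 0)) c) by (simpl; f_equal; ring).
  apply is_lim_seq_scal_r. apply is_lim_seq_minus'; [apply is_lim_seq_const|apply h].
Qed.

Lemma mellin_Ybox_lim bt l1 l2 Y s : admissible bt l1 l2 -> is_lattice_sum bt l1 l2 Y -> 1 < Re s < 3 / 2 ->
  Clim (fun N => mellin (Ybox bt l1 l2 N) (3 - 2 * s)) (mellin Y (3 - 2 * s)).
Proof.
  intros ha hY hs. destruct (hY) as [h1 [h2 _]]. assert (hr := re_3_2s s).
  apply Clim_of_diff.
  apply Clim_squeeze0 with (fun N => (Y 0 - Ybox bt l1 l2 N 0) * / (4 - 2 * Re s)).
  - intros N. destruct (box_representation bt l1 l2 N s ha ltac:(lra)) as [k1 _].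
    assert (k2 := ex_mellin_Y bt l1 l2 Y (3 - 2 * s) hY ltac:(lra)).
    assert (hN := h2 N 0). assert (hia : 0 < / (4 - 2 * Re s)) by (apply Rinv_0_lt_compat; lra).
    unfold mellin. rewrite <- CInt_minus by auto.
    eapply Rle_trans; [apply (Cmod_CInt_tail_le _ (Y 0 - Ybox bt l1 l2 N 0) (4 - 2 * Re s) 1); try lra|].
    + eexists. apply (is_CInt_minus (fun x => RCpow x (3 - 2 * s) * RtoC (Ybox bt l1 l2 N x))%C (fun x => RCpow x (3 - 2 * s) * RtoC (Y x))%C);
        apply CInt_correct; auto.
    + intros x hx.
      replace (RCpow x (3 - 2 * s) * RtoC (Ybox bt l1 l2 N x) - RCpow x (3 - 2 * s) * RtoC (Y x))%C
        with (RCpow x (3 - 2 * s) * RtoC (- (Y x - Ybox bt l1 l2 N x)))%C by (rewrite RtoC_opp, RtoC_minus; ring).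
      rewrite Cmod_mult, Cmod_R, Cmod_RCpow, Rabs_Ropp, hr.
      replace (4 - 2 * Re s - 1) with (3 - 2 * Re s) by ring.
      assert (k := h2 N x). rewrite Rabs_pos_eq, Rmult_comm by lra. apply Rmult_le_compat_r; [left; apply exp_pos|lra].
    + rewrite Rpower_base_1. right. field. lra.
  - apply (Yerr_lim bt l1 l2 Y _ hY).
Qed.

Lemma mellin_Ybox_inv_estimate bt l1 l2 Y s : admissible bt l1 l2 -> is_lattice_sum bt l1 l2 Y -> 1 < Re s < 3 / 2 ->
  exists C, 0 <= C /\ forall N eta, 0 < eta < 1 ->
  Cmod (mellin (fun x => Ybox bt l1 l2 N (/ x)) (2 * s - 5)
        - (mellin (Wrem bt Y) (2 * s - 5) + RtoC (PI / bt) / (2 * s - 2)))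
  <= (Y 0 - Ybox bt l1 l2 N 0) * Rpower eta (2 * Re s - 5) + C * Rpower eta (2 * Re s - 2).
Proof.
  intros ha hY hs. destruct (hY) as [h1 [h2 [hc _]]]. assert (r5 := re_2s_5 s). assert (r2 := re_2s_2 s).
  assert (hb : 0 < bt) by apply ha. set (A := PI / bt). assert (hA : 0 < A) by (apply Rdiv_lt_0_compat; auto; apply PI_RGT_0).
  destruct (Y_inv_le bt l1 l2 Y hb hY) as [C1 [hC1 hY1]].
  destruct (Wrem_bound bt l1 l2 Y 2 hb hY ltac:(lra)) as [C2 [hC2 hW]].
  set (a := 2 * Re s - 2). assert (ha0 : 0 < a) by (unfold a; lra).
  assert (hia : 0 < / a) by (apply Rinv_0_lt_compat; auto).
  exists ((C1 + C2 + A) * / a). split; [apply Rmult_le_pos; lra|].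
  intros N eta he.
  destruct (box_representation bt l1 l2 N s ha ltac:(lra)) as [_ [k1 _]].
  assert (k2 := ex_mellin_W bt l1 l2 Y (2 * s - 5) hb hY).
  set (f := fun x => (RCpow x (2 * s - 5) * RtoC (Ybox bt l1 l2 N (/ x)))%C) in *.
  set (w := fun x => (RCpow x (2 * s - 5) * RtoC (Wrem bt Y x))%C) in *.
  assert (hYN : forall u, 0 <= Ybox bt l1 l2 N u).
  { intros u. eapply Rle_trans; [|apply (rsum_mono_n _ 0 N); [lia|]]; [simpl; lra|]. intros k. apply Ybox_term_nonneg. }
  assert (cf : forall x, 0 < x <= 1 -> ccont f x).
  { intros x hx. apply (ccont_mellin (fun x => Ybox bt l1 l2 N (/ x))); [lra|].
    apply (continuous_comp (fun x => / x) (Ybox bt l1 l2 N)); [|apply Ybox_continuous; auto].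
    apply (ex_derive_continuous (fun x => / x)). auto_derive. lra. }
  assert (cw : forall x, 0 < x <= 1 -> ccont w x).
  { intros x hx. apply ccont_mellin; [lra|]. apply (continuous_Wrem bt l1 l2); auto; lra. }
  destruct (CInt_restrict f eta he cf k1) as [f1 [f2 f3]].
  destruct (CInt_restrict w eta he cw k2) as [w1 [w2 w3]].
  assert (hx2 : forall x, 0 < x -> Rpower x 2 = x ^ 2).
  { intros x hx. rewrite <- (Rpower_pow 2) by lra. f_equal. }
  assert (hpow : forall x, 0 < x -> Rpower x (2 * Re s - 5) * x ^ 2 = Rpower x (a - 1)).
  { intros x hx. rewrite <- hx2, <- Rpower_plus by auto. f_equal. unfold a. ring. }
  assert (b1 : Cmod (CInt f 0 eta) <= C1 * Rpower eta a / a).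
  { apply Cmod_CInt_tail_le; auto; try lra. intros x hx. unfold f. rewrite Cmod_mult, Cmod_R, Cmod_RCpow, r5.
    rewrite Rabs_pos_eq by auto. rewrite <- hpow by lra.
    replace (C1 * (Rpower x (2 * Re s - 5) * x ^ 2)) with (Rpower x (2 * Re s - 5) * (C1 * x ^ 2)) by ring.
    apply Rmult_le_compat_l; [left; apply exp_pos|]. assert (k := h2 N (/ x)). specialize (hY1 x ltac:(lra)). lra. }
  assert (b2 : Cmod (CInt w 0 eta) <= C2 * Rpower eta a / a).
  { apply Cmod_CInt_tail_le; auto; try lra. intros x hx. unfold w. rewrite Cmod_mult, Cmod_R, Cmod_RCpow, r5.
    rewrite <- hpow by lra.
    replace (C2 * (Rpower x (2 * Re s - 5) * x ^ 2)) with (Rpower x (2 * Re s - 5) * (C2 * x ^ 2)) by ring.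
    apply Rmult_le_compat_l; [left; apply exp_pos|]. specialize (hW x ltac:(lra)). rewrite hx2 in hW by lra. lra. }
  assert (hn0 : (2 * s - 2)%C <> RtoC 0) by (apply Re_neq0; lra).
  set (H := fun x => (RtoC A / (2 * s - 2) * RCpow x (2 * s - 2))%C).
  assert (b3 : Cmod (H eta) <= A * Rpower eta a / a).
  { unfold H. rewrite Cmod_mult, Cmod_RCpow, r2. unfold Cdiv. rewrite Cmod_mult, Cmod_inv, Cmod_R, Rabs_pos_eq by (auto; lra).
    fold a. unfold Rdiv. rewrite Rmult_assoc, (Rmult_comm (/ _)), <- Rmult_assoc.
    apply Rmult_le_compat_l; [apply Rmult_le_pos; [lra|left; apply exp_pos]|].
    apply Rinv_le_contravar; auto. unfold a. rewrite <- r2. eapply Rle_trans; [apply Rle_abs|apply re_le_Cmod]. }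
  assert (iH : is_CInt (fun x => RtoC A / (2 * s - 2) * ((2 * s - 2) * RCpow x (2 * s - 2 - 1)))%C eta 1 (H 1 - H eta)%C).
  { apply is_CInt_derive; rewrite Rmin_left, Rmax_right by lra; intros x hx.
    - apply is_rcderive_scal, is_rcderive_RCpow. lra.
    - apply ccont_mult; [apply ccont_const|]. apply ccont_mult; [apply ccont_const|]. apply ccont_RCpow. lra. }
  assert (b4 : Cmod (CInt f eta 1 - CInt w eta 1 - (H 1 - H eta)) <= (Y 0 - Ybox bt l1 l2 N 0) * Rpower eta (2 * Re s - 5)).
  { assert (i1 := is_CInt_minus _ _ _ _ _ _ (is_CInt_minus _ _ _ _ _ _ (CInt_correct _ _ _ f2) (CInt_correct _ _ _ w2)) iH).
    assert (i2 : is_CInt (fun x => RCpow x (2 * s - 5) * RtoC (- (Y (/ x) - Ybox bt l1 l2 N (/ x)))%R)%C eta 1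
       (CInt f eta 1 - CInt w eta 1 - (H 1 - H eta))%C).
    { refine (is_CInt_ext _ _ _ _ _ _ i1). rewrite Rmin_left, Rmax_right by lra. intros x hx. cbv beta.
      replace (2 * s - 2 - 1)%C with ((2 * s - 5) + RtoC (INR 2))%C.
      2: { replace (INR 2) with 2 by (simpl; ring). replace (RtoC 5) with (RtoC 2 + 2 + 1)%C by (rewrite <- !RtoC_plus; f_equal; ring). ring. }
      rewrite RCpow_plus, RCpow_nat by lra.
      unfold f, w, Wrem. fold A. rewrite RtoC_opp, !RtoC_minus, RtoC_mult. field. auto. }
    assert (hE := h2 N 0).
    replace ((Y 0 - Ybox bt l1 l2 N 0) * Rpower eta (2 * Re s - 5)) with
      ((1 - eta) * ((Y 0 - Ybox bt l1 l2 N 0) * Rpower eta (2 * Re s - 5)) + eta * ((Y 0 - Ybox bt l1 l2 N 0) * Rpower eta (2 * Re s - 5))) by ring.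
    set (D := (Y 0 - Ybox bt l1 l2 N 0) * Rpower eta (2 * Re s - 5)).
    assert (hD : 0 <= D) by (apply Rmult_le_pos; [lra|left; apply exp_pos]).
    rewrite <- (is_CInt_unique _ _ _ _ i2).
    apply Rle_trans with ((1 - eta) * D); [|nra].
    apply Cmod_CInt_le_const; [lra| |eexists; exact i2].
    intros x hx. rewrite Cmod_mult, Cmod_R, Cmod_RCpow, r5, Rabs_Ropp.
    assert (k := h2 N (/ x)). rewrite Rabs_pos_eq, Rmult_comm by lra.
    apply Rmult_le_compat; try lra; [left; apply exp_pos|].
    unfold Rpower. apply exp_le. assert (ln eta <= ln x) by (apply ln_le; lra).
    apply Rmult_le_compat_neg_l; lra. }
  assert (eH : H 1 = (RtoC A / (2 * s - 2))%C).
  { unfold H, RCpow. rewrite ln_1, Cmult_0_r, Cexp_0. ring. }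
  unfold mellin. fold f. fold w. rewrite f3, w3, <- eH.
  replace (CInt f 0 eta + CInt f eta 1 - (CInt w 0 eta + CInt w eta 1 + H 1))%C
    with ((CInt f eta 1 - CInt w eta 1 - (H 1 - H eta)) + (CInt f 0 eta - (CInt w 0 eta + H eta)))%C by ring.
  eapply Rle_trans; [apply Cmod_triangle|]. apply Rplus_le_compat; auto.
  unfold Cminus at 1. eapply Rle_trans; [apply Cmod_triangle|]. rewrite Cmod_opp.
  assert (k := Cmod_triangle (CInt w 0 eta) (H eta)).
  replace ((C1 + C2 + A) * / a * Rpower eta a) with (C1 * Rpower eta a / a + (C2 * Rpower eta a / a + A * Rpower eta a / a)) by (field; lra).
  lra.
Qed.

(* [A / (2 s - 2)] is the regularised integral of the main term [A x^(2 s - 3)]. *)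
Definition lattice_mellin (bt : R) (Y : R -> R) (s : C) : C :=
  (mellin Y (3 - 2 * s) + (mellin (Wrem bt Y) (2 * s - 5) + RtoC (PI / bt) / (2 * s - 2)))%C.

Lemma lattice_mellin_lim bt l1 l2 Y s : admissible bt l1 l2 -> is_lattice_sum bt l1 l2 Y -> 1 < Re s < 3 / 2 ->
  Clim (fun N => lsum (fun p => RCpow (lattice_q bt l1 l2 p) (- s)) (zbox N) * beta s)%C (lattice_mellin bt Y s).
Proof.
  intros ha hY hs.
  apply Clim_ext with (fun N => mellin (Ybox bt l1 l2 N) (3 - 2 * s) + mellin (fun x => Ybox bt l1 l2 N (/ x)) (2 * s - 5))%C.
  { intros N. symmetry. apply box_representation; auto. lra. }
  apply Clim_plus; [apply mellin_Ybox_lim; auto|].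
  destruct (mellin_Ybox_inv_estimate bt l1 l2 Y s ha hY hs) as [C [hC h]].
  intros eps he. destruct (Rpower_small (2 * Re s - 2) (eps / (2 * (C + 1)))) as [d [hd hd2]]; [lra|apply Rdiv_lt_0_compat; lra|].
  set (eta := d / 2). assert (heta : 0 < eta < 1) by (unfold eta; lra).
  specialize (hd2 eta ltac:(unfold eta; lra)).
  set (p := Rpower eta (2 * Re s - 5)). assert (hp : 0 < p) by apply exp_pos.
  assert (hlim := Yerr_lim bt l1 l2 Y p hY). apply is_lim_seq_spec in hlim.
  assert (he2 : 0 < eps / 2) by lra.
  destruct (hlim (mkposreal _ he2)) as [N0 hN0]. exists N0. intros n hn. specialize (hN0 n hn). simpl in hN0.
  rewrite Rminus_0_r in hN0. apply Rabs_def2 in hN0.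
  eapply Rle_lt_trans; [apply (h n eta heta)|]. fold p.
  assert (hq : 0 < Rpower eta (2 * Re s - 2)) by apply exp_pos.
  set (q := Rpower eta (2 * Re s - 2)) in *.
  assert (C * q <= eps / 2); [|lra].
  apply Rmult_lt_compat_l with (r := 2 * (C + 1)) in hd2; [|lra].
  replace (2 * (C + 1) * (eps / (2 * (C + 1)))) with eps in hd2 by (field; lra). lra.
Qed.

Lemma lrsum_incl_le {T : Type} (g : T -> R) m l : (forall t, 0 <= g t) -> NoDup m -> incl m l ->
  lrsum g m <= lrsum g l.
Proof.
  intros hg hn hi.
  assert (k := lsum_diff_le (fun t => RtoC (g t)) g m l (fun t => Req_le _ _ (eq_trans (Cmod_R _) (Rabs_pos_eq _ (hg t)))) hn hi).
  assert (k2 := Cmod_ge_0 (lsum (fun t => RtoC (g t)) l - lsum (fun t => RtoC (g t)) m)). lra.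
Qed.

Lemma lrsum_zbox_incr (g : Z * Z -> R) M N : (forall t, 0 <= g t) -> (M <= N)%nat -> lrsum g (zbox M) <= lrsum g (zbox N).
Proof. intros hg h. destruct exhausts_zbox as [h1 [h2 _]]. apply lrsum_incl_le; auto. Qed.

Lemma abs_summable_strip bt l1 l2 Y sg : admissible bt l1 l2 -> is_lattice_sum bt l1 l2 Y -> 1 < sg < 3 / 2 ->
  exists M, forall N, lrsum (fun p => Rpower (lattice_q bt l1 l2 p) (- sg)) (zbox N) <= M.
Proof.
  intros ha hY hs.
  assert (hr : Re (RtoC sg) = sg) by reflexivity.
  assert (h := lattice_mellin_lim bt l1 l2 Y (RtoC sg) ha hY hs).
  assert (hb : 0 < Cmod (beta (RtoC sg))).
  { apply Cmod_gt_0. intros e. assert (k := beta_inv_beta (RtoC sg) hs). rewrite e, Cmult_0_l in k.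
    apply RtoC_inj in k. lra. }
  destruct (h 1 ltac:(lra)) as [N0 hN0].
  set (g := fun p => Rpower (lattice_q bt l1 l2 p) (- sg)).
  assert (hg : forall p, 0 <= g p) by (intros p; left; apply exp_pos).
  exists ((Cmod (lattice_mellin bt Y (RtoC sg)) + 1) / Cmod (beta (RtoC sg))).
  intros N. apply Rle_div_r; [auto|].
  assert (k := hN0 (max N N0) ltac:(lia)). cbv beta in k.
  rewrite (lsum_ext _ (fun p => RtoC (g p))) in k by (intros p; rewrite <- RtoC_opp, RCpow_RtoC; reflexivity).
  rewrite lsum_RtoC in k.
  apply Rle_trans with (lrsum g (zbox (max N N0)) * Cmod (beta (RtoC sg))).
  - apply Rmult_le_compat_r; [lra|]. apply lrsum_zbox_incr; auto. lia.
  - rewrite <- (Rabs_pos_eq (lrsum g (zbox (max N N0)))) by (apply lrsum_nonneg; auto).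
    rewrite <- Cmod_R, <- Cmod_mult.
    assert (k2 := Cmod_triangle_minus (RtoC (lrsum g (zbox (max N N0))) * beta (RtoC sg)) (lattice_mellin bt Y (RtoC sg))). lra.
Qed.

Lemma abs_summable bt l1 l2 sg : admissible bt l1 l2 -> 1 < sg ->
  exists M, forall N, lrsum (fun p => Rpower (lattice_q bt l1 l2 p) (- sg)) (zbox N) <= M.
Proof.
  intros ha hs. destruct (Y_exists bt l1 l2 ha) as [Y hY]. fold (is_lattice_sum bt l1 l2 Y) in hY.
  destruct (Rlt_dec sg (3 / 2)) as [h|h]; [apply (abs_summable_strip bt l1 l2 Y); auto|].
  destruct (abs_summable_strip bt l1 l2 Y (5 / 4) ha hY ltac:(lra)) as [M hM].
  destruct (quad_form_min bt l1 l2 ha) as [qm [hq hqm]].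
  exists (Rpower qm (- (sg - 5 / 4)) * M). intros N.
  apply Rle_trans with (Rpower qm (- (sg - 5 / 4)) * lrsum (fun p => Rpower (lattice_q bt l1 l2 p) (- (5 / 4))) (zbox N)).
  - rewrite <- lrsum_scal. apply lrsum_le. intros p.
    replace (- sg) with (- (sg - 5 / 4) + - (5 / 4)) by ring. rewrite Rpower_plus.
    apply Rmult_le_compat_r; [left; apply exp_pos|].
    unfold Rpower. apply exp_le. apply Rmult_le_compat_neg_l; [lra|]. apply ln_le; auto. apply hqm.
  - apply Rmult_le_compat_l; auto. left; apply exp_pos.
Qed.

(** * The meromorphic continuation *)

Definition lattice_zeta (bt l1 l2 : R) (s : C) : C :=
  epsilon (inhabits (RtoC 0)) (is_sum (fun p => RCpow (lattice_q bt l1 l2 p) (- s))).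

Lemma lattice_zeta_spec bt l1 l2 s : admissible bt l1 l2 -> 1 < Re s ->
  is_sum (fun p => RCpow (lattice_q bt l1 l2 p) (- s)) (lattice_zeta bt l1 l2 s) /\
  Clim (fun N => lsum (fun p => RCpow (lattice_q bt l1 l2 p) (- s)) (zbox N)) (lattice_zeta bt l1 l2 s).
Proof.
  intros ha hs. destruct (abs_summable bt l1 l2 (Re s) ha hs) as [M hM].
  destruct (summable_is_sum zbox (fun p => RCpow (lattice_q bt l1 l2 p) (- s))
    (fun p => Rpower (lattice_q bt l1 l2 p) (- Re s)) M exhausts_zbox) as [v [hv hl]]; auto.
  { intros p. rewrite Cmod_RCpow. right. reflexivity. }
  assert (k : is_sum (fun p => RCpow (lattice_q bt l1 l2 p) (- s)) (lattice_zeta bt l1 l2 s)).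
  { unfold lattice_zeta. apply epsilon_spec. exists v. exact hv. }
  split; auto. rewrite <- (is_sum_unique _ _ _ hv k). exact hl.
Qed.

Lemma lattice_zeta_eq bt l1 l2 Y s : admissible bt l1 l2 -> is_lattice_sum bt l1 l2 Y -> 1 < Re s < 3 / 2 ->
  lattice_zeta bt l1 l2 s = (inv_beta s * lattice_mellin bt Y s)%C.
Proof.
  intros ha hY hs. destruct (lattice_zeta_spec bt l1 l2 s ha) as [_ h]; [lra|].
  assert (h1 := lattice_mellin_lim bt l1 l2 Y s ha hY hs).
  assert (h2 := Clim_mult _ _ _ _ h (Clim_const (beta s))).
  assert (e := Clim_unique _ _ _ h1 h2). rewrite e.
  transitivity (lattice_zeta bt l1 l2 s * (beta s * inv_beta s))%C; [|ring].
  rewrite beta_inv_beta by auto. ring.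
Qed.

Lemma Clim_Cmod_le (u : nat -> C) (l : C) (B : R) : Clim u l -> (forall n, Cmod (u n) <= B) -> Cmod l <= B.
Proof.
  intros h hB. apply le_epsilon. intros e he. destruct (h e he) as [N hN]. specialize (hN N (le_n N)). specialize (hB N).
  assert (k := Cmod_triangle_minus l (u N)). rewrite Cmod_minus_sym in k. lra.
Qed.

Lemma lsum_linear {T : Type} (f g h : T -> C) (c : C) l :
  lsum (fun t => f t - g t - h t * c)%C l = (lsum f l - lsum g l - lsum h l * c)%C.
Proof. unfold lsum. induction l as [|t l IH]; simpl; [|rewrite IH]; ring. Qed.

Lemma lrsum_plus {T : Type} (f g : T -> R) l : lrsum (fun t => f t + g t) l = lrsum f l + lrsum g l.
Proof. unfold lrsum. induction l as [|t l IH]; simpl; [|rewrite IH]; ring. Qed.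

Lemma lattice_zeta_derive bt l1 l2 s : admissible bt l1 l2 -> 1 < Re s ->
  exists l, is_cderive (lattice_zeta bt l1 l2) s l.
Proof.
  intros ha hs. set (q := lattice_q bt l1 l2). set (d := (Re s - 1) / 4). assert (hd : 0 < d) by (unfold d; lra).
  assert (hq : forall p, 0 < q p) by (intros p; apply lattice_q_pos; auto).
  destruct (abs_summable bt l1 l2 (Re s - d) ha) as [M1 hM1]; [unfold d; lra|].
  destruct (abs_summable bt l1 l2 (Re s + d) ha) as [M2 hM2]; [unfold d; lra|].
  destruct (abs_summable bt l1 l2 (Re s - 2 * d) ha) as [M3 hM3]; [unfold d; lra|].
  destruct (abs_summable bt l1 l2 (Re s + 2 * d) ha) as [M4 hM4]; [unfold d; lra|].
  destruct (summable_is_sum zbox (fun p => RtoC (ln (q p)) * RCpow (q p) (- s))%C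
    (fun p => / d * (Rpower (q p) (- (Re s - d)) + Rpower (q p) (- (Re s + d)))) (/ d * (M1 + M2)) exhausts_zbox) as [L [_ hL]].
  { intros p. rewrite Cmod_mult, Cmod_R, Cmod_RCpow.
    replace (Re (- s)) with (- Re s) by (unfold Re; simpl; ring).
    apply Rmult_le_reg_l with d; auto. rewrite <- !Rmult_assoc, Rinv_r, Rmult_1_l by lra.
    replace (- (Re s - d)) with (d + - Re s) by ring. replace (- (Re s + d)) with (- d + - Re s) by ring.
    rewrite !Rpower_plus, <- Rmult_plus_distr_r. apply Rmult_le_compat_r; [left; apply exp_pos|].
    eapply Rle_trans; [|apply exp_abs_ln_le; auto; lra]. assert (k := exp_ineq1_le (d * Rabs (ln (q p)))). lra. }
  { intros N. rewrite lrsum_scal, lrsum_plus. apply Rmult_le_compat_l; [left; apply Rinv_0_lt_compat; auto|].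
    apply Rplus_le_compat; [apply hM1|apply hM2]. }
  set (K := 4 / d ^ 2 * (M3 + M4)).
  assert (hd2 : 0 < 4 / d ^ 2) by (apply Rdiv_lt_0_compat; [lra|apply pow_lt; auto]).
  exists (- L)%C. apply is_cderive_eps. intros eps he.
  set (K1 := Rmax K 1). assert (hK1 : 1 <= K1) by apply Rmax_r. assert (hKK : K <= K1) by apply Rmax_l.
  exists (Rmin d (eps / K1)). split; [apply Rmin_pos; auto; apply Rdiv_lt_0_compat; lra|].
  intros w hw. set (h := (- (w - s))%C).
  assert (hh : Cmod h = Cmod (w - s)) by (unfold h; apply Cmod_opp).
  assert (hw1 : Cmod h <= d) by (rewrite hh; left; eapply Rlt_le_trans; [exact hw|apply Rmin_l]).
  assert (hw2 : Cmod h <= eps / K1) by (rewrite hh; left; eapply Rlt_le_trans; [exact hw|apply Rmin_r]).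
  assert (hrw : 1 < Re w).
  { assert (k := re_le_Cmod (w - s)). rewrite <- hh in k. apply Rabs_le_between in k.
    replace (Re (w - s)) with (Re w - Re s) in k by (unfold Re; simpl; ring). unfold d in hw1. lra. }
  destruct (lattice_zeta_spec bt l1 l2 s ha hs) as [_ ls]. destruct (lattice_zeta_spec bt l1 l2 w ha hrw) as [_ lw].
  fold q in ls, lw.
  assert (hlim := Clim_minus _ _ _ _ (Clim_minus _ _ _ _ lw ls) (Clim_mult _ _ _ _ hL (Clim_const h))).
  assert (hb : Cmod (lattice_zeta bt l1 l2 w - lattice_zeta bt l1 l2 s - L * h) <= Cmod h ^ 2 * K).
  { apply (Clim_Cmod_le _ _ _ hlim). intros N. cbv beta. rewrite <- lsum_linear.
    eapply Rle_trans; [apply (Cmod_lsum_le _ (fun p => Cmod h ^ 2 * (4 / d ^ 2 * (Rpower (q p) (- (Re s - 2 * d)) + Rpower (q p) (- (Re s + 2 * d))))))|].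
    - intros p. replace (- w)%C with (- s + h)%C by (unfold h; ring).
      eapply Rle_trans; [apply (RCpow_second_order (q p) (- s) h d); auto|].
      replace (Re (- s)) with (- Re s) by (unfold Re; simpl; ring).
      replace (- Re s + 2 * d) with (- (Re s - 2 * d)) by ring. replace (- Re s - 2 * d) with (- (Re s + 2 * d)) by ring. lra.
    - rewrite !lrsum_scal, lrsum_plus. apply Rmult_le_compat_l; [apply pow2_ge_0|].
      unfold K. apply Rmult_le_compat_l; [lra|]. apply Rplus_le_compat; [apply hM3|apply hM4]. }
  replace (lattice_zeta bt l1 l2 w - lattice_zeta bt l1 l2 s - - L * (w - s))%C
    with (lattice_zeta bt l1 l2 w - lattice_zeta bt l1 l2 s - L * h)%C by (unfold h; ring).
  eapply Rle_trans; [exact hb|]. rewrite <- hh.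
  assert (h0 := Cmod_ge_0 h).
  apply Rle_trans with (Cmod h * (Cmod h * K1)); [simpl; nra|].
  rewrite Rmult_comm. apply Rmult_le_compat_r; auto. apply Rle_div_r in hw2; lra.
Qed.

Ltac cfield := cbv beta; match goal with |- @eq _ ?a ?b => change (@eq C a b) end; field.

Lemma holomorphic_at_eps (f : C -> C) (p : C) (d : R) : 0 < d ->
  (forall w, Cmod (w - p) < d -> exists l, is_cderive f w l) -> holomorphic_at f p.
Proof. intros hd h. unfold holomorphic_at. apply locally_C_eps. exists d. split; auto. Qed.

Lemma holomorphic_meromorphic (f : C -> C) (p : C) : holomorphic_at f p -> meromorphic_at f p.
Proof.
  intros h. exists 0%nat, f. split; auto. apply locally'_C_eps. exists 1. split; [lra|].
  intros w _ _. simpl. ring.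
Qed.

Lemma ex_cderive_mult (f g : C -> C) (z : C) : (exists l, is_cderive f z l) -> (exists l, is_cderive g z l) ->
  exists l, is_cderive (fun w => f w * g w)%C z l.
Proof. intros [a ha] [b hb]. eexists. apply is_cderive_mult; eauto. Qed.

Lemma ex_cderive_plus (f g : C -> C) (z : C) : (exists l, is_cderive f z l) -> (exists l, is_cderive g z l) ->
  exists l, is_cderive (fun w => f w + g w)%C z l.
Proof. intros [a ha] [b hb]. eexists. apply is_cderive_plus; eauto. Qed.

Lemma is_cderive_affine (a b z : C) : is_cderive (fun s => a * s + b)%C z a.
Proof.
  eapply is_cderive_val; [apply is_cderive_plus; [apply is_cderive_mult; [apply is_cderive_const|apply is_cderive_id]|apply is_cderive_const]|].
  cring.
Qed.

Lemma ex_cderive_comp_affine (f g : C -> C) (a b z : C) : (forall s, g s = a * s + b)%C ->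
  (exists l, is_cderive f (g z) l) -> exists l, is_cderive (fun s => f (g s)) z l.
Proof.
  intros hg [l hl]. eexists. apply is_cderive_comp; [exact hl|].
  apply is_cderive_ext_loc with (fun s => a * s + b)%C 1; [lra| |apply is_cderive_affine].
  intros w _. symmetry. apply hg.
Qed.

Definition mellin_part (bt : R) (Y : R -> R) (s : C) : C :=
  (mellin Y (3 - 2 * s) + mellin (Wrem bt Y) (2 * s - 5))%C.

Lemma mellin_part_derive bt l1 l2 Y s : 0 < bt -> is_lattice_sum bt l1 l2 Y -> Re s < 3 / 2 ->
  exists l, is_cderive (mellin_part bt Y) s l.
Proof.
  intros hb hY hs. apply ex_cderive_plus.
  - apply (ex_cderive_comp_affine (mellin Y) (fun s => 3 - 2 * s)%C (- (2))%C 3 s); [intros; ring|].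
    apply mellin_derive with (Y 0) 0.
    + intros x _. apply hY.
    + intros x hx. rewrite Rpower_O by lra. assert (k := Y_bounds bt l1 l2 Y x hY). rewrite Rabs_pos_eq; lra.
    + rewrite re_3_2s. lra.
  - apply (ex_cderive_comp_affine (mellin (Wrem bt Y)) (fun s => 2 * s - 5)%C 2 (- (5))%C s); [intros; ring|].
    set (M := Rabs (Re (2 * s - 5)) + 1). assert (0 < M) by (unfold M; generalize (Rabs_pos (Re (2 * s - 5))); lra).
    destruct (Wrem_bound bt l1 l2 Y M hb hY) as [C [hC h]]; auto.
    apply mellin_derive with C M; auto.
    + intros x hx. apply (continuous_Wrem bt l1 l2); auto; lra.
    + unfold M. assert (k := Rabs_maj2 (Re (2 * s - 5))). lra.
Qed.

Lemma lattice_mellin_eq bt Y s : lattice_mellin bt Y s = (mellin_part bt Y s + RtoC (PI / bt) / (2 * s - 2))%C.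
Proof. unfold lattice_mellin, mellin_part. ring. Qed.

Lemma C_2s_2_neq0 (s : C) : s <> RtoC 1 -> (2 * s - 2)%C <> RtoC 0.
Proof.
  intros h e. apply h. replace s with ((2 * s - 2) / 2 + 1)%C by (field; apply RtoC_2_neq0). rewrite e. field.
Qed.

Lemma lattice_mellin_derive bt l1 l2 Y s : 0 < bt -> is_lattice_sum bt l1 l2 Y -> Re s < 3 / 2 -> s <> RtoC 1 ->
  exists l, is_cderive (lattice_mellin bt Y) s l.
Proof.
  intros hb hY hs h1. destruct (mellin_part_derive bt l1 l2 Y s hb hY hs) as [l hl].
  eexists. apply is_cderive_ext_loc with (fun s => mellin_part bt Y s + RtoC (PI / bt) / (2 * s + - (2)))%C 1; [lra| |].
  - intros w _. rewrite lattice_mellin_eq. reflexivity.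
  - apply is_cderive_plus; [exact hl|]. apply is_cderive_div; [apply (C_2s_2_neq0 s); auto|apply is_cderive_const|apply is_cderive_affine].
Qed.

Lemma is_cderive_Csinpi s : is_cderive Csinpi s (RtoC PI * ((Cexp (Ci * RtoC PI * s) + Cexp (- (Ci * RtoC PI * s))) / 2))%C.
Proof.
  unfold Csinpi.
  eapply is_cderive_val.
  - apply is_cderive_div; [intros h; apply Cmult_integral in h; destruct h as [h|h]; [apply RtoC_2_neq0|apply Ci_neq0]; auto| |apply is_cderive_const].
    apply is_cderive_minus.
    + apply (is_cderive_comp Cexp (fun s => Ci * RtoC PI * s)%C); [apply is_cderive_Cexp|]. apply is_cderive_scal, is_cderive_id.
    + apply (is_cderive_comp Cexp (fun s => - (Ci * RtoC PI * s))%C); [apply is_cderive_Cexp|].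
      apply is_cderive_ext_loc with (fun s => - (Ci * RtoC PI) * s)%C 1; [lra|intros; ring|]. apply is_cderive_scal, is_cderive_id.
  - cfield. apply Ci_neq0.
Qed.

Lemma pi_s_1_neq0 s : s <> RtoC 1 -> (RtoC PI * (s - 1))%C <> RtoC 0.
Proof.
  intros h e. apply Cmult_integral in e. destruct e as [e|e].
  - apply RtoC_inj in e. generalize PI_RGT_0; lra.
  - apply h. replace s with ((s - 1) + 1)%C by ring. rewrite e. ring.
Qed.

Lemma inv_beta_derive s : s <> RtoC 1 -> exists l, is_cderive inv_beta s l.
Proof.
  intros h. unfold inv_beta. eexists. apply is_cderive_div.
  - apply pi_s_1_neq0; auto.
  - apply is_cderive_scal, is_cderive_Csinpi.
  - apply is_cderive_scal, is_cderive_minus; [apply is_cderive_id|apply is_cderive_const].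
Qed.

Lemma Csinpi_0 : Csinpi 0 = RtoC 0.
Proof. unfold Csinpi. rewrite Cmult_0_r. replace (- 0)%C with (RtoC 0) by ring. unfold Cdiv. ring. Qed.

Lemma inv_beta_0 : inv_beta 0 = RtoC 0.
Proof. unfold inv_beta. rewrite Csinpi_0. unfold Cdiv. ring. Qed.

Lemma inv_beta_derive_0 : is_cderive inv_beta (RtoC 0) (RtoC 2).
Proof.
  assert (h1 : RtoC 0 <> RtoC 1) by (intros h; apply RtoC_inj in h; lra).
  unfold inv_beta. eapply is_cderive_val.
  - apply is_cderive_div.
    + apply (pi_s_1_neq0 0); auto.
    + apply is_cderive_scal, is_cderive_Csinpi.
    + apply is_cderive_scal, is_cderive_minus; [apply is_cderive_id|apply is_cderive_const].
  - cbv beta. rewrite Csinpi_0, Cmult_0_r. replace (- 0)%C with (RtoC 0) by ring. rewrite Cexp_0.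
    cfield. intros h. apply RtoC_inj in h. generalize PI_RGT_0; lra.
Qed.

Definition lattice_zeta_cont (bt l1 l2 : R) (Y : R -> R) (s : C) : C :=
  if Rlt_dec 1 (Re s) then lattice_zeta bt l1 l2 s else (inv_beta s * lattice_mellin bt Y s)%C.

Lemma lattice_zeta_cont_left bt l1 l2 Y s : admissible bt l1 l2 -> is_lattice_sum bt l1 l2 Y -> Re s < 3 / 2 ->
  lattice_zeta_cont bt l1 l2 Y s = (inv_beta s * lattice_mellin bt Y s)%C.
Proof.
  intros ha hY hs. unfold lattice_zeta_cont. destruct (Rlt_dec 1 (Re s)); auto. apply lattice_zeta_eq; auto.
Qed.

Lemma Re_close (w p : C) d : Cmod (w - p) < d -> Re p - d < Re w < Re p + d.
Proof.
  intros h. assert (k := re_le_Cmod (w - p)). apply Rabs_le_between in k.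
  replace (Re (w - p)) with (Re w - Re p) in k by (unfold Re; simpl; ring). lra.
Qed.

Lemma lattice_zeta_cont_derive bt l1 l2 Y s : admissible bt l1 l2 -> is_lattice_sum bt l1 l2 Y -> s <> RtoC 1 ->
  exists l, is_cderive (lattice_zeta_cont bt l1 l2 Y) s l.
Proof.
  intros ha hY hs. destruct (Rlt_dec 1 (Re s)) as [h|h].
  - destruct (lattice_zeta_derive bt l1 l2 s ha h) as [l hl]. exists l.
    apply is_cderive_ext_loc with (lattice_zeta bt l1 l2) (Re s - 1); [lra| |exact hl].
    intros w hw. apply Re_close in hw. unfold lattice_zeta_cont. destruct (Rlt_dec 1 (Re w)); auto. lra.
  - destruct (ex_cderive_mult inv_beta (lattice_mellin bt Y) s) as [l hl].
    + apply inv_beta_derive; auto.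
    + apply (lattice_mellin_derive bt l1 l2); auto; [apply ha|lra].
    + exists l. apply is_cderive_ext_loc with (fun w => inv_beta w * lattice_mellin bt Y w)%C (1 / 2); [lra| |exact hl].
      intros w hw. apply Re_close in hw. symmetry. apply lattice_zeta_cont_left; auto. lra.
Qed.

Lemma lattice_zeta_cont_derive_0 bt l1 l2 Y : admissible bt l1 l2 -> is_lattice_sum bt l1 l2 Y ->
  is_cderive (lattice_zeta_cont bt l1 l2 Y) (RtoC 0) (2 * lattice_mellin bt Y 0)%C.
Proof.
  intros ha hY.
  destruct (lattice_mellin_derive bt l1 l2 Y 0 (proj1 ha) hY) as [l hl]; [unfold Re; simpl; lra|intros h; apply RtoC_inj in h; lra|].
  apply is_cderive_ext_loc with (fun w => inv_beta w * lattice_mellin bt Y w)%C (1 / 2); [lra| |].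
  - intros w hw. apply Re_close in hw. symmetry. apply lattice_zeta_cont_left; auto. change (Re 0) with 0 in hw. lra.
  - eapply is_cderive_val; [apply is_cderive_mult; [apply inv_beta_derive_0|exact hl]|]. rewrite inv_beta_0. ring.
Qed.

Lemma is_sum_scal {T : Type} (c : C) (f g : T -> C) (v : C) : (forall t, g t = c * f t)%C ->
  is_sum f v -> is_sum g (c * v)%C.
Proof.
  intros hg h P hP. apply locally_C_eps in hP. destruct hP as [e [he hP]].
  assert (hc := Cmod_ge_0 c).
  destruct (h (fun z => Cmod (z - v) < e / (Cmod c + 1))) as [l0 hl].
  { apply locally_C_eps. exists (e / (Cmod c + 1)). split; auto. apply Rdiv_lt_0_compat; lra. }
  exists l0. intros l h1 h2. specialize (hl l h1 h2). cbv beta in hl. apply hP.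
  replace (Iter.iter Cplus (RtoC 0) l g) with (c * Iter.iter Cplus (RtoC 0) l f)%C.
  2: { clear - hg. induction l as [|t l IH]; simpl; [ring|]. rewrite <- IH, hg. ring. }
  replace (c * Iter.iter Cplus (RtoC 0) l f - c * v)%C with (c * (Iter.iter Cplus (RtoC 0) l f - v))%C by ring.
  rewrite Cmod_mult. apply Rle_lt_trans with (Cmod c * (e / (Cmod c + 1))).
  - apply Rmult_le_compat_l; lra.
  - apply Rmult_lt_reg_r with (Cmod c + 1); [lra|]. replace (Cmod c * (e / (Cmod c + 1)) * (Cmod c + 1)) with (Cmod c * e) by (field; lra). nra.
Qed.

Lemma EH_term_eq a1 a2 l1 l2 s p : 0 < a1 -> 0 < a2 -> admissible (a1 / a2) l1 l2 ->
  EH_term a1 a2 l1 l2 s p = (RCpow a1 (2 * s) * RCpow (lattice_q (a1 / a2) l1 l2 p) (- s))%C.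
Proof.
  intros h1 h2 ha. unfold EH_term.
  replace (((IZR (fst p) + l1) / a1) ^ 2 + ((IZR (snd p) + l2) / a2) ^ 2) with (/ a1 ^ 2 * lattice_q (a1 / a2) l1 l2 p)
   by (unfold lattice_q; field; split; lra).
  assert (hp : 0 < a1 ^ 2) by (apply pow_lt; auto).
  rewrite RCpow_mult_base by (try apply lattice_q_pos; auto; apply Rinv_0_lt_compat; auto).
  rewrite RCpow_inv, RCpow_sqr by auto. do 2 f_equal. ring.
Qed.

Definition EH_cont (a1 a2 l1 l2 : R) (Y : R -> R) (s : C) : C :=
  (RCpow (2 * PI) (- (2 * s)) * RCpow a1 (2 * s) * lattice_zeta_cont (a1 / a2) l1 l2 Y s)%C.

Definition EH_factor (a1 : R) (s : C) : C := (RCpow (2 * PI) (- (2 * s)) * RCpow a1 (2 * s))%C.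

Lemma EH_factor_derive a1 s : exists l, is_cderive (EH_factor a1) s l.
Proof.
  apply ex_cderive_mult.
  - apply (ex_cderive_comp_affine (RCpow (2 * PI)) (fun s => - (2 * s))%C (- (2))%C 0 s); [intros; ring|].
    eexists. apply is_cderive_RCpow.
  - apply (ex_cderive_comp_affine (RCpow a1) (fun s => 2 * s)%C 2 0 s); [intros; ring|].
    eexists. apply is_cderive_RCpow.
Qed.

Lemma EH_cont_meromorphic_1 a1 a2 l1 l2 Y : admissible (a1 / a2) l1 l2 -> is_lattice_sum (a1 / a2) l1 l2 Y ->
  meromorphic_at (EH_cont a1 a2 l1 l2 Y) 1.
Proof.
  intros ha hY. exists 2%nat, (fun s => EH_factor a1 s * ((- (2) * / RtoC PI * Csinpi s) *
     (mellin_part (a1 / a2) Y s * (1 * s + - (1)) + RtoC (PI / (a1 / a2)) * / 2)))%C.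
  assert (hr1 : Re 1 = 1) by reflexivity. split.
  - apply holomorphic_at_eps with (1 / 2); [lra|]. intros w hw. apply Re_close in hw. rewrite hr1 in hw.
    apply ex_cderive_mult; [apply EH_factor_derive|]. apply ex_cderive_mult.
    + eexists. apply is_cderive_scal, is_cderive_Csinpi.
    + apply ex_cderive_plus; [|eexists; apply is_cderive_const]. apply ex_cderive_mult.
      * apply (mellin_part_derive (a1 / a2) l1 l2); auto; [apply ha|lra].
      * eexists. apply is_cderive_affine.
  - apply locally'_C_eps. exists (1 / 2). split; [lra|]. intros w hw hw1. apply Re_close in hw. rewrite hr1 in hw.
    unfold EH_cont. rewrite lattice_zeta_cont_left by (auto; lra). rewrite lattice_mellin_eq. unfold EH_factor, inv_beta.
    assert (k1 := C_2s_2_neq0 w hw1). assert (k2 := pi_s_1_neq0 w hw1).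
    assert (k3 : (w - 1)%C <> RtoC 0) by (intros e; apply k2; rewrite e; ring).
    assert (k4 : RtoC PI <> RtoC 0) by (intros e; apply k2; rewrite e; ring).
    replace (2 * w - 2)%C with (2 * (w - 1))%C by ring. simpl Cpow. field. repeat split; auto.
Qed.

Lemma EH_cont_derive a1 a2 l1 l2 Y s : admissible (a1 / a2) l1 l2 -> is_lattice_sum (a1 / a2) l1 l2 Y -> s <> RtoC 1 ->
  exists l, is_cderive (EH_cont a1 a2 l1 l2 Y) s l.
Proof.
  intros ha hY hs. apply (ex_cderive_mult (EH_factor a1) (lattice_zeta_cont (a1 / a2) l1 l2 Y)).
  - apply EH_factor_derive. - apply lattice_zeta_cont_derive; auto.
Qed.

Lemma EH_cont_holomorphic a1 a2 l1 l2 Y p : admissible (a1 / a2) l1 l2 -> is_lattice_sum (a1 / a2) l1 l2 Y -> p <> RtoC 1 ->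
  holomorphic_at (EH_cont a1 a2 l1 l2 Y) p.
Proof.
  intros ha hY hp. apply holomorphic_at_eps with (Cmod (1 - p)).
  - apply Cmod_gt_0. intros e. apply hp. replace p with (1 - (1 - p))%C by ring. rewrite e. ring.
  - intros w hw. apply EH_cont_derive; auto. intros e. rewrite e in hw. lra.
Qed.

Lemma EH_cont_is_continuation a1 a2 l1 l2 Y : 0 < a1 -> 0 < a2 ->
  admissible (a1 / a2) l1 l2 -> is_lattice_sum (a1 / a2) l1 l2 Y -> is_EH_continuation a1 a2 l1 l2 (EH_cont a1 a2 l1 l2 Y).
Proof.
  intros h1 h2 ha hY. refine (conj _ (conj _ _)).
  - intros s hs. exists (RCpow a1 (2 * s) * lattice_zeta (a1 / a2) l1 l2 s)%C. split.
    + apply is_sum_scal with (fun p => RCpow (lattice_q (a1 / a2) l1 l2 p) (- s)).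
      * intros t. apply EH_term_eq; auto.
      * apply lattice_zeta_spec; auto.
    + unfold EH_cont, lattice_zeta_cont. destruct (Rlt_dec 1 (Re s)); [ring|lra].
  - intros p. destruct (Ceq_dec p 1) as [e|e].
    + rewrite e. apply EH_cont_meromorphic_1; auto.
    + apply holomorphic_meromorphic, EH_cont_holomorphic; auto.
  - apply EH_cont_holomorphic; auto. intros e. apply RtoC_inj in e. lra.
Qed.

Lemma EH_cont_derive_0 a1 a2 l1 l2 Y : admissible (a1 / a2) l1 l2 -> is_lattice_sum (a1 / a2) l1 l2 Y ->
  is_cderive (EH_cont a1 a2 l1 l2 Y) (RtoC 0) (2 * lattice_mellin (a1 / a2) Y 0)%C.
Proof.
  intros ha hY. destruct (EH_factor_derive a1 (RtoC 0)) as [l hl].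
  eapply is_cderive_val; [apply (is_cderive_mult _ _ _ _ _ hl (lattice_zeta_cont_derive_0 _ _ _ _ ha hY))|].
  rewrite lattice_zeta_cont_left by (auto; unfold Re; simpl; lra). rewrite inv_beta_0.
  unfold EH_factor, RCpow. rewrite Cmult_0_r. replace (- 0)%C with (RtoC 0) by ring. rewrite !Cmult_0_l, Cexp_0. ring.
Qed.

(** * The value of the derivative *)

Lemma is_CInt_RtoC (f : R -> R) (a b v : R) : is_RInt f a b v -> is_CInt (fun x => RtoC (f x)) a b (RtoC v).
Proof.
  intros h. apply is_CInt_pair. split; simpl.
  - exact h.
  - assert (k := is_RInt_const (V := R_NormedModule) a b 0).
    replace (scal (b - a) (0 : R_NormedModule)) with (0 : R_NormedModule) in k by (unfold scal; simpl; unfold mult; simpl; ring).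
    exact k.
Qed.

Lemma is_RInt_inversion (Y : R -> R) (A U : R) : 1 <= U -> (forall u, continuous Y u) ->
  is_RInt (fun x => / x ^ 5 * (Y (/ x) - A * x ^ 2)) (/ U) 1 (RInt (fun u => u ^ 3 * Y u) 1 U - A * (U ^ 2 - 1) / 2).
Proof.
  intros hU hY. set (F := fun u => u ^ 3 * Y u).
  assert (hF : forall u, continuous F u).
  { intros u. apply (continuous_mult (K := R_AbsRing) (fun u => u ^ 3) Y); auto.
    apply (ex_derive_continuous (fun u => u ^ 3)). auto_derive. auto. }
  assert (hi : 0 < / U) by (apply Rinv_0_lt_compat; lra).
  assert (hi1 : / U <= 1) by (rewrite <- Rinv_1; apply Rinv_le_contravar; lra).
  assert (i1 := is_RInt_comp F (fun x => / x) (fun x => - / x ^ 2) (/ U) 1).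
  rewrite Rmin_left, Rmax_right, Rinv_inv, Rinv_1 in i1 by lra.
  assert (i2 : is_RInt (fun x => A * / x ^ 3) (/ U) 1 (- A / 2 - - A / 2 * U ^ 2)).
  { replace (- A / 2 - - A / 2 * U ^ 2) with (minus (- A / 2 * / 1 ^ 2) (- A / 2 * / (/ U) ^ 2)).
    2: { unfold minus, plus, opp; simpl. field. lra. }
    apply (is_RInt_derive (V := R_CompleteNormedModule) (fun x => - A / 2 * / x ^ 2)); rewrite Rmin_left, Rmax_right by lra; intros x hx.
    - auto_derive; [|field; lra]. assert (0 < x * (x * 1)) by (apply Rmult_lt_0_compat; lra). lra.
    - apply (ex_derive_continuous (fun x => A * / x ^ 3)). auto_derive.
      assert (0 < x * (x * (x * 1))) by (apply Rmult_lt_0_compat; [|apply Rmult_lt_0_compat]; lra). lra. }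
  assert (i3 : is_RInt (fun x => - / x ^ 2 * F (/ x)) (/ U) 1 (RInt F U 1)).
  { apply i1.
    - intros x hx. apply hF.
    - intros x hx. split.
      + auto_derive; [lra|]. field; lra.
      + apply (ex_derive_continuous (fun x => - / x ^ 2)). auto_derive.
        assert (0 < x * (x * 1)) by (apply Rmult_lt_0_compat; lra). lra. }
  assert (e : RInt F U 1 = - RInt F 1 U) by (rewrite <- (opp_RInt_swap (V := R_CompleteNormedModule) F 1 U); [reflexivity|apply (ex_RInt_continuous (V := R_CompleteNormedModule)); intros; apply hF]).
  rewrite e in i3.
  assert (i4 := is_RInt_minus _ _ _ _ _ _ (is_RInt_opp _ _ _ _ i3) i2).
  replace (RInt F 1 U - A * (U ^ 2 - 1) / 2) with (minus (opp (- RInt F 1 U)) (- A / 2 - - A / 2 * U ^ 2)).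
  2: { unfold minus, plus, opp; simpl. field. }
  refine (is_RInt_ext _ _ _ _ _ _ i4). rewrite Rmin_left, Rmax_right by lra. intros x hx.
  unfold minus, plus, opp, F; simpl. field. lra.
Qed.

Lemma RCpow_m5 x : 0 < x -> RCpow x (2 * 0 - 5) = RtoC (/ x ^ 5).
Proof.
  intros hx. replace (2 * 0 - 5)%C with (- RtoC (INR 5))%C.
  - rewrite <- RCpow_inv, RCpow_nat, pow_inv by (auto; apply Rinv_0_lt_compat; auto). reflexivity.
  - replace (INR 5) with 5 by (simpl; ring). ring.
Qed.

Lemma RCpow_3 x : 0 < x -> RCpow x (3 - 2 * 0) = RtoC (x ^ 3).
Proof.
  intros hx. replace (3 - 2 * 0)%C with (RtoC (INR 3))%C; [apply RCpow_nat; auto|].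
  replace (INR 3) with 3 by (simpl; ring). ring.
Qed.

Lemma lattice_mellin_0 bt l1 l2 Y V K : 0 < bt -> is_lattice_sum bt l1 l2 Y ->
  (forall U, 1 <= U -> bt <= U -> Rabs (RInt (fun u => u ^ 3 * Y u) 0 U - PI / bt * U ^ 2 / 2 - V) <= K / U) ->
  lattice_mellin bt Y 0 = RtoC V.
Proof.
  intros hb hY hV. destruct (hY) as [_ [_ [hc _]]]. set (A := PI / bt) in *.
  set (F := fun u => u ^ 3 * Y u) in *.
  assert (hF : forall u, continuous F u).
  { intros u. apply (continuous_mult (K := R_AbsRing) (fun u => u ^ 3) Y); auto.
    apply (ex_derive_continuous (fun u => u ^ 3)). auto_derive. auto. }
  assert (hexF : forall a b, ex_RInt F a b) by (intros a b; apply (ex_RInt_continuous (V := R_CompleteNormedModule)); intros; apply hF).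
  assert (m1 : mellin Y (3 - 2 * 0) = RtoC (RInt F 0 1)).
  { apply is_CInt_unique. eapply is_CInt_ext; [|exact (is_CInt_RtoC _ _ _ _ (RInt_correct (V := R_CompleteNormedModule) F 0 1 (hexF 0 1)))].
    rewrite Rmin_left, Rmax_right by lra. intros x hx. cbv beta. rewrite RCpow_3, <- RtoC_mult by lra. reflexivity. }
  destruct (Wrem_bound bt l1 l2 Y 5 hb hY ltac:(lra)) as [C [hC hW]].
  assert (k2 := ex_mellin_W bt l1 l2 Y (2 * 0 - 5) hb hY).
  unfold mellin in *. set (w := fun x => (RCpow x (2 * 0 - 5) * RtoC (Wrem bt Y x))%C) in *.
  assert (cw : forall x, 0 < x <= 1 -> ccont w x).
  { intros x hx. apply ccont_mellin; [lra|]. apply (continuous_Wrem bt l1 l2); auto; lra. }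
  assert (hE : forall U, 1 < U -> bt <= U -> Cmod (lattice_mellin bt Y 0 - RtoC V) <= (K + C) / U).
  { intros U hU hbU. set (eta := / U).
    assert (he : 0 < eta < 1) by (unfold eta; split; [apply Rinv_0_lt_compat; lra|rewrite <- Rinv_1; apply Rinv_lt_contravar; lra]).
    destruct (CInt_restrict w eta he cw k2) as [w1 [w2 w3]].
    assert (b1 : Cmod (CInt w 0 eta) <= C / U).
    { replace (C / U) with (C * Rpower eta 1 / 1) by (rewrite Rpower_1 by lra; unfold eta; field; lra).
      apply Cmod_CInt_tail_le; auto; try lra. intros x hx. unfold w.
      rewrite RCpow_m5, Cmod_mult, !Cmod_R by lra. assert (h5 : 0 < x ^ 5) by (apply pow_lt; lra).
      replace (1 - 1) with 0 by ring. rewrite Rpower_O by lra.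
      specialize (hW x ltac:(lra)).
      replace (Rpower x 5) with (x ^ 5) in hW by (rewrite <- (Rpower_pow 5) by lra; f_equal; simpl; ring).
      rewrite Rabs_pos_eq by (left; apply Rinv_0_lt_compat; auto).
      apply Rmult_le_reg_l with (x ^ 5); auto. rewrite <- Rmult_assoc, Rinv_r by lra. lra. }
    assert (b2 : CInt w eta 1 = RtoC (RInt F 1 U - A * (U ^ 2 - 1) / 2)).
    { apply is_CInt_unique. eapply is_CInt_ext; [|apply is_CInt_RtoC, (is_RInt_inversion Y A U); auto; lra].
      fold eta. rewrite Rmin_left, Rmax_right by lra. intros x hx. cbv beta. unfold w.
      rewrite RCpow_m5, <- RtoC_mult by lra. reflexivity. }
    assert (hch : RInt F 0 U = RInt F 0 1 + RInt F 1 U) by (symmetry; apply (RInt_Chasles (V := R_CompleteNormedModule) F 0 1 U); auto).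
    assert (e : (lattice_mellin bt Y 0 - RtoC V)%C = (RtoC (RInt F 0 U - A * U ^ 2 / 2 - V) + CInt w 0 eta)%C).
    { unfold lattice_mellin, mellin. fold w. fold A. rewrite m1, w3, b2.
      replace (RtoC A / (2 * 0 - 2))%C with (RtoC (- A / 2)).
      - rewrite hch. replace (RInt F 0 1 + RInt F 1 U - A * U ^ 2 / 2 - V) with (RInt F 0 1 + (RInt F 1 U - A * (U ^ 2 - 1) / 2) + - A / 2 - V) by field.
        set (g := RInt F 1 U - A * (U ^ 2 - 1) / 2). rewrite RtoC_minus, !RtoC_plus. ring.
      - unfold Rdiv. rewrite RtoC_mult, RtoC_opp, RtoC_inv by lra. field. }
    rewrite e. eapply Rle_trans; [apply Cmod_triangle|]. rewrite Cmod_R.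
    specialize (hV U ltac:(lra) hbU). unfold Rdiv in *. rewrite Rmult_plus_distr_r. lra. }
  assert (hz : Cmod (lattice_mellin bt Y 0 - RtoC V) <= 0).
  { apply le_epsilon. intros eps heps. set (U := 2 + bt + Rabs (K + C) / eps).
    assert (hp : 0 <= Rabs (K + C) / eps) by (apply Rdiv_le_0_compat; auto; apply Rabs_pos).
    eapply Rle_trans; [apply (hE U); unfold U; lra|]. rewrite Rplus_0_l.
    apply Rle_div_l; [unfold U; lra|]. eapply Rle_trans; [apply Rle_abs|].
    apply Rle_trans with (eps * (Rabs (K + C) / eps)); [right; field; lra|]. apply Rmult_le_compat_l; [lra|unfold U; lra]. }
  assert (k := Cmod_ge_0 (lattice_mellin bt Y 0 - RtoC V)).
  assert (hz0 : (lattice_mellin bt Y 0 - RtoC V)%C = RtoC 0) by (apply Cmod_eq_0; lra).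
  replace (lattice_mellin bt Y 0) with ((lattice_mellin bt Y 0 - RtoC V) + RtoC V)%C by ring. rewrite hz0. ring.
Qed.

Theorem theorem1p2 (a1 a2 l1 l2 : R)
  (ha1 : 0 < a1) (ha2 : 0 < a2)
  (hl1 : 0 <= l1 <= 1) (hl2 : 0 <= l2 <= 1)
  (hl : (l1 <> 0 /\ l1 <> 1) \/ (l2 <> 0 /\ l2 <> 1)) :
  exists P : R,
    0 < P /\
    is_prod
      (fun n : Z =>
         Cmod (1 - Cexp (RtoC (2 * PI) * Ci * RtoC l1)
                   * RtoC (exp (- (2 * PI * (a1 / a2) * Rabs (IZR n + l2)))))%C)
      P /\
    @is_derive C_AbsRing C_NormedModule (zeta_EH a1 a2 l1 l2) (RtoC 0)
      (RtoC (2 * PI * (a1 / a2) * B2 l2 - 2 * ln P)).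
Proof.
  set (bt := a1 / a2). assert (hb : 0 < bt) by (apply Rdiv_lt_0_compat; auto).
  assert (ha : admissible bt l1 l2) by (refine (conj hb (conj hl1 (conj hl2 hl)))).
  destruct (Y_exists bt l1 l2 ha) as [Y hY]. fold (is_lattice_sum bt l1 l2 Y) in hY.
  destruct (Y_regularized_integral bt l1 l2 Y ha) as [LP [K [hLP [hK hV]]]]; try apply hY.
  exists (exp LP). split; [apply exp_pos|]. split; [apply is_prod_factor; auto|].
  rewrite ln_exp.
  assert (hF := EH_cont_is_continuation a1 a2 l1 l2 Y ha1 ha2 ha hY).
  assert (hz : is_EH_continuation a1 a2 l1 l2 (zeta_EH a1 a2 l1 l2)).
  { unfold zeta_EH. apply epsilon_spec. exists (EH_cont a1 a2 l1 l2 Y). exact hF. }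
  destruct (EH_continuation_germ a1 a2 l1 l2 _ _ hF hz) as [d [hd hag]].
  apply is_cderive_ext_loc with (EH_cont a1 a2 l1 l2 Y) d; auto.
  eapply is_cderive_val; [apply EH_cont_derive_0; auto|].
  fold bt. rewrite (lattice_mellin_0 bt l1 l2 Y _ K hb hY hV), <- RtoC_mult. f_equal. ring.
Qed.
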